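(* Suppose that $\rho_v>0$ and $v_n=L_v(n)n^{-b}\rho_v^{-n}$ for all $n\ge 1$, for a slowly varying function $L_v$ and an exponent $b>1$. Furthermore suppose that one of the following two cases holds. (i) $\rho_v=W(\rho_w)$ and $w_n=L_w(n)n^{-a}\rho_w^{-n}$ for all $n\ge 1$, for a slowly varying function $L_w$ and an exponent $a>2$, such that either $1<b<a$, or $b=a$ and $L_w(n)=o(L_v(n))$. (ii) $\rho_v<W(\rho_w)$ and $\gcd\{n\ge 0\mid w_n>0\}=1$. Set $\alpha=\min(a-1,2)$ in case (i) and $\alpha=2$ in case (ii), and let $\mu=W(\rho_u)^{-1}\sum_{n\ge 1} n w_n\rho_u^n$. Let $K_{(1)}\ge K_{(2)}\ge\dots$ denote the component sizes $K_1,\dots,K_{N_n}$ arranged in decreasing order. Then, with $L$ as defined in the context, $$\frac{1}{L(n)n^{1/\alpha}}K_{(1)}\xrightarrow{d}\begin{cases}W_1,&1<\alpha<2\\0,&\alpha=2\end{cases}$$ for a Fréchet-distributed random variable $W_1\ge0$ with $\mathbb P(W_1\le x)=\exp\left(\frac{\mu^\alpha}{\Gamma(1-\alpha)}x^{-\alpha}\right)$ for all $x>0$ (note $\Gamma(1-\alpha)<0$). Moreover, if $1<\alpha<2$, then for each integer $j\ge2$ $$\frac{1}{L(n)n^{1/\alpha}}K_{(j)}\xrightarrow{d}W_j$$ for a random variable $W_j$ with density function, for $x>0$, $$\alpha\,\frac{\mu^\alpha}{|\Gamma(1-\alpha)|}\,x^{-\alpha-1}\,\frac{\left(\frac{\m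u^\alpha}{|\Gamma(1-\alpha)|}x^{-\alpha}\right)^{j-1}}{(j-1)!}\exp\left(-\frac{\mu^\alpha}{|\Gamma(1-\alpha)|}x^{-\alpha}\right).$$
   Context: Gibbs partitions. Let $(v_i)_{i\ge1}$, $(w_i)_{i\ge0}$ be sequences of non-negative reals, $V(x)=\sum_{i\ge1}v_ix^i$, $W(x)=\sum_{i\ge0}w_ix^i$, $U(x)=V(W(x))=\sum_{n\ge0}u_nx^n$, so that $u_n=\sum_{k\ge1}v_k\sum_{x_1+\dots+x_k=n}w_{x_1}\cdots w_{x_k}$ (sum over $x_i\in\mathbb N_0$); all $u_n$ are assumed finite. Let $\rho_u,\rho_v,\rho_w$ be the radii of convergence of $U,V,W$; values such as $W(\rho_w)\in[0,\infty]$ denote the value of the series. For $n\ge1$ with $u_n>0$, the Gibbs partition $P_n$ is the random partition of $\{1,\dots,n\}$ with $\mathbb P(P_n=P)=\frac{1}{n!\,u_n}|P|!\,v_{|P|}\prod_{Q\in P}|Q|!\,w_{|Q|}$ (empty components are allowed if $w_0>0$). $N_n$ is its number of components and $K_1,\dots,K_{N_n}$ are their sizes listed in exchangeable order; precisely $\mathbb P(N_n=k,(K_1,\dots,K_k)=(x_1,\dots,x_k))=v_kw_{x_1}\cdots w_{x_k}/u_n$ for $k\ge1$, $x_i\in\mathbb N_0$, $\sum x_i=n$. Limits are as $n\to\infty$ (along $n$ with $u_n>0$). A function $L:\mathbb R_{>0}\to\mathbb R_{>0}$ is slowly varying if $L(tx)/L(x)\to1$ as $x\to\infty$ for all $t>0$.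 Let $X$ be the random non-negative integer with $\mathbb E[z^X]=W(\rho_uz)/W(\rho_u)$, so $\mu=\mathbb E[X]$. Let $T(x)=\mathbb E[X^2\mathbf 1_{X\le x}]$ and $g(n)=\sqrt{\mathbb V[X]/2}$ if $\mathbb V[X]<\infty$; $g(n)=\sqrt{\tfrac12T\big(\sup\{x\ge0\mid T(x)/x^2\ge 1/n\}\big)}$ if $\mathbb V[X]=\infty$ and $\alpha=2$; $g(n)=n^{-1/\alpha}|\Gamma(1-\alpha)|^{1/\alpha}\inf\{x\ge0\mid\mathbb P(X>x)\le 1/n\}$ if $\mathbb V[X]=\infty$ and $1<\alpha<2$. Set $L(n)=\mu^{-1-1/\alpha}g(n)$.
   Formalization: Slowly varying functions are additionally required to be measurable on the positive reals, as in Karamata's definition; without this the claim fails for functions built from a Hamel basis, where the tail of X need not vary regularly. *)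

(* Defs.v *)
From HB Require Import structures.
From mathcomp Require Import all_boot all_order all_algebra.
From mathcomp Require Import all_classical all_reals all_analysis.

Set Implicit Arguments.
Unset Strict Implicit.
Unset Printing Implicit Defensive.

Import Order.TTheory GRing.Theory Num.Theory.
Import numFieldNormedType.Exports.

Local Open Scope classical_set_scope.
Local Open Scope ring_scope.

(* Value in [0, +oo] at x in [0, +oo] of a power series with non-negative
   coefficients. At x = +oo, the conventions +oo ^+ 0 = 1 and 0 * +oo = 0 give
   the limit of the values at finite x. *)
Definition gf (R : realType) (c : nat -> R) (x : \bar R) : \bar R :=
  (\sum_(0 <= i <oo) (c i)%:E * x ^+ i)%E.

Definition conv_radius (R : realType) (c : nat -> R) : \bar R :=
  ereal_sup [set r%:E | r in [set r : R | 0 <= r /\ (gf c r%:E < +oo)%E]].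

(* Summands of a composition of n are at most n, hence the type 'I_n.+1.
   v 0 does not occur: V has no constant term. *)
Definition gibbs_coef_ereal (R : realType) (v w : nat -> R) (n : nat) : \bar R :=
  (\sum_(1 <= k <oo)
     (v k * \sum_(x : k.-tuple 'I_n.+1 | (\sum_(i < k) tnth x i)%N == n)
              \prod_(i < k) w (tnth x i))%:E)%E.

Definition gibbs_coef (R : realType) (v w : nat -> R) (n : nat) : R :=
  fine (gibbs_coef_ereal v w n).

(* K o = [:: K_1; ...; K_N] is the sequence of component sizes of the Gibbs
   partition of {1, ..., n} in exchangeable order, so N = size (K o). The given
   masses sum to 1. *)
Definition gibbs_component_sizes (R : realType) (v w : nat -> R) (n : nat)
    (d : measure_display) (T : measurableType d) (P : probability T R)
    (K : T -> seq nat) : Prop :=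
  (forall s : seq nat, measurable (K @^-1` [set s])) /\
  (forall s : seq nat, (0 < size s)%N -> sumn s = n ->
    P (K @^-1` [set s]) =
      (v (size s) * (\prod_(x <- s) w x) / gibbs_coef v w n)%:E).

(* j-th largest element, j >= 1; equal to 0 if there are fewer than j. *)
Definition nth_largest (s : seq nat) (j : nat) : nat :=
  nth 0%N (sort geq s) j.-1.

(* Measurability is part of Karamata's definition; without it the uniform
   convergence theorem fails. *)
Definition slowly_varying (R : realType) (L : R -> R) : Prop :=
  [/\ forall x, 0 < x -> 0 < L x,
      measurable_fun (`]0, +oo[%classic : set R) L &
      forall t, 0 < t -> L (t * x) / L x @[x --> +oo%R] --> (1 : R)].

(* g is the gcd of the set A of natural numbers (0 if A is included in {0}). *)
Definition is_gcd_of (A : set nat) (g : nat) : Prop :=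
  (forall n, A n -> (g %| n)%N) /\
  (forall d : nat, (forall n, A n -> (d %| n)%N) -> (d %| g)%N).

(* Euler's integral for x > 0, continued to the negative non-integers by the
   functional equation Gamma (x + 1) = x * Gamma x. *)
Definition Gamma_pos (R : realType) (x : R) : R :=
  \int[lebesgue_measure]_(t in `]0, +oo[) (t `^ (x - 1) * expR (- t)).

Definition Gamma (R : realType) (x : R) : R :=
  let m := if 0 < x then 0%N else (Num.truncn (- x)).+1 in
  Gamma_pos (x + m%:R) / \prod_(i < m) (x + i%:R).

Definition offspring_mean (R : realType) (w : nat -> R) (r : R) : R :=
  (fine (gf w r%:E))^-1 *
  fine (\sum_(1 <= n <oo) (n%:R * w n * r ^+ n)%:E)%E.

(* E[z^X] = W(r z) / W(r); equality on [0, 1] determines the law of X. *)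
Definition has_tilted_pgf (R : realType) (w : nat -> R) (r : R)
    (d : measure_display) (T : measurableType d) (Q : probability T R)
    (X : {RV Q >-> nat}) : Prop :=
  forall z : R, 0 <= z -> z <= 1 ->
    ('E_Q[(fun o => z ^+ X o)%R])%E =
    (fine (gf w (r * z)%:E) / fine (gf w r%:E))%:E.

Definition truncated_second_moment (R : realType)
    (d : measure_display) (T : measurableType d) (Q : probability T R)
    (X : {RV Q >-> nat}) (x : R) : R :=
  fine ('E_Q[(fun o => (X o)%:R ^+ 2 * ((X o)%:R <= x :> R)%:R)%R])%E.

Definition scaling_g (R : realType)
    (d : measure_display) (T : measurableType d) (Q : probability T R)
    (X : {RV Q >-> nat}) (alpha : R) (n : nat) : R :=
  let var : \bar R := ('V_Q[(fun o => (X o)%:R)%R])%E in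
  let T2 := truncated_second_moment X in
  if (var < +oo)%E then Num.sqrt (fine var / 2)
  else if alpha == 2 then
    Num.sqrt (2^-1 * T2 (sup [set x : R | 0 <= x /\ n%:R^-1 <= T2 x / x ^+ 2]))
  else n%:R `^ (- alpha^-1) * `|Gamma (1 - alpha)| `^ alpha^-1 *
    inf [set x : R | 0 <= x /\
                     (Q [set o | (x < (X o)%:R :> R)%R] <= (n%:R^-1)%:E)%E].

Definition scaling_L (R : realType)
    (d : measure_display) (T : measurableType d) (Q : probability T R)
    (X : {RV Q >-> nat}) (alpha mu : R) (n : nat) : R :=
  mu `^ (- 1 - alpha^-1) * scaling_g X alpha n.

(* Convergence in distribution, along the filter F, of random variables Y n
   living on possibly different probability spaces, to the law nu: convergence
   of the distribution functions at the continuity points of the limit. *)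
Definition cvg_in_distribution (R : realType) (F : set_system nat)
    (d : nat -> measure_display) (T : forall n, measurableType (d n))
    (P : forall n, probability (T n) R) (Y : forall n, T n -> R)
    (nu : probability R R) : Prop :=
  forall x : R,
    {for x, continuous (fun t : R => nu `]-oo, t]%classic)} ->
    P n [set o | Y n o <= x] @[n --> F] --> nu `]-oo, x]%classic.

(* Main.v *)
Require Import Defs.
From HB Require Import structures.
From mathcomp Require Import all_boot all_order all_algebra.
From mathcomp Require Import all_classical all_reals all_analysis.
From mathcomp Require Import measurable_realfun.
From mathcomp Require Import ring lra zify.

Set Implicit Arguments.
Unset Strict Implicit.
Unset Printing Implicit Defensive.

Import Order.TTheory GRing.Theory Num.Theory.
Import numFieldNormedType.Exports.

Local Open Scope classical_set_scope.
Local Open Scope ring_scope.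

(** The proof tilts both weight sequences to the critical point. Put
    [rho = rho_v], let [r] be the radius of convergence of [U], and let
    [p l = w l * r ^+ l / rho], [q k = v k * rho ^+ k]. One has [W(r) = rho], so
    [p] is a probability law, in fact that of [X], and multiplying the weight of
    a composition of [n] into [k] parts by [r ^+ n] gives [q k] times the
    probability that [k] independent steps of law [p] realize it
    ([few_tilt]). Hence [u_n r^n] is the sum over [k] of [q k] times the
    probability that the walk [S_k] is at [n], and [P (K_(j) <= y)] is the ratio
    of the same sum, restricted to walks with fewer than [j] steps larger than
    [y], to the full sum ([nth_largest_law]).

    Both sums are carried by the [k] close to [n / mu], [mu] being the mean of
    [p]. A walk of fewer steps needs a step of order [n], which the comparison
    of [w] with [v] makes negligible against [q n]; without such a step the
    Chernoff bound applies ([few_steps_negligible]). A walk of more steps has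
    exponentially small probability to be as low as [n]
    ([many_steps_negligible]). Near [n / mu] the regularly varying weights [q]
    are almost constant. There remains the sum over a window of [k], of
    width a small multiple of [n], of the probabilities that [S_k = n] with
    fewer than [j] large steps. No local limit theorem is needed for it: the
    walk seldom makes a large step inside the window, so the restriction bears
    on its state at the start of the window only, and from there on the sum
    counts the visits to [n], which have expectation about [1 / mu] by the
    renewal theorem ([renewal_cvg], applied in [few_window_bounds]). At the
    start of the window the number of large steps is binomial and converges to
    a Poisson law of mean nearly [lam], when [n P(X > y_n)] tends to [mu lam].
    So the ratio tends to the mass that the Poisson law of mean [lam] gives to
    values below [j] ([few_large_steps], [nth_largest_limit]).

    It then remains to evaluate [lam] for [y_n = x L(n) n^(1/alpha)]. If
    [alpha < 2] this is a multiple of the [1/n]-quantile of [X], whose tail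
    varies regularly with exponent [alpha] by Karamata's theorem, and
    [lam = c x^(-alpha)] with [c = mu^alpha / |Gamma(1 - alpha)|]
    ([scale_heavy]). If [alpha = 2], the tail of [X] is negligible against its
    truncated second moment divided by the squared level, and [lam = 0]
    ([scale_light]). The Poisson masses, as functions of [x], are distribution
    functions having the stated densities ([frechet_probability]).

    Regular variation enters through Potter's bounds only, which rest on
    Karamata's uniform convergence theorem ([slowly_varying_uniform]). That
    [W(r) = rho] holds comes from the fact that [U(x)] is finite exactly when
    [W(x) <= rho] ([conv_radius_gibbs]): in the first case this means up to
    [rho_w], where [W] equals [rho]; in the second one [W] takes the value [rho]
    inside its disc of convergence ([sup_subcritical]), so that [p] has
    exponential tails. *)

(** * Polynomials ordered coefficientwise up to a given degree *)

Definition lecoef (R : realDomainType) (n : nat) (f g : {poly R}) :=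
  forall m, (m <= n)%N -> f`_m <= g`_m.

Lemma lecoef_refl (R : realDomainType) n (f : {poly R}) : lecoef n f f.
Proof. by []. Qed.

Lemma lecoef_trans (R : realDomainType) n (f g h : {poly R}) :
  lecoef n f g -> lecoef n g h -> lecoef n f h.
Proof. by move=> fg gh m mn; exact: le_trans (fg m mn) (gh m mn). Qed.

Lemma lecoefD (R : realDomainType) n (f1 f2 g1 g2 : {poly R}) :
  lecoef n f1 g1 -> lecoef n f2 g2 -> lecoef n (f1 + f2) (g1 + g2).
Proof. by move=> h1 h2 m mn; rewrite !coefD lerD ?h1 ?h2. Qed.

Lemma lecoef_sum (R : realDomainType) n (I : Type) (r : seq I) (Q : pred I)
    (F G : I -> {poly R}) :
  (forall i, Q i -> lecoef n (F i) (G i)) ->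
  lecoef n (\sum_(i <- r | Q i) F i) (\sum_(i <- r | Q i) G i).
Proof.
by move=> h m mn; rewrite !coef_sum; apply: ler_sum => i Qi; apply: h.
Qed.

Lemma lecoef0_sum (R : realDomainType) n (I : Type) (r : seq I) (Q : pred I)
    (F : I -> {poly R}) :
  (forall i, Q i -> lecoef n 0 (F i)) -> lecoef n 0 (\sum_(i <- r | Q i) F i).
Proof.
move=> h; rewrite -[X in lecoef _ X _](@big1 _ _ +%R I r Q _ (fun _ _ => erefl)).
exact: lecoef_sum.
Qed.

Lemma lecoefMn (R : realDomainType) n (f g : {poly R}) k :
  lecoef n f g -> lecoef n (f *+ k) (g *+ k).
Proof. by move=> h m mn; rewrite !coefMn lerMn2r h ?orbT. Qed.

Lemma lecoefMl (R : realDomainType) n (f g h : {poly R}) :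
  lecoef n 0 h -> lecoef n f g -> lecoef n (h * f) (h * g).
Proof.
move=> h0 fg m mn; rewrite !coefM; apply: ler_sum => i _.
have im : (i <= m)%N by rewrite -ltnS.
apply: ler_wpM2l; first by have := h0 _ (leq_trans im mn); rewrite coef0.
by apply: fg; rewrite (leq_trans (leq_subr _ _)).
Qed.

Lemma lecoefMr (R : realDomainType) n (f g h : {poly R}) :
  lecoef n 0 h -> lecoef n f g -> lecoef n (f * h) (g * h).
Proof. by move=> h0 fg; rewrite ![_ * h]mulrC; apply: lecoefMl. Qed.

Lemma lecoef0M (R : realDomainType) n (f g : {poly R}) :
  lecoef n 0 f -> lecoef n 0 g -> lecoef n 0 (f * g).
Proof. by move=> f0 g0; rewrite -(mulr0 f); apply: lecoefMl. Qed.

Lemma lecoef01 (R : realDomainType) n : lecoef n 0 (1 : {poly R}).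
Proof. by move=> m _; rewrite coef0 coef1 ler0n. Qed.

Lemma lecoef0X (R : realDomainType) n (f : {poly R}) k :
  lecoef n 0 f -> lecoef n 0 (f ^+ k).
Proof.
move=> f0; elim: k => [|k IH]; first by rewrite expr0; exact: lecoef01.
by rewrite exprS; apply: lecoef0M.
Qed.

Lemma lecoefX (R : realDomainType) n (f g : {poly R}) k :
  lecoef n 0 f -> lecoef n f g -> lecoef n (f ^+ k) (g ^+ k).
Proof.
move=> f0 fg; have g0 := lecoef_trans f0 fg.
elim: k => [|k IH]; first by rewrite !expr0.
rewrite !exprS; apply: (@lecoef_trans _ _ _ (f * g ^+ k)).
  exact: lecoefMl.
by apply: lecoefMr => //; apply: lecoef0X.
Qed.

(** The Chernoff bound for the lower tail: t^m >= t^n for m <= n, as t <= 1. *)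
Lemma lower_chernoff (R : realFieldType) (f : {poly R}) t n :
  (forall m, 0 <= f`_m) -> 0 < t -> t <= 1 ->
  t ^+ n * \sum_(m < n.+1) f`_m <= f.[t].
Proof.
move=> f0 t0 t1.
have tp m : 0 <= t ^+ m by apply: exprn_ge0; apply: ltW.
rewrite (@horner_coef_wide _ (n.+1 + size f)) ?leq_addl //.
rewrite big_split_ord /= mulr_sumr -[leLHS]addr0; apply: lerD; last first.
  by apply: sumr_ge0 => i _; rewrite mulr_ge0.
apply: ler_sum => i _; rewrite mulrC; apply: ler_wpM2l => //.
by apply: ler_wiXn2l => //; [exact: ltW | rewrite -ltnS].
Qed.

(** The Chernoff bound for the upper tail: t^m >= t^a for m >= a, as 1 <= t. *)
Lemma upper_chernoff (R : realFieldType) (f : {poly R}) t a n :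
  (forall m, 0 <= f`_m) -> 1 <= t ->
  t ^+ a * \sum_(a <= m < n.+1) f`_m <= f.[t].
Proof.
move=> f0 t1.
have tp m : 0 <= t ^+ m by apply: exprn_ge0; rewrite (le_trans ler01).
rewrite (@horner_coef_wide _ (n.+1 + size f)) ?leq_addl // mulr_sumr.
rewrite -(big_mkord xpredT (fun i => f`_i * t ^+ i)).
have [an|na] := leqP a n.+1; last first.
  rewrite [leLHS]big_geq ?(ltnW na) //; apply: sumr_ge0 => i _.
  by rewrite mulr_ge0.
rewrite [leRHS](big_cat_nat _ (n := a)) //= ?(leq_trans an (leq_addr _ _)) //.
rewrite [X in _ + X](big_cat_nat _ (n := n.+1)) //= ?leq_addr //.
rewrite addrCA -[leLHS]addr0; apply: lerD; last first.
  by apply: addr_ge0; apply: sumr_ge0 => i _; rewrite mulr_ge0.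
rewrite !big_nat; apply: ler_sum => i /andP[ai _].
by rewrite mulrC; apply: ler_wpM2l => //; apply: ler_weXn2l.
Qed.

Lemma sum_coef_le_horner1 (R : realFieldType) (f : {poly R}) n :
  (forall m, 0 <= f`_m) -> \sum_(m < n.+1) f`_m <= f.[1].
Proof.
move=> f0; have := @lower_chernoff R f 1 n f0 ltr01 (lexx _).
by rewrite expr1n mul1r.
Qed.

(** * Convolution powers with few large factors *)

(** If s and g are the generating polynomials of a step on the event that it is
    small and on the event that it is large, this is the generating polynomial
    of the sum of k independent steps on the event that fewer than j of them are
    large. *)
Definition few (R : nzRingType) (s g : {poly R}) (j k : nat) : {poly R} :=
  \sum_(i < j) (s ^+ (k - i) * g ^+ i) *+ 'C(k, i).

Lemma few_ge0 (R : realDomainType) n (s g : {poly R}) j k :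
  lecoef n 0 s -> lecoef n 0 g -> lecoef n 0 (few s g j k).
Proof.
move=> s0 g0; apply: lecoef0_sum => i _; rewrite -(mul0rn _ 'C(k, i)); apply: lecoefMn.
by apply: lecoef0M; apply: lecoef0X.
Qed.

Lemma few_total (R : comNzRingType) (s g : {poly R}) k :
  few s g k.+1 k = (s + g) ^+ k.
Proof. by rewrite exprDn. Qed.

(** With one more step, the only way to leave the event is that this step is
    the (j + 1)-st large one. *)
Lemma few_step (R : comNzRingType) (s g : {poly R}) j k :
  (s + g) * few s g j.+1 k =
  few s g j.+1 k.+1 + g * ((s ^+ (k - j) * g ^+ j) *+ 'C(k, j)).
Proof.
have sE i : s * ((s ^+ (k - i) * g ^+ i) *+ 'C(k, i)) =
    (s ^+ (k.+1 - i) * g ^+ i) *+ 'C(k, i).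
  have [ik|ki] := leqP i k; last by rewrite bin_small // !mulr0n mulr0.
  by rewrite -mulrnAr mulrA -exprS subSn // mulrnAr.
have H : few s g j.+1 k.+1 = s * few s g j.+1 k + g * few s g j k.
  rewrite /few !mulr_sumr big_ord_recl [X in _ = X + _]big_ord_recl /= !bin0.
  rewrite -addrA; congr (_ + _).
    by rewrite !mulr1n !subn0 expr0 !mulr1 exprS.
  rewrite -big_split /=; apply: eq_bigr => i _.
  rewrite /bump /= add1n binS mulrnDr sE subSS (exprS g i); congr (_ + _).
  by rewrite mulrCA mulrnAr.
rewrite H mulrDl -addrA; congr (_ + _).
rewrite -mulrDr; congr (_ * _).
by rewrite {1}/few big_ord_recr.
Qed.

Lemma few_le_expr (R : realDomainType) n (s g : {poly R}) j k :
  lecoef n 0 s -> lecoef n 0 g -> lecoef n (few s g j k) ((s + g) ^+ k).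
Proof.
move=> s0 g0; have nz i : lecoef n 0 ((s ^+ (k - i) * g ^+ i) *+ 'C(k, i)).
  rewrite -(mul0rn _ 'C(k, i)); apply: lecoefMn.
  by apply: lecoef0M; apply: lecoef0X.
rewrite -few_total /few.
have [jk|kj] := leqP j k.+1.
  rewrite -!(big_mkord xpredT (fun i => (s ^+ (k - i) * g ^+ i) *+ 'C(k, i))).
  rewrite (big_cat_nat _ (n := j) (p := k.+1)) //= -[X in lecoef _ X _]addr0.
  apply: lecoefD => //.
  exact: lecoef0_sum.
rewrite -!(big_mkord xpredT (fun i => (s ^+ (k - i) * g ^+ i) *+ 'C(k, i))).
rewrite (big_cat_nat _ (n := k.+1) (p := j)) //= ?(ltnW kj) //.
rewrite [X in _ + X]big_nat_cond [X in _ + X]big1 ?addr0 //.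
by move=> i /andP[/andP[ki _] _]; rewrite bin_small.
Qed.

Lemma few_step_bounds (R : realDomainType) n (s g : {poly R}) j k :
  lecoef n 0 s -> lecoef n 0 g -> (0 < j)%N ->
  lecoef n (few s g j k.+1) ((s + g) * few s g j k) /\
  lecoef n ((s + g) * few s g j k) (few s g j k.+1 + g * (s + g) ^+ k).
Proof.
case: j => // j s0 g0 _; rewrite few_step.
have nz : lecoef n 0 ((s ^+ (k - j) * g ^+ j) *+ 'C(k, j)).
  rewrite -(mul0rn _ 'C(k, j)); apply: lecoefMn.
  by apply: lecoef0M; apply: lecoef0X.
split.
  rewrite -[X in lecoef _ X _]addr0; apply: lecoefD => //.
  by apply: lecoef0M.
apply: lecoefD => //; apply: lecoefMl => //.
apply: lecoef_trans (@few_le_expr R n s g j.+1 k s0 g0).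
rewrite /few big_ord_recr /= -[X in lecoef _ X _]add0r; apply: lecoefD => //.
exact: few_ge0.
Qed.

(** Prolonging by r steps, a large step among the last r is needed to leave the
    event, which leaves k + r - 1 unrestricted steps. *)
Lemma few_prolong (R : realDomainType) n (s g : {poly R}) j k r :
  lecoef n 0 s -> lecoef n 0 g -> (0 < j)%N ->
  lecoef n (few s g j (k + r)) ((s + g) ^+ r * few s g j k) /\
  lecoef n ((s + g) ^+ r * few s g j k)
    (few s g j (k + r) + g * (s + g) ^+ (k + r).-1 *+ r).
Proof.
move=> s0 g0 j0; have p0 : lecoef n 0 (s + g).
  by rewrite -[0]addr0; apply: lecoefD.
elim: r => [|r [IH1 IH2]].
  by rewrite addn0 expr0 mul1r mulr0n addr0; split; exact: lecoef_refl.
have [h1 h2] := few_step_bounds (k + r) s0 g0 j0.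
rewrite addnS exprS -mulrA; split.
  by apply: lecoef_trans h1 _; apply: lecoefMl.
apply: lecoef_trans (lecoefMl p0 IH2) _.
rewrite mulrDr mulrS addrA; apply: lecoefD => //.
rewrite -mulrnAr mulrCA -mulrnAr; apply: lecoefMl => //.
case: r {IH1 IH2 h1 h2} => [|r]; first by rewrite !mulr0n mulr0.
by rewrite addnS /= mulrnAr -exprS; exact: lecoef_refl.
Qed.

(** * The renewal theorem *)

(** Two elements of S at the least positive distance d exist; Euclidean
    division shows that d divides S, so S contains consecutive numbers s and
    s + 1, whose non-negative combinations cover all large integers. *)
Lemma numerical_semigroup (S : set nat) :
  S 0%N -> (forall a b, S a -> S b -> S (a + b)%N) ->
  (forall d, (forall n, S n -> (d %| n)%N) -> (d %| 1)%N) ->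
  exists N, forall n, (N <= n)%N -> S n.
Proof.
move=> S0 Sadd Sgcd.
have Smul k a : S a -> S (k * a)%N.
  by move=> Sa; elim: k => [|k IH] //; rewrite mulSn; apply: Sadd.
pose P d := `[< (0 < d)%N /\ exists2 s, S s & S (s + d)%N >].
have exP : exists d, P d.
  apply: contrapT => nP; have : (0 %| 1)%N.
    apply: Sgcd => n Sn; rewrite dvd0n; apply/negPn/negP => n0.
    by apply: nP; exists n; apply/asboolP; split; [rewrite lt0n|exists 0%N].
  by [].
have [d /asboolP[d0 [s Ss Ssd]] dmin] := ex_minnP exP.
have d1 : d = 1%N.
  apply/eqP; rewrite -dvdn1; apply: Sgcd => x Sx.
  have [//|] := eqVneq (x %% d)%N 0%N; first by move/eqP.
  move=> r0; have : P (x %% d)%N.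
    apply/asboolP; split; first by rewrite lt0n.
    exists (x %/ d * (s + d))%N; first exact: Smul.
    rewrite mulnDr -addnA -divn_eq addnC; apply: Sadd => //; exact: Smul.
  by move/dmin; rewrite leqNgt ltn_mod d0.
subst d; case: s Ss Ssd => [|s] Ss Ss1.
  by exists 0%N => n _; rewrite -[n]muln1; apply: Smul.
exists (s.+1 * s.+1)%N => n sn.
have rs : (n %% s.+1 < s.+1)%N by rewrite ltn_mod.
have qs : (s.+1 <= n %/ s.+1)%N by rewrite leq_divRL.
have -> : n = (n %% s.+1 * (s.+1 + 1) + (n %/ s.+1 - n %% s.+1) * s.+1)%N.
  rewrite mulnDr muln1 mulnBl addnAC subnKC -?divn_eq //.
  by rewrite leq_mul2r (leq_trans (ltnW rs) qs) orbT.
by apply: Sadd; apply: Smul.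
Qed.

Lemma limsup_seq_exists (R : realType) (u : nat -> R) (C : R) :
  (forall n, `|u n| <= C) ->
  exists L, (forall e : R, 0 < e -> \forall n \near \oo, u n < L + e) /\
    (forall e : R, 0 < e -> forall N, exists2 n, (N <= n)%N & L - e < u n).
Proof.
move=> uC; pose A := [set x : R | \forall n \near \oo, u n < x].
have A0 : A (C + 1).
  near=> n; apply: le_lt_trans (ler_norm _) _.
  by apply: le_lt_trans (uC n) _; rewrite ltrDl.
have lbA : lbound A (- C).
  move=> x [N _ /(_ N (leqnn N))] /= ux; apply: le_trans (ltW ux).
  by have := uC N; rewrite ler_norml => /andP[].
have infA : has_inf A by split; [exists (C + 1)|exists (- C)].
exists (inf A); split=> e e0.
  have [x Ax xe] := inf_adherent e0 infA.
  by near=> n; apply: lt_trans xe; near: n.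
move=> N; apply: contrapT => nu.
have : A (inf A - e / 2).
  exists N => // n /= Nn; rewrite ltNge; apply/negP => h; apply: nu.
  by exists n => //; apply: lt_le_trans h; lra.
by move/(ge_inf infA.2); lra.
Unshelve. all: by end_near. Qed.

Section renewal.
Context {R : realType}.
Variable p : nat -> R.
Hypothesis p_ge0 : forall l, 0 <= p l.
Hypothesis p_sum1 : series p @ \oo --> (1 : R).
Hypothesis p0_lt1 : p 0%N < 1.

Local Notation tail n := (1 - \sum_(l < n.+1) p l).

Lemma sum_law_le1 n : \sum_(l < n) p l <= 1.
Proof.
have := nondecreasing_cvgn_le _ _ n; move=> /(_ _ (series p)).
rewrite (cvg_lim _ p_sum1) // => h; rewrite -(big_mkord xpredT).
apply: h; last exact: p_sum1.
by apply: nondecreasing_series => k _ _; exact: p_ge0.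
Qed.

Lemma tail_ge0 n : 0 <= tail n.
Proof. by rewrite subr_ge0 sum_law_le1. Qed.

Lemma tail_cvg0 (e : R) : 0 < e -> \forall n \near \oo, tail n < e.
Proof.
move=> e0; have /cvgrPdist_lt/(_ _ e0) [N _ H] := p_sum1.
exists N => // n /= Nn; have := H n.+1 (leqW Nn).
rewrite /series /= big_mkord ger0_norm ?tail_ge0 //.
Qed.

(** The coefficients of 1 / (1 - sum_l p_l x^l). *)
Fixpoint renewal_prefix (n : nat) : seq R :=
  if n is n'.+1 then
    let s := renewal_prefix n' in
    rcons s ((\sum_(l < n'.+1) p l.+1 * nth 0 s (n' - l)) / (1 - p 0%N))
  else [:: (1 - p 0%N)^-1].

Definition renewal (n : nat) : R := nth 0 (renewal_prefix n) n.

Lemma size_renewal_prefix n : size (renewal_prefix n) = n.+1.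
Proof. by elim: n => //= n IH; rewrite size_rcons IH. Qed.

Lemma nth_renewal_prefix n m : (m <= n)%N ->
  nth 0 (renewal_prefix n) m = renewal m.
Proof.
elim: n => [|n IH]; first by rewrite leqn0 => /eqP ->.
rewrite leq_eqVlt => /predU1P[-> //|mn] /=.
by rewrite nth_rcons size_renewal_prefix mn IH.
Qed.

Lemma renewal0 : renewal 0 = (1 - p 0%N)^-1.
Proof. by []. Qed.

Lemma renewalS n :
  renewal n.+1 = (\sum_(l < n.+1) p l.+1 * renewal (n - l)) / (1 - p 0%N).
Proof.
rewrite {1}/renewal /= nth_rcons size_renewal_prefix ltnn eqxx.
congr (_ / _); apply: eq_bigr => l _.
by rewrite nth_renewal_prefix // leq_subr.
Qed.

Lemma renewal_eq n :
  renewal n.+1 = \sum_(l < n.+2) p l * renewal (n.+1 - l).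
Proof.
rewrite big_ord_recl subn0 /=.
have d0 : 1 - p 0%N != 0 by rewrite subr_eq0 eq_sym lt_eqF.
have -> : \sum_(i < n.+1) p (bump 0 i) * renewal (n.+1 - bump 0 i) =
    (1 - p 0%N) * renewal n.+1.
  by rewrite renewalS mulrC divfK //; apply: eq_bigr.
by rewrite mulrBl mul1r addrC subrK.
Qed.

Lemma renewal_bounds n : 0 <= renewal n <= (1 - p 0%N)^-1.
Proof.
have d0 : 0 < 1 - p 0%N by rewrite subr_gt0.
elim/ltn_ind: n => -[|n] IH; first by rewrite renewal0 lexx invr_ge0 ltW.
rewrite renewalS; apply/andP; split.
  apply: divr_ge0; last exact: ltW.
  apply: sumr_ge0 => l _; apply: mulr_ge0 => //.
  by have /andP[] := IH (n - l)%N (leq_ltn_trans (leq_subr _ _) (ltnSn _)).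
rewrite ler_pdivrMr // mulVf ?gt_eqF //.
have : \sum_(l < n.+1) p l.+1 * renewal (n - l) <=
    \sum_(l < n.+1) p l.+1 * (1 - p 0%N)^-1.
  apply: ler_sum => l _; apply: ler_wpM2l => //.
  by have /andP[] := IH (n - l)%N (leq_ltn_trans (leq_subr _ _) (ltnSn _)).
move/le_trans; apply; rewrite -mulr_suml ler_pdivrMr // mul1r.
rewrite lerBrDr addrC.
have := sum_law_le1 n.+2; rewrite big_ord_recl /=.
by under eq_bigr do rewrite /bump /= add1n.
Qed.

(** Every n is overshot exactly once: the last renewal at or before n is at
    some n - j and the next step exceeds j. *)
Lemma renewal_tail n : \sum_(j < n.+1) tail j * renewal (n - j) = 1.
Proof.
have d0 : 1 - p 0%N != 0 by rewrite subr_eq0 eq_sym lt_eqF.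
elim: n => [|n IH].
  by rewrite !big_ord_recl !big_ord0 /= !addr0 subn0 renewal0 divff.
rewrite big_ord_recl /= big_ord_recl big_ord0 addr0 subn0.
rewrite mulrBl mul1r {1}renewal_eq big_ord_recl /= subn0.
rewrite [X in X + _]addrAC subrr add0r -big_split /= -[RHS]IH.
apply: eq_bigr => i _; rewrite /bump /= ?add1n subSS -mulrDl; congr (_ * _).
by rewrite big_ord_recr /=; ring.
Qed.

(** If a bounded sequence satisfying the renewal recursion is eventually below
    L and nearly L at n, it is nearly L at n - l whenever p l > 0, being an
    average of earlier values. *)
Lemma near_max_step (x : nat -> R) (C L : R) l :
  (forall n, `|x n| <= C) ->
  (forall n, x n.+1 = \sum_(l < n.+2) p l * x (n.+1 - l)%N) ->
  (forall e : R, 0 < e -> \forall n \near \oo, x n < L + e) ->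
  0 < p l ->
  forall e : R, 0 < e -> exists2 d, 0 < d & exists N, forall n, (N <= n)%N ->
    L - d < x n -> L - e < x (n - l)%N.
Proof.
move=> xC xrec xL pl0 e e0.
have C0 : 0 <= C by apply: le_trans (xC 0%N).
pose d := e * p l / 4; have d0 : 0 < d by rewrite /d !mulr_gt0.
have [N0 _ xN0] := xL d d0.
pose D := C + `|L| + d; have D0 : 0 < D by rewrite /D ltr_wpDl // addr_ge0.
pose y i := L + d - x i + (i < N0)%N%:R * D.
have y0 i : 0 <= y i.
  rewrite /y; have [iN|Ni] := ltnP i N0; last first.
    by have := xN0 _ Ni; rewrite /= mul0r addr0; lra.
  rewrite mul1r /D; have := xC i; rewrite ler_norml => /andP[_].
  have := ler_norm (- L); rewrite normrN; lra.
have e1 : 0 < d / (2 * D) by rewrite divr_gt0 // mulr_gt0.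
have [N1 _ tN1] := tail_cvg0 e1.
exists d => //; exists (l + N0 + N1).+1 => n Nn xn.
have nl : (l <= n)%N by lia.
have n0 : (N0 <= n)%N by lia.
have lin : (l < n.+1)%N by lia.
have h1 : p l * y (n - l)%N <= \sum_(i < n.+1) p i * y (n - i)%N.
  rewrite (bigD1 (Ordinal lin)) //= lerDl sumr_ge0 // => i _.
  exact: mulr_ge0.
have h2 : \sum_(i < n.+1) p i * y (n - i)%N =
    (1 - tail n) * (L + d) - x n + (\sum_(i < n.+1 | (n - i < N0)%N) p i) * D.
  rewrite /y; under eq_bigr do rewrite mulrDr mulrBr mulrA.
  rewrite big_split /= sumrB -mulr_suml -mulr_suml.
  have -> : \sum_(i < n.+1) p i * x (n - i)%N = x n.
    by case: (n) Nn => // n' _; rewrite -xrec.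
  congr (_ - _ + _ * D); first by congr (_ * _); ring.
  rewrite [RHS]big_mkcond /=; apply: eq_bigr => i _.
  by case: ifP; rewrite ?mulr1 ?mulr0.
have h3 : \sum_(i < n.+1 | (n - i < N0)%N) p i <= tail (n - N0).
  rewrite lerBrDr; apply: le_trans (sum_law_le1 n.+1).
  rewrite [X in _ <= X](bigID (fun i : 'I_n.+1 => (n - i < N0)%N)) /= lerD2l.
  rewrite (@big_ord_widen _ _ _ (n - N0).+1 n.+1) ?ltnS ?leq_subr //.
  rewrite le_eqVlt; apply/orP; left; apply/eqP; apply: eq_bigl => i /=.
  rewrite -leqNgt; have := ltn_ord i; lia.
have h4 : tail (n - N0) < d / (2 * D) by apply: tN1 => /=; clear -Nn; lia.
have h5 : tail n < d / (2 * D) by apply: tN1 => /=; clear -Nn; lia.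
have h6 : tail n * - (L + d) <= tail n * D.
  apply: ler_wpM2l; first exact: tail_ge0.
  rewrite /D; have := ler_norm (- L); rewrite normrN; lra.
have h7 : tail n * D <= d / 2.
  have -> : d / 2 = d / (2 * D) * D by field; rewrite gt_eqF.
  by rewrite ler_wpM2r // ltW.
have h8 : (\sum_(i < n.+1 | (n - i < N0)%N) p i) * D <= d / 2.
  have -> : d / 2 = d / (2 * D) * D by field; rewrite gt_eqF.
  by rewrite ler_wpM2r ?(ltW D0) // (le_trans h3) // ltW.
have h9 : p l * (L + d - x (n - l)%N) <= p l * y (n - l)%N.
  by apply: ler_wpM2l => //; rewrite /y lerDl mulr_ge0 // ltW.
have h10 : p l * (L + d - x (n - l)%N) < p l * e.
  have -> : p l * e = d + d + d + d by rewrite /d; field.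
  apply: le_lt_trans h9 _; apply: le_lt_trans h1 _; rewrite h2.
  move: xn h6 h7 h8; set A := _ * D; set B := _ * D; set t := tail n => *.
  have -> : (1 - t) * (L + d) = L + d + t * - (L + d) by ring.
  lra.
by move: h10; rewrite ltr_pM2l // => ?; lra.
Qed.

Hypothesis p_aperiodic :
  forall d, (forall l, 0 < p l -> (d %| l)%N) -> (d %| 1)%N.

(** The distances l such that x is nearly L at n - l whenever it is nearly L at n
    form an additive semigroup. It contains all l with p l > 0, hence, by
    aperiodicity, all large integers. *)
Lemma near_max_window (x : nat -> R) (C L : R) :
  (forall n, `|x n| <= C) ->
  (forall n, x n.+1 = \sum_(l < n.+2) p l * x (n.+1 - l)%N) ->
  (forall e : R, 0 < e -> \forall n \near \oo, x n < L + e) ->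
  (forall e : R, 0 < e -> forall N, exists2 n, (N <= n)%N & L - e < x n) ->
  forall J (e : R) N, 0 < e -> exists2 n, (N <= n)%N &
    forall j, (j < J)%N -> L - e < x (n - j)%N.
Proof.
move=> xC xrec xL xL' J e N e0.
pose S l := forall e : R, 0 < e -> exists2 d, 0 < d & exists N, forall n,
  (N <= n)%N -> L - d < x n -> L - e < x (n - l)%N.
have [l0 Sl0] : exists l0, forall l, (l0 <= l)%N -> S l.
  apply: numerical_semigroup.
  - by move=> e' e'0; exists e' => //; exists 0%N => n _; rewrite subn0.
  - move=> a b Sa Sb e' e'0; have [d d0 [N1 H1]] := Sb _ e'0.
    have [d' d'0 [N2 H2]] := Sa _ d0.
    exists d' => //; exists (N2 + N1 + a)%N => n Nn xn.
    rewrite subnDA; apply: H1; first by lia.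
    by apply: H2 => //; lia.
  - move=> d dS; apply: p_aperiodic => l pl; apply: dS => e' e'0.
    exact: (near_max_step xC xrec xL pl).
have [d d0 [N1 H]] : exists2 d, 0 < d & exists N1, forall n, (N1 <= n)%N ->
    L - d < x n -> forall j, (j < J)%N -> L - e < x (n - (l0 + j))%N.
  elim: J => [|J [d d0 [N1 H1]]]; first by exists 1 => //; exists 0%N.
  have [d' d'0 [N2 H2]] := Sl0 (l0 + J)%N (leq_addr _ _) e e0.
  exists (Num.min d d'); first by rewrite lt_min d0.
  exists (N1 + N2)%N => n Nn xn j; rewrite ltnS leq_eqVlt => /predU1P[->|jJ].
    apply: H2; first by lia.
    by apply: le_lt_trans xn; rewrite lerD2l lerN2 ge_min lexx orbT.
  apply: H1 => //; first by lia.
  by apply: le_lt_trans xn; rewrite lerD2l lerN2 ge_min lexx.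
have [n Nn xn] := xL' d d0 (N1 + l0 + N)%N.
exists (n - l0)%N; first by lia.
by move=> j jJ; rewrite -subnDA; apply: H => //; lia.
Qed.

Variable mu : R.
Hypothesis mu_gt0 : 0 < mu.
Hypothesis p_mean : series (fun l => l%:R * p l) @ \oo --> mu.

Lemma mean_partial_le n : \sum_(l < n) l%:R * p l <= mu.
Proof.
have := nondecreasing_cvgn_le _ _ n; move=> /(_ _ (series (fun l => l%:R * p l))).
rewrite (cvg_lim _ p_mean) // => h; rewrite -(big_mkord xpredT (fun l => l%:R * p l)).
apply: h; last exact: p_mean.
by apply: nondecreasing_series => k _ _; apply: mulr_ge0.
Qed.

Lemma mean_partial_cvg (e : R) : 0 < e ->
  \forall n \near \oo, mu - e < \sum_(l < n) l%:R * p l.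
Proof.
move=> e0; have /cvgrPdist_lt/(_ _ e0) [N _ H] := p_mean.
exists N => // n /= Nn; have := H n Nn.
rewrite /series /= big_mkord ger0_norm ?subr_ge0 ?mean_partial_le //; lra.
Qed.

Lemma sum_tail n :
  \sum_(j < n) tail j = \sum_(l < n.+1) l%:R * p l + n%:R * tail n.
Proof.
elim: n => [|n IH]; first by rewrite big_ord0 big_ord_recl big_ord0 /= !mul0r !addr0.
rewrite big_ord_recr /= IH [in RHS]big_ord_recr /=.
rewrite [in X in _ = _ + X]big_ord_recr /=.
move: (\sum_(l < n.+1) p l) (\sum_(l < n.+1) l%:R * p l) (p n.+1) => A B c.
by rewrite -(natr1 n); ring.
Qed.

Lemma mul_tail_le n : n%:R * tail n <= mu - \sum_(l < n.+1) l%:R * p l.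
Proof.
have [->|n0] := eqVneq n 0%N.
  by rewrite mul0r subr_ge0 mean_partial_le.
have n0' : 0 < n%:R :> R by rewrite ltr0n lt0n.
rewrite -ler_pdivlMl //; apply/ler_addgt0Pr => /= e e0.
have [N _ H] := tail_cvg0 e0.
have := H (N + n)%N (leq_addr _ _) => /= tN.
apply: (@le_trans _ _ (\sum_(n.+1 <= l < (N + n).+1) p l + e)).
  rewrite -(big_mkord xpredT).
  move: tN; rewrite -(big_mkord xpredT) (big_cat_nat _ (n := n.+1)) //= ?ltnS ?leq_addl //.
  lra.
rewrite lerD2r ler_pdivlMl // mulr_sumr lerBrDr.
apply: le_trans (mean_partial_le (N + n).+1).
rewrite -(big_mkord xpredT (fun l => l%:R * p l)) -(big_mkord xpredT (fun l => l%:R * p l)).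
rewrite [leRHS](big_cat_nat _ (n := n.+1)) //=; last by rewrite ltnS leq_addl.
rewrite addrC; apply: lerD => //.
rewrite !big_nat; apply: ler_sum => l /andP[nl _].
by rewrite ler_wpM2r // ler_nat ltnW.
Qed.

Lemma sum_tail_le n : \sum_(j < n) tail j <= mu.
Proof. by rewrite sum_tail -lerBrDl mul_tail_le. Qed.

(** Erdos-Feller-Pollard. Near a maximum (or minimum) the renewal sequence is
    flat on windows of any length, where the overshoot identity, whose weights
    sum to mu, forces its value to be 1 / mu. *)
Theorem renewal_cvg : renewal @ \oo --> mu^-1.
Proof.
have mu0 := mu_gt0.
set C := (1 - p 0%N)^-1.
have C0 : 0 < C by rewrite invr_gt0 subr_gt0.
have uC n : `|renewal n| <= C.
  by have /andP[u0 uC] := renewal_bounds n; rewrite ger0_norm.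
have NuC n : `|- renewal n| <= C by rewrite normrN.
have Nrec n : - renewal n.+1 = \sum_(l < n.+2) p l * - renewal (n.+1 - l)%N.
  by rewrite renewal_eq -sumrN; apply: eq_bigr => l _; rewrite mulrN.
have [L [LU Lf]] := limsup_seq_exists uC.
have [L' [LU' Lf']] := limsup_seq_exists NuC.
have T_near (e : R) : 0 < e -> exists J, mu - e < \sum_(j < J) tail j.
  move=> e0; have [N _ H] := mean_partial_cvg e0; exists N; rewrite sum_tail.
  apply: lt_le_trans (H _ (leqnSn _)) _; rewrite lerDl mulr_ge0 //.
  exact: tail_ge0.
have split_sum J n : (J <= n)%N ->
    1 = \sum_(j < J) tail j * renewal (n - j)%N +
        \sum_(J <= j < n.+1) tail j * renewal (n - j)%N.
  move=> Jn; rewrite -{1}(renewal_tail n).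
  rewrite -!(big_mkord xpredT (fun j => tail j * renewal (n - j))).
  by rewrite (big_cat_nat _ (n := J)) //= leqW.
have Lmu : L <= mu^-1.
  rewrite -div1r ler_pdivlMr //; apply/ler_addgt0Pr => /= e e0.
  have L0 : 0 <= L.
    apply/ler_addgt0Pr => e' e'0; have [N _ /(_ N (leqnn _))/=] := LU _ e'0.
    by have /andP[] := renewal_bounds N; lra.
  pose e1 := e / (2 * (mu + L + 1)).
  have D0 : 0 < mu + L + 1 by lra.
  have e10 : 0 < e1 by rewrite divr_gt0 // mulr_gt0.
  have [J TJ] := T_near _ e10.
  have [n Jn H] := near_max_window uC renewal_eq LU Lf J J e10.
  have : \sum_(j < J) tail j * (L - e1) <= 1.
    rewrite [leRHS](split_sum _ _ Jn) -[leLHS]addr0; apply: lerD.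
      by apply: ler_sum => j _; rewrite ler_wpM2l ?tail_ge0 // ltW // H.
    apply: sumr_ge0 => j _; rewrite mulr_ge0 ?tail_ge0 //.
    by have /andP[] := renewal_bounds (n - j).
  rewrite -mulr_suml; have := sum_tail_le J; move: TJ.
  set T := \sum_(j < J) tail j => TJ Tmu TL.
  have h1 : (mu - e1) * L <= T * L by rewrite ler_wpM2r // ltW.
  have h2 : T * e1 <= mu * e1 by rewrite ler_wpM2r // ltW.
  have h3 : e1 * (mu + L + 1) = e / 2 by rewrite /e1; field; rewrite gt_eqF.
  nra.
have L'mu : mu^-1 <= - L'.
  rewrite -div1r ler_pdivrMr //; apply/ler_addgt0Pr => /= e e0.
  have L'0 : L' <= 0.
    rewrite -[leRHS]addr0; apply/ler_addgt0Pr => e' e'0.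
    have [n _] := Lf' _ e'0 0%N.
    by have /andP[] := renewal_bounds n; lra.
  pose e1 := e / (2 * (mu + C + - L' + 1)).
  have D0 : 0 < mu + C + - L' + 1 by lra.
  have e10 : 0 < e1 by rewrite divr_gt0 // mulr_gt0.
  have [J TJ] := T_near _ e10.
  have [n Jn H] := near_max_window NuC Nrec LU' Lf' J J e10.
  have : 1 <= \sum_(j < J) tail j * (e1 - L') + (mu - \sum_(j < J) tail j) * C.
    rewrite [leLHS](split_sum _ _ Jn); apply: lerD.
      apply: ler_sum => j _; rewrite ler_wpM2l ?tail_ge0 //.
      by have := H j (ltn_ord j); lra.
    apply: (@le_trans _ _ (\sum_(J <= j < n.+1) tail j * C)).
      apply: ler_sum => j _; rewrite ler_wpM2l ?tail_ge0 //.
      by have /andP[] := renewal_bounds (n - j).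
    rewrite -mulr_suml ler_wpM2r ?(ltW C0) // lerBrDl.
    apply: le_trans (sum_tail_le n.+1).
    rewrite -!(big_mkord xpredT (fun j => tail j)).
    by rewrite [leRHS](big_cat_nat _ (n := J)) //= leqW.
  rewrite -mulr_suml; have := sum_tail_le J; move: TJ.
  set T := \sum_(j < J) tail j => TJ Tmu TL.
  have h1 : (mu - T) * C <= e1 * C by rewrite ler_wpM2r ?(ltW C0) //; lra.
  have h2 : T * (e1 - L') <= mu * (e1 - L') by rewrite ler_wpM2r //; lra.
  have h3 : e1 * (mu + C + - L' + 1) = e / 2 by rewrite /e1; field; rewrite gt_eqF.
  nra.
apply/cvgrPdist_lt => e e0; near=> n.
have h1 : renewal n < L + e by near: n; exact: LU.
have h2 : - renewal n < L' + e by near: n; exact: LU'.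
rewrite ltr_norml; lra.
Unshelve. all: by end_near. Qed.

End renewal.

(** * Exponential bounds for sums of steps *)

Lemma powR_expR (R : realType) (a x : R) : 0 < a -> a `^ x = expR (x * ln a).
Proof. by move=> a0; rewrite /powR gt_eqF. Qed.

Lemma nat_large (R : realType) (x : R) : \forall n \near \oo, x <= n%:R.
Proof.
exists (Num.truncn `|x|).+1 => // n /= h; apply: le_trans (ler_norm x) _.
apply: ltW; apply: lt_le_trans (truncnS_gt _) _; by rewrite ler_nat.
Qed.

Lemma powRN_near0 (R : realType) (c e : R) : 0 < c -> 0 < e ->
  \forall n \near \oo, n%:R `^ (- c) <= e :> R.
Proof.
move=> c0 e0; near=> n.
have n1 : expR (- ln e / c) <= n%:R by near: n; exact: nat_large.
have n0 : 0 < n%:R :> R by apply: lt_le_trans n1; exact: expR_gt0.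
rewrite powR_expR // -ler_ln ?posrE ?expR_gt0 // expRK.
have : - ln e / c <= ln n%:R.
  by rewrite -[X in X <= _]expRK ler_ln ?posrE ?expR_gt0.
by rewrite ler_pdivrMr // => ?; lra.
Unshelve. all: by end_near. Qed.

Section law_polynomials.
Context {R : realType}.
Variable p : nat -> R.

Definition law_poly (n : nat) : {poly R} := \poly_(l < n.+1) p l.

Definition small_poly (n : nat) (y : R) : {poly R} :=
  \poly_(l < n.+1) (if l%:R <= y then p l else 0).

Definition large_poly (n : nat) (y : R) : {poly R} :=
  \poly_(l < n.+1) (if l%:R <= y then 0 else p l).

Lemma small_large n y : small_poly n y + large_poly n y = law_poly n.
Proof.
apply/polyP => i; rewrite coefD !coef_poly; case: ifP => _; last by rewrite addr0.
by case: ifP; rewrite ?addr0 ?add0r.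
Qed.

Hypothesis p_ge0 : forall l, 0 <= p l.

Lemma law_poly_ge0 n m : 0 <= (law_poly n)`_m.
Proof. by rewrite coef_poly; case: ifP. Qed.

Lemma small_poly_ge0 n y m : 0 <= (small_poly n y)`_m.
Proof. by rewrite coef_poly; case: ifP => // _; case: ifP. Qed.

Lemma large_poly_ge0 n y m : 0 <= (large_poly n y)`_m.
Proof. by rewrite coef_poly; case: ifP => // _; case: ifP. Qed.

End law_polynomials.

Lemma coef_expr_ge0 (R : realDomainType) (f : {poly R}) k m :
  (forall m, 0 <= f`_m) -> 0 <= (f ^+ k)`_m.
Proof.
move=> f0; have h : lecoef m 0 f by move=> i _; rewrite coef0.
by have := lecoef0X k h (leqnn m); rewrite coef0.
Qed.

(** Cutting the exponential at 1/2: below, its Taylor remainder is quadratic;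
    above, z ^ r is at least 1/4. *)
Lemma expR_le_powR (R : realType) (z r A : R) : 0 <= z -> 1 <= r -> r <= 2 ->
  1 <= A -> expR z <= A -> expR z <= 1 + z + 4 * A * z `^ r.
Proof.
move=> z0 r1 r2 A1 zA.
have [->|z_neq0] := eqVneq z 0.
  by rewrite expR0 addr0 lerDl mulr_ge0 ?powR_ge0 // mulr_ge0 //; lra.
have zpos : 0 < z by rewrite lt_neqAle eq_sym z_neq0.
have [z1|z1] := leP z 1.
  have zr : z ^+ 2 <= z `^ r.
    by rewrite -powR_mulrn //; apply: ger_powR => //; rewrite zpos.
  have [zh|zh] := leP z (1 / 2).
    apply: (@le_trans _ _ (1 + z + 2 * z ^+ 2)); last first.
      rewrite lerD2l; have := powR_ge0 z r; nra.
    have h := expR_ge1Dx (- z); rewrite expRN in h.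
    have e0 := expR_gt0 z.
    have : expR z * (1 - z) <= 1 by rewrite -ler_pdivlMl // mulr1.
    nra.
  have h : 1 <= 4 * z `^ r by nra.
  have : A <= 4 * A * z `^ r by nra.
  by have := powR_ge0 z r; nra.
have h : 1 <= z `^ r.
  by apply: le_trans (ltW z1) _; apply: le1r_powR => //; apply: ltW.
have : A <= 4 * A * z `^ r by nra.
nra.
Qed.

(** With s of order ln n / n, the factor exp (s l) is at most a small power of n
    for all l <= delta n, which a moment of order 1 + eta compensates. So k steps
    truncated at delta n whose total mean stays below (1 - eps) n reach n with
    probability at most n ^ (- B), for B as large as one likes. *)
Lemma truncated_chernoff (R : realType) (p : nat -> R) (mu eta M eps B : R) :
  (forall l, 0 <= p l) -> (forall n, \sum_(l < n) p l <= 1) ->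
  (forall n, \sum_(l < n) l%:R * p l <= mu) -> 0 < mu ->
  0 < eta -> eta <= 1 -> (forall n, \sum_(l < n) l%:R `^ (1 + eta) * p l <= M) ->
  0 < eps -> 0 < B ->
  exists C delta : R, [/\ 0 < C, 0 < delta & \forall n \near \oo,
    forall k : nat, k%:R * mu <= (1 - eps) * n%:R ->
    (small_poly p n (delta * n%:R)).[expR (C * ln n%:R / n%:R)] ^+ k <=
    expR ((C - B) * ln n%:R)].
Proof.
move=> p0 psum pmean mu0 eta0 eta1 pM eps0 B0.
have M0 : 0 <= M by have := pM 0%N; rewrite big_ord0.
pose C := 2 * B / eps; have C0 : 0 < C by rewrite divr_gt0 // mulr_gt0.
pose delta := eta / (2 * C); have delta0 : 0 < delta by rewrite divr_gt0 // mulr_gt0.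
exists C, delta; split=> //.
pose D := 4 * M / mu * C `^ (1 + eta) * (4 / eta).
have D0 : 0 <= D.
  have i4 : 0 <= 4 / eta by rewrite divr_ge0 // ltW.
  have iM : 0 <= 4 * M / mu by rewrite divr_ge0 ?mulr_ge0 // ltW.
  by apply: mulr_ge0 => //; apply: mulr_ge0 => //; exact: powR_ge0.
have e1 : 0 < B / (D + 1) by rewrite divr_gt0 //; lra.
have eta4 : 0 < eta / 4 by lra.
near=> n => k kn.
have n3 : expR 1 <= n%:R :> R by near: n; exact: nat_large.
have npos : 0 < n%:R :> R by apply: lt_le_trans n3; exact: expR_gt0.
set x := ln n%:R.
have x1 : 1 <= x by rewrite -[leLHS]expRK ler_ln ?posrE ?expR_gt0.
have x0 : 0 < x by lra.
set s := C * x / n%:R.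
have s0 : 0 < s by rewrite divr_gt0 // mulr_gt0.
pose A := expR (eta / 2 * x).
have A1 : 1 <= A by rewrite -expR0 ler_expR mulr_ge0 // ltW // divr_gt0.
pose E := 4 * A * s `^ (1 + eta) * M.
have E0 : 0 <= E by rewrite /E !mulr_ge0 ?powR_ge0 // expR_ge0.
have fE : (small_poly p n (delta * n%:R)).[expR s] <= expR (s * mu + E).
  apply: le_trans (expR_ge1Dx _); rewrite horner_poly.
  apply: (@le_trans _ _ (\sum_(l < n.+1) (p l + s * (l%:R * p l) +
      4 * A * s `^ (1 + eta) * (l%:R `^ (1 + eta) * p l)))).
    apply: ler_sum => l _; case: ifPn => ld; last first.
      have s0' := ltW s0.
      have A0 : 0 <= 4 * A * s `^ (1 + eta) by rewrite !mulr_ge0 ?powR_ge0 // expR_ge0.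
      rewrite mul0r; apply: addr_ge0; last first.
        by apply: mulr_ge0 => //; apply: mulr_ge0 => //; exact: powR_ge0.
      by apply: addr_ge0 => //; apply: mulr_ge0 => //; apply: mulr_ge0.
    rewrite -expRM_natl.
    have sl0 : 0 <= l%:R * s by rewrite mulr_ge0 // ltW.
    have slA : expR (l%:R * s) <= A.
      rewrite ler_expR.
      apply: (@le_trans _ _ (delta * n%:R * s)); first by rewrite ler_wpM2r // ltW.
      rewrite le_eqVlt /s /delta; apply/orP; left; apply/eqP.
      by field; rewrite !gt_eqF.
    have := expR_le_powR sl0 _ _ A1 slA; move=> /(_ (1 + eta)).
    move=> /(_ ltac:(lra)) /(_ ltac:(lra)) h.
    rewrite mulrC; apply: (le_trans (ler_wpM2r (p0 l) h)).
    rewrite powRM ?ler0n ?(ltW s0) // le_eqVlt; apply/orP; left; apply/eqP; ring.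
  rewrite !big_split /= -!mulr_sumr addrA; apply: lerD; first (apply: lerD; first exact: psum).
    by apply: ler_wpM2l; [exact: ltW | exact: pmean].
  rewrite /E; apply: ler_wpM2l; last exact: pM.
  by rewrite !mulr_ge0 ?powR_ge0 // expR_ge0.
apply: (@le_trans _ _ (expR (s * mu + E) ^+ k)).
  rewrite lerXn2r ?nnegrE ?expR_ge0 // horner_poly sumr_ge0 // => l _.
  by rewrite mulr_ge0 ?exprn_ge0 ?expR_ge0 //; case: ifP.
rewrite -expRM_natl ler_expR mulrDr.
have h1 : k%:R * (s * mu) <= (1 - eps) * (C * x).
  have -> : (1 - eps) * (C * x) = (1 - eps) * n%:R * s.
    by rewrite /s; field; rewrite gt_eqF.
  have -> : k%:R * (s * mu) = k%:R * mu * s by ring.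
  by rewrite ler_wpM2r // ltW.
have h2 : k%:R * E <= B * x; last first.
  have -> : (C - B) * x = (1 - eps) * (C * x) + B * x by rewrite /C; field; rewrite gt_eqF.
  exact: lerD.
have kmu : k%:R <= n%:R / mu.
  rewrite ler_pdivlMr //; apply: le_trans kn _.
  by rewrite ler_piMl ?ltW //; lra.
apply: (le_trans (ler_wpM2r E0 kmu)).
have -> : n%:R / mu * E = 4 * M / mu * C `^ (1 + eta) *
    (x `^ eta * expR (- (eta / 2) * x)) * x.
  have x0' := ltW x0; have C0' := ltW C0; have n0' := ltW npos.
  have Cx0 : 0 <= C * x by apply: mulr_ge0.
  have nV0 : 0 <= n%:R^-1 :> R by rewrite invr_ge0.
  rewrite /E /s powRM // powRM // -[n%:R^-1]powR_inv1 // -powRrM.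
  rewrite (@powRD _ x 1 eta); last by rewrite (gt_eqF x0) implybT.
  rewrite powRr1 // (_ : -1 * (1 + eta) = - 1 - eta); last by ring.
  rewrite [n%:R `^ _]powR_expR // -/x.
  have -> : expR ((-1 - eta) * x) = n%:R^-1 * expR (- eta * x).
    by rewrite mulrBl mulN1r expRB expRN lnK ?posrE // mulNr [in RHS]expRN.
  rewrite (_ : - (eta / 2) * x = eta / 2 * x + - eta * x); last by field.
  rewrite expRD /A; field; rewrite !gt_eqF //.
rewrite ler_wpM2r ?(ltW x0) //.
have h3 : x `^ eta * expR (- (eta / 2) * x) <= 4 / eta * n%:R `^ (- (eta / 4)).
  rewrite [n%:R `^ _]powR_expR // -/x.
  have xe : x `^ eta <= x by rewrite -{2}[x]powRr1 ?(ltW x0) //; apply: ler_powR.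
  have xe2 : x <= 4 / eta * expR (eta / 4 * x).
    have := expR_ge1Dx (eta / 4 * x) => h.
    rewrite [leLHS](_ : _ = 4 / eta * (eta / 4 * x)); last by field; rewrite gt_eqF.
    by apply: ler_wpM2l; [rewrite divr_ge0 // ltW | lra].
  have -> : expR (- (eta / 4) * x) = expR (eta / 4 * x) * expR (- (eta / 2) * x).
    by rewrite -expRD; congr expR; field.
  rewrite mulrA ler_wpM2r ?expR_ge0 //; exact: le_trans xe xe2.
have h4 : n%:R `^ (- (eta / 4)) <= B / (D + 1) by near: n; exact: powRN_near0.
apply: (@le_trans _ _ (D * (B / (D + 1)))).
  rewrite /D -[leRHS]mulrA; apply: ler_wpM2l.
    by apply: mulr_ge0; [apply: divr_ge0; [exact: mulr_ge0|exact: ltW]|exact: powR_ge0].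
  by apply: le_trans h3 _; apply: ler_wpM2l => //; rewrite divr_ge0 // ltW.
rewrite mulrA ler_pdivrMr; last by lra.
nra.
Unshelve. all: by end_near. Qed.

(** The steps being non-negative, their exponential moment at - s is at most that
    of the steps below some fixed N carrying nearly all of the mean, for which
    the second-order error is harmless once s is small. So k steps whose total
    mean exceeds (1 + eps) n stay below n with exponentially small
    probability. *)
Lemma lower_tail_chernoff (R : realType) (p : nat -> R) (mu eps : R) :
  (forall l, 0 <= p l) -> (forall n, \sum_(l < n) p l <= 1) ->
  series (fun l => l%:R * p l) @ \oo --> mu -> 0 < mu -> 0 < eps -> eps <= 1 ->
  exists c s : R, [/\ 0 < c, 0 < s & forall n k : nat,
    (1 + eps) * n%:R <= k%:R * mu ->
    (law_poly p n).[expR (- s)] ^+ k * expR (s * n%:R) <= expR (- c * k%:R)].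
Proof.
move=> p0 psum pmean mu0 eps0 eps1.
have e8 : 0 < mu * eps / 8 by rewrite divr_gt0 // mulr_gt0.
have /cvgrPdist_lt/(_ _ e8) [N _ /(_ N (leqnn N))] := pmean.
rewrite /series /= big_mkord => hN.
have {}hN : mu - mu * eps / 8 <= \sum_(l < N) l%:R * p l.
  by move: hN; rewrite ltr_norml => /andP[_]; lra.
pose K : R := N%:R ^+ 2 + 1; have K0 : 0 < K by rewrite /K ltr_wpDl // sqr_ge0.
pose s := mu * eps / 8 / K; have s0 : 0 < s by rewrite divr_gt0.
exists (s * mu * eps / 4), s; split=> // [|n k kn].
  by apply: divr_gt0 => //; apply: mulr_gt0 => //; apply: mulr_gt0.
have f1 : (law_poly p n).[expR (- s)] <= expR (- (s * mu * (1 - eps / 4))).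
  apply: le_trans (expR_ge1Dx _); rewrite horner_poly.
  apply: (@le_trans _ _ (\sum_(l < n.+1 + N) p l * expR (- s) ^+ l)).
    rewrite big_split_ord /= lerDl sumr_ge0 // => l _.
    by rewrite mulr_ge0 // exprn_ge0 // expR_ge0.
  have -> : \sum_(l < n.+1 + N) p l * expR (- s) ^+ l =
     \sum_(l < n.+1 + N) p l - \sum_(l < n.+1 + N) p l * (1 - expR (- s) ^+ l).
    by rewrite -sumrB; apply: eq_bigr => l _; ring.
  apply: lerD => //; rewrite lerN2.
  apply: (@le_trans _ _ (\sum_(l < N) p l * (1 - expR (- s) ^+ l))); last first.
    rewrite addnC big_split_ord /= lerDl sumr_ge0 // => l _.
    rewrite mulr_ge0 // subr_ge0 exprn_ile1 ?expR_ge0 //.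
    by rewrite expR_le1 oppr_le0 ltW.
  apply: (@le_trans _ _ (s * (\sum_(l < N) l%:R * p l) - s ^+ 2 * N%:R ^+ 2)).
    have : s * (mu - mu * eps / 8) <= s * (\sum_(l < N) l%:R * p l) by rewrite ler_wpM2l // ltW.
    have : s * (s * N%:R ^+ 2) <= s * (mu * eps / 8).
      rewrite ler_wpM2l ?(ltW s0) //.
      have -> : mu * eps / 8 = s * K by rewrite /s; field; rewrite gt_eqF.
      by rewrite ler_wpM2l ?(ltW s0) // /K lerDl.
    nra.
  apply: (@le_trans _ _ (\sum_(l < N) p l * (s * l%:R - s ^+ 2 * N%:R ^+ 2))).
    have -> : \sum_(l < N) p l * (s * l%:R - s ^+ 2 * N%:R ^+ 2) =
      s * (\sum_(l < N) l%:R * p l) - s ^+ 2 * N%:R ^+ 2 * (\sum_(l < N) p l).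
      rewrite !mulr_sumr -sumrB; apply: eq_bigr => l _; ring.
    by rewrite lerD2l lerN2 ler_piMr // mulr_ge0 // sqr_ge0.
  apply: ler_sum => l _; apply: ler_wpM2l => //.
  rewrite -expRM_natl mulrN; set z := l%:R * s.
  have z0 : 0 <= z by rewrite mulr_ge0 // ltW.
  have ez : expR (- z) <= 1 - z + z ^+ 2.
    have h := expR_ge1Dx z; rewrite expRN.
    rewrite -div1r ler_pdivrMr ?expR_gt0 //.
    have h0 : 0 <= 1 - z + z ^+ 2 by nra.
    apply: le_trans (ler_wpM2l h0 h); nra.
  have : z ^+ 2 <= s ^+ 2 * N%:R ^+ 2.
    rewrite /z exprMn mulrC ler_wpM2l ?sqr_ge0 //.
    by rewrite lerXn2r ?nnegrE // ler_nat ltnW.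
  rewrite [s * _]mulrC -/z; lra.
apply: (@le_trans _ _ (expR (- (s * mu * (1 - eps / 4))) ^+ k * expR (s * n%:R))).
  rewrite ler_wpM2r ?expR_ge0 // lerXn2r ?nnegrE ?expR_ge0 //.
  rewrite horner_poly sumr_ge0 // => l _.
  by rewrite mulr_ge0 // exprn_ge0 // expR_ge0.
rewrite -expRM_natl -expRD ler_expR.
have kn' : n%:R <= k%:R * mu * (1 - eps / 2).
  have : (1 + eps) * n%:R * (1 - eps / 2) <= k%:R * mu * (1 - eps / 2).
    by rewrite ler_wpM2r //; lra.
  have : 0 <= n%:R * (eps * (1 - eps)).
    by apply: mulr_ge0 => //; apply: mulr_ge0; [exact: ltW | lra].
  lra.
have : s * n%:R <= s * (k%:R * mu * (1 - eps / 2)) by rewrite ler_wpM2l // ltW.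
lra.
Qed.

(** * The Poisson limit of the number of large steps *)

Lemma cvg_near_eq (R : realType) (f g : nat -> R) (l : R) :
  f @ \oo --> l -> (\forall n \near \oo, f n = g n) -> g @ \oo --> l.
Proof. by move=> fl fg; apply: cvg_trans fl; exact: near_eq_cvg. Qed.

Definition poisson_below (R : realType) (j : nat) (x : R) : R :=
  \sum_(i < j) expR (- x) * (x ^+ i / i`!%:R).

Lemma poisson_below_continuous (R : realType) j :
  continuous (@poisson_below R j).
Proof.
move=> x; rewrite /poisson_below; elim: j => [|j IH].
  have -> : (fun x : R => \sum_(i < 0) expR (- x) * (x ^+ i / i`!%:R)) = cst 0.
    by apply/funext => z; rewrite big_ord0.
  exact: cvg_cst.
have -> : (fun x : R => \sum_(i < j.+1) expR (- x) * (x ^+ i / i`!%:R)) =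
    (fun x => \sum_(i < j) expR (- x) * (x ^+ i / i`!%:R)) \+
    (fun x => expR (- x) * (x ^+ j / j`!%:R)).
  by apply/funext => z; rewrite big_ord_recr.
apply: cvgD; first exact: IH.
apply: (@cvgM _ _ _ _ (fun x => expR (- x)) (fun x => x ^+ j / j`!%:R)); last first.
  by apply: (@cvgMr_tmp _ _ _ _ (fun x => x ^+ j)); exact: exprn_continuous.
apply: (@continuous_comp _ _ _ (fun z : R => - z) expR); first exact: opp_continuous.
exact: continuous_expR.
Qed.

Lemma poisson_below_bounds (R : realType) j (x : R) : 0 <= x ->
  0 <= poisson_below j x <= 1.
Proof.
move=> x0; rewrite /poisson_below -mulr_sumr; apply/andP; split.
  rewrite mulr_ge0 ?expR_ge0 // sumr_ge0 // => i _.
  by rewrite divr_ge0 // exprn_ge0.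
rewrite expRN ler_pdivrMl ?expR_gt0 // mulr1.
have h : series (exp_coeff x) j <= expR x.
  rewrite /expR; apply: nondecreasing_cvgn_le; last exact: is_cvg_series_exp_coeff.
  by apply: nondecreasing_series => n _ _; exact: exp_coeff_ge0.
apply: le_trans h; rewrite /series /= big_mkord; apply: ler_sum => i _.
by rewrite /exp_coeff.
Qed.

Lemma pow_one_sub_cvg (R : realType) (k : nat -> nat) (x : nat -> R) (l : R) :
  (fun n => (k n)%:R * x n) @ \oo --> l -> x @ \oo --> (0 : R) ->
  (forall n, 0 <= x n) -> (fun n => (1 - x n) ^+ k n) @ \oo --> expR (- l).
Proof.
move=> kx x0 xp.
have up : (fun n => expR (- ((k n)%:R * x n))) @ \oo --> expR (- l).
  apply: (@continuous_cvg _ _ _ _ _ _ expR); first exact: continuous_expR.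
  exact: cvgN.
have lo : (fun n => expR (- ((k n)%:R * x n * (1 - x n)^-1))) @ \oo --> expR (- l).
  apply: (@continuous_cvg _ _ _ _ _ _ expR); first exact: continuous_expR.
  apply: cvgN; rewrite -[X in _ --> X]mulr1; apply: cvgM => //.
  rewrite -[X in _ --> X]invr1; apply: cvgV; first exact: oner_neq0.
  by rewrite -[X in _ --> X]subr0; apply: cvgB => //; exact: cvg_cst.
apply: squeeze_cvgr lo up; near=> n.
have xn : x n < 1 by near: n; apply: cvgr_lt x0 _ _; exact: ltr01.
have y0 : 0 < 1 - x n by lra.
apply/andP; split; last first.
  rewrite -mulrN expRM_natl lerXn2r ?nnegrE ?expR_ge0 ?(ltW y0) //.
  exact: expR_ge1Dx.
rewrite -mulrA -mulrN expRM_natl lerXn2r ?nnegrE ?expR_ge0 ?(ltW y0) //.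
rewrite expRN -[leRHS]invrK lef_pV2 ?posrE ?invr_gt0 ?expR_gt0 //.
apply: le_trans (expR_ge1Dx _); rewrite le_eqVlt; apply/orP; left; apply/eqP.
by field; rewrite gt_eqF.
Unshelve. all: by end_near. Qed.

(** Here s + g may fall short of 1 by o(1 / k), as happens when steps beyond n are
    left out. *)
Lemma binomial_poisson_cvg (R : realType) (k : nat -> nat) (s g : nat -> R)
    (l : R) (j : nat) :
  (fun n => (k n)%:R : R) @ \oo --> +oo ->
  (fun n => (k n)%:R * (1 - s n)) @ \oo --> l ->
  (fun n => (k n)%:R * g n) @ \oo --> l ->
  (forall n, s n <= 1) ->
  (fun n => \sum_(i < j) (s n ^+ (k n - i) * g n ^+ i) *+ 'C(k n, i)) @ \oo
    --> poisson_below j l.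
Proof.
move=> koo ks kg s1.
have kV : (fun n => (k n)%:R^-1 : R) @ \oo --> (0 : R).
  apply/gtr0_cvgV0 => //; near=> n.
  by near: n; apply: (cvgry_gt koo).
have small (h : nat -> R) : (fun n => (k n)%:R * h n) @ \oo --> l -> h @ \oo --> (0 : R).
  move=> kh; rewrite -[X in _ --> X](mul0r l); apply: cvg_near_eq (cvgM kV kh) _.
  near=> n; rewrite /= mulKf // gt_eqF //.
  by near: n; apply: (cvgry_gt koo).
have xs0 := small _ ks; have g0 := small _ kg.
have sE : s = fun n => 1 - (1 - s n) by apply/funext => n; ring.
have s_cvg : s @ \oo --> (1 : R).
  by rewrite sE -[X in _ --> X]subr0; apply: cvgB => //; exact: cvg_cst.
have sk : (fun n => s n ^+ k n) @ \oo --> expR (- l).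
  rewrite sE; apply: pow_one_sub_cvg => //.
  by move=> n; rewrite subr_ge0.
have ski i : (fun n => s n ^+ (k n - i)) @ \oo --> expR (- l).
  have si : (fun n => (s n ^+ i)^-1) @ \oo --> (1 : R).
    rewrite -[X in _ --> X]invr1; apply: cvgV; first exact: oner_neq0.
    rewrite -[X in _ --> X](expr1n _ i).
    by apply: (@continuous_cvg _ _ _ _ _ _ (fun z : R => z ^+ i)) s_cvg; exact: exprn_continuous.
  rewrite -[X in _ --> X]mulr1; apply: cvg_near_eq (cvgM sk si) _.
  near=> n; rewrite /=.
  have sn0 : 0 < s n by near: n; apply: cvgr_gt s_cvg _ _; exact: ltr01.
  have ik : (i <= k n)%N.
    by rewrite -(ler_nat R); near: n; apply: (cvgry_ge koo).
  by rewrite expfB_cond // gt_eqF.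
have bin i : (fun n => g n ^+ i *+ 'C(k n, i)) @ \oo --> l ^+ i / i`!%:R.
  elim: i => [|i IH].
    rewrite expr0 fact0 divr1; apply: cvg_near_eq (cvg_cst (1 : R)) _.
    by near=> n; rewrite expr0 bin0.
  have -> : l ^+ i.+1 / (i.+1)`!%:R = l ^+ i / i`!%:R * ((l - i%:R * 0) / i.+1%:R).
    rewrite factS natrM exprS mulr0 subr0; field.
    by rewrite nat1r !pnatr_eq0 -!lt0n fact_gt0.
  have hc : (fun n => g n ^+ i *+ 'C(k n, i) *
      (((k n)%:R * g n - i%:R * g n) / i.+1%:R)) @ \oo -->
      l ^+ i / i`!%:R * ((l - i%:R * 0) / i.+1%:R).
    apply: cvgM => //; apply: cvgMr_tmp; apply: cvgB => //; exact: cvgMl_tmp.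
  apply: cvg_near_eq hc _; near=> n; rewrite /=.
  have ik : (i <= k n)%N.
    by rewrite -(ler_nat R); near: n; apply: (cvgry_ge koo).
  have : (i.+1%:R * 'C(k n, i.+1)%:R = (k n - i)%:R * 'C(k n, i)%:R :> R).
    by rewrite -!natrM mul_bin_left.
  rewrite natrB // -(mulr_natr (g n ^+ i)) -(mulr_natr (g n ^+ i.+1)) exprS => h.
  have i0 : i.+1%:R != 0 :> R by rewrite pnatr_eq0.
  apply: (mulfI i0); rewrite [RHS](_ : _ = g n * g n ^+ i * (i.+1%:R * 'C(k n, i.+1)%:R)); last by ring.
  by rewrite h; field; rewrite nat1r.
rewrite /poisson_below; elim: j => [|j IH].
  rewrite big_ord0; apply: cvg_near_eq (cvg_cst (0 : R)) _.
  by near=> n; rewrite big_ord0.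
rewrite big_ord_recr /=.
have -> : (fun n => \sum_(i < j.+1) (s n ^+ (k n - i) * g n ^+ i) *+ 'C(k n, i)) =
   (fun n => \sum_(i < j) (s n ^+ (k n - i) * g n ^+ i) *+ 'C(k n, i)) \+
   (fun n => s n ^+ (k n - j) * (g n ^+ j *+ 'C(k n, j))).
  by apply/funext => n; rewrite big_ord_recr /= mulrnAr.
by apply: cvgD => //; apply: cvgM.
Unshelve. all: by end_near. Qed.

(** * Unrolling the renewal sequence *)

Section unroll.
Context {R : realType}.
Variable p : nat -> R.
Hypothesis p_ge0 : forall l, 0 <= p l.
Hypothesis p_sum1 : series p @ \oo --> (1 : R).
Hypothesis p0_lt1 : p 0%N < 1.

Definition renewal_poly (n : nat) : {poly R} := \poly_(m < n.+1) renewal p m.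

Lemma renewal_poly_ge0 n m : lecoef m 0 (renewal_poly n).
Proof.
move=> i _; rewrite coef0 coef_poly; case: ifP => // _.
by have /andP[] := renewal_bounds p_ge0 p_sum1 p0_lt1 i.
Qed.

Lemma law_poly_lecoef0 n m : lecoef m 0 (law_poly p n).
Proof. by move=> i _; rewrite coef0 law_poly_ge0. Qed.

Lemma renewal_unroll1 n i : (i <= n)%N ->
  (renewal_poly n)`_i = (1 + law_poly p n * renewal_poly n)`_i.
Proof.
move=> i_n; rewrite coefD coef1 coefM coef_poly ltnS i_n.
have -> : \sum_(j < i.+1) (law_poly p n)`_j * (renewal_poly n)`_(i - j) =
    \sum_(j < i.+1) p j * renewal p (i - j).
  apply: eq_bigr => -[j /= ji] _; rewrite !coef_poly !ltnS.
  by rewrite (leq_trans _ i_n) // (leq_trans (leq_subr _ _)).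
case: i i_n => [|i] i_n; last by rewrite add0r renewal_eq.
have d0 : 1 - p 0%N != 0 by rewrite subr_eq0 eq_sym lt_eqF.
rewrite big_ord_recl big_ord0 addr0 /= renewal0.
by field.
Qed.

Lemma renewal_unroll n r i : (i <= n)%N ->
  (renewal_poly n)`_i =
  (\sum_(k < r) law_poly p n ^+ k + law_poly p n ^+ r * renewal_poly n)`_i.
Proof.
elim: r i => [|r IH] i i_n; first by rewrite big_ord0 add0r expr0 mul1r.
rewrite IH // big_ord_recr /= !coefD -addrA; congr (_ + _).
rewrite exprSr -mulrA -coefD -[X in X + _]mulr1 -mulrDr !coefM.
apply: eq_bigr => -[j /= ji] _; congr (_ * _); apply: renewal_unroll1.
by rewrite (leq_trans (leq_subr _ _)).
Qed.

(** The renewal sequence is the sum of all convolution powers of p. *)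
Lemma geometric_le_renewal n c r : lecoef n
  (\sum_(k < r) law_poly p n ^+ (c + k)) (renewal_poly n).
Proof.
have step r' : lecoef n (\sum_(k < r') law_poly p n ^+ k) (renewal_poly n).
  move=> i i_n; rewrite (renewal_unroll r' i_n) coefD lerDl.
  have h : lecoef n 0 (law_poly p n ^+ r' * renewal_poly n).
    by apply: lecoef0M; [apply: lecoef0X; exact: law_poly_lecoef0|exact: renewal_poly_ge0].
  by have := h i i_n; rewrite coef0.
apply: lecoef_trans (step (c + r)%N); rewrite big_split_ord /=.
rewrite -[X in lecoef _ X _]add0r; apply: lecoefD => //.
apply: lecoef0_sum => k _; apply: lecoef0X; exact: law_poly_lecoef0.
Qed.

Lemma coefM_renewal_le n (a : {poly R}) : lecoef n 0 a ->
  (a * renewal_poly n)`_n <= (1 - p 0%N)^-1 * \sum_(m < n.+1) a`_m.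
Proof.
move=> a0; rewrite coefM mulr_sumr; apply: ler_sum => -[m /= mn] _.
rewrite mulrC; apply: ler_wpM2r; first by have := a0 m mn; rewrite coef0.
rewrite coef_poly; case: ifP => _.
  by have /andP[] := renewal_bounds p_ge0 p_sum1 p0_lt1 (n - m).
by rewrite invr_ge0 subr_ge0 ltW.
Qed.

(** The first error term is for m <= n - M, where the renewal sequence at n - m is
    within e of nu; the second one is for larger m, where only its boundedness is
    used. *)
Lemma coefM_renewal_approx n M (a : {poly R}) (nu e : R) :
  (forall m, 0 <= a`_m) -> (M <= n)%N -> 0 <= nu -> 0 <= e ->
  (forall m, (M <= m)%N -> `|renewal p m - nu| <= e) ->
  `|(a * renewal_poly n)`_n - nu * a.[1]| <= e * a.[1] +
     ((1 - p 0%N)^-1 + nu) * (a.[1] - \sum_(m < (n - M).+1) a`_m).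
Proof.
move=> a0 Mn nu0 e0 He; set C := (1 - p 0%N)^-1.
have C0 : 0 <= C by rewrite invr_ge0 subr_ge0 ltW.
have a1 : a.[1] = \sum_(m < (n - M).+1) a`_m + (a.[1] - \sum_(m < (n - M).+1) a`_m).
  by ring.
set A := \sum_(m < (n - M).+1) a`_m in a1 *; set T := a.[1] - A in a1 *.
have nM : ((n - M).+1 <= n.+1)%N by rewrite ltnS leq_subr.
have spl : (a * renewal_poly n)`_n =
    \sum_(m < (n - M).+1) a`_m * renewal p (n - m) +
    \sum_((n - M).+1 <= m < n.+1) a`_m * renewal p (n - m).
  rewrite coefM -[X in _ = X + _](big_mkord xpredT (fun m => a`_m * renewal p (n - m))).
  rewrite -big_cat_nat // big_mkord; apply: eq_bigr => -[m /= mn] _.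
  by rewrite coef_poly ltnS leq_subr.
have h1 : `|\sum_(m < (n - M).+1) a`_m * renewal p (n - m) - nu * A| <= e * A.
  rewrite /A !mulr_sumr -sumrB; apply: le_trans (ler_norm_sum _ _ _) _.
  apply: ler_sum => -[m /= mn] _.
  rewrite [nu * _]mulrC -mulrBr normrM ger0_norm // mulrC.
  by apply: ler_wpM2r => //; apply: He; lia.
have T' : \sum_((n - M).+1 <= m < n.+1) a`_m <= T.
  rewrite /T lerBrDl /A -(big_mkord xpredT (fun m => a`_m)) -big_cat_nat // big_mkord.
  exact: sum_coef_le_horner1.
have h2 : \sum_((n - M).+1 <= m < n.+1) a`_m * renewal p (n - m) <= C * T.
  apply: le_trans (ler_wpM2l C0 T'); rewrite mulr_sumr; apply: ler_sum => m _.
  rewrite mulrC; apply: ler_wpM2r => //.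
  by have /andP[] := renewal_bounds p_ge0 p_sum1 p0_lt1 (n - m).
have h3 : 0 <= \sum_((n - M).+1 <= m < n.+1) a`_m * renewal p (n - m).
  apply: sumr_ge0 => m _; apply: mulr_ge0 => //.
  by have /andP[] := renewal_bounds p_ge0 p_sum1 p0_lt1 (n - m).
have T0 : 0 <= T by apply: le_trans T'; apply: sumr_ge0.
have h4 : 0 <= nu * T by apply: mulr_ge0.
have h5 : 0 <= C * T by apply: mulr_ge0.
have h6 : 0 <= e * T by apply: mulr_ge0.
rewrite spl a1; move: h1; rewrite !ler_norml => /andP[h1 h1'].
by apply/andP; split; nra.
Qed.

End unroll.

(** * Counting steps under smooth weights *)

(** The moment of order larger than 1 serves the Chernoff bound for truncated
    steps, aperiodicity the renewal theorem. *)
Record step_law (R : realType) (p : nat -> R) (mu : R) : Prop := StepLaw {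
  step_ge0 : forall l, 0 <= p l;
  step_sum1 : series p @ \oo --> (1 : R);
  step_mean : series (fun l => l%:R * p l) @ \oo --> mu;
  mean_gt0 : 0 < mu;
  step0_lt1 : p 0%N < 1;
  step_aperiodic : forall d, (forall l, 0 < p l -> (d %| l)%N) -> (d %| 1)%N;
  step_moment : exists2 eta : R, 0 < eta /\ eta <= 1 &
    exists M : R, forall n, \sum_(l < n) l%:R `^ (1 + eta) * p l <= M }.

(** What is used of a regularly varying sequence: polynomial bounds, and control
    of the ratios of neighbouring and of comparable terms. *)
Record smooth_weights (R : realType) (q : nat -> R) : Prop := SmoothWeights {
  weight_gt0 : forall k, (0 < k)%N -> 0 < q k;
  weight_poly : exists B C : R, [/\ 0 < B, 0 < C & forall k, (0 < k)%N ->
    q k <= C /\ C^-1 * k%:R `^ (- B) <= q k];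
  weight_local : forall e : R, 0 < e -> exists2 kap : R, 0 < kap & exists N,
    forall k m, (N <= k)%N -> (N <= m)%N -> `|k%:R - m%:R| <= kap * m%:R ->
    `|q k - q m| <= e * q m;
  weight_ratio : forall K : R, 0 < K -> exists2 C : R, 0 < C & exists N,
    forall k m, (N <= k)%N -> (N <= m)%N -> k%:R <= K * m%:R ->
    m%:R <= K * k%:R -> q k <= C * q m }.

(** Reaching n by a single step of order n, at any of the first K n times, is
    negligible with respect to the weight at n. *)
Definition negligible_jumps (R : realType) (p q : nat -> R) : Prop :=
  forall (K : nat) (delta e : R), 0 < delta -> 0 < e -> \forall n \near \oo,
    forall l, delta * n%:R < l%:R -> (l <= n)%N ->
    p l * (\sum_(1 <= k < K * n) k%:R * q k) <= e * q n.

Lemma few1 (R : nzRingType) (s g : {poly R}) k : few s g 1 k = s ^+ k.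
Proof. by rewrite /few big_ord_recl big_ord0 addr0 /= subn0 expr0 mulr1 bin0. Qed.

(** The union bound over the time of a large step. *)
Lemma expr_split_large (R : realDomainType) n (s g : {poly R}) k :
  lecoef n 0 s -> lecoef n 0 g ->
  lecoef n ((s + g) ^+ k) (s ^+ k + g * (s + g) ^+ k.-1 *+ k).
Proof.
move=> s0 g0; have [_] := few_prolong 0 k s0 g0 (ltn0Sn 0).
by rewrite !few1 expr0 mulr1 add0n.
Qed.

Lemma coefM_le_sup (R : realFieldType) (f g : {poly R}) (h : R) n :
  (forall m, 0 <= f`_m) -> 0 <= h -> (forall i, (i <= n)%N -> g`_i <= h) ->
  (g * f)`_n <= h * f.[1].
Proof.
move=> f0 h0 gh; apply: (@le_trans _ _ (h * \sum_(m < n.+1) f`_m)); last first.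
  by apply: ler_wpM2l => //; exact: sum_coef_le_horner1.
rewrite coefM mulr_sumr [leRHS](reindex_inj rev_ord_inj) /=.
apply: ler_sum => -[i /= i_n] _; rewrite subSS; apply: ler_wpM2r => //.
exact: gh.
Qed.

Lemma geometric_sum_le (R : realFieldType) (t : R) a b : 0 <= t -> t < 1 ->
  \sum_(a <= k < b) t ^+ k <= t ^+ a / (1 - t).
Proof.
move=> t0 t1; have d0 : 0 < 1 - t by lra.
have [ab|ba] := leqP a b; last first.
  by rewrite big_geq ?(ltnW ba) // divr_ge0 ?exprn_ge0 // ltW.
suff -> : \sum_(a <= k < b) t ^+ k = (t ^+ a - t ^+ b) / (1 - t).
  by rewrite ler_pM2r ?invr_gt0 // gerBl exprn_ge0.
rewrite -(subnKC ab); elim: (b - a)%N => [|d IH].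
  by rewrite addn0 big_geq // subrr mul0r.
rewrite addnS big_nat_recr ?leq_addr //= IH exprSr; field; rewrite gt_eqF //.
Qed.

Lemma horner1_tail_mono (R : realFieldType) (f g : {poly R}) b :
  (forall m, f`_m <= g`_m) ->
  f.[1] - \sum_(m < b.+1) f`_m <= g.[1] - \sum_(m < b.+1) g`_m.
Proof.
move=> fg; have h : forall m, 0 <= (g - f)`_m by move=> m; rewrite coefB subr_ge0.
have := sum_coef_le_horner1 b h; rewrite hornerD hornerN.
have -> : \sum_(m < b.+1) (g - f)`_m = \sum_(m < b.+1) g`_m - \sum_(m < b.+1) f`_m.
  by rewrite -sumrB; apply: eq_bigr => i _; rewrite coefB.
by lra.
Qed.

Lemma horner1_tail_chernoff (R : realFieldType) (f : {poly R}) t b :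
  (forall m, 0 <= f`_m) -> 1 <= t ->
  t ^+ b.+1 * (f.[1] - \sum_(m < b.+1) f`_m) <= f.[t].
Proof.
move=> f0 t1; apply: le_trans (upper_chernoff b.+1 (b.+1 + size f) f0 t1).
apply: ler_wpM2l; first by rewrite exprn_ge0 // (le_trans ler01).
rewrite lerBlDl -(big_mkord xpredT (fun m => f`_m)) -big_cat_nat //=; last by lia.
rewrite big_mkord (@horner_coef_wide _ (b.+1 + size f).+1); last by lia.
by apply: ler_sum => i _; rewrite expr1n mulr1.
Qed.

Lemma expR_poly_near (R : realType) (c B e : R) : 0 < c -> 0 < B -> 0 < e ->
  \forall n \near \oo, expR (- (c * n%:R)) <= e * n%:R `^ (- B) :> R.
Proof.
move=> c0 B0 e0; pose a := c / (2 * B).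
have a0 : 0 < a by rewrite divr_gt0 // mulr_gt0.
near=> n.
have n1 : 1 <= n%:R :> R by near: n; exact: nat_large.
have nb : (- ln e - B * ln a) * (2 / c) <= n%:R by near: n; exact: nat_large.
have npos : 0 < n%:R :> R by lra.
have ln_n : ln n%:R <= a * n%:R - ln a.
  have := ln_sublinear (mulr_gt0 a0 npos).
  by rewrite lnM ?posrE // => /ltW; lra.
rewrite powR_expR // -{1}[e]lnK ?posrE // -expRD ler_expR.
have h1 : B * ln n%:R <= B * (a * n%:R - ln a) by rewrite ler_wpM2l // ltW.
have h2 : B * (a * n%:R) = c / 2 * n%:R by rewrite /a; field; rewrite gt_eqF.
have h3 : - ln e - B * ln a <= c / 2 * n%:R.
  by rewrite -ler_pdivrMl ?divr_gt0 // invf_div mulrC.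
lra.
Unshelve. all: by end_near. Qed.

Section weighted_counts.
Context {R : realType}.
Variables (p q : nat -> R) (mu : R).
Hypotheses (lawp : step_law p mu) (smq : smooth_weights q)
  (negl : negligible_jumps p q).

Let p_ge0 := step_ge0 lawp.
Let psum_le1 := sum_law_le1 p_ge0 (step_sum1 lawp).
Let pmean_le := mean_partial_le p_ge0 (step_mean lawp).

(** The law of large numbers: sums of k steps reach n mostly for k close to
    n / mu. *)
Definition typical (n : nat) : nat := Num.truncn (n%:R / mu).
Definition window_lo (kap : R) (n : nat) : nat :=
  (Num.truncn ((1 - kap) * (n%:R / mu))).+1.
Definition window_hi (kap : R) (n : nat) : nat :=
  (Num.truncn ((1 + kap) * (n%:R / mu))).+1.

Lemma law_poly1_le1 n : (law_poly p n).[1] <= 1.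
Proof.
rewrite horner_poly; apply: le_trans (psum_le1 n.+1).
by apply: ler_sum => i _; rewrite expr1n mulr1.
Qed.

Lemma law_poly1_ge0 n : 0 <= (law_poly p n).[1].
Proof.
by rewrite horner_poly sumr_ge0 // => i _; rewrite expr1n mulr1.
Qed.

Lemma law_poly_exp1_le1 n k : (law_poly p n ^+ k).[1] <= 1.
Proof. by rewrite horner_exp exprn_ile1 ?law_poly1_ge0 ?law_poly1_le1. Qed.

Lemma n_over_mu_ge (x : R) : \forall n \near \oo, x <= n%:R / mu.
Proof.
have m0 := mean_gt0 lawp.
by near=> n; rewrite ler_pdivlMr //; near: n; exact: nat_large.
Unshelve. all: by end_near. Qed.

Lemma typical_bounds n : (typical n)%:R <= n%:R / mu < (typical n)%:R + 1.
Proof.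
have m0 := mean_gt0 lawp.
by rewrite natr1; apply: truncn_itv; apply: divr_ge0 => //; exact: ltW.
Qed.

Lemma typical_near N : \forall n \near \oo, (N <= typical n)%N.
Proof.
have h := n_over_mu_ge N%:R; near=> n; rewrite truncn_ge_nat; first by near: n; exact: h.
by apply: divr_ge0 => //; apply: ltW; exact: mean_gt0 lawp.
Unshelve. all: by end_near. Qed.

Lemma weight_typical_lower : exists B c : R, [/\ 0 < B, 0 < c &
  \forall n \near \oo, c * n%:R `^ (- B) <= q (typical n)].
Proof.
have m0 := mean_gt0 lawp.
have [B [C [B0 C0 qb]]] := weight_poly smq.
exists B, (C^-1 * mu `^ B); split=> //; first by rewrite mulr_gt0 ?invr_gt0 ?powR_gt0.
near=> n.
have t1 : (1 <= typical n)%N by near: n; exact: typical_near.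
have n1 : 1 <= n%:R :> R by near: n; exact: nat_large.
have n0 : 0 < n%:R :> R by lra.
apply: le_trans (qb _ t1).2; rewrite -mulrA; apply: ler_wpM2l.
  by rewrite invr_ge0 ltW.
have t0 : 0 < (typical n)%:R :> R by rewrite ltr0n.
have /andP[tn _] := typical_bounds n.
rewrite !powR_expR // -expRD ler_expR.
have : ln (typical n)%:R <= ln n%:R - ln mu.
  by rewrite -ln_div ?posrE // ler_ln ?posrE // divr_gt0.
move=> /(ler_wpM2l (ltW B0)); lra.
Unshelve. all: by end_near. Qed.

Lemma weight_le_typical : exists2 C : R, 0 < C &
  \forall n \near \oo, q n <= C * q (typical n).
Proof.
have m0 := mean_gt0 lawp.
have K0 : 0 < 2 * mu + mu^-1 by rewrite addr_gt0 ?invr_gt0 // mulr_gt0.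
have [C C0 [N H]] := weight_ratio smq K0; exists C => //; near=> n.
have t1 : (1 <= typical n)%N by near: n; exact: typical_near.
have tN : (N <= typical n)%N by near: n; exact: typical_near.
have /andP[tn nt] := typical_bounds n.
have t0 : 1 <= (typical n)%:R :> R by rewrite ler1n.
apply: H => //; first by near: n; exists N.
  rewrite ltr_pdivrMr // in nt.
  have : 0 <= mu^-1 * (typical n)%:R by rewrite mulr_ge0 // invr_ge0 ltW.
  nra.
apply: le_trans tn _; rewrite mulrDl [n%:R / mu]mulrC lerDr.
by rewrite !mulr_ge0 // ltW.
Unshelve. all: by end_near. Qed.

Lemma window_lo_bounds kap n : kap <= 1 ->
  (1 - kap) * (n%:R / mu) < (window_lo kap n)%:R <= (1 - kap) * (n%:R / mu) + 1.
Proof.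
move=> kap1; have m0 := mean_gt0 lawp.
have x0 : 0 <= (1 - kap) * (n%:R / mu).
  by rewrite mulr_ge0 ?divr_ge0 ?subr_ge0 // ltW.
have /andP[h1 h2] := truncn_itv x0.
by rewrite /window_lo h2 -natr1 lerD2r.
Qed.

Lemma window_hi_bounds kap n : 0 <= kap ->
  (1 + kap) * (n%:R / mu) < (window_hi kap n)%:R <= (1 + kap) * (n%:R / mu) + 1.
Proof.
move=> kap0; have m0 := mean_gt0 lawp.
have x0 : 0 <= (1 + kap) * (n%:R / mu).
  by rewrite mulr_ge0 ?divr_ge0 ?addr_ge0 // ltW.
have /andP[h1 h2] := truncn_itv x0.
by rewrite /window_hi h2 -natr1 lerD2r.
Qed.

(** A walk of mean at most (1 - kap) n that reaches n either makes a step larger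
    than delta n, at one of its k times, which [negligible_jumps] covers, or is a
    sum of truncated steps, for which the Chernoff exponent can be made to beat
    the polynomial lower bound on q. *)
Lemma few_steps_negligible (kap e : R) : 0 < kap -> kap < 1 -> 0 < e ->
  \forall n \near \oo,
    \sum_(1 <= k < window_lo kap n) q k * (law_poly p n ^+ k)`_n <=
    e * q (typical n).
Proof.
move=> kap0 kap1 e0; have m0 := mean_gt0 lawp.
have [eta [eta0 eta1] [M pM]] := step_moment lawp.
have [B [c [B0 c0 qlow]]] := weight_typical_lower.
have [C1 C10 qC1] := weight_le_typical.
have [B' [C2 [_ C20 qb]]] := weight_poly smq.
have B20 : 0 < B + 2 by lra.
have [C [delta [C0 delta0 chern]]] :=
  truncated_chernoff p_ge0 psum_le1 pmean_le m0 eta0 eta1 pM kap0 B20.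
pose K := (Num.truncn (mu^-1 + 1)).+2.
have KE : mu^-1 + 1 <= K%:R.
  by apply: ltW; apply: lt_le_trans (truncnS_gt _) _; rewrite ler_nat.
have e10 : 0 < e / (2 * C1) by rewrite divr_gt0 // mulr_gt0.
have jumps := negl K delta0 e10.
have e20 : 0 < e * c / (2 * C2 * K%:R) by rewrite divr_gt0 ?mulr_gt0 // ltr0n.
near=> n.
have n1 : 1 <= n%:R :> R by near: n; exact: nat_large.
have n0 : 0 < n%:R :> R by lra.
have nV : n%:R `^ (- 1) <= e * c / (2 * C2 * K%:R).
  by near: n; apply: powRN_near0.
have lo_le : (window_lo kap n <= K * n)%N.
  rewrite -(ler_nat R) natrM.
  have /andP[_ h] := window_lo_bounds n (ltW kap1).
  apply: le_trans h _; apply: (@le_trans _ _ ((mu^-1 + 1) * n%:R)); last first.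
    by rewrite ler_wpM2r // ltW.
  have x0 : 0 <= n%:R / mu by rewrite divr_ge0 // ltW.
  have kx : 0 <= kap * (n%:R / mu) by rewrite mulr_ge0 // ltW.
  lra.
set S := \sum_(1 <= k < K * n) k%:R * q k.
have S0 : 0 < S.
  have Kn : (1 < K * n)%N.
    by rewrite (@leq_trans (K * 1)) // leq_mul2l; rewrite -(ler_nat R) in n1 *; apply/orP; right.
  rewrite /S big_ltn // ltr_wpDr //; last by rewrite mulr_gt0 // (weight_gt0 smq).
  rewrite big_nat sumr_ge0 // => k /andP[k2 _].
  by rewrite mulr_ge0 // ltW // (weight_gt0 smq) // (leq_trans _ k2).
set h := e / (2 * C1) * q n / S.
have qn0 : 0 < q n by apply: (weight_gt0 smq); rewrite -(ltr0n R).
have h0 : 0 <= h by rewrite divr_ge0 ?(ltW S0) // mulr_ge0 // ltW.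
have Hh i : (i <= n)%N -> (large_poly p n (delta * n%:R))`_i <= h.
  move=> i_n; rewrite coef_poly; case: ifP => // _; case: (leP i%:R) => // li.
  rewrite /h ler_pdivlMr // /S; move: i li i_n; near: n; exact: jumps.
set P := law_poly p n; set T := small_poly p n (delta * n%:R).
set H := large_poly p n (delta * n%:R).
have bound k : (0 < k)%N -> (k < window_lo kap n)%N ->
    (P ^+ k)`_n <= n%:R `^ (- (B + 2)) + k%:R * h.
  move=> k0 klo.
  have kmu : k%:R * mu <= (1 - kap) * n%:R.
    rewrite -ler_pdivlMr // -mulrA -truncn_ge_nat //.
    by rewrite mulr_ge0 ?divr_ge0 ?(ltW m0) //; lra.
  have s0 : lecoef n 0 T by move=> i _; rewrite coef0 small_poly_ge0.
  have g0 : lecoef n 0 H by move=> i _; rewrite coef0 large_poly_ge0.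
  have := expr_split_large k s0 g0 (leqnn n); rewrite small_large -/P => hs.
  apply: le_trans hs _; rewrite coefD; apply: lerD; last first.
    rewrite [leLHS](_ : _ = k%:R * (H * P ^+ k.-1)`_n); last by rewrite coefMn mulr_natl.
    apply: ler_wpM2l => //.
    apply: le_trans (coefM_le_sup _ h0 Hh) _.
      by move=> m; apply: coef_expr_ge0 => i; exact: law_poly_ge0.
    by rewrite ler_piMr // law_poly_exp1_le1.
  have t1 : 1 <= expR (C * ln n%:R / n%:R).
    by rewrite -[leLHS]expR0 ler_expR divr_ge0 ?(ltW n0) // mulr_ge0 ?(ltW C0) // ln_ge0.
  have T0 m : 0 <= (T ^+ k)`_m by apply: coef_expr_ge0 => i; exact: small_poly_ge0.
  have := upper_chernoff n n T0 t1; rewrite big_nat1 horner_exp => hc.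
  have hc2 : T.[expR (C * ln n%:R / n%:R)] ^+ k <= expR ((C - (B + 2)) * ln n%:R).
    rewrite /T; move: k kmu {k0 klo T0 hc}; near: n; exact: chern.
  rewrite -expRM_natl in hc; have hc3 := le_trans hc hc2.
  rewrite powR_expR //.
  have -> : - (B + 2) * ln n%:R = (C - (B + 2)) * ln n%:R - n%:R * (C * ln n%:R / n%:R).
    by field; rewrite gt_eqF.
  by rewrite expRB ler_pdivlMr ?expR_gt0 // mulrC.
apply: (@le_trans _ _ (\sum_(1 <= k < window_lo kap n)
    (C2 * n%:R `^ (- (B + 2)) + k%:R * q k * h))).
  rewrite !big_nat; apply: ler_sum => k /andP[k0 klo].
  have qk := weight_gt0 smq k0.
  apply: le_trans (ler_wpM2l (ltW qk) (bound k k0 klo)) _.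
  rewrite mulrDr; apply: lerD; last by rewrite mulrCA mulrA.
  by rewrite ler_wpM2r ?powR_ge0 //; exact: (qb k k0).1.
rewrite big_split /= sumr_const_nat.
have qt : c * n%:R `^ (- B) <= q (typical n) by near: n; exact: qlow.
have qnt : q n <= C1 * q (typical n) by near: n; exact: qC1.
have part2 : (\sum_(1 <= k < window_lo kap n) k%:R * q k) * h <= e / 2 * q (typical n).
  have hS : \sum_(1 <= k < window_lo kap n) k%:R * q k <= S.
    rewrite /S [leRHS](big_cat_nat _ (n := window_lo kap n)) //= lerDl.
    rewrite big_nat sumr_ge0 // => k /andP[k2 _].
    by rewrite mulr_ge0 // ltW // (weight_gt0 smq) // (leq_trans _ k2).
  apply: le_trans (ler_wpM2r h0 hS) _.
  have -> : S * h = e / (2 * C1) * q n by rewrite /h; field; rewrite !gt_eqF.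
  have -> : e / 2 * q (typical n) = e / (2 * C1) * (C1 * q (typical n)).
    by field; rewrite gt_eqF.
  by rewrite ler_wpM2l // ltW.
have part1 : (window_lo kap n - 1)%:R * (C2 * n%:R `^ (- (B + 2))) <= e / 2 * q (typical n).
  apply: (@le_trans _ _ (e / 2 * (c * n%:R `^ (- B)))); last first.
    by rewrite ler_wpM2l // ltW // divr_gt0.
  apply: (@le_trans _ _ (K%:R * n%:R * (C2 * n%:R `^ (- (B + 2))))).
    rewrite ler_wpM2r ?mulr_ge0 ?powR_ge0 ?(ltW C20) // -natrM ler_nat.
    by rewrite (leq_trans (leq_subr _ _)).
  have -> : n%:R `^ (- (B + 2)) = n%:R `^ (- B) * (n%:R `^ (- 1) * n%:R `^ (- 1)).
    by rewrite !powR_expR // -!expRD; congr expR; ring.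
  have nn : n%:R * n%:R `^ (- 1) = 1 :> R.
    by rewrite powR_inv1 ?(ltW n0) // divff // gt_eqF.
  have -> : K%:R * n%:R * (C2 * (n%:R `^ (- B) * (n%:R `^ (- 1) * n%:R `^ (- 1)))) =
     K%:R * C2 * n%:R `^ (- B) * n%:R `^ (- 1) * (n%:R * n%:R `^ (- 1)) by ring.
  rewrite nn mulr1.
  apply: (le_trans (ler_wpM2l _ nV)).
    by rewrite !mulr_ge0 ?powR_ge0 // ltW.
  rewrite le_eqVlt; apply/orP; left; apply/eqP; field.
  by rewrite (gt_eqF C20) andbT pnatr_eq0.
have -> : e * q (typical n) = e / 2 * q (typical n) + e / 2 * q (typical n) by field.
rewrite -(mulr_natl (_ * _) (_ - _)); apply: lerD => //.
by rewrite -[leLHS]mulr_suml.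
Unshelve. all: by end_near. Qed.

Lemma many_steps_mass (kap : R) : 0 < kap -> kap <= 1 ->
  exists2 c : R, 0 < c & forall n k, (1 + kap) * n%:R <= k%:R * mu ->
    \sum_(m < n.+1) (law_poly p n ^+ k)`_m <= expR (- c * k%:R).
Proof.
move=> kap0 kap1.
have [c [s [c0 s0 H]]] :=
  lower_tail_chernoff p_ge0 psum_le1 (step_mean lawp) (mean_gt0 lawp) kap0 kap1.
exists c => // n k nk; apply: le_trans (H n k nk).
have P0 m : 0 <= (law_poly p n ^+ k)`_m by apply: coef_expr_ge0; exact: law_poly_ge0.
have t1 : expR (- s) <= 1 by rewrite expR_le1 oppr_le0 ltW.
have := lower_chernoff n P0 (expR_gt0 (- s)) t1.
rewrite horner_exp -expRM_natl mulrN [expR (- (_ * _))]expRN ler_pdivrMl ?expR_gt0 //.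
by rewrite mulrC [n%:R * s]mulrC.
Qed.

(** Exponential decay in k beats the polynomial bounds on q. *)
Lemma many_steps_negligible (kap e : R) : 0 < kap -> kap <= 1 -> 0 < e ->
  \forall n \near \oo, forall K,
    \sum_(window_hi kap n <= k < K) q k * (law_poly p n ^+ k)`_n <=
    e * q (typical n).
Proof.
move=> kap0 kap1 e0; have m0 := mean_gt0 lawp.
have [c c0 H] := many_steps_mass kap0 kap1.
have [B [c' [B0 c'0 qlow]]] := weight_typical_lower.
have [B' [C2 [_ C20 qb]]] := weight_poly smq.
have t1 : expR (- c) < 1 by rewrite expR_lt1 oppr_lt0.
have d0 : 0 < 1 - expR (- c) by lra.
have e10 : 0 < e * c' * (1 - expR (- c)) / C2 by rewrite divr_gt0 // !mulr_gt0.
have cm : 0 < c / mu by rewrite divr_gt0.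
near=> n => K.
have /andP[hi _] := window_hi_bounds n (ltW kap0).
have x0 : 0 <= n%:R / mu by rewrite divr_ge0 // ltW.
apply: (@le_trans _ _ (\sum_(window_hi kap n <= k < K) C2 * expR (- c) ^+ k)).
  rewrite !big_nat; apply: ler_sum => k /andP[hik _].
  have k0 : (0 < k)%N by apply: leq_trans hik.
  have P0 m : 0 <= (law_poly p n ^+ k)`_m by apply: coef_expr_ge0; exact: law_poly_ge0.
  apply: ler_pM => //; first exact: ltW (weight_gt0 smq k0).
    exact: (qb k k0).1.
  rewrite -expRM_natl mulrC; apply: le_trans (H n k _).
    by rewrite big_ord_recr /= lerDr sumr_ge0.
  rewrite -ler_pdivrMr // -mulrA; apply: le_trans (ltW hi) _.
  by rewrite ler_nat.
rewrite -mulr_sumr.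
apply: (le_trans (ler_wpM2l (ltW C20) (geometric_sum_le _ _ (expR_ge0 _) t1))).
have qt : c' * n%:R `^ (- B) <= q (typical n) by near: n; exact: qlow.
apply: le_trans (ler_wpM2l (ltW e0) qt).
have ex : expR (- c) ^+ window_hi kap n <= expR (- (c / mu * n%:R)).
  rewrite -expRM_natl ler_expR mulrN lerN2 [_ / mu * _]mulrAC [leLHS](_ : _ = n%:R / mu * c); last by ring.
  apply: le_trans (ler_wpM2r (ltW c0) (ltW hi)).
  apply: ler_wpM2r; first exact: ltW.
  by rewrite mulrDl mul1r lerDl mulr_ge0 // ltW.
have ey : expR (- (c / mu * n%:R)) <= e * c' * (1 - expR (- c)) / C2 * n%:R `^ (- B).
  by near: n; apply: expR_poly_near.
rewrite mulrA ler_pdivrMr //.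
apply: (le_trans (ler_wpM2l (ltW C20) (le_trans ex ey))).
rewrite le_eqVlt; apply/orP; left; apply/eqP; field; rewrite gt_eqF //.
Unshelve. all: by end_near. Qed.

End weighted_counts.

(** * Few large steps, given that n is reached *)

Lemma few_horner1 (R : comNzRingType) (s g : {poly R}) j k :
  (few s g j k).[1] = \sum_(i < j) (s.[1] ^+ (k - i) * g.[1] ^+ i) *+ 'C(k, i).
Proof.
rewrite /few horner_sum; apply: eq_bigr => i _.
by rewrite hornerMn hornerM !horner_exp.
Qed.

Section window.
Context {R : realType}.
Variables (p : nat -> R) (mu : R).
Hypothesis lawp : step_law p mu.

Let p_ge0 := step_ge0 lawp.
Let psum_le1 := sum_law_le1 p_ge0 (step_sum1 lawp).
Let pmean_le := mean_partial_le p_ge0 (step_mean lawp).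

(** A walk that has few large steps at the start of the window still has few of
    them later on, unless it makes a large step inside the window. Up to this
    error and to the visits to n after the window, the sum therefore counts all
    visits to n of the walk started in its state at time lo. *)
Lemma few_window_bounds n y j lo hi :
  let s := small_poly p n y in let g := large_poly p n y in
  let P := law_poly p n in let a := few s g j lo in
  let C := (1 - p 0%N)^-1 in
  (0 < j)%N -> (0 < lo)%N -> (lo <= hi)%N ->
  \sum_(lo <= k < hi) (few s g j k)`_n <= (a * renewal_poly p n)`_n /\
  (a * renewal_poly p n)`_n - C * \sum_(m < n.+1) (P ^+ hi)`_m
    - (hi - lo)%:R * (C * g.[1]) <= \sum_(lo <= k < hi) (few s g j k)`_n.
Proof.
move=> s g P a C j0 lo0 lohi; set U := renewal_poly p n.
have s0 : lecoef n 0 s by move=> i _; rewrite coef0 small_poly_ge0.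
have g0 : lecoef n 0 g by move=> i _; rewrite coef0 large_poly_ge0.
have P0 : lecoef n 0 P by move=> i _; rewrite coef0 law_poly_ge0.
have U0 : lecoef n 0 U.
  by apply: renewal_poly_ge0 => //; [exact: step_sum1 lawp|exact: step0_lt1 lawp].
have a0 : lecoef n 0 a by apply: few_ge0.
have sgP : s + g = P by exact: small_large.
set d := (hi - lo)%N.
have sumE : \sum_(lo <= k < hi) (few s g j k)`_n = (\sum_(r < d) few s g j (lo + r))`_n.
  rewrite coef_sum -{1}[lo]add0n big_addn big_mkord.
  by apply: eq_bigr => r _; rewrite addnC.
have geo r : lecoef n (\sum_(k < d) P ^+ (r + k)) U.
  by apply: geometric_le_renewal => //; [exact: step_sum1 lawp|exact: step0_lt1 lawp].
have geo0 := geo 0%N.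
have geo1 := geo lo.-1.
rewrite sumE; split.
  have h : lecoef n (\sum_(r < d) few s g j (lo + r)) (\sum_(r < d) P ^+ (0 + r) * a).
    apply: lecoef_sum => r _; rewrite add0n -sgP.
    by have [] := few_prolong lo r s0 g0 j0.
  apply: le_trans (h n (leqnn n)) _; rewrite -mulr_suml mulrC.
  exact: (lecoefMl a0 geo0 (leqnn n)).
have h1 : lecoef n (\sum_(r < d) P ^+ (0 + r) * a)
    (\sum_(r < d) few s g j (lo + r) + g * U *+ d).
  apply: (@lecoef_trans _ _ _ (\sum_(r < d) (few s g j (lo + r) + g * P ^+ (lo.-1 + r) *+ d))).
    apply: lecoef_sum => -[r /= rd] _; rewrite add0n.
    have [_] := few_prolong lo r s0 g0 j0; rewrite sgP => h.
    apply: lecoef_trans h _; apply: lecoefD => //.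
    rewrite -[(lo + r)%N]prednK ?addn_gt0 ?lo0 //= -subn1 addnC -addnBA // subn1 addnC.
    move=> m mn; rewrite !coefMn; apply: ler_wpMn2l; last exact: ltnW.
    have : lecoef n 0 (g * P ^+ (lo.-1 + r)) by apply: lecoef0M => //; exact: lecoef0X.
    by move=> /(_ m mn); rewrite coef0.
  rewrite big_split /=; apply: lecoefD => //.
  rewrite sumrMnl -mulr_sumr; apply: lecoefMn; exact: lecoefMl.
have h2 : lecoef n (a * U) (\sum_(r < d) P ^+ (0 + r) * a + P ^+ hi * U).
  apply: (@lecoef_trans _ _ _ (a * (\sum_(r < d) P ^+ r + P ^+ d * U))).
    apply: lecoefMl => // i i_n.
    by rewrite -(renewal_unroll (step0_lt1 lawp) d i_n).
  rewrite mulrDr -mulr_suml [X in lecoef _ (X + _) _]mulrC; apply: lecoefD => //.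
  rewrite -(subnKC lohi) exprD mulrA; apply: lecoefMr => //.
  apply: lecoefMr; first exact: lecoef0X.
  by rewrite -sgP; apply: few_le_expr.
have := h1 n (leqnn n); have := h2 n (leqnn n).
rewrite !coefD coefMn -(mulr_natl (g * U)`_n d).
have e1 := coefM_renewal_le p_ge0 (step_sum1 lawp) (step0_lt1 lawp) (lecoef0X hi P0).
have e2 := coefM_renewal_le p_ge0 (step_sum1 lawp) (step0_lt1 lawp) g0.
have C0 : 0 <= C by rewrite invr_ge0 subr_ge0 ltW // (step0_lt1 lawp).
have e3 : d%:R * (g * U)`_n <= d%:R * (C * g.[1]).
  apply: ler_wpM2l => //; apply: le_trans e2 _; apply: ler_wpM2l => //.
  by apply: sum_coef_le_horner1; exact: large_poly_ge0.
move: e1 e3; rewrite -/C -/U -/d.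
move: (d%:R * (g * U)`_n) (d%:R * (C * g.[1])) (C * _) => x1 x2 x3.
move: (P ^+ hi * U)`_n (a * U)`_n => x4 x5; lra.
Qed.

(** The contribution to the mean of the values larger than delta n vanishes. *)
Lemma far_steps_negligible (delta e : R) : 0 < delta -> 0 < e ->
  \forall n \near \oo, n%:R * (large_poly p n (delta * n%:R)).[1] <= e.
Proof.
move=> d0 e0; have e1 : 0 < e * delta by rewrite mulr_gt0.
case: (mean_partial_cvg p_ge0 (step_mean lawp) e1) => N _ /(_ N (leqnn N)) /= HN.
near=> n.
have n1 : 1 <= n%:R :> R by near: n; exact: nat_large.
have n0 : 0 < n%:R :> R by lra.
have nN : N%:R / delta <= n%:R by near: n; exact: nat_large.
have {}nN : N%:R <= delta * n%:R by rewrite mulrC -ler_pdivrMr.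
rewrite horner_poly -(ler_pM2l d0) [leRHS]mulrC mulrA mulr_sumr.
apply: (@le_trans _ _ (\sum_(l < n.+1) (if l%:R <= delta * n%:R then 0 else l%:R * p l))).
  apply: ler_sum => l _; rewrite expr1n mulr1; case: ifPn => [_|]; first by rewrite mulr0.
  rewrite -ltNge => /ltW dl; exact: ler_wpM2r.
have hle : \sum_(l < n.+1) (if l%:R <= delta * n%:R then 0 else l%:R * p l) +
    \sum_(l < N) l%:R * p l <= mu.
  apply: le_trans (pmean_le (n.+1 + N)).
  rewrite -(big_mkord xpredT (fun l => if l%:R <= delta * n%:R then 0 else l%:R * p l)).
  rewrite -!(big_mkord xpredT (fun l => l%:R * p l)).
  have [Nn|nN'] := leqP N n.+1; last first.
    rewrite big_nat big1 ?add0r; last first.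
      move=> l /andP[_ ln]; rewrite ifT // (le_trans _ nN) // ler_nat; lia.
    by rewrite [leRHS](big_cat_nat _ (n := N)) ?leq_addl //= lerDl sumr_ge0 // => l _; rewrite mulr_ge0.
  rewrite (big_cat_nat _ (n := N)) //=.
  rewrite big_nat [X in X + _ + _]big1 ?add0r; last first.
    move=> l /andP[_ ln]; rewrite ifT // (le_trans _ nN) // ler_nat; lia.
  rewrite [leRHS](big_cat_nat _ (n := n.+1)) ?leq_addr //= .
  rewrite (big_cat_nat _ (n := N) (p := n.+1) (m := 0)) //=.
  rewrite [leLHS]addrC -addrA lerD2l -[leLHS]addr0; apply: lerD.
    by apply: ler_sum => l _; case: ifP => // _; rewrite mulr_ge0.
  by rewrite sumr_ge0 // => l _; rewrite mulr_ge0.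
lra.
Unshelve. all: by end_near. Qed.

(** Markov's inequality, improved by the convergence of the mean: n P(X > n) is
    at most the contribution of the values larger than n to the mean. *)
Lemma mass_escape_cvg : (fun n => n%:R * (1 - (law_poly p n).[1])) @ \oo --> (0 : R).
Proof.
apply/cvgrPdist_le => /= e e0.
have [N _ H] := mean_partial_cvg p_ge0 (step_mean lawp) e0.
near=> n; rewrite sub0r normrN.
have -> : (law_poly p n).[1] = \sum_(l < n.+1) p l.
  by rewrite horner_poly; apply: eq_bigr => l _; rewrite expr1n mulr1.
rewrite ger0_norm ?mulr_ge0 ?subr_ge0 //.
apply: le_trans (mul_tail_le p_ge0 (step_sum1 lawp) (step_mean lawp) n) _.
have h : mu - e < \sum_(l < n.+1) l%:R * p l.
  by near: n; exists N => // n /= Nn; apply: H; exact: leqW.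
lra.
Unshelve. all: by end_near. Qed.

Lemma window_lo_cvg kap : kap <= 1 ->
  (fun n => (window_lo mu kap n)%:R / n%:R) @ \oo --> (1 - kap) / mu.
Proof.
move=> kap1; have m0 := mean_gt0 lawp.
have up : (fun n => (1 - kap) / mu + n%:R^-1) @ \oo --> (1 - kap) / mu.
  rewrite -[X in _ --> X]addr0; apply: cvgD; first exact: cvg_cst.
  apply/gtr0_cvgV0; last exact: cvgr_idn.
  by exists 1%N => // n /= n1; rewrite ltr0n.
apply: squeeze_cvgr (cvg_cst ((1 - kap) / mu)) up; near=> n.
have n1 : 1 <= n%:R :> R by near: n; exact: nat_large.
have n0 : 0 < n%:R :> R by lra.
have /andP[h1 h2] := window_lo_bounds lawp n kap1.
have E : (1 - kap) * (n%:R / mu) = (1 - kap) / mu * n%:R by ring.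
rewrite {}E in h1 h2; apply/andP; split; first by rewrite ler_pdivlMr // ltW.
by rewrite ler_pdivrMr // mulrDl mulVf ?gt_eqF.
Unshelve. all: by end_near. Qed.

(** At the start of the window the mean of the walk is (1 - kap) n, so the walk
    exceeds n - M only by a step of order n or by a deviation of truncated
    steps. *)
Lemma window_start_margin (kap e : R) (M : nat) : 0 < kap -> kap < 1 -> 0 < e ->
  \forall n \near \oo,
    (law_poly p n ^+ window_lo mu kap n).[1] -
    \sum_(m < (n - M).+1) (law_poly p n ^+ window_lo mu kap n)`_m <= e.
Proof.
move=> kap0 kap1 e0; have m0 := mean_gt0 lawp.
have [eta [eta0 eta1] [M' pM]] := step_moment lawp.
have k20 : 0 < kap / 2 by rewrite divr_gt0.
have [C [delta [C0 delta0 chern]]] :=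
  truncated_chernoff p_ge0 psum_le1 pmean_le m0 eta0 eta1 pM k20 ltr01.
have e2 : 0 < e / (2 * (mu^-1 + 1)).
  by rewrite divr_gt0 // mulr_gt0 // addr_gt0 // invr_gt0.
have far := far_steps_negligible delta0 e2.
have e3 : 0 < e / 2 * expR (- (C * M%:R)) by rewrite mulr_gt0 ?expR_gt0 // divr_gt0.
near=> n; set f := law_poly p n ^+ _.
have n1 : 1 <= n%:R :> R by near: n; exact: nat_large.
have n0 : 0 < n%:R :> R by lra.
have nM : M%:R <= n%:R :> R by near: n; exact: nat_large.
have nmu : 2 * mu / kap <= n%:R by near: n; exact: nat_large.
have farn : n%:R * (large_poly p n (delta * n%:R)).[1] <= e / (2 * (mu^-1 + 1)).
  by near: n; exact: far.
set lo := window_lo mu kap n in f *.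
have /andP[_ lo_up] := window_lo_bounds lawp n (ltW kap1).
have x0 : 0 <= n%:R / mu by rewrite divr_ge0 // ltW.
have lomu : lo%:R * mu <= (1 - kap / 2) * n%:R.
  apply: (le_trans (ler_wpM2r (ltW m0) lo_up)).
  have -> : ((1 - kap) * (n%:R / mu) + 1) * mu = (1 - kap) * n%:R + mu.
    by field; rewrite gt_eqF.
  have : mu <= kap / 2 * n%:R.
    by rewrite -ler_pdivrMl // invf_div mulrC mulrA [mu * 2]mulrC.
  lra.
set P := law_poly p n; set T := small_poly p n (delta * n%:R).
set H := large_poly p n (delta * n%:R).
pose f' := T ^+ lo + H * P ^+ lo.-1 *+ lo.
have ff' m : f`_m <= f'`_m.
  have s0 : lecoef m 0 T by move=> i _; rewrite coef0 small_poly_ge0.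
  have g0 : lecoef m 0 H by move=> i _; rewrite coef0 large_poly_ge0.
  by have := expr_split_large lo s0 g0 (leqnn m); rewrite small_large.
apply: le_trans (horner1_tail_mono (n - M) ff') _.
have H0 m : 0 <= H`_m by exact: large_poly_ge0.
have HP0 m : 0 <= (H * P ^+ lo.-1)`_m.
  rewrite coefM sumr_ge0 // => i _; rewrite mulr_ge0 //.
  by apply: coef_expr_ge0; exact: law_poly_ge0.
have T0 m : 0 <= (T ^+ lo)`_m by apply: coef_expr_ge0; exact: small_poly_ge0.
have part2 : (H * P ^+ lo.-1 *+ lo).[1] <= e / 2.
  rewrite hornerMn hornerM -(mulr_natl (_ * _) lo).
  have Hp : 0 <= H.[1] by rewrite horner_poly sumr_ge0 // => i _; rewrite expr1n mulr1; case: ifP.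
  apply: (@le_trans _ _ (lo%:R * H.[1])).
    apply: ler_wpM2l => //; rewrite ler_piMr //; exact: law_poly_exp1_le1 lawp _ _.
  have lon : lo%:R <= (mu^-1 + 1) * n%:R.
    apply: le_trans lo_up _.
    have : 0 <= kap * (n%:R / mu) by rewrite mulr_ge0 // ltW.
    lra.
  apply: (le_trans (ler_wpM2r Hp lon)); rewrite -mulrA.
  have mm : 0 < mu^-1 + 1 by rewrite addr_gt0 // invr_gt0.
  rewrite -ler_pdivlMl //; apply: le_trans farn _.
  by rewrite le_eqVlt; apply/orP; left; apply/eqP; field; rewrite !gt_eqF //; lra.
have part1 : (T ^+ lo).[1] - \sum_(m < (n - M).+1) (T ^+ lo)`_m <= e / 2.
  set t := expR (C * ln n%:R / n%:R).
  have ln0 : 0 <= ln n%:R :> R by exact: ln_ge0.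
  have s0 : 0 <= C * ln n%:R / n%:R.
    by rewrite divr_ge0 ?(ltW n0) // mulr_ge0 ?(ltW C0).
  have t1 : 1 <= t by rewrite -[leLHS]expR0 ler_expR.
  have hc := horner1_tail_chernoff (n - M) T0 t1.
  have hc2 : T.[t] ^+ lo <= expR ((C - 1) * ln n%:R).
    rewrite /T /t; move: (lo) lomu; near: n; exact: chern.
  rewrite [_.[t]]horner_exp -expRM_natl in hc.
  have hc3 := le_trans hc hc2.
  rewrite -ler_pdivlMl ?expR_gt0 // -expRN -expRD in hc3.
  apply: le_trans hc3 _.
  have nV : n%:R `^ (- 1) <= e / 2 * expR (- (C * M%:R)).
    by near: n; exact: powRN_near0.
  have -> : e / 2 = e / 2 * expR (- (C * M%:R)) * expR (C * M%:R).
    by rewrite -mulrA -expRD addNr expR0 mulr1.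
  apply: le_trans (ler_wpM2r (expR_ge0 _) nV).
  rewrite powR_expR // -expRD ler_expR.
  have hs : (n%:R - M%:R) * (C * ln n%:R / n%:R) <= (n - M).+1%:R * (C * ln n%:R / n%:R).
    apply: ler_wpM2r => //; rewrite -natr1 natrB; first by lra.
    by rewrite -(ler_nat R).
  have hM : M%:R * (C * ln n%:R / n%:R) <= C * M%:R.
    rewrite mulrA ler_pdivrMr // mulrCA mulrA; apply: ler_wpM2l.
      by rewrite mulr_ge0 // ltW.
    exact: ltW (ln_sublinear n0).
  have hn : n%:R * (C * ln n%:R / n%:R) = C * ln n%:R by field; rewrite gt_eqF.
  lra.
rewrite /f' hornerD.
have -> : \sum_(m < (n - M).+1) (T ^+ lo + H * P ^+ lo.-1 *+ lo)`_m =
   \sum_(m < (n - M).+1) (T ^+ lo)`_m + \sum_(m < (n - M).+1) (H * P ^+ lo.-1 *+ lo)`_m.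
  by rewrite -big_split; apply: eq_bigr => i _; rewrite coefD.
have : 0 <= \sum_(m < (n - M).+1) (H * P ^+ lo.-1 *+ lo)`_m.
  by rewrite sumr_ge0 // => i _; rewrite coefMn mulrn_wge0.
lra.
Unshelve. all: by end_near. Qed.

End window.

(** * Asymptotics of the weighted counts *)

Lemma small1E (R : realType) (p : nat -> R) (y : nat -> R) n :
  (small_poly p n (y n)).[1] = (law_poly p n).[1] - (large_poly p n (y n)).[1].
Proof. by rewrite -(small_large p n (y n)) hornerD addrK. Qed.

Lemma large1_ge0 (R : realType) (p : nat -> R) (y : nat -> R) n :
  (forall l, 0 <= p l) -> 0 <= (large_poly p n (y n)).[1].
Proof.
by move=> p0; rewrite horner_poly sumr_ge0 // => i _; rewrite expr1n mulr1; case: ifP.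
Qed.

(** At the start of the window the number of large steps is binomial. *)
Lemma window_start_poisson (R : realType) (p : nat -> R) (mu : R)
    (y : nat -> R) (lam : R) (j : nat) (kap : R) :
  step_law p mu ->
  (fun n => n%:R * (large_poly p n (y n)).[1]) @ \oo --> mu * lam ->
  0 < kap -> kap < 1 ->
  (fun n => (few (small_poly p n (y n)) (large_poly p n (y n)) j (window_lo mu kap n)).[1])
    @ \oo --> poisson_below j ((1 - kap) * lam).
Proof.
move=> lawp large_cvg kap0 kap1; have m0 := mean_gt0 lawp.
have p_ge0 := step_ge0 lawp.
have lo_cvg := window_lo_cvg lawp (ltW kap1).
under eq_cvg do rewrite few_horner1.
have nz : \forall n \near \oo, n%:R != 0 :> R.
  by exists 1%N => // n /= n1; rewrite pnatr_eq0 -lt0n.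
have lE : (1 - kap) * lam = (1 - kap) / mu * (mu * lam) by field; rewrite gt_eqF.
apply: binomial_poisson_cvg.
- apply/cvgryPge => A; near=> n.
  have /andP[h _] := window_lo_bounds lawp n (ltW kap1).
  apply: ltW; apply: le_lt_trans h; rewrite mulrA ler_pdivlMr //.
  rewrite -ler_pdivrMl ?subr_gt0 //; near: n; exact: nat_large.
- rewrite lE -[mu * lam]add0r.
  apply: cvg_near_eq (cvgM lo_cvg (cvgD (mass_escape_cvg lawp) large_cvg)) _.
  near=> n; rewrite small1E.
  have n0 : n%:R != 0 :> R by near: n.
  transitivity ((window_lo mu kap n)%:R / n%:R *
    (n%:R * (1 - (law_poly p n).[1]) + n%:R * (large_poly p n (y n)).[1])); first by [].
  by field.
- rewrite lE; apply: cvg_near_eq (cvgM lo_cvg large_cvg) _; near=> n.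
  have n0 : n%:R != 0 :> R by near: n.
  by rewrite /=; field.
- move=> n; rewrite small1E lerBlDr; apply: le_trans (law_poly1_le1 lawp n) _.
  by rewrite lerDl; exact: large1_ge0.
Unshelve. all: by end_near. Qed.

(** Outside a window around n / mu the terms are negligible, and inside it q is
    almost constant. The remaining sum is a renewal convolution started from the
    state at the beginning of the window: it is close to 1 / mu times the
    probability that this state has few large steps, which is nearly Poisson of
    mean (1 - kap) lam. The relative width kap of the window is small enough for
    the continuity of the Poisson masses, for the variation of q, and for the
    number of large steps made inside the window, of order kap lam. *)
Theorem few_large_steps (R : realType) (p q : nat -> R) (mu : R)
    (y : nat -> R) (lam : R) (j : nat) (e : R) :
  step_law p mu -> smooth_weights q -> negligible_jumps p q ->
  0 <= lam -> (0 < j)%N ->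
  (fun n => n%:R * (large_poly p n (y n)).[1]) @ \oo --> mu * lam -> 0 < e ->
  \forall n \near \oo, \forall K \near \oo,
    `|\sum_(1 <= k < K) q k * (few (small_poly p n (y n)) (large_poly p n (y n)) j k)`_n -
      q (typical mu n) * (poisson_below j lam / mu)| <= e * q (typical mu n).
Proof.
move=> lawp smq negl lam_ge0 j_gt0 large_cvg e0.
have m0 := mean_gt0 lawp; have p_ge0 := step_ge0 lawp.
set Phi := poisson_below j lam.
have /andP[Phi0 Phi1] : 0 <= Phi <= 1 := poisson_below_bounds j lam_ge0.
pose nu := mu^-1; have nu0 : 0 < nu by rewrite invr_gt0.
pose C := (1 - p 0%N)^-1.
have C0 : 0 < C by rewrite invr_gt0 subr_gt0 (step0_lt1 lawp).
pose E := e / 4; have E0 : 0 < E by rewrite divr_gt0.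
pose e1 := e / (4 * (1 + nu + e)).
have d1 : 0 < 1 + nu + e by rewrite !addr_gt0.
have e10 : 0 < e1 by rewrite divr_gt0 // mulr_gt0.
have e1E : e1 * (1 + nu + e) = e / 4 by rewrite /e1; field; rewrite gt_eqF.
have [kw kw0 [Nw Hw]] := weight_local smq e10.
have E6 : 0 < E / (6 * nu) by rewrite divr_gt0 // mulr_gt0.
have /cvgrPdist_lt/(_ _ E6) := @poisson_below_continuous R j lam.
move=> /nbhs_ballP[d /= d0 Hd].
have lam1 : 0 < lam + 1 by lra.
pose kap := Num.min (Num.min (1 / 2) (kw / 2))
  (Num.min (d / (2 * (lam + 1))) (E / (24 * C * (lam + 1)))).
have kap0 : 0 < kap by rewrite !lt_min !divr_gt0 // !mulr_gt0.
have kapa : kap <= 1 / 2 by rewrite !ge_min lexx.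
have kapb : kap <= kw / 2 by rewrite !ge_min lexx orbT.
have kapc : kap <= d / (2 * (lam + 1)) by rewrite !ge_min lexx !orbT.
have kapd : kap <= E / (24 * C * (lam + 1)) by rewrite !ge_min lexx !orbT.
have kap1 : kap < 1 by lra.
have PhiK : nu * `|Phi - poisson_below j ((1 - kap) * lam)| <= E / 6.
  have hb : ball lam d ((1 - kap) * lam).
    rewrite /ball /= (_ : lam - (1 - kap) * lam = kap * lam); last by ring.
    rewrite ger0_norm ?mulr_ge0 ?(ltW kap0) //.
    have : kap * lam <= d / (2 * (lam + 1)) * (lam + 1).
      apply: ler_pM => //; first exact: ltW.
      by rewrite lerDl.
    have -> : d / (2 * (lam + 1)) * (lam + 1) = d / 2 by field; rewrite gt_eqF.
    lra.
  have := Hd _ hb => /ltW /(ler_wpM2l (ltW nu0)).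
  by have -> : nu * (E / (6 * nu)) = E / 6 by field; rewrite gt_eqF.
have [c c0 Hmass] := many_steps_mass lawp kap0 (ltW kap1).
have e20 : 0 < E / 6 by rewrite divr_gt0.
have /cvgrPdist_le/(_ _ e20) [M _ HM] := renewal_cvg p_ge0 (step_sum1 lawp)
  (step0_lt1 lawp) (step_aperiodic lawp) m0 (step_mean lawp).
have DT : 0 < E / (6 * (C + nu)) by rewrite divr_gt0 // mulr_gt0 // addr_gt0.
have start := @window_start_poisson R p mu y lam j kap lawp large_cvg kap0 kap1.
have low := few_steps_negligible lawp smq negl kap0 kap1 e10.
have high := many_steps_negligible lawp smq kap0 (ltW kap1) e10.
have margin := window_start_margin lawp M kap0 kap1 DT.
have startE := start; move: startE => /cvgrPdist_le/(_ _ E6) startE.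
have xN' : \forall n \near \oo, 2 * Nw%:R <= n%:R / mu := n_over_mu_ge lawp _.
have xc' : \forall n \near \oo, c^-1 * - ln (E / 6 / C) <= n%:R / mu := n_over_mu_ge lawp _.
have ng' : \forall n \near \oo, n%:R * (large_poly p n (y n)).[1] <= mu * (lam + 1).
  by apply: (cvgr_le (mu * lam)) large_cvg _ _; rewrite ltr_pM2l // ltrDl.
near=> n.
have m1 : (1 <= typical mu n)%N by near: n; exact: (typical_near lawp).
have mNw : (Nw <= typical mu n)%N by near: n; exact: (typical_near lawp).
have mbig : ((Num.truncn ((1 + kap) / kap)).+1 <= typical mu n)%N.
  by near: n; exact: (typical_near lawp).
have lown : \sum_(1 <= k < window_lo mu kap n) q k * (law_poly p n ^+ k)`_n <=
    e1 * q (typical mu n) by near: n; exact: low.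
have highn : forall K, \sum_(window_hi mu kap n <= k < K) q k * (law_poly p n ^+ k)`_n <=
    e1 * q (typical mu n) by near: n; exact: high.
have marginn : (law_poly p n ^+ window_lo mu kap n).[1] -
    \sum_(m < (n - M).+1) (law_poly p n ^+ window_lo mu kap n)`_m <= E / (6 * (C + nu)).
  by near: n; exact: margin.
have startn : `|poisson_below j ((1 - kap) * lam) -
    (few (small_poly p n (y n)) (large_poly p n (y n)) j (window_lo mu kap n)).[1]| <= E / (6 * nu).
  by near: n; exact: startE.
have xN : 2 * Nw%:R <= n%:R / mu by near: n; exact: xN'.
have xc : c^-1 * - ln (E / 6 / C) <= n%:R / mu by near: n; exact: xc'.
have ng : n%:R * (large_poly p n (y n)).[1] <= mu * (lam + 1) by near: n; exact: ng'.
have nM : (M <= n)%N by near: n; exact: nbhs_infty_ge.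
have ngb : mu * (lam + 1) / (E / (12 * C)) <= n%:R by near: n; exact: nat_large.
set x := n%:R / mu.
have x0 : 0 <= x by rewrite divr_ge0 // ltW.
have n1 : 1 <= n%:R :> R by near: n; exact: nat_large.
have n0 : 0 < n%:R :> R by lra.
set m := typical mu n; set lo := window_lo mu kap n; set hi := window_hi mu kap n.
have qm : 0 < q m by exact: weight_gt0 smq _ m1.
have /andP[lo1 lo2] := window_lo_bounds lawp n (ltW kap1).
have /andP[hi1 hi2] := window_hi_bounds lawp n (ltW kap0).
rewrite -/lo -/x in lo1 lo2; rewrite -/hi -/x in hi1 hi2.
have lohi : (lo <= hi)%N.
  by rewrite ltnS; apply: le_truncn; apply: ler_wpM2r => //; rewrite lerD2l ge0_cp //; exact: ltW.
near=> K.
have hiK : (hi <= K)%N by near: K; exact: nbhs_infty_ge.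
set P := law_poly p n.
have s0 i : lecoef i 0 (small_poly p n (y n)) by move=> l _; rewrite coef0 small_poly_ge0.
have g0 i : lecoef i 0 (large_poly p n (y n)) by move=> l _; rewrite coef0 large_poly_ge0.
have few_ge0' k l : 0 <= (few (small_poly p n (y n)) (large_poly p n (y n)) j k)`_l.
  by have := few_ge0 j k (s0 l) (g0 l) (leqnn l); rewrite coef0.
have few_le k l : (few (small_poly p n (y n)) (large_poly p n (y n)) j k)`_l <= (P ^+ k)`_l.
  by have := few_le_expr j k (s0 l) (g0 l) (leqnn l); rewrite small_large.
set F := fun k => (few (small_poly p n (y n)) (large_poly p n (y n)) j k)`_n.
set X := \sum_(lo <= k < hi) F k.
have spl : \sum_(1 <= k < K) q k * F k = \sum_(1 <= k < lo) q k * F k +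
    \sum_(lo <= k < hi) q k * F k + \sum_(hi <= k < K) q k * F k.
  rewrite (big_cat_nat _ (n := lo)) //=; last exact: leq_trans lohi hiK.
  by rewrite (big_cat_nat _ (n := hi) (m := lo)) //= addrA.
have lowb : 0 <= \sum_(1 <= k < lo) q k * F k <= e1 * q m.
  apply/andP; split.
    rewrite big_nat sumr_ge0 // => k /andP[k1 _].
    by apply: mulr_ge0; [exact: ltW (weight_gt0 smq k1)|exact: few_ge0'].
  apply: (@le_trans _ _ (\sum_(1 <= k < lo) q k * (P ^+ k)`_n)).
    rewrite !big_nat; apply: ler_sum => k /andP[k1 _].
    apply: ler_wpM2l; last exact: few_le.
    exact: ltW (weight_gt0 smq k1).
  exact: lown.
have highb : 0 <= \sum_(hi <= k < K) q k * F k <= e1 * q m.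
  apply/andP; split.
    rewrite big_nat sumr_ge0 // => k /andP[k1 _].
    apply: mulr_ge0; last exact: few_ge0'.
    by apply/ltW/(weight_gt0 smq); apply: leq_trans k1.
  apply: (@le_trans _ _ (\sum_(hi <= k < K) q k * (P ^+ k)`_n)).
    rewrite !big_nat; apply: ler_sum => k /andP[k1 _].
    apply: ler_wpM2l; last exact: few_le.
    by apply/ltW/(weight_gt0 smq); apply: leq_trans k1.
  exact: highn.
have X0 : 0 <= X by rewrite sumr_ge0 // => k _; exact: few_ge0'.
have midq k : (lo <= k < hi)%N -> `|q k - q m| <= e1 * q m.
  move=> /andP[lok khi].
  have kub : k%:R <= (1 + kap) * x.
    by rewrite -truncn_ge_nat // mulr_ge0 // addr_ge0 // ltW.
  have klb : (1 - kap) * x < k%:R.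
    by apply: lt_le_trans lo1 _; rewrite ler_nat.
  have /andP[mx xm] := typical_bounds lawp n; rewrite -/m -/x in mx xm.
  have mbig' : (1 + kap) / kap <= m%:R.
    have : (Num.truncn ((1 + kap) / kap)).+1%:R <= m%:R :> R by rewrite ler_nat.
    by apply: le_trans; apply: ltW; exact: truncnS_gt.
  rewrite ler_pdivrMr // in mbig'.
  apply: Hw => //.
    have h : Nw%:R <= (1 - kap) * x.
      have : kap * x <= 1 / 2 * x by exact: ler_wpM2r.
      by move: xN; rewrite -/x; clear; lra.
    by rewrite -(ler_nat R); apply: ltW; exact: le_lt_trans h klb.
  have km : `|k%:R - m%:R| <= 2 * kap * m%:R.
    rewrite ler_norml; have : kap * x <= kap * (m%:R + 1) by rewrite ler_wpM2l ?ltW.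
    by move: kub klb mx xm mbig'; clear; move=> *; apply/andP; split; lra.
  by apply: le_trans km _; apply: ler_wpM2r => //; move: kapb; clear; lra.
have midb : `|\sum_(lo <= k < hi) q k * F k - q m * X| <= e1 * q m * X.
  rewrite /X !mulr_sumr -sumrB; apply: le_trans (ler_norm_sum _ _ _) _.
  rewrite !big_nat; apply: ler_sum => k hk.
  rewrite -mulrBl normrM (ger0_norm (few_ge0' _ _)).
  by apply: ler_wpM2r; [exact: few_ge0' | exact: midq].
(* The four errors, each at most E / 6 or E / 3: visits to n after the window
   (hiE), large steps inside it (gE), the renewal sequence against its limit
   and the margin where it is not close to it (aU, tailE), and the law of the
   number of large steps against the Poisson law (aPhi, PhiK). *)
set a := few (small_poly p n (y n)) (large_poly p n (y n)) j lo.
have [Xup Xlo] := few_window_bounds lawp n (y n) j_gt0 (ltn0Sn _ : (0 < lo)%N) lohi.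
rewrite -/a -/X in Xup; rewrite -/a -/X -/C -/P in Xlo.
have hiE : C * \sum_(i < n.+1) (P ^+ hi)`_i <= E / 6.
  have hm : \sum_(i < n.+1) (P ^+ hi)`_i <= expR (- c * hi%:R).
    by apply: Hmass; rewrite -ler_pdivrMr // -mulrA ltW.
  have hx : expR (- c * hi%:R) <= E / 6 / C.
    rewrite -[leRHS]lnK ?posrE ?divr_gt0 // ler_expR mulNr lerNl -ler_pdivrMl //.
    apply: ltW; apply: le_lt_trans hi1; apply: (@le_trans _ _ x).
      exact: xc.
    by rewrite mulrDl mul1r lerDl mulr_ge0 // ltW.
  have := ler_wpM2l (ltW C0) (le_trans hm hx).
  by rewrite (_ : C * (E / 6 / C) = E / 6) //; field; rewrite gt_eqF.
have gE : (hi - lo)%:R * (C * (large_poly p n (y n)).[1]) <= E / 6.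
  have gg := large1_ge0 y n p_ge0.
  have hl : (hi - lo)%:R <= 2 * kap * x + 1 by rewrite natrB //; move: hi2 lo1; clear; lra.
  apply: (@le_trans _ _ ((2 * kap * x + 1) * (C * (large_poly p n (y n)).[1]))).
    by apply: ler_wpM2r => //; rewrite mulr_ge0 // ltW.
  have xg : x * (large_poly p n (y n)).[1] <= lam + 1.
    rewrite /x mulrAC ler_pdivrMr // [leRHS]mulrC //.
  have g1 : (large_poly p n (y n)).[1] <= E / (12 * C).
    have E12 : 0 < E / (12 * C) by rewrite divr_gt0 // mulr_gt0.
    rewrite -(ler_pM2l n0); apply: le_trans ng _.
    by move: ngb; rewrite ler_pdivrMr.
  have k1 : kap * (C * (lam + 1)) <= E / 24.
    have := ler_wpM2r (ltW (mulr_gt0 C0 lam1)) kapd.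
    by rewrite (_ : E / (24 * C * (lam + 1)) * (C * (lam + 1)) = E / 24) //;
      field; rewrite !gt_eqF.
  have k2 : C * (large_poly p n (y n)).[1] <= E / 12.
    have := ler_wpM2l (ltW C0) g1.
    by rewrite (_ : C * (E / (12 * C)) = E / 12) //; field; rewrite gt_eqF.
  have k3 : kap * C * (x * (large_poly p n (y n)).[1]) <= kap * C * (lam + 1).
    by apply: ler_wpM2l => //; rewrite mulr_ge0 // ltW.
  move: k1 k2 k3; clear; lra.
have aU := coefM_renewal_approx p_ge0 (step_sum1 lawp) (step0_lt1 lawp)
  (few_ge0' lo) nM (ltW nu0) (ltW e20).
rewrite -/a -/C in aU.
have a1 : a.[1] <= 1.
  apply: le_trans (law_poly_exp1_le1 lawp n lo).
  have := horner1_tail_mono 0 (few_le lo); rewrite -/a -/P !big_ord_recl !big_ord0 !addr0 /=.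
  have := few_le lo 0%N; rewrite -/a; clear; lra.
have tailE : (C + nu) * (a.[1] - \sum_(i < (n - M).+1) a`_i) <= E / 6.
  have h1 := horner1_tail_mono (n - M) (few_le lo).
  have h2 : (P ^+ lo).[1] - \sum_(i < (n - M).+1) (P ^+ lo)`_i <= E / (6 * (C + nu)).
    exact: marginn.
  have := ler_wpM2l (ltW (addr_gt0 C0 nu0)) (le_trans h1 h2).
  by rewrite (_ : (C + nu) * (E / (6 * (C + nu))) = E / 6) //; field; rewrite gt_eqF // addr_gt0.
have aPhi : nu * `|poisson_below j ((1 - kap) * lam) - a.[1]| <= E / 6.
  have h : `|poisson_below j ((1 - kap) * lam) - a.[1]| <= E / (6 * nu) := startn.
  have := ler_wpM2l (ltW nu0) h.
  by rewrite (_ : nu * (E / (6 * nu)) = E / 6) //; field; rewrite gt_eqF.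
have {}aU : `|(a * renewal_poly p n)`_n - nu * a.[1]| <= E / 6 + E / 6.
  apply: le_trans (aU _) _.
    by move=> i Mi; rewrite distrC; apply: HM.
  by apply: lerD => //; rewrite ler_piMr // ltW.
have XE : `|X - nu * Phi| <= E.
  have t1 : `|nu * a.[1] - nu * poisson_below j ((1 - kap) * lam)| <= E / 6.
    by rewrite -mulrBr normrM (gtr0_norm nu0) distrC.
  have t2 : `|nu * poisson_below j ((1 - kap) * lam) - nu * Phi| <= E / 6.
    by rewrite -mulrBr normrM (gtr0_norm nu0) distrC.
  move: aU t1 t2 Xup Xlo hiE gE.
  move: (nu * a.[1]) (nu * poisson_below _ _) (nu * Phi) => z1 z2 z3.
  move: (a * _)`_n (C * _) (_ * (C * _)) => z4 z5 z6.
  rewrite !ler_norml; clear => /andP[? ?] /andP[? ?] /andP[? ?] ? ? ? ?.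
  by apply/andP; split; lra.
have PhiE : Phi / mu = nu * Phi by rewrite mulrC.
rewrite spl PhiE.
have XB : X <= nu + e.
  have : nu * Phi <= nu by rewrite ler_piMr // ltW.
  move: XE e0; rewrite ler_norml /E => /andP[_]; clear; lra.
have qX : q m * `|X - nu * Phi| <= q m * E by rewrite ler_wpM2l // ltW.
have eX : e1 * q m * X <= e1 * q m * (nu + e) by rewrite ler_wpM2l // mulr_ge0 // ltW.
have fin : q m * E + e1 * q m * (nu + e) + e1 * q m <= e * q m - q m * E.
  have -> : q m * E + e1 * q m * (nu + e) + e1 * q m = q m * E + q m * (e1 * (1 + nu + e)) by ring.
  rewrite e1E /E; move: (mulr_ge0 (ltW e0) (ltW qm)); clear; lra.
have e1q : e1 * q m <= q m * E.
  have : e1 * 1 <= e1 * (1 + nu + e) by rewrite ler_wpM2l ?ltW //; move: nu0 e0; clear; lra.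
  rewrite e1E mulr1 => h; rewrite mulrC; apply: ler_wpM2l; [exact: ltW|exact: h].
have normq : `|q m * X - q m * (nu * Phi)| <= q m * E.
  by rewrite -mulrBr normrM (gtr0_norm qm).
move: lowb highb midb normq eX fin e1q; rewrite /E.
move: (\sum_(1 <= k < lo) _) (\sum_(lo <= k < hi) _) (\sum_(hi <= k < K) _).
move: (q m * X) (q m * (nu * Phi)) (e1 * q m * X) (e1 * q m * (nu + e)) (e1 * q m).
clear => z1 z2 z3 z4 z5 z6 z7 z8 /andP[? ?] /andP[? ?].
rewrite !ler_norml => /andP[? ?] /andP[? ?] ? ? ?.
by apply/andP; split; lra.
Unshelve. all: by end_near. Qed.

(** * Slowly varying functions *)

Lemma lebesgue_measure_shift (R : realType) (c : R) (A : set R) :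
  measurable A ->
  lebesgue_measure ((fun x : R => x + c) @^-1` A) = lebesgue_measure A.
Proof.
move=> mA.
have mf : measurable_fun [set: measurableTypeR R]
    (fun x : measurableTypeR R => (x : R) + c : measurableTypeR R).
  by apply: measurable_funD => //; exact: measurable_cst.
pose f : {mfun measurableTypeR R >-> measurableTypeR R} :=
  HB.pack (fun x : measurableTypeR R => (x : R) + c : measurableTypeR R)
      (isMeasurableFun.Build _ _ _ _ _ mf).
rewrite [LHS](_ : _ = pushforward lebesgue_measure f A) //.
apply/esym/(@lebesgue_measure_unique R (pushforward lebesgue_measure f)) => //= X [[a b]] _ <-.
rewrite /pushforward (_ : _ @^-1` _ = `]a - c, b - c]%classic).
  by rewrite !lebesgue_measure_itv /= !lte_fin ltrD2r -!EFinB; congr (if _ then _ else _);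
    congr EFin; ring.
by apply/seteqP; split => x /=; rewrite !in_itv /= ltrBlDr lerBrDr.
Qed.

Section uniform_convergence.
Context {R : realType}.
Variable h : R -> R.
Hypothesis mh : measurable_fun [set: R] h.
Hypothesis h_slow : forall t : R, (fun x => h (x + t) - h x) @ +oo --> (0 : R).

Let bad (e z : R) : set R :=
  `[0, 2]%classic `&` [set s | e < `|h (z + s) - h z|].

Lemma measurable_bad e z : measurable (bad e z).
Proof.
apply: measurableI => //.
have mf : measurable_fun [set: R] (fun s => `|h (z + s) - h z|).
  apply: measurableT_comp => //; apply: measurable_funB; last exact: measurable_cst.
  apply: measurableT_comp => //; apply: measurable_funD => //; exact: measurable_cst.
have := mf measurableT `]e, +oo[%classic (measurable_itv _).
rewrite setTI => H; apply: eq_ind H _ _; apply/seteqP; split => s /=;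
  by rewrite in_itv /= andbT.
Qed.

(** For each s the point s leaves the bad sets eventually, so their upper limit
    is empty, and continuity from above applies on the bounded interval [0, 2]. *)
Lemma bad_measure_cvg (e : R) (z : nat -> R) : 0 < e -> (forall n, n%:R <= z n) ->
  \forall n \near \oo, (lebesgue_measure (bad e (z n)) < 2^-1%:E)%E.
Proof.
move=> e0 zn.
have mF k : measurable (bad e (z k)) by exact: measurable_bad.
have lim0 : lim_sup_set (fun k => bad e (z k)) = set0.
  apply/seteqP; split => // s hs.
  have /cvgrPdist_lt/(_ e e0) [M [_ HM]] := h_slow s.
  pose n := (Num.truncn `|M|).+1.
  have [k /= nk [_ /=]] := hs n I.
  rewrite ltNge => /negP; apply; apply: ltW.
  have : M < z k.
    apply: le_lt_trans (ler_norm _) _; apply: lt_le_trans (truncnS_gt _) _.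
    by apply: le_trans (zn k); rewrite ler_nat.
  by move/HM; rewrite sub0r normrN.
have fin : (lebesgue_measure (\bigcup_(k >= 0) bad e (z k)) < +oo)%E.
  apply: (@le_lt_trans _ _ (lebesgue_measure (`[0, 2]%classic : set R))).
    apply: le_measure; rewrite ?inE //; first by apply: bigcup_measurable => *; exact: mF.
    by move=> s [k _ []].
  by rewrite lebesgue_measure_itv /= lte_fin ltr0n -EFinB ltry.
have := lim_sup_set_cvg lebesgue_measure _ mF fin; rewrite lim0 measure0 => cv.
have h2 : (0 < 2^-1%:E :> \bar R)%E by rewrite lte_fin invr_gt0.
have oi : nbhs (0 : \bar R) [set x | (x < 2^-1%:E)%E].
  by apply: open_nbhs_nbhs; split => //; exact: open_ereal_lt_ereal.
have [N _ HN] := cv _ oi.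
exists N => // n /= Nn; apply: le_lt_trans (HN n Nn).
apply: le_measure; rewrite ?inE; [exact: mF| |by move=> s hs; exists n => /=].
by apply: bigcup_measurable => *; exact: mF.
Qed.

(** If convergence failed along x_n, y_n = x_n + t_n with 0 <= t_n <= 1, the set
    of s in [t_n, 2] at which x_n + s is far from x_n or from y_n in value would
    have measure less than 1, so some s would bring the two values together. *)
Lemma additive_uniform_convergence (e : R) : 0 < e ->
  exists x0 : R, forall x t, x0 <= x -> 0 <= t -> t <= 1 ->
    `|h (x + t) - h x| <= e.
Proof.
move=> e0; apply: contrapT => nex.
have {}nex n : exists xt : R * R, [/\ n%:R <= xt.1, 0 <= xt.2, xt.2 <= 1 &
    e < `|h (xt.1 + xt.2) - h xt.1|].
  apply: contrapT => H; apply: nex; exists n%:R => x t nx t0 t1.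
  by rewrite leNgt; apply/negP => lt; apply: H; exists (x, t).
pose xt n := projT1 (cid (nex n)).
have xtP n : [/\ n%:R <= (xt n).1, 0 <= (xt n).2, (xt n).2 <= 1 &
    e < `|h ((xt n).1 + (xt n).2) - h (xt n).1|] by exact: projT2 (cid (nex n)).
have e2 : 0 < e / 2 by rewrite divr_gt0.
have B1 : \forall n \near \oo,
    (lebesgue_measure (bad (e / 2) (xt n).1) < 2^-1%:E)%E.
  by apply: bad_measure_cvg => // n; have [] := xtP n.
have B2 : \forall n \near \oo,
    (lebesgue_measure (bad (e / 2) ((xt n).1 + (xt n).2)) < 2^-1%:E)%E.
  apply: bad_measure_cvg => // n; have [h1 h2 _ _] := xtP n.
  by apply: le_trans h1 _; rewrite lerDl.
have [N [H1 H2]] : exists n,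
    (lebesgue_measure (bad (e / 2) (xt n).1) < 2^-1%:E)%E /\
    (lebesgue_measure (bad (e / 2) ((xt n).1 + (xt n).2)) < 2^-1%:E)%E.
  near \oo => n; exists n; split; near: n; [exact: B1|exact: B2].
have [_ t0 t1 far] := xtP N.
move: (xt N).1 (xt N).2 t0 t1 far H1 H2 => x t t0 t1 far H1 H2.
have mb := measurable_bad (e / 2).
have msh : measurable ((fun s : R => s - t) @^-1` bad (e / 2) (x + t)).
  rewrite -[X in measurable X]setTI.
  have mf : measurable_fun [set: R] (fun s : R => s - t).
    by apply: measurable_funD => //; exact: measurable_cst.
  exact: mf.
have sub : `[t, 2]%classic `<=`
    bad (e / 2) x `|` (fun s : R => s - t) @^-1` bad (e / 2) (x + t).
  move=> s /=; rewrite in_itv /= => /andP[ts s2].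
  apply: contrapT => /not_orP[nb1 nb2].
  have h1 : `|h (x + s) - h x| <= e / 2.
    rewrite leNgt; apply/negP => lt; apply: nb1; split => //=.
    by rewrite in_itv /= (le_trans t0 ts) s2.
  have h2 : `|h (x + s) - h (x + t)| <= e / 2.
    rewrite leNgt; apply/negP => lt; apply: nb2; split => /=.
      by rewrite in_itv /= subr_ge0 ts; lra.
    by rewrite (_ : x + t + (s - t) = x + s) //; ring.
  have : `|h (x + t) - h x| <= e; last by rewrite leNgt far.
  rewrite (_ : h (x + t) - h x = (h (x + s) - h x) - (h (x + s) - h (x + t))); last by ring.
  by apply: le_trans (ler_normB _ _) _; lra.
have : (lebesgue_measure (`[t, 2%R]%classic : set R) < 1%:E)%E.
  apply: (@le_lt_trans _ _ (lebesgue_measure (bad (e / 2)%R x) +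
     lebesgue_measure ((fun s : R => (s - t)%R) @^-1` bad (e / 2)%R (x + t)%R))%E).
    have U2 : (lebesgue_measure (bad (e / 2)%R x `|`
          (fun s : R => (s - t)%R) @^-1` bad (e / 2)%R (x + t)%R) <=
        lebesgue_measure (bad (e / 2)%R x) +
        lebesgue_measure ((fun s : R => (s - t)%R) @^-1` bad (e / 2)%R (x + t)%R))%E.
      by apply: measureU2; [exact: mb|exact: msh].
    apply: le_trans U2.
    apply: le_measure; rewrite ?inE; [exact: measurable_itv| |exact: sub].
    by apply: measurableU; [exact: mb|exact: msh].
  rewrite lebesgue_measure_shift //.
  rewrite (_ : 1%:E = (2^-1%:E + 2^-1%:E)%E :> \bar R); first exact: lteD.
  by rewrite -EFinD; congr EFin; field.
rewrite lebesgue_measure_itv /= lte_fin.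
have t2 : t < 2 by lra.
by rewrite t2 -EFinB lte_fin; lra.
Unshelve. all: by end_near. Qed.

End uniform_convergence.

(** Karamata's uniform convergence theorem. *)
Lemma slowly_varying_uniform (R : realType) (L : R -> R) (e : R) :
  slowly_varying L -> 0 < e ->
  exists2 x0 : R, 0 < x0 & forall x y, x0 <= x -> x <= y -> y <= expR 1 * x ->
    `|ln (L y) - ln (L x)| <= e.
Proof.
move=> [L0 mL Lslow] e0.
pose h t := ln (L (expR t)).
have mh : measurable_fun [set: R] h.
  apply: measurableT_comp; first exact: measurable_ln.
  apply: (measurable_comp _ _ mL); [exact: measurable_itv| |exact: measurable_expR].
  by move=> _ [t _ <-] /=; rewrite in_itv /= andbT expR_gt0.
have hslow t : (fun x => h (x + t) - h x) @ +oo --> (0 : R).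
  apply/cvgrPdist_lt => d d0; rewrite /= .
  have c1 : ln (L (expR t * x) / L x) @[x --> +oo] --> ln (1 : R).
    apply: (@continuous_cvg _ _ _ _ _ _ (@ln R)); first exact: continuous_ln.
    by apply: Lslow; exact: expR_gt0.
  have /cvgrPdist_lt/(_ d d0) [M [_ HM]] := c1.
  exists (ln (Num.max M 1)); split; first exact: num_real.
  move=> x Mx.
  have Mex : M < expR x.
    apply: (@le_lt_trans _ _ (Num.max M 1)); first by rewrite le_max lexx.
    have m0 : 0 < Num.max M 1 by rewrite lt_max ltr01 orbT.
    by rewrite -[ltLHS]lnK ?posrE // ltr_expR.
  have := HM _ Mex; rewrite ln1 ln_div ?posrE ?L0 ?mulr_gt0 ?expR_gt0 //.
  by rewrite /h expRD mulrC.
have [x0 Hx0] := additive_uniform_convergence mh hslow e0.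
exists (expR x0); first exact: expR_gt0.
move=> x y x0x xy yx.
have xp : 0 < x by apply: lt_le_trans x0x; exact: expR_gt0.
have yp : 0 < y by apply: lt_le_trans xy.
have E : ln x + (ln y - ln x) = ln y by ring.
have := Hx0 (ln x) (ln y - ln x); rewrite /h E !lnK ?posrE //; apply.
- by rewrite -[x0]expRK ler_ln ?posrE ?expR_gt0.
- by rewrite subr_ge0 ler_ln ?posrE.
- rewrite lerBlDr -[X in _ <= X + _]expRK -lnM ?posrE ?expR_gt0 //.
  by rewrite ler_ln ?posrE ?mulr_gt0 ?expR_gt0.
Qed.

(** Potter's bounds, by chaining the uniform convergence theorem along factors
    exp 1. *)
Lemma slowly_varying_potter (R : realType) (L : R -> R) (e : R) :
  slowly_varying L -> 0 < e ->
  exists2 x0 : R, 0 < x0 & forall x y, x0 <= x -> x <= y ->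
    `|ln (L y) - ln (L x)| <= e * (1 + ln (y / x)).
Proof.
move=> Ls e0; have [x0 x00 H] := slowly_varying_uniform Ls e0.
exists x0 => // x y x0x xy.
have step k u : x0 <= u -> u <= y -> y <= expR k%:R * u ->
    `|ln (L y) - ln (L u)| <= e * k%:R.
  elim: k u => [|k IH] u x0u uy yk.
    rewrite expR0 mul1r in yk.
    have -> : y = u by apply/eqP; rewrite eq_le yk uy.
    by rewrite subrr normr0 mulr0.
  have [yu|uy'] := leP y (expR 1 * u).
    apply: le_trans (H u y x0u uy yu) _.
    by rewrite ler_peMr ?(ltW e0) // ler1n.
  have u0 : 0 <= u by apply: le_trans x0u; exact: ltW.
  have uu : u <= expR 1 * u.
    by rewrite ler_peMl // -[leLHS]expR0 ler_expR.
  rewrite -(subrK (ln (L (expR 1 * u))) (ln (L y))) -addrA.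
  apply: le_trans (ler_normD _ _) _; rewrite -natr1 mulrDr mulr1; apply: lerD.
    apply: IH; [exact: le_trans x0u uu|exact: ltW|].
    by rewrite mulrA -expRD natr1.
  exact: H.
have xp : 0 < x by apply: lt_le_trans x0x.
have yp : 0 < y by apply: lt_le_trans xy.
have z0 : 0 <= ln (y / x) by rewrite ln_ge0 // ler_pdivlMr // mul1r.
have /andP[h1 h2] := truncn_itv z0.
have h3 : y <= expR (Num.truncn (ln (y / x))).+1%:R * x.
  rewrite -ler_pdivrMr // -[leLHS]lnK ?posrE ?divr_gt0 // ler_expR.
  exact: ltW.
apply: le_trans (step _ x x0x xy h3) _; rewrite ler_wpM2l ?(ltW e0) //.
by rewrite -natr1 addrC lerD2l.
Qed.

(** * Regularly varying sequences *)

Definition regular_seq (R : realType) (q : nat -> R) (L : R -> R) (c b : R) :=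
  [/\ 0 < c, slowly_varying L &
    forall k, (0 < k)%N -> q k = c * L k%:R * k%:R `^ (- b)].

Section regular_sequences.
Context {R : realType}.
Implicit Types (q p : nat -> R) (L : R -> R).

Lemma regular_gt0 q L c b k : regular_seq q L c b -> (0 < k)%N -> 0 < q k.
Proof.
move=> [c0 [L0 _ _] qE] k0; rewrite qE // !mulr_gt0 ?powR_gt0 ?L0 ?ltr0n //.
Qed.

(** Potter's bounds in logarithmic form: up to a small slope and a small constant,
    ln q is - b ln. *)
Lemma regular_log q L c b (e : R) : regular_seq q L c b -> 0 < e ->
  exists2 N, (0 < N)%N & forall k m, (N <= k)%N -> (N <= m)%N ->
    `|ln (q k) - ln (q m) + b * (ln k%:R - ln m%:R)| <=
      e * (1 + `|ln k%:R - ln m%:R|).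
Proof.
move=> [c0 Ls qE] e0; have [L0 _ _] := Ls.
have [x0 x00 H] := slowly_varying_potter Ls e0.
exists (Num.truncn x0).+1 => // k m.
wlog km : k m / (k <= m)%N.
  move=> Hw; have [km|mk] := leqP k m; first exact: Hw.
  move=> hk hm; have := Hw m k (ltnW mk) hm hk; rewrite (distrC (ln m%:R) (ln k%:R)).
  have -> : ln (q m) - ln (q k) + b * (ln m%:R - ln k%:R) =
    - (ln (q k) - ln (q m) + b * (ln k%:R - ln m%:R)) by ring.
  by rewrite normrN.
move=> hk hm; have k0 : (0 < k)%N by apply: leq_trans hk.
have m0 : (0 < m)%N by apply: leq_trans hm.
have kR : 0 < k%:R :> R by rewrite ltr0n.
have mR : 0 < m%:R :> R by rewrite ltr0n.
have lnq i : (0 < i)%N -> ln (q i) = ln c + ln (L i%:R) - b * ln i%:R.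
  move=> i0; have iR : 0 < i%:R :> R by rewrite ltr0n.
  by rewrite qE // !lnM ?posrE ?mulr_gt0 ?powR_gt0 ?L0 // ln_powR mulNr.
rewrite !lnq //.
have x0k : x0 <= k%:R.
  by apply: ltW; apply: lt_le_trans (truncnS_gt _) _; rewrite ler_nat.
have := H k%:R m%:R x0k; rewrite ler_nat => /(_ km).
rewrite ln_div ?posrE //.
have lnkm : ln k%:R <= ln m%:R :> R by rewrite ler_ln ?posrE // ler_nat.
rewrite [`|ln k%:R - _|]distrC (ger0_norm (_ : 0 <= ln m%:R - ln k%:R)) ?subr_ge0 //.
by rewrite distrC; congr (`|_| <= _); ring.
Qed.

Lemma finite_positive_bounds q N : (forall k, (0 < k)%N -> 0 < q k) ->
  exists2 C : R, 0 < C & forall k, (0 < k)%N -> (k < N)%N -> q k <= C /\ C^-1 <= q k.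
Proof.
move=> q0; elim: N => [|N [C C0 IH]]; first by exists 1.
exists (Num.max C (Num.max (q N) (q N)^-1)); first by rewrite lt_max C0.
move=> k k0; rewrite ltnS leq_eqVlt => /predU1P[kN|kN]; last first.
  have [h1 h2] := IH k k0 kN; split; first by rewrite le_max h1.
  apply: le_trans h2; rewrite lef_pV2 ?posrE ?lt_max ?C0 //.
  by rewrite le_max lexx.
have [N0|N0] := posnP N.
  by move: k0; rewrite kN N0.
have qN := q0 N N0; rewrite kN; split; first by rewrite !le_max lexx !orbT.
rewrite -[leRHS]invrK lef_pV2 ?posrE ?invr_gt0 ?lt_max ?C0 //.
by rewrite !le_max lexx !orbT.
Qed.

Lemma regular_poly q L c b (e : R) : regular_seq q L c b -> 0 < e ->
  exists2 C : R, 0 < C & forall k, (0 < k)%N ->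
    q k <= C * k%:R `^ (- b + e) /\ C^-1 * k%:R `^ (- b - e) <= q k.
Proof.
move=> rq e0; have [N N0 H] := regular_log rq e0.
have q0 k (k0 : (0 < k)%N) := regular_gt0 rq k0.
pose A k := q k * k%:R `^ b.
have A0 k : (0 < k)%N -> 0 < A k by move=> k0; rewrite mulr_gt0 ?q0 // powR_gt0 // ltr0n.
have [C1 C10 HC1] := finite_positive_bounds N A0.
have NR : 0 < N%:R :> R by rewrite ltr0n.
pose C2 := expR (`|ln (q N) + b * ln N%:R| + e).
have C20 : 0 < C2 by exact: expR_gt0.
exists (C1 + C2); first exact: addr_gt0.
move=> k k0; have kR : 0 < k%:R :> R by rewrite ltr0n.
have lnk : 0 <= ln k%:R :> R by rewrite ln_ge0 // ler1n.
have pb : k%:R `^ (- b) * k%:R `^ b = 1 :> R by rewrite !powR_expR // -expRD mulNr addNr expR0.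
have pe : 1 <= k%:R `^ e :> R by rewrite powR_expR // -[leLHS]expR0 ler_expR mulr_ge0 // ltW.
have pme : k%:R `^ (- e) <= 1 :> R.
  by rewrite powR_expR // -[leRHS]expR0 ler_expR mulNr oppr_le0 mulr_ge0 // ltW.
have split1 : k%:R `^ (- b + e) = k%:R `^ (- b) * k%:R `^ e :> R.
  by rewrite !powR_expR // -expRD -mulrDl.
have split2 : k%:R `^ (- b - e) = k%:R `^ (- b) * k%:R `^ (- e) :> R.
  by rewrite !powR_expR // -expRD -mulrDl.
have qA : q k = A k * k%:R `^ (- b) by rewrite /A -mulrA [_ `^ b * _]mulrC pb mulr1.
suff [h1 h2] : A k <= (C1 + C2) * k%:R `^ e /\ (C1 + C2)^-1 * k%:R `^ (- e) <= A k.
  have b0 : 0 <= k%:R `^ (- b) :> R by exact: powR_ge0.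
  rewrite qA split1 split2; split.
    by rewrite [_ * (_ * _)]mulrCA [leLHS]mulrC; apply: ler_wpM2l.
  by rewrite mulrCA [leRHS]mulrC; apply: ler_wpM2l.
have Cinv C' : 0 < C' -> C' <= C1 + C2 -> (C1 + C2)^-1 <= C'^-1.
  by move=> C'0 hC; rewrite lef_pV2 ?posrE // addr_gt0.
have [kN|Nk] := ltnP k N.
  have [h1 h2] := HC1 k k0 kN; split.
    apply: le_trans h1 _; apply: (@le_trans _ _ (C1 * k%:R `^ e)).
      by rewrite ler_peMr // ltW.
    by rewrite ler_wpM2r ?powR_ge0 // lerDl ltW.
  apply: le_trans h2; apply: (@le_trans _ _ (C1^-1 * k%:R `^ (- e))).
    by rewrite ler_wpM2r ?powR_ge0 // Cinv // lerDl ltW.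
  by rewrite ler_piMr // invr_ge0 ltW.
have := H k N Nk (leqnn N).
have lnkN : ln N%:R <= ln k%:R :> R by rewrite ler_ln ?posrE // ler_nat.
rewrite (ger0_norm (_ : 0 <= ln k%:R - ln N%:R)) ?subr_ge0 //.
have lnN : 0 <= ln N%:R :> R by rewrite ln_ge0 // ler1n.
have AE : A k = expR (ln (q k) + b * ln k%:R).
  by rewrite expRD lnK ?posrE ?q0 // /A powR_expR.
have eN : 0 <= e * ln N%:R by rewrite mulr_ge0 // ltW.
have ek : e * (1 + (ln k%:R - ln N%:R)) <= e + e * ln k%:R by lra.
rewrite ler_norml => /andP[g1 g2].
have := ler_norm (ln (q N) + b * ln N%:R); have := ler_norm (- (ln (q N) + b * ln N%:R)).
rewrite normrN => n1 n2; split.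
  apply: (@le_trans _ _ (C2 * k%:R `^ e)); last first.
    by rewrite ler_wpM2r ?powR_ge0 // lerDr ltW.
  by rewrite AE /C2 powR_expR // -expRD ler_expR; lra.
apply: (@le_trans _ _ (C2^-1 * k%:R `^ (- e))).
  by rewrite ler_wpM2r ?powR_ge0 // Cinv // lerDr ltW.
by rewrite AE /C2 -expRN powR_expR // -expRD ler_expR; lra.
Qed.

Lemma ratio_of_logs (x y d : R) : 0 < x -> 0 < y -> ln x - ln y <= d ->
  x <= expR d * y.
Proof.
move=> x0 y0 h; rewrite -[leLHS]lnK ?posrE // -[X in _ <= _ * X]lnK ?posrE // -expRD.
by rewrite ler_expR -lerBlDr.
Qed.

Lemma ln_le_sub1 (z : R) : 0 < z -> ln z <= z - 1.
Proof.
move=> z0; have E : 1 + (z - 1) = z by ring.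
by have := @le_ln1Dx R (z - 1); rewrite E; apply; lra.
Qed.

Lemma log_near (x y kap : R) : 0 < x -> 0 < y -> kap <= 1 / 2 ->
  `|x - y| <= kap * y -> `|ln x - ln y| <= 2 * kap.
Proof.
move=> x0 y0 k1; rewrite ler_norml => /andP[h1 h2].
have hx : x / y - 1 <= kap by rewrite lerBlDr ler_pdivrMr //; lra.
have k0 : 0 <= kap.
  have : 0 <= kap * y by lra.
  by rewrite pmulr_lge0.
have l1 : ln x - ln y <= kap.
  rewrite -ln_div ?posrE //; apply: le_trans hx.
  by apply: ln_le_sub1; exact: divr_gt0.
have xy2 : y / 2 <= x by nra.
have l2 : ln y - ln x <= 2 * kap.
  rewrite -ln_div ?posrE //; apply: le_trans (ln_le_sub1 (divr_gt0 y0 x0)) _.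
  rewrite lerBlDr ler_pdivrMr //; nra.
rewrite ler_norml; lra.
Qed.

(** Potter's bounds on logarithms. For neighbouring terms the error e (1 + ...) is
    dominated by the constant e, for comparable terms it is bounded by a function
    of the ratio. *)
Lemma regular_smooth q L c b : 0 < b -> regular_seq q L c b -> smooth_weights q.
Proof.
move=> b0 rq; have q0 k (k0 : (0 < k)%N) := regular_gt0 rq k0.
split=> [//|||].
- have [C C0 H] := regular_poly rq b0.
  exists (b + b), C; split; rewrite ?addr_gt0 // => k k0.
  have [h1 h2] := H k k0; split; last by rewrite opprD.
  by apply: le_trans h1 _; rewrite addNr powRr0 mulr1.
- move=> e e0; pose d := ln (1 + e).
  have d0 : 0 < d by rewrite ln_gt0 // ltrDl.
  pose e' := Num.min 1 (d / 4).
  have e'0 : 0 < e' by rewrite lt_min ltr01 divr_gt0.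
  have e'1 : e' <= 1 by rewrite ge_min lexx.
  have e'd : e' <= d / 4 by rewrite ge_min lexx orbT.
  have [N N0 H] := regular_log rq e'0.
  pose kap := Num.min (1 / 2) (d / (4 * (b + 1))).
  have kap0 : 0 < kap by rewrite lt_min !divr_gt0 // mulr_gt0 // addr_gt0.
  have kap2 : kap <= 1 / 2 by rewrite ge_min lexx.
  have kapd : 2 * (b + 1) * kap <= d / 2.
    have h : kap <= d / (4 * (b + 1)) by rewrite ge_min lexx orbT.
    have b1 : 0 < b + 1 by lra.
    have := ler_wpM2l (ltW (mulr_gt0 (ltr0n _ 2) b1)) h.
    rewrite (_ : 2%:R * (b + 1) * (d / (4 * (b + 1))) = d / 2) //.
    by field; rewrite gt_eqF.
  exists kap => //; exists N => k m Nk Nm km.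
  have k0 : (0 < k)%N by apply: leq_trans Nk.
  have m0 : (0 < m)%N by apply: leq_trans Nm.
  have kR : 0 < k%:R :> R by rewrite ltr0n.
  have mR : 0 < m%:R :> R by rewrite ltr0n.
  have lkm := log_near kR mR kap2 km.
  have := H k m Nk Nm; set D := ln k%:R - ln m%:R in lkm *.
  have bD : `|b * D| <= b * (2 * kap).
    by rewrite normrM (gtr0_norm b0) ler_wpM2l // ltW.
  have eD : e' * (1 + `|D|) <= d / 4 + 2 * kap.
    rewrite mulrDr mulr1; apply: lerD => //.
    apply: le_trans lkm; rewrite ler_piMl //.
  move=> hk.
  have hd : `|ln (q k) - ln (q m)| <= d.
    rewrite -(addrK (b * D) (ln (q k) - ln (q m))).
    by apply: le_trans (ler_normB _ _) _; lra.
  have qk := q0 k k0; have qm := q0 m m0.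
  move: hd; rewrite ler_norml => /andP[d1 d2].
  have r1 := ratio_of_logs qk qm d2.
  have d1' : ln (q m) - ln (q k) <= d by lra.
  have r2 := ratio_of_logs qm qk d1'.
  have ed : expR d = 1 + e by rewrite /d lnK ?posrE // addr_gt0.
  rewrite ed in r1 r2; rewrite ler_norml; apply/andP; split; last by lra.
  have : e * q k <= e * ((1 + e) * q m) by rewrite ler_wpM2l ?(ltW e0).
  have [km'|mk'] := leP (q m) (q k); first by have := mulr_gt0 e0 qm; lra.
  have : e * q k <= e * q m by rewrite ler_wpM2l ?(ltW e0) // ltW.
  lra.
- move=> K K0; have [N N0 H] := regular_log rq ltr01.
  exists (expR ((b + 1) * `|ln K| + 1)); first exact: expR_gt0.
  exists N => k m Nk Nm kK mK.
  have k0 : (0 < k)%N by apply: leq_trans Nk.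
  have m0 : (0 < m)%N by apply: leq_trans Nm.
  have kR : 0 < k%:R :> R by rewrite ltr0n.
  have mR : 0 < m%:R :> R by rewrite ltr0n.
  apply: ratio_of_logs; [exact: q0|exact: q0|].
  have := H k m Nk Nm; set D := ln k%:R - ln m%:R.
  have h1 : D <= ln K by rewrite lerBlDr -lnM ?posrE // ler_ln ?posrE ?mulr_gt0.
  have h2 : - D <= ln K by rewrite opprB lerBlDr -lnM ?posrE // ler_ln ?posrE ?mulr_gt0.
  have hD : `|D| <= `|ln K|.
    by rewrite ler_norml; have := ler_norm (ln K); lra.
  have bD : `|b * D| <= b * `|ln K| by rewrite normrM (gtr0_norm b0) ler_wpM2l // ltW.
  rewrite mul1r; move: bD; rewrite !ler_norml => /andP[? ?] /andP[? ?]; lra.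
Qed.

(** Comparison with the telescoping sum of k ^ (- e). *)
Lemma powR_sum_bounds (e : R) k : 0 < e -> (0 < k)%N ->
  e * k.+1%:R `^ (- 1 - e) <= k%:R `^ (- e) - k.+1%:R `^ (- e) <=
  e * k%:R `^ (- 1 - e).
Proof.
move=> e0 k0.
have kR : 0 < k%:R :> R by rewrite ltr0n.
have k1R : 0 < k.+1%:R :> R by rewrite ltr0n.
have sp (x : R) : 0 < x -> x `^ (- 1 - e) = x^-1 * x `^ (- e).
  by move=> x0; rewrite !powR_expR // mulrBl mulN1r expRD expRN lnK ?posrE // mulNr.
have lt : k%:R < k.+1%:R :> R by rewrite ltr_nat.
have k1E : k.+1%:R = k%:R + 1 :> R by rewrite natr1.
rewrite !sp //; apply/andP; split.
  have h : 1 + e * k.+1%:R^-1 <= k%:R `^ (- e) / k.+1%:R `^ (- e).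
    rewrite !powR_expR // -expRN -expRD; apply: le_trans (expR_ge1Dx _).
    rewrite lerD2l (_ : - e * ln k%:R + - (- e * ln k.+1%:R) = e * - (ln k%:R - ln k.+1%:R)); last by ring.
    apply: ler_wpM2l; first exact: ltW.
    rewrite lerNr -ln_div ?posrE //; apply: le_trans (ln_le_sub1 (divr_gt0 kR k1R)) _.
    rewrite le_eqVlt; apply/orP; left; apply/eqP; rewrite k1E; field.
    by rewrite -k1E gt_eqF.
  rewrite ler_pdivlMr ?powR_gt0 // in h; move: h.
  move: (k%:R `^ (- e)) (k.+1%:R `^ (- e)) (k.+1%:R^-1) => B A V; clear; lra.
have h : 1 - e * k%:R^-1 <= k.+1%:R `^ (- e) / k%:R `^ (- e).
  rewrite !powR_expR // -expRN -expRD; apply: le_trans (expR_ge1Dx _).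
  rewrite lerD2l (_ : - e * ln k.+1%:R + - (- e * ln k%:R) = - (e * (ln k.+1%:R - ln k%:R))); last by ring.
  rewrite lerN2; apply: ler_wpM2l; first exact: ltW.
  rewrite -ln_div ?posrE //; apply: le_trans (ln_le_sub1 (divr_gt0 k1R kR)) _.
  by rewrite le_eqVlt; apply/orP; left; apply/eqP; rewrite k1E; field; rewrite gt_eqF.
rewrite ler_pdivlMr ?powR_gt0 // in h; move: h.
move: (k%:R `^ (- e)) (k.+1%:R `^ (- e)) (k%:R^-1) => B A V; clear; lra.
Qed.

Lemma powR_series_le (e : R) n : 0 < e ->
  \sum_(1 <= k < n) k%:R `^ (- 1 - e) <= 1 + e^-1.
Proof.
move=> e0; case: n => [|[|n]].
- by rewrite big_geq // addr_ge0 // invr_ge0 ltW.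
- by rewrite big_geq // addr_ge0 // invr_ge0 ltW.
have : \sum_(1 <= k < n.+2) k%:R `^ (- 1 - e) <= 1 + e^-1 * (1 - n.+1%:R `^ (- e)).
  elim: n => [|n IH]; first by rewrite big_nat1 !powR1 subrr mulr0 addr0.
  rewrite big_nat_recr //=.
  have /andP[h _] := powR_sum_bounds e0 (ltn0Sn n).
  rewrite -ler_pdivlMl // in h; lra.
move=> h; apply: le_trans h _; by rewrite lerD2l ler_piMr ?invr_ge0 ?(ltW e0) // gerBl powR_ge0.
Qed.

End regular_sequences.

(** * Step laws and the single big jump *)

Lemma powRDl (R : realType) (x a b : R) : 0 < x -> x `^ (a + b) = x `^ a * x `^ b.
Proof. by move=> x0; rewrite !powR_expR // mulrDl expRD. Qed.

Lemma powR_nat_le (R : realType) (k m : nat) (a : R) : 0 <= a -> (k <= m)%N ->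
  k%:R `^ a <= m%:R `^ a :> R.
Proof. by move=> a0 km; apply: ge0_ler_powR; rewrite ?nnegrE ?ler_nat. Qed.

Lemma powRN_nat_le (R : realType) (x y a : R) : 0 <= a -> 0 < x -> x <= y ->
  y `^ (- a) <= x `^ (- a).
Proof.
move=> a0 x0 xy; have y0 := lt_le_trans x0 xy.
rewrite !powR_expR // ler_expR !mulNr lerN2 ler_wpM2l // ler_ln ?posrE //.
Qed.

(** The decay of p beyond the exponent 2 leaves room for a moment of order
    1 + e / 2. *)
Lemma step_law_of_bound (R : realType) (p : nat -> R) (C e : R) :
  (forall l, 0 <= p l) -> series p @ \oo --> (1 : R) -> 0 < e ->
  (forall l, (0 < l)%N -> p l <= C * l%:R `^ (- 2 - e)) ->
  (exists2 l, (0 < l)%N & 0 < p l) ->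
  (forall d, (forall l, 0 < p l -> (d %| l)%N) -> (d %| 1)%N) ->
  step_law p (limn (series (fun l => l%:R * p l))).
Proof.
move=> p0 psum e0 pC [l0 l00 pl0] aper.
have C0 : 0 <= C.
  have l0R : 0 < l0%:R :> R by rewrite ltr0n.
  have := lt_le_trans pl0 (pC l0 l00).
  by rewrite pmulr_lgt0 ?powR_gt0 // => /ltW.
have bound (r : R) n : 0 <= r -> r <= e / 2 ->
    \sum_(l < n) l%:R `^ (1 + r) * p l <= C * (1 + (e / 2)^-1).
  move=> r0 r1; case: n => [|n].
    by rewrite big_ord0 mulr_ge0 // addr_ge0 // invr_ge0 divr_ge0 // ltW.
  rewrite -(big_mkord xpredT (fun l => l%:R `^ (1 + r) * p l)) big_ltn //.
  rewrite powR0 ?mul0r ?add0r; last by rewrite gt_eqF //; lra.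
  have e2 : 0 < e / 2 by lra.
  apply: le_trans (ler_wpM2l C0 (powR_series_le n.+1 e2)).
  rewrite mulr_sumr !big_nat; apply: ler_sum => l /andP[l1 _].
  have lR : 0 < l%:R :> R by rewrite ltr0n.
  apply: (le_trans (ler_wpM2l (powR_ge0 _ _) (pC l l1))).
  rewrite mulrCA; apply: ler_wpM2l => //; rewrite -powRDl //.
  by apply: ler_powR; [rewrite ler1n | lra].
have cv : cvgn (series (fun l => l%:R * p l)).
  apply: nondecreasing_is_cvgn.
    by apply: nondecreasing_series => k _ _; exact: mulr_ge0.
  exists (C * (1 + (e / 2)^-1)) => _ [n _ <-].
  rewrite /series /= big_mkord; apply: le_trans (bound 0 n (lexx _) _); last by lra.
  by apply: ler_sum => l _; rewrite addr0 powRr1.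
split=> //.
- apply: (@lt_le_trans _ _ (series (fun l => l%:R * p l) l0.+1)); last first.
    apply: nondecreasing_cvgn_le => //.
    by apply: nondecreasing_series => k _ _; exact: mulr_ge0.
  rewrite /series /= big_nat_recr //= ltr_wpDl ?mulr_gt0 ?ltr0n //.
  by rewrite sumr_ge0 // => k _; exact: mulr_ge0.
- have := sum_law_le1 p0 psum l0.+1; rewrite big_ord_recl /=.
  have : p l0 <= \sum_(i < l0) p (bump 0 i).
    case: l0 l00 pl0 => // l0 _ _; rewrite big_ord_recr /= /bump /= add1n lerDr.
    exact: sumr_ge0.
  lra.
- exists (Num.min 1 (e / 2)); first by rewrite lt_min ltr01 divr_gt0 // ge_min lexx.
  exists (C * (1 + (e / 2)^-1)) => n; apply: bound; last by rewrite ge_min lexx orbT.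
  by rewrite le_min ler01 divr_ge0 // ltW.
Qed.

Lemma exponential_rapid (R : realType) (p : nat -> R) (A c B : R) :
  0 < c -> 0 < A -> 0 < B -> (forall l, p l <= A * expR (- (c * l%:R))) ->
  exists2 C : R, 0 < C & forall l, (0 < l)%N -> p l <= C * l%:R `^ (- B).
Proof.
move=> c0 A0 B0 pA; have a0 : 0 < c / B by rewrite divr_gt0.
exists (A * expR (- (B * ln (c / B)))); first by rewrite mulr_gt0 ?expR_gt0.
move=> l l0; have lR : 0 < l%:R :> R by rewrite ltr0n.
apply: le_trans (pA l) _; rewrite -mulrA; apply: ler_wpM2l; first exact: ltW.
rewrite powR_expR // -expRD ler_expR.
have := ln_sublinear (mulr_gt0 a0 lR); rewrite (@lnM _ (c / B) l%:R) ?posrE // => /ltW.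
move=> /(ler_wpM2l (ltW B0)).
by rewrite (_ : B * (c / B * l%:R) = c * l%:R); [lra | field; rewrite gt_eqF].
Qed.

(** The sum over k is at most of order n^2 and q n decays polynomially, so a
    sufficiently high power of 1 / n for p wins. *)
Lemma negligible_rapid (R : realType) (p q : nat -> R) (L : R -> R) (c b : R) :
  (forall l, 0 <= p l) ->
  (forall B : R, 0 < B -> exists2 C : R, 0 < C &
    forall l, (0 < l)%N -> p l <= C * l%:R `^ (- B)) ->
  0 < b -> regular_seq q L c b -> negligible_jumps p q.
Proof.
move=> p0 rapid b0 rq K delta e delta0 e0.
have [Cq Cq0 Hq] := regular_poly rq b0.
have B0 : 0 < b + b + 3 by lra.
have [C C0 HC] := rapid _ B0.
pose D := C * delta `^ (- (b + b + 3)) * K%:R ^+ 2 * Cq.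
have D0 : 0 <= D by rewrite /D !mulr_ge0 ?powR_ge0 ?sqr_ge0 // ltW.
have e1 : 0 < e / Cq / (D + 1) by rewrite divr_gt0 ?divr_gt0 // ltr_wpDl.
near=> n => l ln l_n.
have n1 : 1 <= n%:R :> R by near: n; exact: nat_large.
have n0 : 0 < n%:R :> R by lra.
have nV : n%:R `^ (- 1) <= e / Cq / (D + 1) by near: n; exact: powRN_near0.
have dn0 : 0 < delta * n%:R by rewrite mulr_gt0.
have lR : 0 < l%:R :> R by exact: lt_trans ln.
have l0 : (0 < l)%N by rewrite -(ltr0n R).
have pl : p l <= C * (delta `^ (- (b + b + 3)) * n%:R `^ (- (b + b + 3))).
  apply: le_trans (HC l l0) _; apply: ler_wpM2l; first exact: ltW.
  rewrite -powRM ?(ltW delta0) //.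
  by apply: powRN_nat_le; [exact: ltW| |exact: ltW].
have Sle : \sum_(1 <= k < K * n) k%:R * q k <= K%:R ^+ 2 * n%:R ^+ 2 * Cq.
  apply: (@le_trans _ _ (\sum_(1 <= k < K * n) (K * n)%:R * Cq)).
    rewrite !big_nat; apply: ler_sum => k /andP[k1 kn].
    have [h _] := Hq k k1; rewrite addNr powRr0 mulr1 in h.
    apply: ler_pM => //; first exact: ltW (regular_gt0 rq k1).
    by rewrite ler_nat ltnW.
  rewrite sumr_const_nat -(mulr_natl (_ * Cq)) mulrA; apply: ler_wpM2r; first exact: ltW.
  rewrite -exprMn expr2 -[K%:R * n%:R]natrM; apply: ler_wpM2r => //.
  by rewrite ler_nat leq_subr.
have S0 : 0 <= \sum_(1 <= k < K * n) k%:R * q k.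
  rewrite big_nat sumr_ge0 // => k /andP[k1 _].
  by rewrite mulr_ge0 // ltW // (regular_gt0 rq).
apply: (le_trans (ler_pM (p0 l) S0 pl Sle)).
have n00 : (0 < n)%N by rewrite -(ltr0n R).
have [_ qn] := Hq n n00.
apply: le_trans (ler_wpM2l (ltW e0) qn).
have -> : n%:R `^ (- (b + b + 3)) = n%:R `^ (- b - b) * (n%:R `^ (- 1) * (n%:R `^ (- 1) * n%:R `^ (- 1))).
  by rewrite -!powRDl //; congr (_ `^ _); ring.
have nn : n%:R * n%:R `^ (- 1) = 1 :> R by rewrite powR_inv1 ?(ltW n0) // divff // gt_eqF.
rewrite [leLHS](_ : _ = D * (n%:R * n%:R `^ (- 1)) ^+ 2 * n%:R `^ (- 1) * n%:R `^ (- b - b)); last first.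
  by rewrite /D; ring.
rewrite nn expr1n mulr1 mulrA; apply: ler_wpM2r; first exact: powR_ge0.
apply: (le_trans (ler_wpM2l D0 nV)); rewrite mulrA ler_pdivrMr ?ltr_wpDl //.
rewrite mulrC; apply: ler_wpM2l; first by rewrite divr_ge0 // ltW.
by rewrite lerDl.
Unshelve. all: by end_near. Qed.

(** All p l with l between delta n and n are comparable to p n. If b > 2 the sum
    of k q k converges, and p n = o(q n) is what the comparison of p with q
    says. If b <= 2 the sum is at most of order n^(2 - b), up to an arbitrarily
    small power of n, and multiplied by p n it is o(q n) because a > 2. *)
Lemma negligible_regular (R : realType) (p q : nat -> R) (Lp Lq : R -> R)
    (cp cq a b : R) :
  regular_seq p Lp cp a -> regular_seq q Lq cq b -> 2 < a -> 1 < b ->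
  b < a \/ b = a /\ (forall e : R, 0 < e -> \forall n \near \oo,
    Lp n%:R <= e * Lq n%:R) ->
  negligible_jumps p q.
Proof.
move=> rp rq a2 b1 hab K delta e delta0 e0.
have a0 : 0 < a by lra.
have K0 : 0 < 1 + delta^-1 by rewrite addr_gt0 // invr_gt0.
have [C1 C10 [N1 H1]] := weight_ratio (regular_smooth a0 rp) K0.
suff key (e' : R) : 0 < e' ->
    \forall n \near \oo, p n * (\sum_(1 <= k < K * n) k%:R * q k) <= e' * q n.
  have e1 : 0 < e / C1 by rewrite divr_gt0.
  have key1 := key _ e1.
  near=> n => l ln l_n.
  have nN : N1.+1%:R <= n%:R :> R by near: n; exact: nat_large.
  have nN2 : N1%:R / delta <= n%:R by near: n; exact: nat_large.
  have lN : (N1 <= l)%N.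
    rewrite -(ler_nat R); apply: ltW; apply: le_lt_trans ln.
    by rewrite mulrC -ler_pdivrMr.
  have pl : p l <= C1 * p n.
    apply: H1 => //; first by rewrite -(ler_nat R); apply: le_trans nN; rewrite ler_nat.
      apply: (@le_trans _ _ n%:R); first by rewrite ler_nat.
      by rewrite ler_peMl // lerDl invr_ge0 ltW.
    rewrite mulrDl mul1r; apply: (@le_trans _ _ (delta^-1 * l%:R)).
      by rewrite ler_pdivlMl // ltW.
    by rewrite lerDr.
  have S0 : 0 <= \sum_(1 <= k < K * n) k%:R * q k.
    rewrite big_nat sumr_ge0 // => k /andP[k1 _].
    by rewrite mulr_ge0 // ltW // (regular_gt0 rq).
  apply: (le_trans (ler_wpM2r S0 pl)); rewrite -mulrA.
  rewrite -ler_pdivlMl // mulrA [C1^-1 * e]mulrC; near: n; exact: key1.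
move=> e'0; have [b2|b2] := ltP 2 b.
- pose d := (b - 2) / 2; have d0 : 0 < d by rewrite /d; lra.
  have [Cq Cq0 Hq] := regular_poly rq d0.
  pose S0 := Cq * (1 + d^-1).
  have S00 : 0 < S0 by rewrite mulr_gt0 // addr_gt0 // invr_gt0.
  have SS n : \sum_(1 <= k < K * n) k%:R * q k <= S0.
    apply: le_trans (ler_wpM2l (ltW Cq0) (powR_series_le (K * n) d0)).
    rewrite mulr_sumr !big_nat; apply: ler_sum => k /andP[k1 _].
    have kR : 0 < k%:R :> R by rewrite ltr0n.
    have [h _] := Hq k k1; apply: (le_trans (ler_wpM2l _ h)) => //.
    rewrite mulrCA -{1}[k%:R]powRr1 // -powRDl //.
    by rewrite (_ : 1 + (- b + d) = - 1 - d) //; rewrite /d; field.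
  suff pq : \forall n \near \oo, p n <= e' / S0 * q n.
    near=> n.
    have n0 : (0 < n)%N by near: n; exact: nbhs_infty_ge.
    apply: (le_trans (ler_wpM2l (ltW (regular_gt0 rp n0)) (SS n))).
    rewrite -ler_pdivlMr // mulrAC; near: n; exact: pq.
  have e2 : 0 < e' / S0 by rewrite divr_gt0.
  case: hab => [ba|[ba LL]].
    pose f := (a - b) / 4; have f0 : 0 < f by rewrite /f; lra.
    have [Cp Cp0 Hp] := regular_poly rp f0.
    have [Cq' Cq'0 Hq'] := regular_poly rq f0.
    have f2 : 0 < (a - b) / 2 by lra.
    have e3 : 0 < e' / S0 / (Cp * Cq') by rewrite divr_gt0 // mulr_gt0.
    near=> n.
    have n0 : (0 < n)%N by near: n; exact: nbhs_infty_ge.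
    have nR : 0 < n%:R :> R by rewrite ltr0n.
    have [hp _] := Hp n n0; have [_ hq] := Hq' n n0.
    have nf : n%:R `^ (- ((a - b) / 2)) <= e' / S0 / (Cp * Cq').
      by near: n; exact: powRN_near0.
    apply: le_trans hp _; apply: le_trans (ler_wpM2l (ltW e2) hq).
    have -> : n%:R `^ (- a + f) = n%:R `^ (- ((a - b) / 2)) * n%:R `^ (- b - f).
      by rewrite -powRDl //; congr (_ `^ _); rewrite /f; field.
    rewrite !mulrA; apply: ler_wpM2r; first exact: powR_ge0.
    apply: (le_trans (ler_wpM2l (ltW Cp0) nf)).
    by rewrite le_eqVlt; apply/orP; left; apply/eqP; field; rewrite !gt_eqF.
  have [cp0 _ pE] := rp; have [cq0 _ qE] := rq.
  have e4 : 0 < e' / S0 * cq / cp by rewrite divr_gt0 // mulr_gt0.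
  have LLe := LL _ e4.
  near=> n.
  have n0 : (0 < n)%N by near: n; exact: nbhs_infty_ge.
  rewrite pE // qE // ba mulrA; apply: ler_wpM2r; first exact: powR_ge0.
  have h : Lp n%:R <= e' / S0 * cq / cp * Lq n%:R by near: n; exact: LLe.
  apply: (le_trans (ler_wpM2l (ltW cp0) h)).
  by rewrite le_eqVlt; apply/orP; left; apply/eqP; field; rewrite !gt_eqF.
have ba : b < a by lra.
pose d := (a - 2) / 8; have d0 : 0 < d by rewrite /d; lra.
have [Cq Cq0 Hq] := regular_poly rq d0.
have [Cp Cp0 Hp] := regular_poly rp d0.
pose r := 2 - b + 2 * d; have r0 : 0 <= r by rewrite /r; lra.
pose S0 := Cq * (1 + d^-1) * K%:R `^ r.
have S00 : 0 <= S0.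
  by rewrite !mulr_ge0 ?powR_ge0 ?addr_ge0 ?invr_ge0 // ltW.
have SS n : (0 < n)%N -> \sum_(1 <= k < K * n) k%:R * q k <= S0 * n%:R `^ r.
  move=> n0; have nR : 0 < n%:R :> R by rewrite ltr0n.
  rewrite /S0 -[leRHS]mulrA -powRM //.
  apply: (@le_trans _ _ (Cq * (\sum_(1 <= k < K * n) k%:R `^ (- 1 - d)) * (K%:R * n%:R) `^ r)).
    rewrite mulr_sumr mulr_suml !big_nat; apply: ler_sum => k /andP[k1 kKn].
    have kR : 0 < k%:R :> R by rewrite ltr0n.
    have [h _] := Hq k k1; apply: (le_trans (ler_wpM2l _ h)) => //.
    rewrite mulrCA -mulrA; apply: ler_wpM2l; first exact: ltW.
    rewrite -{1}[k%:R]powRr1 // -powRDl //.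
    rewrite (_ : 1 + (- b + d) = (- 1 - d) + r); last by rewrite /r; ring.
    rewrite powRDl //; apply: ler_wpM2l; first exact: powR_ge0.
    by rewrite -natrM; apply: powR_nat_le => //; exact: ltnW.
  apply: ler_wpM2r; first exact: powR_ge0.
  by apply: ler_wpM2l; [exact: ltW|exact: powR_series_le].
clearbody S0.
have a22 : 0 < (a - 2) / 2 by lra.
have e3 : 0 < e' / Cq / (Cp * S0 + 1) by rewrite divr_gt0 ?divr_gt0 // ltr_wpDl // mulr_ge0 // ltW.
near=> n.
have n0 : (0 < n)%N by near: n; exact: nbhs_infty_ge.
have nR : 0 < n%:R :> R by rewrite ltr0n.
have [hp _] := Hp n n0; have [_ hq] := Hq n n0.
have nf : n%:R `^ (- ((a - 2) / 2)) <= e' / Cq / (Cp * S0 + 1).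
  by near: n; exact: powRN_near0.
have Sn0 : 0 <= \sum_(1 <= k < K * n) k%:R * q k.
  rewrite big_nat sumr_ge0 // => k /andP[k1 _].
  by rewrite mulr_ge0 // ltW // (regular_gt0 rq).
apply: (le_trans (ler_pM (ltW (regular_gt0 rp n0)) Sn0 hp (SS n n0))).
apply: le_trans (ler_wpM2l (ltW e'0) hq).
rewrite [leLHS](_ : _ = Cp * S0 * (n%:R `^ (- a + d) * n%:R `^ r)); last by ring.
rewrite -powRDl // (_ : - a + d + r = - ((a - 2) / 2) + (- b - d)); last first.
  by rewrite /r /d; field.
rewrite powRDl // !mulrA; apply: ler_wpM2r; first exact: powR_ge0.
have CS : 0 <= Cp * S0 by rewrite mulr_ge0 // ltW.
apply: (le_trans (ler_wpM2l CS nf)); rewrite mulrA ler_pdivrMr ?ltr_wpDl //.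
rewrite mulrC; apply: ler_wpM2l; first by rewrite divr_ge0 // ltW.
by rewrite lerDl.
Unshelve. all: by end_near. Qed.

(** * Tails of regularly varying step laws *)

Definition tail_mass (R : realType) (p : nat -> R) (n : nat) : R :=
  1 - \sum_(l < n.+1) p l.

Section tails.
Context {R : realType}.
Implicit Types (p : nat -> R) (L : R -> R).

Lemma tail_mass_ge p N M : (forall l, 0 <= p l) -> series p @ \oo --> (1 : R) ->
  \sum_(N.+1 <= l < M) p l <= tail_mass p N.
Proof.
move=> p0 p1; rewrite /tail_mass lerBrDl.
have [NM|MN] := leqP N.+1 M; last first.
  by rewrite [X in _ + X]big_geq ?(ltnW MN) // addr0; exact: sum_law_le1.
rewrite -(big_mkord xpredT) -big_cat_nat //= big_mkord; exact: sum_law_le1.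
Qed.

Lemma tail_mass_le p N B : (forall l, 0 <= p l) -> series p @ \oo --> (1 : R) ->
  (forall M, (N < M)%N -> \sum_(N.+1 <= l < M) p l <= B) -> tail_mass p N <= B.
Proof.
move=> p0 p1 H; apply/ler_addgt0Pr => /= e e0.
have [N1 _ H1] := tail_cvg0 p0 p1 e0.
have := H1 (N + N1)%N (leq_addl _ _) => /= t1.
have NM : (N < (N + N1).+1)%N by rewrite ltnS leq_addr.
have := H _ NM; move: t1; rewrite /tail_mass -!(big_mkord xpredT).
rewrite [X in 1 - X < _](big_cat_nat _ (n := N.+1)) //=; lra.
Qed.

Lemma tail_mass_ge0 p N : (forall l, 0 <= p l) -> series p @ \oo --> (1 : R) ->
  0 <= tail_mass p N.
Proof. by move=> p0 p1; rewrite subr_ge0; exact: sum_law_le1. Qed.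

Lemma tail_mass_anti p N M : (forall l, 0 <= p l) -> (N <= M)%N ->
  tail_mass p M <= tail_mass p N.
Proof.
move=> p0 NM; rewrite lerD2l lerN2 -!(big_mkord xpredT).
by rewrite [leRHS](big_cat_nat _ (n := N.+1)) //= lerDl sumr_ge0.
Qed.

(** The steps beyond n are missing from the polynomial. *)
Lemma large_poly_tail p n (y : R) : (forall l, 0 <= p l) ->
  series p @ \oo --> (1 : R) -> 0 <= y ->
  `|(large_poly p n y).[1] - tail_mass p (Num.truncn y)| <= tail_mass p n.
Proof.
move=> p0 p1 y0; have E : (large_poly p n y).[1] =
    \sum_(0 <= l < n.+1) (if (l <= Num.truncn y)%N then 0 else p l).
  rewrite horner_poly big_mkord; apply: eq_bigr => l _; rewrite expr1n mulr1.
  by rewrite truncn_ge_nat.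
have [yn|ny] := leqP (Num.truncn y) n.
  have -> : (large_poly p n y).[1] = tail_mass p (Num.truncn y) - tail_mass p n.
    rewrite E /tail_mass (big_cat_nat _ (n := (Num.truncn y).+1)) //=.
    rewrite big_nat big1 ?add0r; last by move=> l /andP[_]; rewrite ltnS => ->.
    rewrite -!(big_mkord xpredT) [X in _ - (1 - X)](big_cat_nat _ (n := (Num.truncn y).+1)) //=.
    rewrite [RHS](_ : _ = \sum_((Num.truncn y).+1 <= l < n.+1) p l); last first.
      by rewrite !big_mkord; ring.
    by rewrite !big_nat; apply: eq_bigr => l /andP[h _]; rewrite leqNgt h.
  by rewrite addrAC subrr add0r normrN ger0_norm // tail_mass_ge0.
rewrite E big_nat big1 ?sub0r; last first.
  by move=> l /andP[_ ln]; rewrite ifT // ltnW // (leq_trans ln).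
by rewrite normrN ger0_norm ?tail_mass_ge0 //; apply: tail_mass_anti => //; exact: ltnW.
Qed.

(** Karamata's theorem for the tail: summing Potter's bounds for p l / p N over
    l > N against the telescoping bounds for sums of powers. *)
Lemma tail_log_karamata p L c a (e : R) : (forall l, 0 <= p l) ->
  series p @ \oo --> (1 : R) -> regular_seq p L c a -> 1 < a -> 0 < e ->
  exists2 N0, (0 < N0)%N & forall N, (N0 <= N)%N -> 0 < tail_mass p N /\
    `|ln (tail_mass p N) - (ln N%:R + ln (p N) - ln (a - 1))| <= e.
Proof.
move=> p0 p1 rp a1 e0; pose b := a - 1; have b0 : 0 < b by rewrite /b; lra.
pose d := Num.min (b / 2) (e / (2 * (1 + 2 / b))).
have den : 0 < 1 + 2 / b by rewrite addr_gt0 // divr_gt0.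
have d0 : 0 < d by rewrite lt_min !divr_gt0 // mulr_gt0.
have db : d <= b / 2 by rewrite ge_min lexx.
have de : d * (1 + 2 / b) <= e / 2.
  have h : d <= e / (2 * (1 + 2 / b)) by rewrite ge_min lexx orbT.
  have := ler_wpM2r (ltW den) h.
  by rewrite (_ : e / (2 * (1 + 2 / b)) * (1 + 2 / b) = e / 2) //; field; rewrite !gt_eqF // addr_gt0.
have [N1 N10 H] := regular_log rp d0.
exists (N1 + (Num.truncn (2 * (b + d) / e)).+1)%N; first by rewrite addn_gt0 N10.
move=> N N0N.
have N1N : (N1 <= N)%N by apply: leq_trans N0N; exact: leq_addr.
have NR0 : (0 < N)%N by apply: leq_trans N1N.
have NR : 0 < N%:R :> R by rewrite ltr0n.
have Nbig : 2 * (b + d) / e <= N%:R.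
  apply: ltW; apply: lt_le_trans (truncnS_gt _) _; rewrite ler_nat.
  by apply: leq_trans N0N; exact: leq_addl.
have pN : 0 < p N := regular_gt0 rp NR0.
have logs l : (N < l)%N -> [/\ 0 < l%:R :> R,
    p l <= p N * expR d * (l%:R `^ (- 1 - (b - d)) * N%:R `^ (1 + (b - d))) &
    p N * expR (- d) * (l%:R `^ (- 1 - (b + d)) * N%:R `^ (1 + (b + d))) <= p l].
  move=> Nl; have l0 : (0 < l)%N by apply: leq_trans Nl.
  have lR : 0 < l%:R :> R by rewrite ltr0n.
  have := H l N (leq_trans N1N (ltnW Nl)) N1N.
  have lnl : ln N%:R <= ln l%:R :> R by rewrite ler_ln ?posrE // ler_nat ltnW.
  rewrite (ger0_norm (_ : 0 <= ln l%:R - ln N%:R)) ?subr_ge0 // ler_norml => /andP[h1 h2].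
  have pl : 0 < p l := regular_gt0 rp l0.
  have aE : a = b + 1 by rewrite /b; ring.
  split=> //.
    rewrite -[leLHS]lnK ?posrE // -{1}[p N]lnK ?posrE // !powR_expR // -!expRD ler_expR.
    move: h2; rewrite aE; lra.
  rewrite -[leRHS]lnK ?posrE // -{1}[p N]lnK ?posrE // !powR_expR // -!expRD ler_expR.
  move: h1; rewrite aE; lra.
have bd0 : 0 < b - d by lra.
have bd1 : 0 < b + d by lra.
have tele (r : R) M : 0 < r -> (N < M)%N ->
    r * (\sum_(N.+1 <= l < M) l%:R `^ (- 1 - r)) <= N%:R `^ (- r) - M.-1%:R `^ (- r) /\
    N.+1%:R `^ (- r) - M%:R `^ (- r) <= r * (\sum_(N.+1 <= l < M) l%:R `^ (- 1 - r)).
  move=> r0 NM; rewrite -(subnKC NM); elim: (M - N.+1)%N => [|k [IH1 IH2]].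
    by rewrite addn0 big_geq // mulr0 /= !subrr.
  rewrite addnS big_nat_recr ?leq_addr //= mulrDr.
  have k0 : (0 < N + k)%N by rewrite addn_gt0 NR0.
  have /andP[g1 _] := powR_sum_bounds r0 k0.
  have /andP[_ g2] := powR_sum_bounds r0 (ltn0Sn (N + k)).
  move: IH1 IH2; rewrite !addSn /= => IH1 IH2; split; lra.
have NN r : N%:R `^ (1 + r) * N%:R `^ (- r) = N%:R :> R.
  by rewrite -powRDl // (_ : 1 + r + - r = 1) ?powRr1 ?(ltW NR) //; ring.
have up : tail_mass p N <= p N * expR d * N%:R / (b - d).
  apply: tail_mass_le => // M NM.
  apply: (@le_trans _ _ (p N * expR d * N%:R `^ (1 + (b - d)) *
      \sum_(N.+1 <= l < M) l%:R `^ (- 1 - (b - d)))).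
    rewrite mulr_sumr !big_nat; apply: ler_sum => l /andP[Nl _].
    by have [_ h _] := logs l Nl; apply: le_trans h _; rewrite le_eqVlt; apply/orP; left; apply/eqP; ring.
  have [h _] := tele _ M bd0 NM.
  have h' : \sum_(N.+1 <= l < M) l%:R `^ (- 1 - (b - d)) <= N%:R `^ (- (b - d)) / (b - d).
    rewrite ler_pdivlMr // mulrC; apply: le_trans h _; rewrite gerBl powR_ge0 //.
  have pos : 0 <= p N * expR d * N%:R `^ (1 + (b - d)).
    by rewrite !mulr_ge0 ?powR_ge0 ?expR_ge0.
  apply: le_trans (ler_wpM2l pos h') _.
  rewrite le_eqVlt; apply/orP; left; apply/eqP; rewrite -[in RHS](NN (b - d)); ring.
have lo : p N * expR (- d) * N%:R `^ (1 + (b + d)) * (N.+1%:R `^ (- (b + d)) / (b + d)) <=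
    tail_mass p N.
  apply/ler_addgt0Pr => /= f f0.
  have CC : 0 < p N * expR (- d) * N%:R `^ (1 + (b + d)) / (b + d).
    by rewrite divr_gt0 // !mulr_gt0 ?powR_gt0 ?expR_gt0.
  have fC : 0 < f / (p N * expR (- d) * N%:R `^ (1 + (b + d)) / (b + d)) by rewrite divr_gt0.
  have [N2 _ HN2] := @powRN_near0 R (b + d) _ bd1 fC.
  pose M := (N2 + N.+1)%N.
  have NM : (N < M)%N by rewrite /M addnS ltnS leq_addl.
  have hM : M%:R `^ (- (b + d)) <= f / (p N * expR (- d) * N%:R `^ (1 + (b + d)) / (b + d)).
    by apply: HN2; rewrite /= leq_addr.
  have := tail_mass_ge N M p0 p1.
  have [_ h] := tele _ M bd1 NM.
  have hs : p N * expR (- d) * N%:R `^ (1 + (b + d)) *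
      \sum_(N.+1 <= l < M) l%:R `^ (- 1 - (b + d)) <= \sum_(N.+1 <= l < M) p l.
    rewrite mulr_sumr !big_nat; apply: ler_sum => l /andP[Nl _].
    by have [_ _ g] := logs l Nl; apply: le_trans g; rewrite le_eqVlt; apply/orP; left; apply/eqP; ring.
  have pos : 0 <= p N * expR (- d) * N%:R `^ (1 + (b + d)).
    by rewrite !mulr_ge0 ?powR_ge0 ?expR_ge0.
  have h2 : (N.+1%:R `^ (- (b + d)) - M%:R `^ (- (b + d))) / (b + d) <=
      \sum_(N.+1 <= l < M) l%:R `^ (- 1 - (b + d)).
    by rewrite ler_pdivrMr // mulrC.
  have h3 := ler_wpM2l pos h2.
  rewrite ler_pdivlMr // in hM.
  move: hM hs h3; set A := p N * expR (- d) * _; set Q := N.+1%:R `^ _; set W := M%:R `^ _.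
  set S := \sum_(_ <= l < _) _ `^ _; set S' := \sum_(_ <= l < _) p l.
  move: A Q W S S' (b + d) => A Q W S S' r; clear.
  rewrite (_ : W * (A / r) = A * (W / r)); last by ring.
  rewrite (_ : A * ((Q - W) / r) = A * (Q / r) - A * (W / r)); last by ring.
  lra.
have lo0 : 0 < p N * expR (- d) * N%:R `^ (1 + (b + d)) * (N.+1%:R `^ (- (b + d)) / (b + d)).
  by rewrite !mulr_gt0 ?powR_gt0 ?expR_gt0 ?invr_gt0 ?ltr0n.
have t0 : 0 < tail_mass p N by exact: lt_le_trans lo.
split=> //.
have lnb1 : ln (b + d) <= ln b + d / b.
  rewrite -lerBlDl -ln_div ?posrE //; apply: le_trans (ln_le_sub1 (divr_gt0 bd1 b0)) _.
  by rewrite le_eqVlt; apply/orP; left; apply/eqP; field; rewrite gt_eqF.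
have lnb2 : ln b <= ln (b - d) + 2 * d / b.
  rewrite -lerBlDl -ln_div ?posrE //; apply: le_trans (ln_le_sub1 (divr_gt0 b0 bd0)) _.
  rewrite lerBlDr ler_pdivrMr // mulrDl mul1r -[leLHS](subrK d) addrC lerD2r.
  have : 2 * d / b * (b / 2) <= 2 * d / b * (b - d).
    by rewrite ler_wpM2l ?divr_ge0 ?mulr_ge0 ?(ltW d0) ?(ltW b0) //; lra.
  by rewrite (_ : 2 * d / b * (b / 2) = d) //; field; rewrite gt_eqF.
have lnN1 : (b + d) * (ln N.+1%:R - ln N%:R) <= e / 2.
  have h : ln N.+1%:R - ln N%:R <= N%:R^-1 :> R.
    rewrite -ln_div ?posrE ?ltr0n //; apply: le_trans (ln_le_sub1 _) _.
      by rewrite divr_gt0 ?ltr0n.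
    by rewrite -natr1 le_eqVlt; apply/orP; left; apply/eqP; field; rewrite gt_eqF.
  apply: (le_trans (ler_wpM2l (ltW bd1) h)); rewrite ler_pdivrMr //.
  by move: Nbig; rewrite ler_pdivrMr //; lra.
have U : ln (tail_mass p N) <= ln (p N) + d + ln N%:R - ln (b - d).
  have hh : 0 < p N * expR d * N%:R by rewrite !mulr_gt0 // expR_gt0.
  have h : ln (tail_mass p N) <= ln (p N * expR d * N%:R / (b - d)).
    by rewrite ler_ln ?posrE // divr_gt0.
  by rewrite ln_div ?posrE // !lnM ?posrE ?mulr_gt0 ?expR_gt0 // expRK in h.
have D : ln (p N) - d + (1 + (b + d)) * ln N%:R - (b + d) * ln N.+1%:R - ln (b + d) <=
    ln (tail_mass p N).
  have h : ln (p N * expR (- d) * N%:R `^ (1 + (b + d)) * (N.+1%:R `^ (- (b + d)) / (b + d))) <=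
      ln (tail_mass p N) by rewrite ler_ln ?posrE.
  have n1R : 0 < N.+1%:R :> R by rewrite ltr0n.
  rewrite lnM ?posrE ?divr_gt0 ?mulr_gt0 ?powR_gt0 ?expR_gt0 // in h.
  rewrite ln_div ?posrE ?powR_gt0 // !lnM ?posrE ?mulr_gt0 ?powR_gt0 ?expR_gt0 // in h.
  rewrite !ln_powR expRK in h; lra.
have dE : d * (1 + 2 / b) = d + 2 * d / b by ring.
have db0 : 0 <= d / b by rewrite divr_ge0 ?ltW.
have d2b : 2 * d / b = 2 * (d / b) by ring.
rewrite ler_norml -/b; apply/andP; split.
  move: D lnN1 lnb1 de; rewrite dE d2b; move: (ln (tail_mass _ _)) db0 d0 => t; clear; lra.
move: U lnb2 de; rewrite dE d2b; move: (ln (tail_mass _ _)) db0 d0 e0 => t; clear; lra.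
Qed.

(** By Karamata's theorem the tail is close to N p N / (a - 1), and so inherits
    the bounds of [regular_log], the factor N lowering the exponent by 1. *)
Lemma tail_log p L c a (e : R) : (forall l, 0 <= p l) ->
  series p @ \oo --> (1 : R) -> regular_seq p L c a -> 1 < a -> 0 < e ->
  exists2 N0, (0 < N0)%N & forall k m, (N0 <= k)%N -> (N0 <= m)%N ->
    [/\ 0 < tail_mass p k, 0 < tail_mass p m &
    `|ln (tail_mass p k) - ln (tail_mass p m) + (a - 1) * (ln k%:R - ln m%:R)| <=
      e * (1 + `|ln k%:R - ln m%:R|)].
Proof.
move=> p0 p1 rp a1 e0; have e4 : 0 < e / 4 by lra.
have [N1 N10 H1] := tail_log_karamata p0 p1 rp a1 e4.
have [N2 N20 H2] := regular_log rp e4.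
exists (N1 + N2)%N; first by rewrite addn_gt0 N10.
move=> k m hk hm.
have [k0 hk1] := H1 k (leq_trans (leq_addr _ _) hk).
have [m0 hm1] := H1 m (leq_trans (leq_addr _ _) hm).
have h := H2 k m (leq_trans (leq_addl _ _) hk) (leq_trans (leq_addl _ _) hm).
split=> //; set D := ln k%:R - ln m%:R in h *.
have -> : ln (tail_mass p k) - ln (tail_mass p m) + (a - 1) * D =
  (ln (tail_mass p k) - (ln k%:R + ln (p k) - ln (a - 1))) -
  (ln (tail_mass p m) - (ln m%:R + ln (p m) - ln (a - 1))) +
  (ln (p k) - ln (p m) + a * D) by rewrite /D; ring.
apply: le_trans (ler_normD _ _) _; have := ler_normB (ln (tail_mass p k) - (ln k%:R + ln (p k) - ln (a - 1)))
  (ln (tail_mass p m) - (ln m%:R + ln (p m) - ln (a - 1))).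
have D0 := normr_ge0 D; have : 0 <= e * `|D| by rewrite mulr_ge0 // ltW.
lra.
Qed.

End tails.

(** * The scale of the largest component *)

Section scales.
Context {R : realType}.
Implicit Types (p : nat -> R) (L : R -> R).

Lemma ln_truncn_near (z e : R) : 0 < e -> 1 + 2 / e <= z -> 1 <= z / 2 ->
  `|ln (Num.truncn z)%:R - ln z| <= e /\ (0 < Num.truncn z)%N.
Proof.
move=> e0 z1 z2; have z0 : 0 < z by lra.
have /andP[h1 h2] := truncn_itv (ltW z0).
have h3 : z - 1 <= (Num.truncn z)%:R by move: h2; rewrite -natr1; lra.
have h0 : 0 < (Num.truncn z)%:R :> R by lra.
split; last by rewrite -(ltr0n R).
rewrite distrC ger0_norm; last by rewrite subr_ge0 ler_ln ?posrE.
rewrite -ln_div ?posrE //; apply: le_trans (ln_le_sub1 (divr_gt0 z0 h0)) _.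
rewrite lerBlDr ler_pdivrMr // mulrDl mul1r.
have : e * (1 + 2 / e - 1) <= e * (Num.truncn z)%:R by rewrite ler_wpM2l ?(ltW e0) //; lra.
rewrite (_ : e * (1 + 2 / e - 1) = 2); first by lra.
by field; rewrite gt_eqF.
Qed.

Lemma tail_mass_gt0 p L c a N : (forall l, 0 <= p l) ->
  series p @ \oo --> (1 : R) -> regular_seq p L c a -> 0 < tail_mass p N.
Proof.
move=> p0 p1 rp; apply: lt_le_trans (tail_mass_ge N N.+2 p0 p1).
by rewrite big_nat1; exact: regular_gt0 rp _.
Qed.

(** At its 1/n-quantile N the tail is 1/n up to the ratio of the tails at N and
    N - 1, which tends to 1; stretching N by t then brings in the factor
    t^(1 - a) by regular variation. *)
Lemma tail_quantile p L c a (N : nat -> nat) (t : R) : (forall l, 0 <= p l) ->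
  series p @ \oo --> (1 : R) -> regular_seq p L c a -> 1 < a -> 0 < t ->
  (forall n m, (0 < n)%N -> (tail_mass p m <= n%:R^-1) = (N n <= m)%N) ->
  n%:R * tail_mass p (Num.truncn (t * (N n)%:R)) @[n --> \oo] --> t `^ (- (a - 1)).
Proof.
move=> p0 p1 rp a1 t0 NP; have tp N' : 0 < tail_mass p N' := tail_mass_gt0 N' p0 p1 rp.
have Noo M : \forall n \near \oo, (M <= N n)%N.
  exists (Num.truncn (tail_mass p M)^-1).+1 => //= n /= hn.
  have n0 : (0 < n)%N by apply: leq_trans hn.
  have : ~~ (N n <= M)%N.
    rewrite -NP // -ltNge invf_plt ?posrE ?ltr0n //.
    by apply: lt_le_trans (truncnS_gt _) _; rewrite ler_nat.
  by rewrite -ltnNge => /ltnW.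
have lim : ln (n%:R * tail_mass p (Num.truncn (t * (N n)%:R))) @[n --> \oo] -->
    - (a - 1) * ln t.
  apply/cvgrPdist_le => /= e0 e00.
  pose C := 4 + `|ln t| + 2 * (a - 1).
  have C0 : 0 < C by have := normr_ge0 (ln t); rewrite /C; lra.
  pose e := Num.min 1 (e0 / C).
  have e1 : 0 < e by rewrite lt_min ltr01 divr_gt0.
  have ele1 : e <= 1 by rewrite ge_min lexx.
  have eC : e * C <= e0 by rewrite -ler_pdivlMr // ge_min lexx orbT.
  have [N0 N00 H] := tail_log p0 p1 rp a1 e1.
  pose B := Num.max (N0%:R + 1) (Num.max (1 + 2 / e) 2).
  have B0 : 0 < B by rewrite lt_max ltr_wpDl.
  near=> n.
  have Nbig : (N0 + (Num.truncn (B + B / t)).+2 <= N n)%N by near: n; exact: Noo.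
  have n0 : (0 < n)%N by near: n; exact: nbhs_infty_gt.
  have nR : 0 < n%:R :> R by rewrite ltr0n.
  have hN0 : (N0 <= N n)%N by apply: leq_trans Nbig; exact: leq_addr.
  have hN1 : B + B / t <= (N n)%:R - 1.
    rewrite lerBrDr; apply: (@le_trans _ _ (Num.truncn (B + B / t)).+2%:R).
      by rewrite -[X in _ <= X]natr1 lerD2r ltW // truncnS_gt.
    by rewrite ler_nat; apply: leq_trans Nbig; exact: leq_addl.
  have Bt0 : 0 < B / t by rewrite divr_gt0.
  have NR : 0 < (N n)%:R :> R by lra.
  have Npos : (0 < N n)%N by rewrite -(ltr0n R).
  have tN : B <= t * (N n)%:R.
    have : t * (B / t) <= t * (N n)%:R by rewrite ler_wpM2l ?(ltW t0) //; lra.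
    by rewrite (_ : t * (B / t) = B) //; field; rewrite gt_eqF.
  have B1 : N0%:R + 1 <= B by rewrite le_max lexx.
  have B2 : 1 + 2 / e <= B by rewrite !le_max lexx orbT.
  have B3 : 2 <= B by rewrite !le_max lexx !orbT.
  have [hk k0] := ln_truncn_near e1 (le_trans B2 tN) (ltac:(lra) : 1 <= t * (N n)%:R / 2).
  have N0k : (N0 <= Num.truncn (t * (N n)%:R))%N.
    by rewrite truncn_ge_nat ?mulr_ge0 ?(ltW t0) //; lra.
  rewrite lnM ?posrE // in hk.
  have hp : (N0 <= (N n).-1)%N.
    by rewrite -ltnS prednK // -(ltr_nat R); lra.
  have [_ _ A1] := H _ _ N0k hN0.
  have [_ _ A2] := H _ _ hp hN0.
  have pR : 0 < (N n).-1%:R :> R.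
    by rewrite ltr0n; apply: leq_trans hp.
  have hl : `|ln (N n).-1%:R - ln (N n)%:R| <= e.
    have E : (N n)%:R = (N n).-1%:R + 1 :> R by rewrite natr1 prednK.
    rewrite distrC ger0_norm; last by rewrite subr_ge0 ler_ln ?posrE // E; lra.
    rewrite -ln_div ?posrE //; apply: le_trans (ln_le_sub1 (divr_gt0 NR pR)) _.
    rewrite lerBlDr ler_pdivrMr // mulrDl mul1r {1}E addrC lerD2r.
    have : e * (2 / e) <= e * (N n).-1%:R by rewrite ler_wpM2l ?(ltW e1) //; lra.
    by rewrite (_ : e * (2 / e) = 2); [lra | field; rewrite gt_eqF].
  have q1 : ln (tail_mass p (N n)) <= - ln n%:R.
    by rewrite -lnV ?posrE // ler_ln ?posrE ?invr_gt0 // NP.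
  have q2 : - ln n%:R <= ln (tail_mass p (N n).-1).
    rewrite -lnV ?posrE // ler_ln ?posrE ?invr_gt0 //; apply: ltW; rewrite ltNge NP //.
    by rewrite -ltnNge prednK.
  rewrite lnM ?posrE //.
  move: A1 A2 hk hl q1 q2.
  set lk := ln (Num.truncn _)%:R; set lN := ln (N n)%:R; set lp := ln (N n).-1%:R.
  set Tk := ln (tail_mass p (Num.truncn _)); set TN := ln (tail_mass p (N n)).
  set Tp := ln (tail_mass p (N n).-1); set ln' := ln n%:R.
  move=> A1 A2 hk hl q1 q2.
  have n1 : `|lk - lN| <= 1 + `|ln t|.
    rewrite (_ : lk - lN = (lk - (ln t + lN)) + ln t); last by ring.
    by apply: le_trans (ler_normD _ _) _; rewrite lerD2r; exact: le_trans hk ele1.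
  have n2 : e * (1 + `|lk - lN|) <= e * (2 + `|ln t|).
    by rewrite ler_wpM2l ?(ltW e1) //; lra.
  have n3 : e * (1 + `|lp - lN|) <= e * 2.
    by rewrite ler_wpM2l ?(ltW e1) //; lra.
  have a0 : 0 <= a - 1 by lra.
  have m1 : `|(a - 1) * (lk - (ln t + lN))| <= (a - 1) * e.
    by rewrite normrM (ger0_norm a0) ler_wpM2l.
  have m2 : `|(a - 1) * (lp - lN)| <= (a - 1) * e.
    by rewrite normrM (ger0_norm a0) ler_wpM2l.
  have {}A1 := le_trans A1 n2; have {}A2 := le_trans A2 n3.
  move: eC A1 A2 m1 m2 q1 q2; rewrite /C !ler_norml => eC /andP[u1 u2] /andP[u3 u4] /andP[u5 u6] /andP[u7 u8] q1 q2.
  apply/andP; split; clear - eC u1 u2 u3 u4 u5 u6 u7 u8 q1 q2; lra.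
have := cvg_comp _ _ lim (@continuous_expR R _).
rewrite -powR_expR // => h; apply: cvg_trans h; apply: near_eq_cvg; near=> n.
by rewrite /= lnK ?posrE // mulr_gt0 // ltr0n; near: n; exact: nbhs_infty_gt.
Unshelve. all: by end_near.
Qed.

Lemma harmonic_ge_ln m n : (0 < m)%N -> (m <= n)%N ->
  ln n%:R - ln m%:R <= \sum_(m <= l < n) l%:R^-1 :> R.
Proof.
move=> m0 mn; rewrite -(subnKC mn); elim: (n - m)%N => [|k IH].
  by rewrite addn0 big_geq // subrr.
rewrite addnS big_nat_recr ?leq_addr //=.
have k0 : 0 < (m + k)%:R :> R by rewrite ltr0n addn_gt0 m0.
have : ln (m + k).+1%:R - ln (m + k)%:R <= (m + k)%:R^-1 :> R.
  rewrite -ln_div ?posrE ?ltr0n ?addn_gt0 ?m0 //.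
  apply: le_trans (ln_le_sub1 _) _; first by rewrite divr_gt0 // ltr0n.
  have E : (m + k).+1%:R = (m + k)%:R + 1 :> R by rewrite natr1.
  by rewrite E le_eqVlt; apply/orP; left; apply/eqP; move: (_%:R) k0 => z z0; field; rewrite gt_eqF.
lra.
Qed.

Definition second_moment_below p (N : nat) : R := \sum_(l < N.+1) l%:R ^+ 2 * p l.

(** Below exponent 3 the terms l^2 p l dominate the harmonic series. *)
Lemma second_moment_infinite p L c a (B : R) : (forall l, 0 <= p l) ->
  regular_seq p L c a -> a < 3 -> exists N, B < second_moment_below p N.
Proof.
move=> p0 rp a3; have e0 : 0 < 3 - a by lra.
have [C C0 H] := regular_poly rp e0.
pose N := (Num.truncn (expR (B * C))).+1.
exists N; have N0 : (0 < N)%N by [].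
rewrite /second_moment_below -(big_mkord xpredT (fun l => l%:R ^+ 2 * p l)).
rewrite big_nat_recl // expr0n /= mul0r add0r.
have hl : B * C < ln N%:R by rewrite -ltr_expR lnK ?posrE ?ltr0n //; exact: truncnS_gt.
apply: (@lt_le_trans _ _ (C^-1 * \sum_(1 <= l < N.+1) l%:R^-1)).
  rewrite mulrC ltr_pdivlMr //; apply: lt_le_trans hl _.
  have := @harmonic_ge_ln 1 N.+1 isT isT; rewrite ln1 subr0; apply: le_trans.
  by rewrite ler_ln ?posrE ?ltr0n // ler_nat.
rewrite mulr_sumr big_add1 /=; apply: ler_sum => l _.
have lR : 0 < l.+1%:R :> R by rewrite ltr0n.
have [_ h] := H l.+1 isT.
rewrite (_ : - a - (3 - a) = - 3) in h; last by ring.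
have := ler_wpM2l (sqr_ge0 (l.+1%:R : R)) h; apply: le_trans.
rewrite mulrCA ler_wpM2l ?invr_ge0 ?(ltW C0) // -powR_mulrn ?(ltW lR) //.
by rewrite -powRDl // (_ : 2%:R + - 3 = -1) ?powR_inv1 ?(ltW lR) //; ring.
Qed.

(** From exponent 3 on, the second moment picks up N^3 p N / l from each l of
    order N, hence a divergent multiple of N^2 times the tail. *)
Lemma tail_negligible p L c a (e : R) : (forall l, 0 <= p l) ->
  series p @ \oo --> (1 : R) -> regular_seq p L c a -> 3 <= a -> 0 < e ->
  \forall N \near \oo, N%:R ^+ 2 * tail_mass p N <= e * second_moment_below p N.
Proof.
move=> p0 p1 rp a3 e0.
have [N1 N10 H1] := tail_log_karamata p0 p1 rp (ltac:(lra) : 1 < a) ltr01.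
(* The terms l^2 p l with N / K <= l <= N are compared to N^3 p N / l. Potter's
   bound costs a factor exp (- 1), its slope 1 / (1 + ln K) being chosen so that
   its error is at most 1 on this range; the harmonic sum over the range is at
   least ln (K / 2) = J, and the tail is at most exp 1 times N p N. Hence
   J = exp 2 / e. *)
pose J := expR 2 / e; have J0 : 0 < J by rewrite divr_gt0 ?expR_gt0.
pose K := 2 * expR J; have K1 : 1 < K.
  by have := expR_gt1 J; rewrite J0 /K => h; move: (h) => /idP; lra.
have K0 : 0 < K by lra.
have lK : 0 < 1 + ln K by rewrite addr_gt0 // ln_gt0.
have d0 : 0 < (1 + ln K)^-1 by rewrite invr_gt0.
have [N2 N20 H2] := regular_log rp d0.
near=> N.
have NN1 : (N1 <= N)%N by near: N; exact: nbhs_infty_ge.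
have NK : K * (N2%:R + 1) <= N%:R by near: N; exact: nat_large.
have N0 : (0 < N)%N by apply: leq_trans N10 _.
have NR : 0 < N%:R :> R by rewrite ltr0n.
have pN : 0 < p N := regular_gt0 rp N0.
have [t0 hk] := H1 N NN1.
have tN : tail_mass p N <= expR 1 * (N%:R * p N).
  apply: ratio_of_logs => //; first by rewrite mulr_gt0.
  have : 0 <= ln (a - 1) by rewrite ln_ge0 //; lra.
  move: hk; rewrite ler_norml lnM ?posrE // => /andP[_].
  by move: (ln _) => T; clear; lra.
pose m := (Num.truncn (N%:R / K)).+1.
have NK0 : 0 <= N%:R / K by rewrite divr_ge0 ?ltW.
have m1 : N%:R / K < m%:R by exact: truncnS_gt.
have m2 : m%:R <= 2 * (N%:R / K).
  have E : m%:R = (Num.truncn (N%:R / K))%:R + 1 :> R by rewrite natr1.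
  have h : (Num.truncn (N%:R / K))%:R <= N%:R / K by rewrite truncn_le.
  have : 1 <= N%:R / K; last by rewrite E; move: h; clear; lra.
  rewrite ler_pdivlMr // mul1r; apply: le_trans NK.
  by rewrite ler_peMr ?(ltW K0) // ler_wpDl.
have hN2 : (N2 <= m)%N.
  rewrite -(ler_nat R); apply: le_trans (ltW m1); rewrite ler_pdivlMr // mulrC.
  by apply: le_trans NK; rewrite ler_wpM2l ?(ltW K0) //; lra.
have NN2 : (N2 <= N)%N.
  rewrite -(ler_nat R); apply: le_trans NK; rewrite -[leLHS]mul1r ler_pM //; lra.
have mN : (m <= N.+1)%N.
  rewrite ltnS truncn_le_nat; apply: le_lt_trans (_ : N%:R < _); last by rewrite ltr_nat.
  by rewrite ler_pdivrMr // ler_peMr ?(ltW NR) ?(ltW K1).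
have low : expR (-1) * (N%:R ^+ 3 * p N) * J <= second_moment_below p N.
  rewrite /second_moment_below -(big_mkord xpredT (fun l => l%:R ^+ 2 * p l)).
  rewrite (big_cat_nat _ (n := m)) //=.
  apply: (@le_trans _ _ (\sum_(m <= l < N.+1) l%:R ^+ 2 * p l)); last first.
    by rewrite lerDr sumr_ge0 // => l _; rewrite mulr_ge0 ?exprn_ge0.
  apply: (@le_trans _ _ (\sum_(m <= l < N.+1) expR (-1) * (N%:R ^+ 3 * p N) * l%:R^-1)).
    rewrite -mulr_sumr ler_wpM2l ?mulr_ge0 ?expR_ge0 ?exprn_ge0 ?(ltW pN) //.
    apply: le_trans (harmonic_ge_ln _ mN) => //.
    have h1 : ln m%:R <= ln (2 * (N%:R / K)) by rewrite ler_ln ?posrE ?ltr0n // mulr_gt0 // divr_gt0.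
    have h2 : ln N%:R <= ln N.+1%:R :> R by rewrite ler_ln ?posrE ?ltr0n // ler_nat.
    have h3 : ln (2 * (N%:R / K)) = ln N%:R - J.
      rewrite /K (_ : 2 * _ = N%:R / expR J); last by field; rewrite gt_eqF ?expR_gt0.
      by rewrite ln_div ?posrE ?expR_gt0 // expRK.
    lra.
  rewrite !big_nat; apply: ler_sum => l /andP[ml lN].
  have l0 : (0 < l)%N by apply: leq_trans ml.
  have lR : 0 < l%:R :> R by rewrite ltr0n.
  have pl : 0 < p l := regular_gt0 rp l0.
  have := H2 l N (leq_trans hN2 ml) NN2.
  have lnlN : ln l%:R <= ln N%:R :> R by rewrite ler_ln ?posrE // ler_nat.
  have lnK' : ln N%:R - ln K <= ln l%:R.
    rewrite -ln_div ?posrE // ler_ln ?posrE ?divr_gt0 //.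
    by apply: le_trans (ltW m1) _; rewrite ler_nat.
  rewrite (distrC (ln l%:R)) (ger0_norm (_ : 0 <= ln N%:R - ln l%:R)) ?subr_ge0 //.
  have dK : (1 + ln K)^-1 * (1 + (ln N%:R - ln l%:R)) <= 1.
    by rewrite mulrC ler_pdivrMr // mul1r; lra.
  rewrite ler_norml => /andP[h _].
  have h' : -1 <= ln (p l) - ln (p N) + a * (ln l%:R - ln N%:R).
    by apply: le_trans h; rewrite lerN2.
  rewrite -[leLHS]lnK ?posrE ?mulr_gt0 ?expR_gt0 ?exprn_gt0 ?invr_gt0 //.
  rewrite -[leRHS]lnK ?posrE ?mulr_gt0 ?exprn_gt0 // ler_expR.
  rewrite !lnM ?posrE ?mulr_gt0 ?expR_gt0 ?exprn_gt0 ?invr_gt0 // expRK lnV ?posrE //.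
  have : 3 * (ln N%:R - ln l%:R) <= a * (ln N%:R - ln l%:R) by rewrite ler_wpM2r // subr_ge0.
  move: h'; move: (ln (p l)) (ln (p N)) (ln N%:R) (ln l%:R) => A B C D; clear; lra.
apply: le_trans (ler_wpM2l (ltW e0) low).
apply: le_trans (ler_wpM2l (sqr_ge0 (N%:R : R)) tN) _.
rewrite le_eqVlt; apply/orP; left; apply/eqP; rewrite /J.
have E : expR 2 = expR 1 * expR 1 :> R by rewrite -expRD.
rewrite E expRN; field; rewrite !gt_eqF ?expR_gt0 //.
Unshelve. all: by end_near.
Qed.

(** Chebyshev's inequality, where the second moment may be replaced by its part
    beyond s sqrt n, which vanishes. *)
Lemma tail_finite_second_moment p (B s : R) : (forall l, 0 <= p l) ->
  series p @ \oo --> (1 : R) -> (forall N, second_moment_below p N <= B) -> 0 < s ->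
  n%:R * tail_mass p (Num.truncn (s * Num.sqrt n%:R)) @[n --> \oo] --> (0 : R).
Proof.
move=> p0 p1 HB s0.
have nd : nondecreasing_seq (second_moment_below p).
  apply/nondecreasing_seqP => n; rewrite /second_moment_below [leRHS]big_ord_recr /=.
  by rewrite lerDl mulr_ge0 ?exprn_ge0.
have hub : has_ubound (range (second_moment_below p)).
  by exists B => _ [n _ <-].
have cv := nondecreasing_cvgn nd hub; set S := sup _ in cv.
apply/cvgrPdist_le => /= e e0.
have es : 0 < e * s ^+ 2 by rewrite mulr_gt0 // exprn_gt0.
have /cvgrPdist_le/(_ _ es)[N0 _ H] := cv.
near=> n.
have hn : (N0%:R / s) ^+ 2 <= n%:R by near: n; exact: nat_large.
have n0 : 0 <= n%:R :> R by [].
set N := Num.truncn _.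
have sn0 : 0 <= s * Num.sqrt n%:R by rewrite mulr_ge0 ?sqrtr_ge0 // ltW.
have NN0 : (N0 <= N)%N.
  have q0 : 0 <= N0%:R / s by rewrite divr_ge0 // ltW.
  by rewrite /N truncn_ge_nat // mulrC -ler_pdivrMr // -(ger0_norm q0) -sqrtr_sqr ler_wsqrtr.
rewrite sub0r normrN ger0_norm; last by rewrite mulr_ge0 // tail_mass_ge0.
have key : N.+1%:R ^+ 2 * tail_mass p N <= e * s ^+ 2.
  rewrite mulrC -ler_pdivlMr ?exprn_gt0 ?ltr0n //; apply: tail_mass_le => // M NM.
  rewrite ler_pdivlMr ?exprn_gt0 ?ltr0n // mulrC mulr_sumr.
  apply: (@le_trans _ _ (second_moment_below p M - second_moment_below p N)).
    rewrite /second_moment_below -!(big_mkord xpredT (fun l => l%:R ^+ 2 * p l)).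
    have NM1 : (N.+1 <= M.+1)%N by rewrite ltnS ltnW.
    rewrite [X in _ <= X - _](big_cat_nat _ (n := N.+1)) //=.
    rewrite addrAC subrr add0r big_nat_recr ?(ltnW NM) //=.
    rewrite ler_wpDr ?mulr_ge0 ?exprn_ge0 // !big_nat; apply: ler_sum => l /andP[Nl _].
    by rewrite ler_wpM2r // lerXn2r ?nnegrE // ler_nat.
  have hM : second_moment_below p M <= S by apply: ub_le_sup => //; exists M.
  by have := H N NN0; rewrite /= ler_norml => /andP[_]; lra.
have : s ^+ 2 * n%:R <= N.+1%:R ^+ 2.
  rewrite -[X in _ * X]sqr_sqrtr // -exprMn lerXn2r ?nnegrE //.
  by apply: ltW; exact: truncnS_gt.
move=> /(ler_wpM2r (tail_mass_ge0 N p0 p1)) h.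
rewrite -(ler_pM2l (_ : 0 < s ^+ 2)) ?exprn_gt0 // mulrA [leRHS]mulrC.
exact: le_trans h key.
Unshelve. all: by end_near.
Qed.

End scales.

Section infinite_variance.
Context {R : realType}.
Implicit Types (p : nat -> R) (L : R -> R).

Lemma second_moment_below_ge0 p N : (forall l, 0 <= p l) ->
  0 <= second_moment_below p N.
Proof. by move=> p0; rewrite sumr_ge0 // => l _; rewrite mulr_ge0 ?exprn_ge0. Qed.

Lemma second_moment_below_le p N M : (forall l, 0 <= p l) -> (N <= M)%N ->
  second_moment_below p N <= second_moment_below p M.
Proof.
move=> p0 NM; rewrite /second_moment_below.
rewrite -!(big_mkord xpredT (fun l => l%:R ^+ 2 * p l)).
rewrite [leRHS](big_cat_nat _ (n := N.+1)) //= lerDl sumr_ge0 // => l _.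
by rewrite mulr_ge0 ?exprn_ge0.
Qed.

(** At x = sup {x | n^-1 <= T x / x^2} the truncated second moment T x is of order
    x^2 / n, so that sqrt (n T x) is of order x, whereas the tail at multiples of
    x is negligible with respect to T x / x^2. *)
Lemma tail_infinite_second_moment p L c a (m s : R) : (forall l, 0 <= p l) ->
  series p @ \oo --> (1 : R) -> regular_seq p L c a -> 3 <= a ->
  (forall n, \sum_(l < n) l%:R * p l <= m) ->
  (forall B : R, exists N, B < second_moment_below p N) -> 0 < s ->
  let T (x : R) := second_moment_below p (Num.truncn x) in
  let x_ n := sup [set x : R | 0 <= x /\ n%:R^-1 <= T x / x ^+ 2] in
  n%:R * tail_mass p (Num.truncn (s * (Num.sqrt (T (x_ n)) * Num.sqrt n%:R)))
    @[n --> \oo] --> (0 : R).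
Proof.
move=> p0 p1 rp a3 pm Too s0 T x_.
have T0 x : 0 <= T x by exact: second_moment_below_ge0.
have Tle (x y : R) : x <= y -> T x <= T y.
  by move=> xy; apply: second_moment_below_le => //; exact: le_truncn.
have Tm (x : R) : 0 <= x -> T x <= x * m.
  move=> x0; apply: (@le_trans _ _ (x * \sum_(l < (Num.truncn x).+1) l%:R * p l)); last first.
    by rewrite ler_wpM2l.
  rewrite mulr_sumr; apply: ler_sum => -[l /= lx] _.
  rewrite expr2 -mulrA ler_wpM2r ?mulr_ge0 //.
  by rewrite -truncn_ge_nat.
pose S n := [set x : R | 0 <= x /\ n%:R^-1 <= T x / x ^+ 2].
have Sle n x : (0 < n)%N -> S n x -> 0 < x /\ x ^+ 2 <= n%:R * T x.
  move=> n0 [x0 h]; have nR : 0 < n%:R :> R by rewrite ltr0n.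
  have xp : 0 < x.
    rewrite lt_neqAle x0 andbT eq_sym; apply/eqP => xE; move: h.
    by rewrite xE expr0n /= invr0 mulr0 invr_le0 leNgt nR.
  split=> //; move: h; rewrite ler_pdivlMr ?exprn_gt0 // mulrC ler_pdivrMr //.
  by rewrite mulrC.
have Sub n : (0 < n)%N -> has_ubound (S n).
  move=> n0; exists (n%:R * m) => x /(Sle _ _ n0)[x0 h].
  rewrite -(ler_pM2l x0) -expr2; apply: le_trans h _.
  by rewrite [leRHS]mulrCA ler_wpM2l // Tm // ltW.
have SX (X : R) : 0 < X -> 0 < T X -> \forall n \near \oo, S n X.
  move=> X0 TX; near=> n; split; first exact: ltW.
  have n0 : 0 < n%:R :> R by rewrite ltr0n; near: n; exact: nbhs_infty_gt.
  rewrite -[leRHS]invrK lef_pV2 ?posrE ?invr_gt0 ?divr_gt0 ?exprn_gt0 //.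
  by near: n; exact: nat_large.
have [N1 HN1] := Too 0.
have xoo (M : R) : \forall n \near \oo, M <= x_ n /\ S n !=set0.
  pose X := Num.max M N1%:R + 1.
  have X0 : 0 < X.
    by rewrite /X ltr_wpDl // le_max ler0n orbT.
  have MX : M <= X by rewrite /X ler_wpDr // le_max lexx.
  have TX : 0 < T X.
    apply: lt_le_trans HN1 _; apply: second_moment_below_le => //.
    by rewrite truncn_ge_nat ?(ltW X0) // /X ler_wpDr // le_max lexx orbT.
  near=> n.
  have SnX : S n X by near: n; exact: SX.
  have n0 : (0 < n)%N by near: n; exact: nbhs_infty_gt.
  split; last by exists X.
  by apply: le_trans MX _; apply: ub_le_sup => //; exact: Sub.
(* As the tail is decreasing, s may be lowered to at most 1, which makes the
   second moment below s x at most T x. *)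
pose s' := Num.min s 1; have s'0 : 0 < s' by rewrite lt_min s0 ltr01.
have s's : s' <= s by rewrite ge_min lexx.
have s'1 : s' <= 1 by rewrite ge_min lexx orbT.
apply/cvgrPdist_le => /= e e0.
have e1 : 0 < e * s' ^+ 2 / 16 by rewrite divr_gt0 ?mulr_gt0 ?exprn_gt0.
have [N0 _ HN0] := tail_negligible p0 p1 rp a3 e1.
near=> n.
have n0 : (0 < n)%N by near: n; exact: nbhs_infty_gt.
have nR : 0 < n%:R :> R by rewrite ltr0n.
have [xbig Sne] : (N0%:R + 2) / s' + N1%:R <= x_ n /\ S n !=set0 by near: n; exact: xoo.
rewrite sub0r normrN ger0_norm; last by rewrite mulr_ge0 // tail_mass_ge0.
have hb : 0 < (N0%:R + 2) / s' by rewrite divr_gt0 // ltr_wpDl.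
have N1R : 0 <= N1%:R :> R by [].
have x0 : 0 < x_ n by lra.
have N1x : N1%:R <= x_ n by lra.
have sx : N0%:R + 2 <= s' * x_ n.
  have : s' * ((N0%:R + 2) / s') <= s' * x_ n by rewrite ler_wpM2l ?(ltW s'0) //; lra.
  by rewrite (_ : s' * ((N0%:R + 2) / s') = N0%:R + 2) //; field; rewrite gt_eqF.
have [x xE] : exists x, x_ n = x by exists (x_ n).
rewrite xE in x0 N1x sx *.
have TX : 0 < T x.
  apply: lt_le_trans HN1 _; apply: second_moment_below_le => //.
  by rewrite truncn_ge_nat ?(ltW x0).
have up : x <= Num.sqrt (T x) * Num.sqrt n%:R.
  rewrite -[leLHS]xE; apply: ge_sup => // y Sy; have [y0 hy] := Sle _ _ n0 Sy.
  have yx : y <= x by rewrite -xE; apply: ub_le_sup => //; exact: Sub.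
  rewrite -sqrtrM // -[leLHS](ger0_norm (ltW y0)) -sqrtr_sqr ler_wsqrtr //.
  by apply: le_trans hy _; rewrite mulrC ler_wpM2r // Tle.
have lo : n%:R * T x <= 4 * x ^+ 2.
  have nS : ~ S n (2 * x).
    move=> h; have : 2 * x <= x by rewrite -[leRHS]xE; apply: ub_le_sup => //; exact: Sub.
    lra.
  have x20 : 0 <= 2 * x by rewrite mulr_ge0 // ltW.
  have : T (2 * x) / (2 * x) ^+ 2 < n%:R^-1.
    by rewrite ltNge; apply/negP => h; apply: nS.
  rewrite ltr_pdivrMr ?exprn_gt0 ?mulr_gt0 // [X in _ < X]mulrC ltr_pdivlMr // => /ltW h.
  have : n%:R * T x <= n%:R * T (2 * x) by rewrite ler_wpM2l // Tle //; lra.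
  rewrite [leRHS]mulrC => h'; apply: le_trans h' (le_trans h _).
  by rewrite exprMn -natrX.
pose N := Num.truncn (s' * x).
have sx0 : 0 <= s' * x by rewrite mulr_ge0 // ltW.
have N0N : (N0 <= N)%N by rewrite /N truncn_ge_nat //; lra.
have tN := HN0 N N0N.
have TN : second_moment_below p N <= T x.
  apply: second_moment_below_le => //; apply: le_truncn.
  by rewrite -[leRHS]mul1r ler_wpM2r // ltW.
have Nx : s' * x / 2 <= N%:R.
  have := truncnS_gt (s' * x); rewrite -/N -natr1; have := ler0n R N0; lra.
apply: (@le_trans _ _ (n%:R * tail_mass p N)).
  rewrite ler_wpM2l //; apply: tail_mass_anti => //; apply: le_truncn.
  by apply: ler_pM => //; exact: ltW.
have sq : (s' * x / 2) ^+ 2 * tail_mass p N <= e * s' ^+ 2 / 16 * T x.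
  apply: le_trans (ler_wpM2l (ltW e1) TN); apply: le_trans tN.
  by rewrite ler_wpM2r ?tail_mass_ge0 // lerXn2r ?nnegrE // divr_ge0.
have xx : 0 < x ^+ 2 by rewrite exprn_gt0.
have ss : 0 < s' ^+ 2 by rewrite exprn_gt0.
have t4 : x ^+ 2 * tail_mass p N <= e / 4 * T x.
  rewrite -(ler_pM2l ss); move: sq.
  rewrite (_ : (s' * x / 2) ^+ 2 * _ = (s' ^+ 2 * (x ^+ 2 * tail_mass p N)) / 4); last by field.
  move: (s' ^+ 2 * (x ^+ 2 * _)) => A.
  rewrite (_ : e * s' ^+ 2 / 16 * T x = (s' ^+ 2 * (e / 4 * T x)) / 4); last by field.
  lra.
rewrite -(ler_pM2l xx).
have : (x ^+ 2 * tail_mass p N) * n%:R <= e / 4 * T x * n%:R by rewrite ler_wpM2r.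
have : e / 4 * (n%:R * T x) <= e / 4 * (4 * x ^+ 2) by rewrite ler_wpM2l // divr_ge0 // ltW.
rewrite (_ : e / 4 * (4 * x ^+ 2) = x ^+ 2 * e); last by field.
rewrite (_ : x ^+ 2 * (n%:R * tail_mass p N) = x ^+ 2 * tail_mass p N * n%:R); last by ring.
rewrite (_ : e / 4 * (n%:R * T x) = e / 4 * T x * n%:R); last by ring.
by move=> h1 h2; exact: le_trans h2 h1.
Unshelve. all: by end_near.
Qed.

End infinite_variance.

(** * Laws with a density on the positive half-line *)

Definition half_line_density (R : realType) (f : R -> R) (A : set R) : \bar R :=
  (\int[lebesgue_measure]_(x in A `&` `]0%R, +oo[%classic) (f x)%:E)%E.

Section densities.
Context {R : realType}.
Variable f : R -> R.
Hypothesis f0 : forall x : R, 0 < x -> 0 <= f x.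
Hypothesis fc : forall x : R, 0 < x -> {for x, continuous f}.
Notation nu := (half_line_density f).

Lemma half_line_measurable : measurable_fun (`]0, +oo[%classic : set R) (EFin \o f).
Proof.
apply/measurable_EFinP; apply: open_continuous_measurable_fun => //.
by move=> x; rewrite inE /= in_itv /= andbT => /fc.
Qed.

Lemma half_line_integrand_ge0 (A : set R) x :
  (A `&` `]0, +oo[%classic) x -> (0 <= (f x)%:E)%E.
Proof. by move=> [_] /=; rewrite in_itv /= andbT lee_fin => /f0. Qed.

Let nu0 : nu set0 = 0%E.
Proof. by rewrite /half_line_density set0I integral_set0. Qed.

Let nu_ge0 A : (0 <= nu A)%E.
Proof. by apply: integral_ge0 => x; exact: half_line_integrand_ge0. Qed.

Let nu_sigma_additive : semi_sigma_additive nu.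
Proof.
move=> /= F mF tF mUF; rewrite /half_line_density; apply: cvg_toP.
  apply: ereal_nondecreasing_is_cvgn => m n mn.
  apply: lee_sum_nneg_natr => // k _ _; exact: nu_ge0.
rewrite setI_bigcupl ge0_integral_bigcup //=.
- by move=> k; apply: (measurableI _ _ (mF k)); exact: measurable_itv.
- apply: measurable_funS half_line_measurable => //.
  by move=> x [k _ []].
- by move=> x [k _]; exact: half_line_integrand_ge0.
- by apply: trivIset_setIr.
Qed.

HB.instance Definition _ := isMeasure.Build _ _ _ nu nu0 nu_ge0 nu_sigma_additive.

Definition half_line_measure : {measure set R -> \bar R} := nu.

Variable F : R -> R.
Hypothesis F' : forall x : R, 0 < x -> is_derive x 1 F (f x).

Lemma half_line_density_itv (a b : R) : 0 < a -> a < b ->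
  nu `]a, b] = (F b - F a)%:E.
Proof.
move=> a0 ab; have b0 := lt_trans a0 ab.
have E : `]a, b]%classic `&` `]0, +oo[%classic = `]a, b]%classic :> set R.
  apply/setIidl => x /=; rewrite !in_itv /= andbT => /andP[ax _].
  exact: lt_trans ax.
rewrite /half_line_density E integral_itv_obnd_cbnd; last first.
  apply: measurable_funS half_line_measurable => //.
  by move=> x /=; rewrite !in_itv /= andbT => /andP[ax _]; exact: lt_trans ax.
have Fd x : 0 < x -> derivable F x 1 by move=> x0; have [] := F' x0.
have Fc x : 0 < x -> {for x, continuous F}.
  by move=> x0; apply: differentiable_continuous; apply/derivable1_diffP; exact: Fd.
rewrite EFinB; apply: continuous_FTC2 => //.
- apply/continuous_within_itvP => //; split.
  + by move=> x; rewrite in_itv /= => /andP[ax _]; apply: fc; exact: lt_trans ax.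
  + by apply: cvg_at_right_filter; exact: fc.
  + by apply: cvg_at_left_filter; exact: fc.
- split.
  + by move=> x; rewrite in_itv /= => /andP[ax _]; apply: Fd; exact: lt_trans ax.
  + by apply: cvg_at_right_filter; exact: Fc.
  + by apply: cvg_at_left_filter; exact: Fc.
- move=> x; rewrite in_itv /= => /andP[ax _].
  by rewrite derive1E; have [] := F' (lt_trans a0 ax).
Qed.

(** The fundamental theorem of calculus on [1/n, x], the density being possibly
    unbounded near 0. *)
Lemma half_line_density_below (A x : R) : F n.+1%:R^-1 @[n --> \oo] --> A -> 0 < x ->
  nu `]0, x] = (F x - A)%:E.
Proof.
move=> FA x0; pose E n := (`]n.+1%:R^-1, x]%classic : set R).
have UE : \bigcup_n E n = `]0, x]%classic.
  apply/seteqP; split => y /=.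
    move=> [n _]; rewrite /E /= !in_itv /= => /andP[h ->]; rewrite andbT.
    by apply: lt_trans h; rewrite invr_gt0 ltr0n.
  rewrite in_itv /= => /andP[y0 yx]; exists (Num.truncn y^-1) => //=.
  rewrite /E /= in_itv /= yx andbT invf_plt ?posrE ?ltr0n //; exact: truncnS_gt.
have := @nondecreasing_cvg_mu _ _ _ half_line_measure E.
rewrite UE => /(_ _ _ _) h.
have {}h : (nu \o E) n @[n --> \oo] --> nu `]0, x].
  apply: h => //; first by move=> n; exact: measurable_itv.
  move=> n m nm; apply/subsetPset => y; rewrite /E /= !in_itv /= => /andP[h ->].
  by rewrite andbT; apply: le_lt_trans h; rewrite lef_pV2 ?posrE ?ltr0n // ler_nat ltnS.
apply: (cvg_unique _ h) => //=.
have : (F x - F n.+1%:R^-1)%:E @[n --> \oo] --> (F x - A)%:E.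
  by apply: cvg_EFin; [exact: nearW | apply: cvgB => //; exact: cvg_cst].
apply: cvg_trans; apply: near_eq_cvg; near=> n.
rewrite /= /E half_line_density_itv ?invr_gt0 ?ltr0n // invf_plt ?posrE ?ltr0n //.
apply: lt_trans (truncnS_gt _) _; rewrite ltr_nat ltnS.
by near: n; exact: nbhs_infty_gt.
Unshelve. all: by end_near.
Qed.

Lemma half_line_density_total (A B : R) : F n.+1%:R^-1 @[n --> \oo] --> A ->
  F n.+1%:R @[n --> \oo] --> B -> nu setT = (B - A)%:E.
Proof.
move=> FA FB; pose E n := (`]0, n.+1%:R]%classic : set R).
have UE : \bigcup_n E n = `]0, +oo[%classic.
  apply/seteqP; split => y /=.
    by move=> [n _]; rewrite /E /= !in_itv /= => /andP[-> _].
  rewrite in_itv /= andbT => y0; exists (Num.truncn y) => //=.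
  by rewrite /E /= in_itv /= y0 ltW // truncnS_gt.
have -> : nu setT = nu `]0, +oo[ by rewrite /half_line_density setTI setIid.
have := @nondecreasing_cvg_mu _ _ _ half_line_measure E.
rewrite UE => /(_ _ _ _) h.
have {}h : (nu \o E) n @[n --> \oo] --> nu `]0, +oo[.
  apply: h => //; first by move=> n; exact: measurable_itv.
  move=> n m nm; apply/subsetPset => y; rewrite /E /= !in_itv /= => /andP[-> h] /=.
  by apply: le_trans h _; rewrite ler_nat ltnS.
apply: (cvg_unique _ h) => //=.
have : (F n.+1%:R - A)%:E @[n --> \oo] --> (B - A)%:E.
  by apply: cvg_EFin; [exact: nearW | apply: cvgB => //; exact: cvg_cst].
apply: cvg_trans; apply: near_eq_cvg; near=> n.
by rewrite /= /E (half_line_density_below FA).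
Unshelve. all: by end_near.
Qed.

Lemma half_line_density_nonpos (x : R) : x <= 0 -> nu `]-oo, x] = 0%E.
Proof.
move=> x0; rewrite /half_line_density (_ : _ `&` _ = set0) ?integral_set0 //.
apply/seteqP; split => y //= [] /=; rewrite !in_itv /= andbT => yx y0.
by move: (lt_le_trans y0 (le_trans yx x0)); rewrite ltxx.
Qed.

Lemma half_line_density_cdf (A x : R) : F n.+1%:R^-1 @[n --> \oo] --> A -> 0 < x ->
  nu `]-oo, x] = (F x - A)%:E.
Proof.
move=> FA x0; rewrite -(half_line_density_below FA x0) /half_line_density.
congr integral; apply/seteqP; split => y [] /=; rewrite !in_itv /= andbT => yx y0.
  by rewrite yx y0.
by move: yx => /andP[].
Qed.

Lemma half_line_probability : F n.+1%:R^-1 @[n --> \oo] --> (0 : R) ->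
  F n.+1%:R @[n --> \oo] --> (1 : R) ->
  exists Q : probability R R, [/\ forall A, measurable A -> Q A = nu A,
    forall x, 0 < x -> Q `]-oo, x]%classic = (F x)%:E &
    forall x, x <= 0 -> Q `]-oo, x]%classic = 0%E].
Proof.
move=> FA FB.
have nu1 : half_line_measure setT = 1%E.
  by rewrite /= (half_line_density_total FA FB) subr0.
pose Q := HB.pack_for (probability R R) (Measure.sort half_line_measure)
  (@Measure_isProbability.Build _ _ R half_line_measure nu1).
exists Q; split=> //= x x0.
  by rewrite (half_line_density_cdf FA x0) subr0.
exact: half_line_density_nonpos.
Qed.

End densities.

Lemma expr_le_expR (R : realType) (i : nat) (y : R) : 0 < y ->
  expR (- y) * y ^+ i <= i.+1`!%:R / y.
Proof.
move=> y0; have i0 : 0 < i.+1`!%:R :> R by rewrite ltr0n fact_gt0.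
have h := expR_ge1Dxn i (ltW y0).
rewrite ler_pdivlMr // -mulrA -exprSr expRN mulrC ler_pdivrMr ?expR_gt0 //.
rewrite mulrC -ler_pdivrMr //; apply: le_trans h; rewrite lerDr //.
Qed.

(** Any decay at infinity is enough to see that the distribution functions below
    vanish at 0. *)
Lemma poisson_below_small (R : realType) j : exists C : R, forall y, 0 < y ->
  poisson_below j y <= C / y.
Proof.
exists (\sum_(i < j) i.+1`!%:R) => y y0; rewrite mulr_suml.
apply: ler_sum => i _; apply: le_trans (expr_le_expR i y0).
rewrite mulrA ler_pdivrMr ?ltr0n ?fact_gt0 // ler_peMr ?ler1n ?fact_gt0 //.
by rewrite mulr_ge0 ?expR_ge0 // exprn_ge0 // ltW.
Qed.

Lemma poisson_below0 (R : realType) j : poisson_below j.+1 (0 : R) = 1.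
Proof.
rewrite /poisson_below big_ord_recl big1 ?addr0 /= ?oppr0 ?expR0 ?expr0 ?mul1r ?fact0 ?invr1 //.
by move=> i _; rewrite expr0n /= mul0r mulr0.
Qed.

(** The sum of the derivatives telescopes. *)
Lemma is_derive_poisson_below (R : realType) j (x : R) :
  is_derive x 1 (@poisson_below R j.+1) (- (expR (- x) * (x ^+ j / j`!%:R))).
Proof.
have dE : is_derive x 1 (fun y : R => expR (- y)) (- expR (- x)).
  by apply: is_derive_eq; rewrite /GRing.scale /= mulrN1.
elim: j => [|j IH].
  rewrite (_ : poisson_below 1 = fun y : R => expR (- y)); last first.
    by apply/funext => y; rewrite /poisson_below big_ord_recl big_ord0 addr0 expr0 fact0 divr1 mulr1.
  by rewrite expr0 fact0 divr1 mulr1.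
rewrite (_ : poisson_below j.+2 = poisson_below j.+1 \+
    (fun y : R => expR (- y) * (y ^+ j.+1 / j.+1`!%:R))); last first.
  by apply/funext => y; rewrite /poisson_below big_ord_recr.
have dX : is_derive x 1 (fun y : R => y ^+ j.+1) (j.+1%:R * x ^+ j).
  have := @is_deriveX _ _ id j.+1 x 1 1 _.
  rewrite (_ : id ^+ j.+1 = fun y : R => y ^+ j.+1); last first.
    by apply/funext => y; rewrite fctE.
  by move=> h; apply: is_derive_eq; rewrite /GRing.scale /= mulr1.
have dM := is_deriveM dE (is_deriveZ (j.+1`!%:R^-1 : R) dX).
have dD := is_deriveD IH dM.
rewrite (_ : (_ \+ _) = poisson_below j.+1 + (fun y : R => expR (- y)) *
    (j.+1`!%:R^-1 \*: (fun y : R => y ^+ j.+1))); last first.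
  by apply/funext => y; rewrite !fctE /= [_ / _]mulrC.
apply: (is_derive_eq dD); rewrite /GRing.scale /= factS natrM /GRing.scale /=.
have : j`!%:R != 0 :> R by rewrite pnatr_eq0 -lt0n fact_gt0.
have : j.+1%:R != 0 :> R by rewrite pnatr_eq0.
move: (j.+1%:R) (j`!%:R) (x ^+ j) (x ^+ j.+1) => a b z z' a0 b0; field.
by rewrite a0 b0.
Qed.

(** In a Poisson process on the half-line with c x^(-alpha) points beyond x on
    average, the point preceded by j larger ones has the density and the
    distribution function below. *)
Section frechet.
Context {R : realType}.
Variables (alpha c : R) (j : nat).
Hypotheses (alpha0 : 0 < alpha) (c0 : 0 < c).

Definition frechet_density (x : R) : R :=
  alpha * c * x `^ (- alpha - 1) * ((c * x `^ (- alpha)) ^+ j / j`!%:R) *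
  expR (- (c * x `^ (- alpha))).

Definition frechet_cdf (x : R) : R := poisson_below j.+1 (c * x `^ (- alpha)).

Lemma is_derive_frechet_cdf (x : R) : 0 < x ->
  is_derive x 1 frechet_cdf (frechet_density x).
Proof.
move=> x0; have dp := is_derive1_powR (- alpha) x0.
have dL := is_deriveZ c dp.
have := is_derive1_comp (is_derive_poisson_below j _) dL.
rewrite (_ : _ \o _ = frechet_cdf); last by [].
move=> h; apply: (is_derive_eq h); rewrite /frechet_density /GRing.scale /=.
by move: (_ `^ _) (expR _) => u v; move: (_ `^ _) => u'; ring.
Qed.

Lemma frechet_density_continuous (x : R) : 0 < x -> {for x, continuous frechet_density}.
Proof.
move=> x0; have cp r : {for x, continuous (fun y : R => y `^ r)}.
  have [h _] := is_derive1_powR r x0.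
  by apply: differentiable_continuous; apply/derivable1_diffP.
have cl : {for x, continuous (fun y => c * y `^ (- alpha))}.
  by apply: cvgM; [exact: cvg_cst | exact: cp].
apply: cvgM; last first.
  by apply: (@continuous_comp _ _ _ (fun y => - (c * y `^ (- alpha))) expR);
    [apply: cvgN; exact: cl | exact: continuous_expR].
apply: cvgM; first by apply: cvgM; [exact: cvg_cst | exact: cp].
apply: cvgM; last exact: cvg_cst.
by apply: (@continuous_comp _ _ _ (fun y => c * y `^ (- alpha)) (fun z => z ^+ j));
  [exact: cl | exact: exprn_continuous].
Qed.

Lemma frechet_density_ge0 (x : R) : 0 < x -> 0 <= frechet_density x.
Proof.
move=> x0; rewrite /frechet_density !mulr_ge0 ?powR_ge0 ?expR_ge0 ?invr_ge0 ?(ltW alpha0) ?(ltW c0) //.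
by rewrite exprn_ge0 // mulr_ge0 ?powR_ge0 ?(ltW c0).
Qed.

Lemma frechet_cdf_cvg0 : frechet_cdf n.+1%:R^-1 @[n --> \oo] --> (0 : R).
Proof.
have [C HC] := poisson_below_small R j.+1.
apply/cvgrPdist_le => /= e e0.
have d0 : 0 < e * c / (`|C| + 1) by rewrite divr_gt0 ?mulr_gt0 // ltr_wpDl.
have [N0 _ H] := powRN_near0 alpha0 d0; exists N0 => // n /= nN.
have n0 : 0 < n.+1%:R :> R by rewrite ltr0n.
have l0 : 0 < c * n.+1%:R^-1 `^ (- alpha) by rewrite mulr_gt0 ?powR_gt0 ?invr_gt0.
have /andP[p0 _] := poisson_below_bounds j.+1 (ltW l0).
rewrite sub0r normrN ger0_norm //; apply: le_trans (HC _ l0) _.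
have hn : n.+1%:R `^ (- alpha) <= e * c / (`|C| + 1) by apply: H => /=; exact: leqW.
have E : n.+1%:R^-1 `^ (- alpha) * n.+1%:R `^ (- alpha) = 1 :> R.
  by rewrite -powRM ?invr_ge0 // mulVf ?gt_eqF // powR1.
rewrite ler_pdivrMr //; apply: (@le_trans _ _ (`|C| + 1)).
  by rewrite (le_trans (ler_norm _)) // lerDl.
have u0 : 0 < n.+1%:R^-1 `^ (- alpha) :> R by rewrite powR_gt0 // invr_gt0.
rewrite ler_pdivlMr ?ltr_wpDl // in hn.
have h := ler_wpM2l (ltW u0) hn; rewrite mulrA E mul1r in h; apply: le_trans h _.
by rewrite mulrC mulrA.
Qed.

Lemma frechet_cdf_cvg1 : frechet_cdf n.+1%:R @[n --> \oo] --> (1 : R).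
Proof.
rewrite -[X in _ --> X](poisson_below0 R j).
have : c * n.+1%:R `^ (- alpha) @[n --> \oo] --> (0 : R).
  rewrite -[X in _ --> X](mulr0 c); apply: cvgM; first exact: cvg_cst.
  apply/cvgrPdist_le => /= e e0; have [N0 _ H] := powRN_near0 alpha0 e0.
  exists N0 => // n /= nN; rewrite sub0r normrN ger0_norm ?powR_ge0 //.
  by apply: H => /=; exact: leqW.
by move=> h; apply: (cvg_comp _ _ h); exact: poisson_below_continuous.
Qed.

Lemma frechet_probability : exists Q : probability R R,
  [/\ forall A, measurable A -> Q A =
        (\int[lebesgue_measure]_(x in A `&` `]0%R, +oo[%classic) (frechet_density x)%:E)%E,
      forall x, 0 < x -> Q `]-oo, x]%classic = (frechet_cdf x)%:E &
      forall x, x <= 0 -> Q `]-oo, x]%classic = 0%E].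
Proof.
exact: (half_line_probability frechet_density_ge0 frechet_density_continuous
  is_derive_frechet_cdf frechet_cdf_cvg0 frechet_cdf_cvg1).
Qed.

End frechet.

(** * Values of the Gamma function *)

(** The integrand is at most t^(-b) on ]0, 1] and at most exp (- t) beyond, hence
    the integral is finite; it is bounded below on ]1, 2]. Finiteness matters, as
    an infinite integral would be given the value 0. *)
Lemma Gamma_pos_gt0 (R : realType) (b : R) : 0 < b -> b < 1 ->
  0 < Gamma_pos (1 - b).
Proof.
move=> b0 b1; rewrite /Gamma_pos.
pose f (t : R) := t `^ (1 - b - 1) * expR (- t).
have fge (t : R) : 0 < t -> 0 <= f t by move=> _; rewrite /f mulr_ge0 ?powR_ge0 ?expR_ge0.
have cp (r x : R) : 0 < x -> {for x, continuous (fun y : R => y `^ r)}.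
  move=> x0; have [h _] := is_derive1_powR r x0.
  by apply: differentiable_continuous; apply/derivable1_diffP.
have ce (x : R) : {for x, continuous (fun y : R => expR (- y))}.
  by apply: (@continuous_comp _ _ _ (fun y : R => - y) expR);
    [apply: cvgN; exact: cvg_id | exact: continuous_expR].
have fc (x : R) : 0 < x -> {for x, continuous f}.
  by move=> x0; apply: cvgM; [exact: cp | exact: ce].
have mf := half_line_measurable fc.
have eE : half_line_density (fun t : R => expR (- t)) setT = 1%E.
  rewrite (@half_line_density_total R _ (fun x _ => expR_ge0 _) (fun x _ => ce x)
    (fun t : R => - expR (- t)) _ (-1) 0) ?opprK ?add0r //.
  - move=> x _; have dE : is_derive x 1 (fun y : R => expR (- y)) (- expR (- x)).
      by apply: is_derive_eq; rewrite /GRing.scale /= mulrN1.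
    by have := is_deriveN dE; rewrite opprK; apply.
  - apply: cvgN; have := cvg_comp _ _ (@cvg_harmonic R) (ce 0).
    by rewrite oppr0 expR0.
  - rewrite -[X in _ --> X]oppr0; apply: cvgN.
    by have := @cvgn_expR R; rewrite -cvg_shiftS.
pose g (t : R) := t `^ (- b).
have gge (t : R) : 0 < t -> 0 <= g t by move=> _; exact: powR_ge0.
have gc (x : R) : 0 < x -> {for x, continuous g} by exact: cp.
have b10 : 0 < 1 - b by lra.
have gE : half_line_density g `]-oo, 1]%classic = ((1 - b)^-1)%:E.
  rewrite (@half_line_density_cdf R g gge gc (fun t => (1 - b)^-1 * t `^ (1 - b)) _ 0) //.
  - by rewrite powR1 mulr1 subr0.
  - move=> x x0; have h := is_deriveZ (1 - b)^-1 (is_derive1_powR (1 - b) x0).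
    apply: (is_derive_eq h); rewrite /GRing.scale /= mulrA mulVf ?gt_eqF // mul1r.
    by rewrite /g; congr (_ `^ _); ring.
  - apply/cvgrPdist_le => /= e e0.
    have d0 : 0 < e * (1 - b) by rewrite mulr_gt0.
    have [N0 _ H] := powRN_near0 b10 d0; exists N0 => // n /= nN.
    have hn : n.+1%:R `^ (- (1 - b)) <= e * (1 - b) by apply: H => /=; exact: leqW.
    rewrite sub0r normrN ger0_norm ?mulr_ge0 ?powR_ge0 ?invr_ge0 ?(ltW b10) //.
    rewrite mulrC ler_pdivrMr //; apply: le_trans hn.
    by rewrite -powR_inv1 // -powRrM mulN1r.
have mI (A : set R) : measurable A -> measurable (A `&` `]0, +oo[%classic).
  by move=> mA; apply: measurableI => //; exact: measurable_itv.
have mS (h : R -> R) (A : set R) : (forall x : R, 0 < x -> {for x, continuous h}) ->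
    measurable_fun (A `&` `]0, +oo[%classic) (EFin \o h).
  by move=> hc; apply: measurable_funS (half_line_measurable hc) => // x [].
have I1 : (half_line_density f `]-oo, 1%R]%classic <= ((1 - b)^-1)%:E)%E.
  rewrite -gE; apply: ge0_le_integral.
  - by apply: mI; exact: measurable_itv.
  - by move=> x; exact: half_line_integrand_ge0.
  - exact: mS.
  - exact: mS.
  - move=> x [_] /=; rewrite in_itv /= andbT => x0; rewrite lee_fin /f /g.
    rewrite (_ : 1 - b - 1 = - b); last by ring.
    by rewrite ler_piMr ?powR_ge0 // expR_le1 oppr_le0 ltW.
have I2 : (half_line_density f `]1%R, +oo[%classic <= 1)%E.
  rewrite -eE; apply: (@le_trans _ _ (half_line_density (fun t : R => expR (- t)) `]1%R, +oo[%classic)).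
    apply: ge0_le_integral.
    + by apply: mI; exact: measurable_itv.
    + by move=> x; exact: half_line_integrand_ge0.
    + exact: mS.
    + by apply: mS => x _; exact: ce.
    + move=> x [/=]; rewrite !in_itv /= !andbT => x1 x0; rewrite lee_fin /f.
      rewrite (_ : 1 - b - 1 = - b); last by ring.
      by rewrite ler_piMl ?expR_ge0 // powR_expR // expR_le1 mulNr oppr_le0 mulr_ge0 ?(ltW b0) // ln_ge0 // ltW.
  apply: ge0_subset_integral.
  + by apply: mI; exact: measurable_itv.
  + by apply: mI.
  + by apply: mS => x _; exact: ce.
  + by move=> x _; rewrite lee_fin expR_ge0.
  + by apply: setSI.
have fin : (half_line_density f setT <= ((1 - b)^-1)%:E + 1)%E.
  have -> : setT = `]-oo, 1]%classic `|` `]1, +oo[%classic :> set R.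
    apply/esym/seteqP; split => // x _ /=; rewrite !in_itv /= andbT.
    by have [] := leP x 1; [left|right].
  apply: le_trans (leeD I1 I2).
  by have := measureU2 (half_line_measure fge fc); apply; exact: measurable_itv.
have I3 : ((2 `^ (- b) * expR (- 2))%:E <= half_line_density f setT)%E.
  apply: (@le_trans _ _ (\int[lebesgue_measure]_(x in `]1%R, 2%R]) (cst (2 `^ (- b) * expR (- 2))%:E) x)%E).
    rewrite integral_cst //= lebesgue_measure_itv /= lte_fin ltr1n /= -EFinB.
    by rewrite (_ : 2 - 1 = 1) ?mule1 //; ring.
  apply: (@le_trans _ _ (\int[lebesgue_measure]_(x in `]1%R, 2%R]) (f x)%:E)%E).
    apply: ge0_le_integral => //.
    - by move=> x _; rewrite lee_fin mulr_ge0 ?powR_ge0 ?expR_ge0.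
    - apply: measurable_funS mf => // x /=; rewrite !in_itv /= andbT => /andP[x1 _]; lra.
    - move=> x; rewrite /= in_itv /= => /andP[x1 x2]; rewrite lee_fin /f.
      rewrite (_ : 1 - b - 1 = - b); last by ring.
      rewrite ler_pM ?powR_ge0 ?expR_ge0 ?ler_expR ?lerN2 //.
      by apply: powRN_nat_le => //; [exact: ltW | lra].
  rewrite /half_line_density setTI; apply: ge0_subset_integral => //.
  - by move=> x /=; rewrite in_itv /= andbT => x0; rewrite lee_fin fge.
  - by move=> x /=; rewrite !in_itv /= andbT => /andP[x1 _]; lra.
have -> : \int[lebesgue_measure]_(t in `]0, +oo[) (t `^ (1 - b - 1) * expR (- t)) =
    fine (half_line_density f setT) by rewrite /half_line_density setTI.
move: fin I3; case: (half_line_density f setT) => [r| |] //= _.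
by rewrite lee_fin; apply: lt_le_trans; rewrite mulr_gt0 ?powR_gt0 ?expR_gt0.
Qed.

(** The functional equation gives Gamma (1 - alpha) = Gamma (2 - alpha) / (1 - alpha)
    and a negative denominator. *)
Lemma Gamma_continued (R : realType) (alpha : R) : 1 < alpha < 2 ->
  Gamma (1 - alpha) < 0.
Proof.
move=> /andP[a1 a2]; rewrite /Gamma ifN; last by rewrite -leNgt; lra.
have -> : Num.truncn (- (1 - alpha)) = 0%N.
  by apply/eqP; rewrite -leqn0 truncn_le_nat; lra.
rewrite big_ord_recl big_ord0 mulr1 addr0.
have h : 0 < Gamma_pos (1 - (alpha - 1)) by apply: Gamma_pos_gt0; lra.
rewrite (_ : 1 - alpha + 1 = 1 - (alpha - 1)); last by ring.
by rewrite pmulr_rlt0 // invr_lt0; lra.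
Qed.

(** * Power series with non-negative coefficients *)

Section power_series.
Context {R : realType}.
Implicit Types (c : nat -> R).

Lemma gf_partial_le c (x : R) N : (forall i, 0 <= c i) -> 0 <= x ->
  ((\sum_(i < N) c i * x ^+ i)%:E <= gf c x%:E)%E.
Proof.
move=> c0 x0; have h n : (0 <= n)%N -> xpredT n -> (0 <= (c n)%:E * x%:E ^+ n)%E.
  by move=> _ _; rewrite -EFin_expe -EFinM lee_fin mulr_ge0 // exprn_ge0.
apply: le_trans (nneseries_lim_ge N h); rewrite big_mkord -sumEFin.
by apply: lee_sum => i _; rewrite EFinM EFin_expe.
Qed.

Lemma gf_le c (x B : R) : (forall i, 0 <= c i) -> 0 <= x ->
  (gf c x%:E <= B%:E)%E <-> forall N, \sum_(i < N) c i * x ^+ i <= B.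
Proof.
move=> c0 x0; split=> [h N|h].
  by rewrite -lee_fin; apply: le_trans (gf_partial_le N c0 x0) h.
apply: lime_le.
  apply: is_cvg_nneseries => n _ _.
  by rewrite -EFin_expe -EFinM lee_fin mulr_ge0 // exprn_ge0.
apply: nearW => N; rewrite big_mkord.
under eq_bigr do rewrite -EFin_expe -EFinM.
by rewrite sumEFin lee_fin.
Qed.

Lemma gf_ge0 c (x : R) : (forall i, 0 <= c i) -> 0 <= x -> (0 <= gf c x%:E)%E.
Proof. by move=> c0 x0; have := gf_partial_le 0 c0 x0; rewrite big_ord0. Qed.

Lemma gf_finite c (x : R) : (forall i, 0 <= c i) -> 0 <= x -> (gf c x%:E < +oo)%E ->
  exists2 s : R, gf c x%:E = s%:E & series (fun i => c i * x ^+ i) @ \oo --> s.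
Proof.
move=> c0 x0 fin; have g0 := gf_ge0 c0 x0.
have [s sE] : exists s, gf c x%:E = s%:E.
  by move: fin g0; case: (gf c _) => // s _ _; exists s.
exists s => //.
have bnd N : series (fun i => c i * x ^+ i) N <= s.
  by rewrite -lee_fin -sE /series /= big_mkord; exact: gf_partial_le.
have nd : nondecreasing_seq (series (fun i => c i * x ^+ i)).
  by apply: nondecreasing_series => n _ _; rewrite mulr_ge0 // exprn_ge0.
have ub : has_ubound (range (series (fun i => c i * x ^+ i))).
  by exists s => _ [N _ <-].
have cv := nondecreasing_cvgn nd ub.
suff -> : s = sup (range (series (fun i => c i * x ^+ i))) by [].
apply/eqP; rewrite eq_le; apply/andP; split; last first.
  by apply: ge_sup; [exists (series (fun i => c i * x ^+ i) 0%N), 0%N | move=> _ [N _ <-]].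
rewrite -lee_fin -sE; apply/gf_le => // N.
apply: ub_le_sup; first by exists s => _ [M _ <-].
by exists N => //; rewrite /series /= big_mkord.
Qed.

Lemma gf_of_series c (x s : R) : (forall i, 0 <= c i) -> 0 <= x ->
  series (fun i => c i * x ^+ i) @ \oo --> s -> gf c x%:E = s%:E.
Proof.
move=> c0 x0 cv.
have nd : nondecreasing_seq (series (fun i => c i * x ^+ i)).
  by apply: nondecreasing_series => n _ _; rewrite mulr_ge0 // exprn_ge0.
have h : (gf c x%:E <= s%:E)%E.
  apply/gf_le => // N; have := nondecreasing_cvgn_le nd (cvgP _ cv) N.
  by rewrite (cvg_lim _ cv) // /series /= big_mkord.
have [s' -> cv'] := gf_finite c0 x0 (le_lt_trans h (ltry _)).
by congr EFin; exact: cvg_unique cv' cv.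
Qed.

Lemma gf_mono c (x y : R) : (forall i, 0 <= c i) -> 0 <= x -> x <= y ->
  (gf c x%:E <= gf c y%:E)%E.
Proof.
move=> c0 x0 xy; apply: lee_nneseries => [i _ _|i _].
  by rewrite -EFin_expe -EFinM lee_fin mulr_ge0 // exprn_ge0.
rewrite -!EFin_expe -!EFinM lee_fin ler_wpM2l // lerXn2r ?nnegrE //.
exact: le_trans xy.
Qed.

Lemma gf_inside c (x : R) : (forall i, 0 <= c i) -> 0 <= x ->
  (x%:E < conv_radius c)%E -> (gf c x%:E < +oo)%E.
Proof.
move=> c0 x0; rewrite lt_neqAle => /andP[xN xle].
have /ereal_sup_gt[_ [r [r0 hr] <-]] : (x%:E < conv_radius c)%E by rewrite lt_neqAle xN.
rewrite lte_fin => /ltW xr; exact: le_lt_trans (gf_mono c0 x0 xr) hr.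
Qed.

Lemma gf_outside c (x : R) : 0 <= x ->
  (conv_radius c < x%:E)%E -> gf c x%:E = +oo%E.
Proof.
move=> x0 h; apply/eqP; rewrite -leye_eq leNgt; apply/negP => fin.
move: h; rewrite ltNge => /negP; apply; apply: ereal_sup_ubound.
by exists x.
Qed.

Lemma conv_radius_ge0 c : (forall i, 0 <= c i) -> (0 <= conv_radius c)%E.
Proof.
move=> c0; apply: ereal_sup_ubound; exists 0 => //=; split => //.
apply: (@le_lt_trans _ _ (c 0%N)%:E); last exact: ltry.
apply/gf_le => // -[|N]; first by rewrite big_ord0.
rewrite big_ord_recl big1 ?addr0 ?expr0 ?mulr1 // => i _.
by rewrite expr0n /= mulr0.
Qed.

End power_series.

(** * Sizes of components and powers of polynomials *)

Section tuples.
Context {R : realType}.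
Variables (p : nat -> R) (n : nat) (y : R).

Lemma distribute_tuples (V : comNzRingType) (A : 'I_n.+1 -> V) k :
  (\sum_l A l) ^+ k = \sum_(t : k.-tuple 'I_n.+1) \prod_(i < k) A (tnth t i).
Proof.
rewrite -[k in LHS]card_ord -prodr_const bigA_distr_bigA /=.
rewrite (reindex (fun t : k.-tuple 'I_n.+1 => [ffun i => tnth t i])) /=.
  by apply: eq_bigr => t _; apply: eq_bigr => i _; rewrite ffunE.
exists (fun f : {ffun 'I_k -> 'I_n.+1} => [tuple f i | i < k]) => [t _|f _].
  by apply: eq_from_tnth => i; rewrite tnth_mktuple ffunE.
by apply/ffunP => i; rewrite ffunE tnth_mktuple.
Qed.

(** Expanding the k-th power of the sum over l of p_l x^l z^[l > y]: the second
    variable counts the entries of the tuple that exceed y. *)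
Lemma few_tuples j k :
  (few (small_poly p n y) (large_poly p n y) j k)`_n =
  \sum_(t : k.-tuple 'I_n.+1 | ((\sum_(i < k) tnth t i)%N == n) &&
      (\sum_(i < k) (y < (nat_of_ord (tnth t i))%:R)%R < j)%N) \prod_(i < k) p (tnth t i).
Proof.
pose A (l : 'I_n.+1) : {poly {poly R}} := (p l *: 'X^l)%:P * 'X^((y < (nat_of_ord l)%:R)%R).
have AE : \sum_l A l = (small_poly p n y)%:P + (large_poly p n y)%:P * 'X.
  rewrite /small_poly /large_poly !poly_def !rmorph_sum /= mulr_suml -big_split /=.
  apply: eq_bigr => l _; rewrite /A; case: leP => _ /=.
    by rewrite scale0r polyC0 mul0r addr0 expr0 mulr1.
  by rewrite scale0r polyC0 add0r expr1.
have AX i : (((small_poly p n y)%:P + (large_poly p n y)%:P * 'X) ^+ k)`_i =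
    (small_poly p n y ^+ (k - i) * large_poly p n y ^+ i) *+ 'C(k, i).
  rewrite exprDn coef_sum.
  under eq_bigr => l _ do
    rewrite exprMn -!rmorphXn /= mulrA -rmorphM /= coefMn coefCM coefXn.
  have [ik|ki] := leqP i k; last first.
    rewrite bin_small // mulr0n big1 // => l _.
    by rewrite gtn_eqF ?mulr0 ?mul0rn // (leq_ltn_trans _ ki) // -ltnS.
  rewrite (bigD1 (Ordinal (ik : (i < k.+1)%N))) //= eqxx mulr1 big1 ?addr0 //.
  move=> l; rewrite -val_eqE /= eq_sym => /negbTE ->.
  by rewrite mulr0 mul0rn.
have few_coef : few (small_poly p n y) (large_poly p n y) j k =
    \sum_(i < j) ((\sum_l A l) ^+ k)`_i.
  by rewrite AE; apply: eq_bigr => i _; rewrite AX.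
have prodE (t : k.-tuple 'I_n.+1) : \prod_(i < k) A (tnth t i) =
    (\prod_(i < k) p (tnth t i) *: 'X^(\sum_(i < k) tnth t i))%:P *
    'X^(\sum_(i < k) (y < (nat_of_ord (tnth t i))%:R)%R).
  rewrite /A big_split /= -rmorph_prod /= scaler_prod.
  by rewrite prodrXr prodrXr.
rewrite few_coef distribute_tuples.
under eq_bigr do rewrite coef_sum.
rewrite exchange_big /= coef_sum [RHS]big_mkcond /=; apply: eq_bigr => t _.
rewrite prodE; under eq_bigr do rewrite coefCM coefXn.
case: (ltnP (\sum_(i < k) (y < (nat_of_ord (tnth t i))%:R)%R)%N j) => tj; last first.
  rewrite andbF big1 ?coef0 // => i _.
  by rewrite ltn_eqF ?mulr0 // (leq_trans _ tj).
rewrite (bigD1 (Ordinal tj)) //= eqxx mulr1 [X in _ + X]big1 ?addr0; last first.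
  by move=> i; rewrite -val_eqE /= => /negbTE ->; rewrite mulr0.
by rewrite andbT coefZ coefXn eq_sym; case: eqP; rewrite ?mulr1 ?mulr0.
Qed.

End tuples.

Lemma law_poly_tuples (R : realType) (p : nat -> R) n k :
  (law_poly p n ^+ k)`_n =
  \sum_(t : k.-tuple 'I_n.+1 | (\sum_(i < k) tnth t i)%N == n) \prod_(i < k) p (tnth t i).
Proof.
rewrite -(small_large p n n%:R) -few_total few_tuples; apply: eq_bigl => t.
rewrite [X in _ && X](_ : _ = true) ?andbT // ltnS -[leqRHS]card_ord -sum1_card.
by apply: leq_sum => i _; exact: leq_b1.
Qed.

(** Rescaling by w l = rho p l r^(-l) multiplies the weight of a composition of n
    into k parts by rho^k r^(-n). *)
Lemma few_tilt (R : realType) (p w : nat -> R) (r rho : R) n (y : R) j k :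
  (forall l, p l * rho = w l * r ^+ l) ->
  (few (small_poly w n y) (large_poly w n y) j k)`_n * r ^+ n =
  rho ^+ k * (few (small_poly p n y) (large_poly p n y) j k)`_n.
Proof.
move=> pw; rewrite !few_tuples mulr_suml mulr_sumr.
apply: eq_bigr => t /andP[/eqP tn _].
rewrite -[X in r ^+ X]tn -prodrXr -big_split /= -[k in rho ^+ k]card_ord -prodr_const.
by rewrite -big_split; apply: eq_bigr => i _; rewrite /= -pw mulrC.
Qed.

Lemma law_poly_tilt (R : realType) (p w : nat -> R) (r rho : R) n k :
  (forall l, p l * rho = w l * r ^+ l) ->
  (law_poly w n ^+ k)`_n * r ^+ n = rho ^+ k * (law_poly p n ^+ k)`_n.
Proof.
by move=> pw; rewrite -!(small_large _ n n%:R) -!few_total; exact: few_tilt.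
Qed.

(** In a decreasing list, the entries larger than y come first. The default value
    0 of the entries beyond the end agrees with 0 <= y. *)
Lemma nth_largest_le (R : realType) (s : seq nat) j (y : R) : 0 <= y ->
  ((nth_largest s j.+1)%:R <= y) = (count (fun l => (y < l%:R)%R) s < j.+1)%N.
Proof.
move=> y0; rewrite /nth_largest /=; pose a (l : nat) := y < l%:R; rewrite -/a.
have sE : count a s = count a (sort geq s) by apply/permP; rewrite perm_sym perm_sort.
rewrite sE; have : sorted geq (sort geq s) by apply: sort_sorted => u v; exact: leq_total.
move: (sort geq s) => {sE}s srt.
have anti u v : (u <= v)%N -> a u -> a v.
  by move=> uv; rewrite /a => h; apply: lt_le_trans h _; rewrite ler_nat.
have mono i i' : (i <= i')%N -> (i' < size s)%N -> (nth 0 s i' <= nth 0 s i)%N.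
  move=> ii' i's; have tr : transitive geq by move=> u v z /= h1 h2; exact: leq_trans h2 h1.
  have rf : reflexive geq by move=> u /=.
  by apply: (sorted_leq_nth tr rf 0 srt) => //; rewrite inE //; exact: leq_ltn_trans ii' i's.
rewrite leNgt -[_ < _]/(a (nth 0 s j)) -[in RHS](cat_take_drop j s) count_cat.
have [js|sj] := leqP (size s) j.
  rewrite nth_default // /a ltNge y0 /= drop_oversize // addn0 take_oversize //.
  by rewrite ltnS (leq_trans (count_size _ _)).
have st : size (take j s) = j by rewrite size_takel // ltnW.
case: (boolP (a (nth 0 s j))) => aj.
  symmetry; apply/negbTE; rewrite -leqNgt (drop_nth 0 sj) /= aj.
  suff /eqP -> : count a (take j s) == size (take j s) by rewrite st addnA addn1 leq_addr.
  rewrite -all_count; apply/(all_nthP 0) => i; rewrite st => ij.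
  by rewrite nth_take //; apply: anti aj; apply: mono => //; exact: ltnW.
rewrite /= (_ : count a (drop j s) = 0)%N ?addn0; last first.
  apply/eqP; rewrite -leqn0 leqNgt -has_count; apply/negP => /(has_nthP 0)[i].
  rewrite size_drop ltn_subRL nth_drop => ij h; move/negP: aj; apply.
  by apply: anti h; apply: mono => //; exact: leq_addr.
by rewrite ltnS -{2}st count_size.
Qed.

(** * The radius of convergence of the composed series *)

Lemma sum_horner_le (R : realFieldType) (f : {poly R}) (r : R) N : 0 <= r ->
  (forall i, 0 <= f`_i) -> \sum_(i < N) f`_i * r ^+ i <= f.[r].
Proof.
move=> r0 f0; rewrite (horner_coef_wide r (leq_maxr N (size f))).
rewrite -!(big_mkord xpredT (fun i => f`_i * r ^+ i)).
rewrite [leRHS](big_cat_nat _ (n := N)) ?leq_maxl //= lerDl sumr_ge0 // => i _.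
by rewrite mulr_ge0 // exprn_ge0.
Qed.

Definition partial_coef (R : realType) (v w : nat -> R) (n K : nat) : R :=
  \sum_(1 <= k < K) v k * (law_poly w n ^+ k)`_n.

Section radius.
Context {R : realType}.
Variables (v w : nat -> R).
Hypotheses (v0 : forall i, 0 <= v i) (w0 : forall i, 0 <= w i).
Hypothesis u_fin : forall n, (gibbs_coef_ereal v w n < +oo)%E.
Notation u := (gibbs_coef v w).

Let law_coef_ge0 N k i : 0 <= (law_poly w N ^+ k)`_i.
Proof. by apply: coef_expr_ge0 => l; rewrite coef_poly; case: ifP. Qed.

Lemma gibbs_coef_cvg n : partial_coef v w n @ \oo --> u n.
Proof.
pose c k := if k is 0%N then 0 else v k * (law_poly w n ^+ k)`_n.
have c0 k : 0 <= c k by case: k => //= k; rewrite mulr_ge0 // law_coef_ge0.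
have cE : gf c 1%:E = gibbs_coef_ereal v w n.
  rewrite /gf nneseries_recl //; last first.
    by move=> k _; rewrite -EFin_expe -EFinM lee_fin mulr_ge0 // exprn_ge0.
  rewrite mul0e add0e /gibbs_coef_ereal; congr (limn _); apply/funext => K.
  apply: eq_big_nat => -[//|k] _.
  by rewrite /c -EFin_expe expr1n mule1 law_poly_tuples.
have [s sE cv] := gf_finite c0 ler01 (eq_ind_r (fun z => z < +oo)%E (u_fin n) cE).
have -> : u n = s by rewrite /gibbs_coef -cE sE.
apply: cvg_near_eq cv _; exists 1%N => // -[|K] //= _.
rewrite /partial_coef /series /= big_nat_recl // mul0r add0r big_add1 /=.
by apply: eq_bigr => k _; rewrite expr1n mulr1.
Qed.

Lemma partial_coef_nd n : nondecreasing_seq (partial_coef v w n).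
Proof.
apply/nondecreasing_seqP => -[|K]; first by rewrite /partial_coef !big_geq.
by rewrite /partial_coef [leRHS]big_nat_recr //= lerDl mulr_ge0 // law_coef_ge0.
Qed.

Lemma partial_coef_le n K : partial_coef v w n K <= u n.
Proof.
have cv := @gibbs_coef_cvg n.
by rewrite -(cvg_lim _ cv) //; apply: nondecreasing_cvgn_le (@partial_coef_nd n) (cvgP _ cv) K.
Qed.

Lemma gibbs_coef_ge0 n : 0 <= u n.
Proof. by apply: le_trans (partial_coef_le n 0); rewrite /partial_coef big_geq. Qed.

Lemma term_le_gibbs_coef n k : (0 < k)%N -> v k * (law_poly w n ^+ k)`_n <= u n.
Proof.
move=> k0; apply: le_trans (partial_coef_le n k.+1).
rewrite /partial_coef big_nat_recr //= lerDr sumr_ge0 // => i _.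
by rewrite mulr_ge0 // law_coef_ge0.
Qed.

Variables (rho : R) (q : nat -> R).
Hypotheses (rho0 : 0 < rho) (qE : forall k, q k = v k * rho ^+ k).
Hypothesis (q_smooth : smooth_weights q).

(** The exponential growth of (s / rho)^k beats the polynomial lower bound on
    v k rho^k. *)
Lemma weights_unbounded (s B : R) : rho < s -> exists2 k, (0 < k)%N & B < v k * s ^+ k.
Proof.
move=> rs; have s0 := lt_trans rho0 rs.
have [A [C [A0 C0 HC]]] := weight_poly q_smooth.
have c0 : 0 < ln (s / rho) by rewrite ln_gt0 // ltr_pdivlMr // mul1r.
have A1 : 0 < A + 1 by rewrite addr_gt0.
have hp l : (rho / s) ^+ l <= 1 * expR (- (ln (s / rho) * l%:R)).
  rewrite mul1r expRN expRM_natr lnK ?posrE ?divr_gt0 // -exprVn invf_div //.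
have [D D0 HD] := exponential_rapid c0 ltr01 A1 hp.
pose k := (Num.truncn `|B * (C * D)|).+1.
exists k => //; have kR : 0 < k%:R :> R by rewrite ltr0n.
have hk : B * (C * D) < k%:R by apply: le_lt_trans (ler_norm _) (truncnS_gt _).
have [_ h1] := HC k isT; have h2 := HD k isT.
have E : v k * s ^+ k = q k / (rho / s) ^+ k.
  rewrite qE expr_div_n invf_div mulrA mulrAC -mulrA.
  by rewrite -mulrA (mulrA (rho ^+ k)) divff ?mul1r // gt_eqF // exprn_gt0.
have rk : 0 < (rho / s) ^+ k by rewrite exprn_gt0 // divr_gt0.
rewrite E ltr_pdivlMr // mulrC.
have [B0|B0] := leP B 0.
  apply: (@le_lt_trans _ _ 0); first by rewrite mulr_ge0_le0 // ltW.
  exact: weight_gt0 q_smooth _ _.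
apply: lt_le_trans h1.
apply: (@le_lt_trans _ _ (D * k%:R `^ (- (A + 1)) * B)); first by rewrite ler_wpM2r // ltW.
rewrite opprD powRDl // powR_inv1 ?(ltW kR) //.
have kA : 0 < k%:R `^ (- A) :> R by rewrite powR_gt0.
rewrite [X in X < _](_ : _ = k%:R `^ (- A) * (D * B / k%:R)); last by ring.
rewrite [ltLHS]mulrC ltr_pM2r // ltr_pdivrMr // [ltRHS]mulrC ltr_pdivlMr //.
by rewrite (_ : D * B * C = B * (C * D)) //; ring.
Qed.

(** If a partial sum W_M (r) of W exceeds rho, the single terms v k W_M (r)^k of
    the composition are already unbounded. *)
Lemma gf_gibbs_finite_le (r : R) : 0 <= r -> (gf u r%:E < +oo)%E ->
  (gf w r%:E <= rho%:E)%E.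
Proof.
move=> r0 /(gf_finite gibbs_coef_ge0 r0)[B uB _].
apply/gf_le => // M; rewrite leNgt; apply/negP => rs.
have [k k0 Bk] := weights_unbounded B rs.
pose Q := \poly_(m < M) w m.
have QE : Q.[r] = \sum_(m < M) w m * r ^+ m by rewrite horner_poly.
have Q0 i : 0 <= Q`_i by rewrite coef_poly; case: ifP.
pose N := (M.-1 * k).+1.
have szN : (size (Q ^+ k) <= N)%N.
  apply: leq_trans (size_poly_exp_leq _ _) _; rewrite ltnS leq_mul2r.
  by apply/orP; right; rewrite -!subn1 leq_sub2r // size_poly.
have uB' : \sum_(n < N) u n * r ^+ n <= B.
  by move: N {szN}; apply/gf_le; rewrite ?uB //; exact: gibbs_coef_ge0.
move: Bk; rewrite ltNge => /negP; apply; apply: le_trans uB'.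
rewrite -QE -horner_exp (horner_coef_wide _ szN) mulr_sumr; apply: ler_sum => n _.
rewrite mulrA ler_wpM2r ?exprn_ge0 //; apply: le_trans (term_le_gibbs_coef n k0).
rewrite ler_wpM2l //.
have h : lecoef n (Q ^+ k) (law_poly w n ^+ k).
  apply: lecoefX => i iN; first by rewrite coef0.
  by rewrite !coef_poly ltnS iN; case: ifP.
exact: h.
Qed.

(** U(r) is at most the sum of the v k W(r)^k, hence of the q k. *)
Lemma gf_gibbs_le_finite (r Bq : R) : 0 <= r ->
  (forall K, \sum_(1 <= k < K) q k <= Bq) -> (gf w r%:E <= rho%:E)%E ->
  (gf u r%:E < +oo)%E.
Proof.
move=> r0 HB wr; apply: (@le_lt_trans _ _ Bq%:E); last exact: ltry.
apply/(gf_le _ gibbs_coef_ge0 r0) => N.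
have cv : (fun K => \sum_(n < N) partial_coef v w n K * r ^+ n) @ \oo -->
    \sum_(n < N) u n * r ^+ n.
  elim: N => [|N IH].
    by under eq_fun do rewrite big_ord0; rewrite big_ord0; exact: cvg_cst.
  under eq_fun do rewrite big_ord_recr; rewrite big_ord_recr /=.
  by apply: cvgD => //; apply: cvgM; [exact: gibbs_coef_cvg | exact: cvg_cst].
rewrite -(cvg_lim _ cv) //; apply: limr_le; first exact: cvgP cv.
apply: nearW => K; apply: le_trans (HB K).
rewrite /partial_coef; under eq_bigr do rewrite mulr_suml.
rewrite exchange_big /=; apply: ler_sum => k _; rewrite qE.
under eq_bigr do rewrite -mulrA.
rewrite -mulr_sumr ler_wpM2l //.
apply: (@le_trans _ _ (law_poly w N ^+ k).[r]); last first.
  rewrite horner_exp horner_poly lerXn2r ?nnegrE ?(ltW rho0) //.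
    by rewrite sumr_ge0 // => i _; rewrite mulr_ge0 // exprn_ge0.
  by move: N.+1 => M; move: M; apply/gf_le.
apply: (@le_trans _ _ (\sum_(n < N) (law_poly w N ^+ k)`_n * r ^+ n)); last first.
  by apply: sum_horner_le => // i; exact: law_coef_ge0.
apply: ler_sum => n _; rewrite ler_wpM2r ?exprn_ge0 //.
have h : lecoef n (law_poly w n ^+ k) (law_poly w N ^+ k).
  apply: lecoefX => i iN; rewrite ?coef0 !coef_poly ?ltnS; first by case: ifP.
  by rewrite iN (leq_trans iN) // ltnW.
exact: h.
Qed.

Lemma conv_radius_gibbs (Bq : R) : (forall K, \sum_(1 <= k < K) q k <= Bq) ->
  conv_radius u = ereal_sup [set r%:E | r in [set r : R | 0 <= r /\ (gf w r%:E <= rho%:E)%E]].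
Proof.
move=> HB; rewrite /conv_radius; congr ereal_sup; apply/seteqP; split => z [r [r0 h] <-].
  by exists r => //; split => //; exact: gf_gibbs_finite_le.
by exists r => //; split => //; exact: gf_gibbs_le_finite HB h.
Qed.

(** If w 0 = rho, the coefficients v k C(k, m) w_0^(k - m) w_l^m of x^(m l) would be
    unbounded in k for m large. *)
Lemma w0_lt l : (0 < l)%N -> 0 < w l -> w 0%N < rho.
Proof.
move=> l0 wl.
have w0le : w 0%N <= rho.
  have : (gf w 0%:E <= rho%:E)%E.
    apply: gf_gibbs_finite_le => //; apply: (@le_lt_trans _ _ (u 0%N)%:E); last exact: ltry.
    apply/(gf_le _ gibbs_coef_ge0 (lexx 0)) => -[|N].
      by rewrite big_ord0; exact: gibbs_coef_ge0.
    rewrite big_ord_recl big1 ?addr0 ?expr0 ?mulr1 // => i _.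
    by rewrite expr0n /= mulr0.
  move/(gf_le _ w0 (lexx 0))/(_ 1%N).
  by rewrite big_ord_recl big_ord0 addr0 expr0 mulr1.
rewrite lt_neqAle w0le andbT; apply/eqP => w0E.
have [A [C [A0 C0 HC]]] := weight_poly q_smooth.
pose m := (Num.truncn A).+2; pose n := (m * l)%N.
have mA : A + 1 <= m%:R by rewrite /m -natr1 lerD2r ltW // truncnS_gt.
have bnd k : (2 * m <= k)%N -> k%:R <= 2 ^+ m * m`!%:R * (C * (rho ^+ m / w l ^+ m) * u n).
  move=> mk; have k0 : (0 < k)%N by apply: leq_trans mk; rewrite muln_gt0.
  have kR : 0 < k%:R :> R by rewrite ltr0n.
  have mk' : (m <= k)%N by apply: leq_trans mk; rewrite leq_pmull.
  have c1 : (w 0%N ^+ (k - m) * w l ^+ m) *+ 'C(k, m) <= (law_poly w n ^+ k)`_n.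
    have h : lecoef n (((w 0%N)%:P + (w l)%:P * 'X^l) ^+ k) (law_poly w n ^+ k).
      have E i : ((w 0%N)%:P + (w l)%:P * 'X^l)`_i =
          if i == 0%N then w 0%N else if i == l then w l else 0.
        rewrite coefD coefC coefCM coefXn; case: eqP => [->|_].
          by rewrite (ltn_eqF l0) mulr0 addr0.
        by rewrite add0r; case: eqP; rewrite ?mulr1 ?mulr0.
      apply: lecoefX => i iN; rewrite ?coef0 E.
        by case: ifP => // _; case: ifP.
      rewrite coef_poly ltnS iN; case: eqP => [-> //|_]; case: eqP => [-> //|_].
      exact: w0.
    apply: le_trans (h n (leqnn n)); rewrite exprDn coef_sum.
    have mk1 : (m < k.+1)%N by rewrite ltnS.
    rewrite (bigD1 (Ordinal mk1)) //= coefMn exprMn -!rmorphXn /= coefCM coefCM -exprM coefXn.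
    rewrite mulnC eqxx mulr1 lerDl sumr_ge0 // => i _.
    rewrite exprMn -!rmorphXn /= coefMn coefCM coefCM -exprM coefXn.
    by rewrite mulrn_wge0 // !mulr_ge0 // exprn_ge0.
  have fk i : (i <= m)%N -> (k%:R / 2) ^+ i <= (k ^_ i)%:R :> R.
    elim: i => [|i IH] im; first by rewrite expr0 ffactn0.
    rewrite exprSr ffactnSr natrM ler_pM ?exprn_ge0 ?IH ?(ltnW im) //.
    have ik : (2 * i <= k)%N by apply: leq_trans mk; rewrite leq_mul2l ltnW.
    rewrite natrB; last by apply: leq_trans ik; rewrite leq_pmull.
    move: ik; rewrite -(ler_nat R) natrM; lra.
  have h1 := le_trans (ler_wpM2l (v0 k) c1) (term_le_gibbs_coef n k0).
  have [_ h2] := HC k k0; rewrite qE in h2.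
  have wm : 0 < w l ^+ m by rewrite exprn_gt0.
  have rm : 0 < rho ^+ m by rewrite exprn_gt0.
  have fm : 0 < m`!%:R :> R by rewrite ltr0n fact_gt0.
  have h3 : (k%:R / 2) ^+ m / m`!%:R <= 'C(k, m)%:R :> R.
    by rewrite ler_pdivrMr // -natrM bin_ffact fk.
  have h4 : v k * rho ^+ k * (w l ^+ m / rho ^+ m) * 'C(k, m)%:R <= u n.
    apply: le_trans h1; rewrite w0E -mulr_natr le_eqVlt; apply/orP; left; apply/eqP.
    rewrite -[in rho ^+ k](subnK mk') exprD; field.
    by rewrite gt_eqF.
  have h5 : C^-1 * k%:R `^ (- A) * (w l ^+ m / rho ^+ m) * ((k%:R / 2) ^+ m / m`!%:R) <= u n.
    apply: le_trans h4; apply: ler_pM => //.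
    + rewrite mulr_ge0 ?divr_ge0 ?(ltW wm) ?(ltW rm) // mulr_ge0 ?powR_ge0 //.
      by rewrite invr_ge0 ltW.
    + by rewrite ler_wpM2r // divr_ge0 ?(ltW wm) ?(ltW rm).
  have h6 : k%:R <= k%:R `^ (- A) * k%:R ^+ m.
    rewrite -powR_mulrn ?(ltW kR) // -powRDl // -[leLHS](powRr1 (ltW kR)).
    by apply: ler_powR; [rewrite ler1n | lra].
  apply: le_trans h6 _; move: h5; rewrite expr_div_n.
  have t2 : 0 < 2 ^+ m :> R by rewrite exprn_gt0.
  move: (k%:R `^ _) (k%:R ^+ m) (w l ^+ m) (rho ^+ m) (m`!%:R) (2 ^+ m) wm rm fm t2.
  move=> a z e f g h e0 f0 g0 hh0 H.
  have P : 0 < C^-1 * (e / f) / h / g by rewrite !divr_gt0 // ?mulr_gt0 ?invr_gt0 // divr_gt0.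
  rewrite -(ler_pM2l P).
  rewrite (_ : _ * (a * z) = C^-1 * a * (e / f) * (z / h / g)); last by ring.
  apply: le_trans H _; rewrite le_eqVlt; apply/orP; left; apply/eqP; field.
  by rewrite !gt_eqF.
pose D := 2 ^+ m * m`!%:R * (C * (rho ^+ m / w l ^+ m) * u n).
pose k := (2 * m + (Num.truncn `|D|).+1)%N.
have := bnd k (leq_addr _ _); rewrite leNgt => /negP; apply.
apply: le_lt_trans (ler_norm _) _; apply: lt_le_trans (truncnS_gt _) _.
by rewrite ler_nat leq_addl.
Qed.

End radius.

Section tilting_radius.
Context {R : realType}.
Implicit Types (w : nat -> R).

Lemma bernoulli_ineq (d : R) M : 0 <= d -> d <= 1 -> 1 - M%:R * d <= (1 - d) ^+ M.
Proof.
move=> d0 d1; elim: M => [|M IH]; first by rewrite mul0r subr0 expr0.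
have d2 : 0 <= 1 - d by lra.
rewrite exprS; apply: le_trans (ler_wpM2l d2 IH).
rewrite -natr1; have : 0 <= M%:R * d * d by rewrite !mulr_ge0.
by move: (M%:R) => z; lra.
Qed.

(** Bernoulli's inequality gives an explicit modulus of lower semicontinuity. *)
Lemma partial_sum_shrink w (x rho : R) M : (forall i, 0 <= w i) -> 0 < x -> 0 < rho ->
  rho < \sum_(i < M) w i * x ^+ i ->
  exists y, [/\ 0 <= y, y < x & rho < \sum_(i < M) w i * y ^+ i].
Proof.
move=> w0 x0 rho0 h; set S := \sum_(i < M) w i * x ^+ i in h *.
have S0 : 0 < S by exact: lt_trans h.
pose d := (1 - rho / S) / (2 * (M%:R + 1)).
have rS : rho / S < 1 by rewrite ltr_pdivrMr // mul1r.
have rS0 : 0 < rho / S by rewrite divr_gt0.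
have M1 : 0 < 2 * (M%:R + 1) :> R by rewrite mulr_gt0 // ltr_wpDl.
have d0 : 0 < d by rewrite divr_gt0 // subr_gt0.
have dE : d * (2 * (M%:R + 1)) = 1 - rho / S by rewrite divfK // gt_eqF.
have Md : 0 <= M%:R * d by rewrite mulr_ge0 // ltW.
have dE' : d * (2 * (M%:R + 1)) = 2 * (M%:R * d) + 2 * d by ring.
have d1 : d < 1 by lra.
exists ((1 - d) * x); split.
- by rewrite mulr_ge0 ?(ltW x0) //; lra.
- by rewrite gtr_pMl //; lra.
have b := bernoulli_ineq M (ltW d0) (ltW d1).
have h2 : rho / S < (1 - d) ^+ M by lra.
apply: (@lt_le_trans _ _ ((1 - d) ^+ M * S)).
  by rewrite -ltr_pdivrMr.
rewrite /S mulr_sumr; apply: ler_sum => i _.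
rewrite exprMn mulrCA ler_wpM2l // ler_wpM2r ?exprn_ge0 ?(ltW x0) //.
by apply: ler_wiXn2l; [lra | lra | exact: ltnW].
Qed.

Lemma expr_convex (x y t : R) m : 0 <= x -> x <= y -> 0 <= t -> t <= 1 ->
  (x + t * (y - x)) ^+ m <= (1 - t) * x ^+ m + t * y ^+ m.
Proof.
move=> x0 xy t0 t1; elim: m => [|m IH]; first by rewrite !expr0; lra.
have z0 : 0 <= x + t * (y - x) by rewrite addr_ge0 // mulr_ge0 // subr_ge0.
rewrite exprS; apply: le_trans (ler_wpM2l z0 IH) _; rewrite !exprS.
have : 0 <= t * (1 - t) * ((y - x) * (y ^+ m - x ^+ m)).
  rewrite !mulr_ge0 ?subr_ge0 // lerXn2r ?nnegrE //; exact: le_trans xy.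
by move: (x ^+ m) (y ^+ m) => X Y; rewrite -subr_ge0 => h; rewrite -subr_ge0; apply: le_trans h _;
  rewrite le_eqVlt; apply/orP; left; apply/eqP; ring.
Qed.

Lemma gf_convex w (x y t A B : R) : (forall i, 0 <= w i) -> 0 <= x -> x <= y ->
  0 <= t -> t <= 1 -> gf w x%:E = A%:E -> gf w y%:E = B%:E ->
  (gf w (x + t * (y - x))%:E <= ((1 - t) * A + t * B)%:E)%E.
Proof.
move=> w0 x0 xy t0 t1 xA yB; have y0 : 0 <= y by exact: le_trans xy.
have z0 : 0 <= x + t * (y - x) by rewrite addr_ge0 // mulr_ge0 // subr_ge0.
apply/gf_le => // N.
have hA : \sum_(i < N) w i * x ^+ i <= A by move: N; apply/gf_le; rewrite ?xA.
have hB : \sum_(i < N) w i * y ^+ i <= B by move: N {hA}; apply/gf_le; rewrite ?yB.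
have t2 : 0 <= 1 - t by lra.
apply: le_trans (lerD (ler_wpM2l t2 hA) (ler_wpM2l t0 hB)).
rewrite !mulr_sumr -big_split /=; apply: ler_sum => i _.
have := ler_wpM2l (w0 i) (expr_convex i x0 xy t0 t1).
by rewrite [X in _ <= X -> _]mulrDr ![w i * (_ * _ ^+ _)]mulrCA.
Qed.

(** If rho = W(rho_w), the inequality W <= rho holds up to rho_w, where the
    radius of convergence of W ends. *)
Lemma sup_critical w (rho rho_w : R) : (forall i, 0 <= w i) -> 0 <= rho_w ->
  conv_radius w = rho_w%:E -> gf w rho_w%:E = rho%:E ->
  ereal_sup [set r%:E | r in [set r : R | 0 <= r /\ (gf w r%:E <= rho%:E)%E]] = rho_w%:E.
Proof.
move=> w0 rw0 cr gw; apply/eqP; rewrite eq_le; apply/andP; split.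
  apply: ge_ereal_sup => _ [r [r0 hr] <-]; rewrite leNgt; apply/negP => h.
  by move: hr; rewrite (gf_outside r0) ?cr // leye_eq.
by apply: ereal_sup_ubound; exists rho_w => //=; split=> //; rewrite gw.
Qed.

(** Let r be the supremum. W (r) <= rho because the partial sums of W are
    continuous, and W (r) >= rho because otherwise convexity of W between r and
    a point where it is finite and larger than rho would let the inequality hold
    beyond r. *)
Lemma sup_subcritical w (rho : R) l : (forall i, 0 <= w i) -> 0 < rho ->
  (rho%:E < gf w (conv_radius w))%E -> (0 < l)%N -> 0 < w l -> w 0%N < rho ->
  exists r r' : R, [/\ ereal_sup [set r%:E | r in [set r : R | 0 <= r /\
      (gf w r%:E <= rho%:E)%E]] = r%:E, 0 < r, r < r',
    gf w r%:E = rho%:E & (gf w r'%:E < +oo)%E].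
Proof.
move=> w0 rho0 sub l0 wl w0r.
have gw0 : gf w 0%:E = (w 0%N)%:E.
  apply: gf_of_series => //; apply: cvg_near_eq (cvg_cst _) _.
  exists 1%N => // -[|N] //= _; rewrite /series /= big_nat_recl //= expr0 mulr1 big1 ?addr0 //.
  by move=> i _; rewrite expr0n /= mulr0.
have [r' [r'0 fin' rho']] : exists r', [/\ 0 <= r', (gf w r'%:E < +oo)%E & (rho%:E < gf w r'%:E)%E].
  move: sub (conv_radius_ge0 w0); case E: (conv_radius w) => [x| |] //= sub x0.
    rewrite lee_fin in x0.
    have [M hM] : exists M, rho < \sum_(i < M) w i * x ^+ i.
      apply/not_existsP => h; move: sub; rewrite ltNge => /negP; apply.
      by apply/gf_le => // N; rewrite leNgt; apply/negP; exact: h.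
    have xp : 0 < x.
      rewrite lt_neqAle x0 andbT; apply/eqP => x00; move: sub; rewrite -x00 gw0 lte_fin.
      by rewrite ltNge (ltW w0r).
    have [y [y0 yx hy]] := partial_sum_shrink w0 xp rho0 hM.
    exists y; split=> //; first by apply: gf_inside => //; rewrite E lte_fin.
    apply: lt_le_trans (gf_partial_le M w0 y0); by rewrite lte_fin.
  have y0 : 0 <= 1 + rho / w l by rewrite addr_ge0 // divr_ge0 // ltW.
  exists (1 + rho / w l); split=> //; first by apply: gf_inside => //; rewrite E ltry.
  apply: lt_le_trans (gf_partial_le l.+1 w0 y0); rewrite lte_fin.
  rewrite (bigD1 ord_max) //= ltr_wpDr ?sumr_ge0 //.
    by move=> i _; rewrite mulr_ge0 // exprn_ge0.
  apply: (@lt_le_trans _ _ (w l * (1 + rho / w l))).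
    by rewrite mulrDr mulr1 mulrC divfK ?gt_eqF // ltrDr.
  rewrite ler_wpM2l // -[leLHS]expr1; apply: ler_weXn2l => //.
  by rewrite lerDl divr_ge0 // ltW.
pose S := [set r : R | 0 <= r /\ (gf w r%:E <= rho%:E)%E].
have S0 : S 0 by split => //; rewrite gw0 lee_fin ltW.
have Sub : ubound S r'.
  move=> x [x0 hx]; rewrite leNgt; apply/negP => /ltW h.
  by have := lt_le_trans rho' (le_trans (gf_mono w0 r'0 h) hx); rewrite ltxx.
have hub : has_ubound S by exists r'.
pose r := sup S; have r0 : 0 <= r by apply: ub_le_sup.
have rr' : r <= r' by apply: ge_sup => //; exists 0.
have fin : (gf w r%:E < +oo)%E by apply: le_lt_trans (gf_mono w0 r0 rr') fin'.
have [A rA _] := gf_finite w0 r0 fin; have [B rB _] := gf_finite w0 r'0 fin'.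
have rhoB : rho < B by rewrite -lte_fin -rB.
have le : A <= rho.
  rewrite -lee_fin -rA; apply/gf_le => // M; rewrite leNgt; apply/negP => h.
  have [r00|rp] := eqVneq r 0.
    have : (gf w r%:E <= rho%:E)%E by rewrite r00 gw0 lee_fin ltW.
    by move/(gf_le _ w0 r0)/(_ M); rewrite leNgt h.
  have rp0 : 0 < r by rewrite lt_neqAle eq_sym rp.
  have [y [y0 yr hy]] := partial_sum_shrink w0 rp0 rho0 h.
  have [x [x0 hx] yx] : exists2 x, S x & y < x by apply: sup_gt => //; exists 0.
  have := le_trans (gf_mono w0 y0 (ltW yx)) hx.
  by move/(gf_le _ w0 y0)/(_ M); rewrite leNgt hy.
have ge : rho <= A.
  rewrite leNgt; apply/negP => h.
  have AB : 0 < B - A by lra.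
  pose t := (rho - A) / (B - A).
  have t0 : 0 < t by rewrite divr_gt0 // subr_gt0.
  have t1 : t <= 1 by rewrite ler_pdivrMr // mul1r; lra.
  have rlt : r < r'.
    rewrite lt_neqAle rr' andbT; apply/eqP => E.
    by move: rhoB; have := rA; rewrite E rB => -[->]; lra.
  have := gf_convex w0 r0 rr' (ltW t0) t1 rA rB.
  rewrite (_ : (1 - t) * A + t * B = rho); last first.
    by rewrite /t; field; rewrite gt_eqF.
  move=> h2; have : r + t * (r' - r) <= r.
    apply: ub_le_sup => //; split => //.
    by rewrite addr_ge0 // mulr_ge0 ?(ltW t0) // subr_ge0.
  rewrite gerDl leNgt => /negP; apply.
  by rewrite mulr_gt0 // subr_gt0.
have AE : A = rho by apply/eqP; rewrite eq_le le ge.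
exists r, r'; split=> //.
- by rewrite ereal_sup_EFin //; exists 0.
- rewrite lt_neqAle r0 andbT; apply/eqP => E; move: rA; rewrite -E gw0 => -[h].
  by move: w0r; rewrite h AE ltxx.
- rewrite lt_neqAle rr' andbT; apply/eqP => E.
  by move: rhoB; have := rA; rewrite E rB => -[->]; rewrite AE ltxx.
- by rewrite rA AE.
Qed.

End tilting_radius.

(** * The law of the component sizes *)

Section discrete_preimages.
Context {R : realType} (d : measure_display) (T : measurableType d).
Context (P : {measure set T -> \bar R}) (I : countType) (K : T -> I).
Hypothesis mK : forall s : I, measurable (K @^-1` [set s]).

Lemma measurable_discrete (A : set I) : measurable (K @^-1` A).
Proof.
have -> : K @^-1` A = \bigcup_i K @^-1` [set s | A s /\ pickle s = i].
  apply/seteqP; split => o /=; first by move=> Ao; exists (pickle (K o)).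
  by move=> [i _ []].
apply: bigcup_measurable => i _.
have [[s [As si]]|no] := pselect (exists s, A s /\ pickle s = i).
  rewrite (_ : [set s | _] = [set s]); first exact: mK.
  apply/seteqP; split => t /=; last by move=> ->.
  by move=> [_ ti]; apply: (pcan_inj (@pickleK I)); rewrite ti si.
rewrite (_ : [set s | _] = set0) ?preimage_set0 //.
by apply/seteqP; split => t //= ht; apply: no; exists t.
Qed.

Lemma measure_discrete_seq (r : seq I) : uniq r ->
  P (K @^-1` [set` r]) = (\sum_(s <- r) P (K @^-1` [set s]))%E.
Proof.
elim: r => [_|s r IH /= /andP[sr ur]].
  by rewrite set_nil preimage_set0 measure0 big_nil.
have -> : [set` s :: r] = [set s] `|` [set` r].
  apply/seteqP; split => t /=; rewrite in_cons; first by move=> /predU1P[]; [left|right].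
  by move=> [->|->]; rewrite ?eqxx ?orbT.
rewrite big_cons -IH // preimage_setU measureU //; try exact: measurable_discrete.
by apply/seteqP; split => o //= [] /= -> sr'; move: sr; rewrite sr'.
Qed.

End discrete_preimages.

Section component_law.
Context {R : realType} (v w : nat -> R) (n : nat).
Context (d : measure_display) (T : measurableType d) (P : probability T R).
Context (K : T -> seq nat).
Hypotheses (v0 : forall i, 0 <= v i) (w0 : forall i, 0 <= w i).
Hypothesis u_fin : forall m, (gibbs_coef_ereal v w m < +oo)%E.
Hypothesis u0 : 0 < gibbs_coef v w n.
Hypothesis K_law : gibbs_component_sizes v w n P K.
Notation u := (gibbs_coef v w n).

Let mK : forall s : seq nat, measurable (K @^-1` [set s]) := K_law.1.

Lemma sumn_tuple k (t : k.-tuple 'I_n.+1) : sumn (map val t) = (\sum_(i < k) tnth t i)%N.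
Proof. by rewrite sumnE big_map big_tuple. Qed.

Lemma composition_law k (Q : pred (seq nat)) : (0 < k)%N ->
  P (K @^-1` [set s | [/\ size s = k, sumn s = n & Q s]]) =
  (v k * (\sum_(t : k.-tuple 'I_n.+1 | ((\sum_(i < k) tnth t i)%N == n) && Q (map val t))
    \prod_(i < k) w (tnth t i)) / u)%:E.
Proof.
move=> k0; pose c (t : k.-tuple 'I_n.+1) := ((\sum_(i < k) tnth t i)%N == n) && Q (map val t).
pose r := [seq map val (tval t) | t <- enum c].
have ur : uniq r.
  rewrite map_inj_uniq ?enum_uniq // => t t' /(inj_map val_inj) h; exact: val_inj.
have -> : [set s | [/\ size s = k, sumn s = n & Q s]] = [set` r].
  apply/seteqP; split => s /=.
    move=> [sk sn Qs].
    have sle l : l \in s -> (l < n.+1)%N.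
      by move=> ls; rewrite ltnS -sn sumnE (big_rem l) //= leq_addr.
    have st : size (map (@inord n) s) == k by rewrite size_map sk.
    have E : map val (Tuple st) = s.
      rewrite /= -map_comp -[RHS]map_id; apply/eq_in_map => l ls /=.
      by rewrite inordK // sle.
    apply/mapP; exists (Tuple st) => //; rewrite mem_enum; apply/andP.
    by rewrite -sumn_tuple E sn eqxx.
  move=> /mapP[t]; rewrite mem_enum => /andP[/eqP tn Qt] ->.
  by split => //; [rewrite size_map size_tuple | rewrite sumn_tuple].
rewrite measure_discrete_seq // big_map big_enum_cond /=.
rewrite mulr_sumr mulr_suml -sumEFin; apply: eq_big => [t|t]; first by rewrite andbT.
rewrite andbT => /andP[/eqP tn _].
rewrite K_law.2 ?size_map ?size_tuple ?sumn_tuple //.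
by rewrite big_map big_tuple.
Qed.

Definition realized (Q : pred (seq nat)) (M : nat) : set T :=
  K @^-1` [set s | [/\ (0 < size s)%N, (size s < M)%N, sumn s = n & Q s]].

Lemma measurable_realized Q M : measurable (realized Q M).
Proof. by apply: measurable_discrete; exact: mK. Qed.

Lemma realized_law Q M : P (realized Q M) =
  (\sum_(1 <= k < M) v k * (\sum_(t : k.-tuple 'I_n.+1 |
    ((\sum_(i < k) tnth t i)%N == n) && Q (map val t)) \prod_(i < k) w (tnth t i)) / u)%:E.
Proof.
elim: M => [|[|M] IH].
- rewrite big_geq // (_ : realized Q 0 = set0) ?measure0 //.
  by apply/seteqP; split => o //= [].
- rewrite big_geq // (_ : realized Q 1 = set0) ?measure0 //.
  by apply/seteqP; split => o //= [] h1; rewrite ltnS leqn0 => /eqP h2; rewrite h2 in h1.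
rewrite big_nat_recr //= EFinD -IH -composition_law //.
rewrite -measureU ?measurable_realized //.
- congr (P _); apply/seteqP; split => o.
    move=> [s0 sM sn Qs]; move: sM; rewrite ltnS leq_eqVlt => /predU1P[sE|sM].
      by right; split.
    by left; split.
  move=> [[s0 sM sn Qs]|[sE sn Qs]]; split => //; first by rewrite (leq_trans sM).
    by rewrite sE.
  by rewrite sE.
- exact: measurable_realized.
- by apply: measurable_discrete; exact: mK.
- apply/seteqP; split => o //= [[_ sM _ _] [sE _ _]].
  by rewrite sE ltnn in sM.
Qed.

Lemma realized_cvg Q : (P \o realized Q) @ \oo --> P (\bigcup_M realized Q M).
Proof.
apply: nondecreasing_cvg_mu.
- by move=> M; exact: measurable_realized.
- by apply: bigcup_measurable => M _; exact: measurable_realized.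
- move=> M M' MM; apply/subsetPset => o /= [h1 h2 h3 h4]; split => //.
  exact: leq_trans MM.
Qed.

(** The masses of the compositions of n sum to 1, so the sizes almost surely form
    one of them. *)
Lemma realized_total : P (\bigcup_M realized xpredT M) = 1%E.
Proof.
apply: (cvg_unique _ (@realized_cvg xpredT)) => //=.
have cv : partial_coef v w n M / u @[M --> \oo] --> (1 : R).
  rewrite -(divff (_ : u != 0)) ?gt_eqF //.
  by apply: cvgM; [exact: gibbs_coef_cvg | exact: cvg_cst].
have : (partial_coef v w n M / u)%:E @[M --> \oo] --> 1%:E.
  by apply: cvg_EFin; [exact: nearW | exact: cv].
apply: cvg_trans; apply: near_eq_cvg; apply: nearW => M /=.
rewrite realized_law /partial_coef mulr_suml; congr EFin; apply: eq_bigr => k _.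
by rewrite law_poly_tuples; congr (_ * _ / _); apply: eq_bigl => t; rewrite andbT.
Qed.

(** The compositions with at most j parts larger than y, weighted by the product
    of w over their parts, are counted by [few]. *)
Lemma nth_largest_law j (y : R) : 0 <= y ->
  (fun M => \sum_(1 <= k < M) v k *
     (few (small_poly w n y) (large_poly w n y) j.+1 k)`_n) @ \oo -->
  fine (P [set o | (nth_largest (K o) j.+1)%:R <= y]) * u.
Proof.
move=> y0; pose Q : pred (seq nat) := fun s => (nth_largest s j.+1)%:R <= y.
have mE : measurable (K @^-1` [set s | Q s]) by apply: measurable_discrete; exact: mK.
have mH : measurable (\bigcup_M realized xpredT M).
  by apply: bigcup_measurable => M _; exact: measurable_realized.
have PE : P (K @^-1` [set s | Q s]) = P (\bigcup_M realized Q M).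
  rewrite -(setIT (K @^-1` _)) -(setUv (\bigcup_M realized xpredT M)) setIUr measureU.
  - rewrite [X in _ + X](_ : _ = 0)%E ?adde0.
      congr (P _); apply/seteqP; split => o.
        by move=> [/= Qo [M _ [h1 h2 h3 _]]]; exists M.
      by move=> [M _ [h1 h2 h3 h4]]; split => //; exists M.
    apply/eqP; rewrite eq_le measure_ge0 andbT.
    apply: (@le_trans _ _ (P (~` \bigcup_M realized xpredT M))).
      apply: le_measure; rewrite ?inE //.
      + by apply: measurableI => //; exact: measurableC.
      + exact: measurableC.
    by rewrite probability_setC // realized_total subee.
  - exact: measurableI.
  - by apply: measurableI => //; exact: measurableC.
  - by rewrite setIACA setIid setICr setI0.
have cv := @realized_cvg Q; rewrite -PE in cv.
have pfin : P (K @^-1` [set s | Q s]) \is a fin_num by exact: fin_num_measure.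
rewrite -[P (K @^-1` _)]fineK // in cv.
have cv' : (fine \o (P \o realized Q)) @ \oo --> fine (P (K @^-1` [set s | Q s])).
  by apply: fine_cvg.
have : fine (P (realized Q M)) * u @[M --> \oo] --> fine (P (K @^-1` [set s | Q s])) * u.
  by apply: cvgM; [exact: cv' | exact: cvg_cst].
apply: cvg_trans; apply: near_eq_cvg; apply: nearW => M /=.
rewrite realized_law /= mulr_suml; apply: eq_bigr => k _.
rewrite divfK ?gt_eqF // few_tuples; congr (_ * _).
apply: eq_bigl => t; rewrite /Q nth_largest_le //; congr (_ && (_ < _)%N).
by rewrite -sumn_count sumnE !big_map big_tuple.
Qed.

End component_law.

(** * The limit law of the large components *)

Lemma mul_tail_mass_cvg0 (R : realType) (p : nat -> R) (mu : R) : step_law p mu ->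
  n%:R * tail_mass p n @[n --> \oo] --> (0 : R).
Proof.
move=> lawp; have p0 := step_ge0 lawp; have p1 := step_sum1 lawp.
apply/cvgrPdist_le => /= e e0; have /cvgrPdist_le/(_ _ e0)[N _ H] := step_mean lawp.
exists N => // n /= Nn; rewrite sub0r normrN ger0_norm; last first.
  by rewrite mulr_ge0 // tail_mass_ge0.
have := @mul_tail_le R p p0 p1 mu (step_mean lawp) n.
move=> h; apply: le_trans h _; have := H n.+1 (leqW Nn).
by rewrite /series /= big_mkord; apply: le_trans; exact: ler_norm.
Qed.

Lemma large_poly_cvg (R : realType) (p : nat -> R) (mu l : R) (y : nat -> R) :
  step_law p mu -> (forall n, 0 <= y n) ->
  n%:R * tail_mass p (Num.truncn (y n)) @[n --> \oo] --> l ->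
  n%:R * (large_poly p n (y n)).[1] @[n --> \oo] --> l.
Proof.
move=> lawp y0 h; apply/cvgrPdist_le => /= e e0.
have e2 : 0 < e / 2 by rewrite divr_gt0.
have /cvgrPdist_le/(_ _ e2) h1 := h.
have /cvgrPdist_le/(_ _ e2) h2 := mul_tail_mass_cvg0 lawp.
near=> n.
have b1 : `|l - n%:R * tail_mass p (Num.truncn (y n))| <= e / 2 by near: n; exact: h1.
have b2 : `|0 - n%:R * tail_mass p n| <= e / 2 by near: n; exact: h2.
have b3 := large_poly_tail n (step_ge0 lawp) (step_sum1 lawp) (y0 n).
have b4 : n%:R * `|(large_poly p n (y n)).[1] - tail_mass p (Num.truncn (y n))| <= e / 2.
  apply: le_trans (ler_wpM2l (ler0n _ _) b3) _; apply: le_trans b2.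
  by rewrite sub0r normrN ler_norm.
rewrite (_ : l - _ = (l - n%:R * tail_mass p (Num.truncn (y n))) -
  n%:R * ((large_poly p n (y n)).[1] - tail_mass p (Num.truncn (y n)))); last by ring.
apply: le_trans (ler_normB _ _) _; rewrite normrM (ger0_norm (ler0n _ _)).
by rewrite (splitr e) lerD.
Unshelve. all: by end_near.
Qed.

Section largest_components.
Context {R : realType}.
Variables (v w : nat -> R) (p q : nat -> R) (r rho mu : R).
Hypotheses (v0 : forall i, 0 <= v i) (w0 : forall i, 0 <= w i).
Hypothesis u_fin : forall n, (gibbs_coef_ereal v w n < +oo)%E.
Context (dP : nat -> measure_display) (Omega : forall n, measurableType (dP n)).
Context (P : forall n, probability (Omega n) R) (K : forall n, Omega n -> seq nat).
Hypothesis K_law : forall n, (0 < n)%N -> 0 < gibbs_coef v w n ->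
  gibbs_component_sizes v w n (P n) (@K n).
Hypotheses (r0 : 0 < r) (pw : forall l, p l * rho = w l * r ^+ l)
  (qE : forall k, q k = v k * rho ^+ k).
Hypotheses (lawp : step_law p mu) (smq : smooth_weights q) (negl : negligible_jumps p q).
Notation u := (gibbs_coef v w).

(** Both u n and u n times the probability that K_(j+1) <= y n are sums over the
    number of steps, asymptotic to 1 / mu and to poisson_below / mu times the
    weight of the typical number of steps. *)
Theorem nth_largest_limit (j : nat) (lam : R) (y : nat -> R) :
  0 <= lam -> (forall n, 0 <= y n) ->
  n%:R * tail_mass p (Num.truncn (y n)) @[n --> \oo] --> mu * lam ->
  P n [set o | (nth_largest (@K n o) j.+1)%:R <= y n]
    @[n --> within [set n | 0 < u n] \oo] --> (poisson_below j.+1 lam)%:E.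
Proof.
move=> lam0 y0 ytail.
have mu0 := mean_gt0 lawp; have m0 : 0 < mu := mu0.
pose pr n := fine (P n [set o | (nth_largest (@K n o) j.+1)%:R <= y n]).
pose phi := poisson_below j.+1 lam.
have /andP[phi0 phi1] : 0 <= phi <= 1 := poisson_below_bounds j.+1 lam0.
suff H : pr n @[n --> within [set n | 0 < u n] \oo] --> phi.
  have : (pr n)%:E @[n --> within [set n | 0 < u n] \oo] --> phi%:E.
    by apply: cvg_EFin; [exact: nearW | exact: H].
  apply: cvg_trans; apply: near_eq_cvg; rewrite near_withinE; near=> n => un.
  have n0 : (0 < n)%N by near: n; exact: nbhs_infty_gt.
  have [mK _] := K_law n0 un.
  rewrite /= /pr fineK //; apply: fin_num_measure.
  exact: (measurable_discrete mK [set s | (nth_largest s j.+1)%:R <= y n]).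
apply/cvgrPdist_le => /= e e0; rewrite near_withinE.
pose e1 := Num.min (e / (4 * mu)) (1 / (2 * mu)).
have e10 : 0 < e1 by rewrite lt_min !divr_gt0 // mulr_gt0.
have e1a : 4 * mu * e1 <= e.
  by rewrite mulrC -ler_pdivlMr ?mulr_gt0 // ge_min lexx.
have e1b : 2 * mu * e1 <= 1.
  by rewrite mulrC -ler_pdivlMr ?mulr_gt0 // ge_min lexx orbT.
have num := few_large_steps lawp smq negl lam0 (ltn0Sn j) (large_poly_cvg lawp y0 ytail) e10.
have ycvg : n%:R * tail_mass p (Num.truncn (n%:R : R)) @[n --> \oo] --> mu * 0.
  rewrite mulr0; apply: cvg_near_eq (mul_tail_mass_cvg0 lawp) _.
  by apply: nearW => n; rewrite natrK.
have den := few_large_steps lawp smq negl (lexx 0) (ltn0Sn 0)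
  (large_poly_cvg lawp (fun n => ler0n _ n) ycvg) e10.
have typ : \forall n \near \oo, (0 < typical mu n)%N.
  near=> n; rewrite truncn_gt0 // ler_pdivlMr // mul1r.
  by near: n; exact: nat_large.
near=> n => un.
have n0 : (0 < n)%N by near: n; exact: nbhs_infty_gt.
have typn : (0 < typical mu n)%N by near: n; exact: typ.
have numn : \forall K \near \oo,
    `|\sum_(1 <= k < K) q k * (few (small_poly p n (y n)) (large_poly p n (y n)) j.+1 k)`_n -
      q (typical mu n) * (phi / mu)| <= e1 * q (typical mu n) by near: n; exact: num.
have denn : \forall K \near \oo,
    `|\sum_(1 <= k < K) q k * (few (small_poly p n n%:R) (large_poly p n n%:R) 1 k)`_n -
      q (typical mu n) * (poisson_below 1 0 / mu)| <= e1 * q (typical mu n).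
  by near: n; exact: den.
move: numn denn; rewrite poisson_below0; set t := q (typical mu n) => numn denn.
have t0 : 0 < t by exact: weight_gt0 smq _ typn.
have rn : 0 < r ^+ n by rewrite exprn_gt0.
have cn : (fun M => \sum_(1 <= k < M) q k *
    (few (small_poly p n (y n)) (large_poly p n (y n)) j.+1 k)`_n) @ \oo -->
    pr n * u n * r ^+ n.
  have : (\sum_(1 <= k < M) v k * (few (small_poly w n (y n)) (large_poly w n (y n)) j.+1 k)`_n) *
      r ^+ n @[M --> \oo] --> pr n * u n * r ^+ n.
    apply: cvgM; last exact: cvg_cst.
    have := @nth_largest_law R v w n _ _ (P n) (@K n) v0 w0 u_fin un (K_law n0 un) j (y n) (y0 n).
    by apply.
  apply: cvg_trans; apply: near_eq_cvg; apply: nearW => M /=.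
  rewrite mulr_suml; apply: eq_bigr => k _.
  by rewrite -mulrA (few_tilt _ _ _ _ pw) mulrA -qE.
have cd : (fun M => \sum_(1 <= k < M) q k *
    (few (small_poly p n n%:R) (large_poly p n n%:R) 1 k)`_n) @ \oo --> u n * r ^+ n.
  have : partial_coef v w n M * r ^+ n @[M --> \oo] --> u n * r ^+ n.
    by apply: cvgM; [exact: gibbs_coef_cvg | exact: cvg_cst].
  apply: cvg_trans; apply: near_eq_cvg; apply: nearW => M /=.
  rewrite mulr_suml; apply: eq_bigr => k _; rewrite few1.
  have -> : small_poly p n n%:R = law_poly p n.
    by apply/polyP => i; rewrite !coef_poly ler_nat; case: (ltnP i n.+1); rewrite // ltnS => ->.
  by rewrite -mulrA (law_poly_tilt _ _ pw) mulrA -qE.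
have bnd (f : nat -> R) (l c : R) : f @ \oo --> l ->
    (\forall M \near \oo, `|f M - c| <= e1 * t) -> `|l - c| <= e1 * t.
  move=> fl fb.
  have h : `|f M - c| @[M --> \oo] --> `|l - c|.
    by apply: cvg_norm; apply: cvgB => //; exact: cvg_cst.
  by rewrite -(cvg_lim _ h) //; apply: limr_le => //; exact: cvgP h.
have bn := bnd _ _ _ cn numn; have bd := bnd _ _ _ cd denn.
have D : t * (1 / mu) - e1 * t <= u n * r ^+ n.
  by move: bd; rewrite ler_norml => /andP[]; lra.
have tm : t / (2 * mu) <= u n * r ^+ n.
  apply: le_trans D; have : t * (2 * mu * e1) <= t by rewrite ler_piMr // ltW.
  move=> h; rewrite -subr_ge0.
  rewrite (_ : _ - _ = (t - t * (2 * mu * e1)) / (2 * mu)); last by field; rewrite gt_eqF.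
  by rewrite divr_ge0 ?subr_ge0 // mulr_ge0 // ltW.
set U := u n * r ^+ n in tm bd *.
have U0 : 0 < U by rewrite mulr_gt0.
rewrite -(ler_pM2r U0) -[X in _ * X](ger0_norm (ltW U0)) -normrM.
have -> : (phi - pr n) * U = phi * (U - t * (1 / mu)) - (pr n * u n * r ^+ n - t * (phi / mu)).
  by rewrite /U; field; rewrite gt_eqF.
apply: le_trans (ler_normB _ _) _; rewrite normrM (ger0_norm phi0).
have b1 : phi * `|U - t * (1 / mu)| <= e1 * t.
  by apply: le_trans bd; rewrite ler_piMl.
apply: le_trans (lerD b1 bn) _.
have h1 : e * (t / (2 * mu)) <= e * U by rewrite ler_pM2l.
apply: le_trans h1; rewrite mulrA ler_pdivlMr ?mulr_gt0 //.
have := ler_wpM2r (ltW t0) e1a; lra.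
Unshelve. all: by end_near.
Qed.

End largest_components.

(** * The tilted offspring variable *)

Section generating_function_uniqueness.
Context {R : realType}.
Implicit Types (a p : nat -> R).

(** If the coefficients of lower degree agree, dividing the difference of the
    series by z^m and letting z tend to 0 compares those of degree m. *)
Let gf_coef_le a p (B : R) m : (forall i, 0 <= a i) -> (forall i, 0 <= p i) ->
  gf a 1%:E = B%:E ->
  (forall z : R, 0 <= z -> z <= 1 -> gf a z%:E = gf p z%:E) ->
  (forall l, (l < m)%N -> a l = p l) -> p m <= a m.
Proof.
move=> a0 p0 aB ap IH; apply/ler_addgt0Pr => /= e e0.
have B0 : 0 <= B by rewrite -lee_fin -aB gf_ge0.
have B1 : 0 < B + 1 by rewrite ltr_wpDl.
pose z := Num.min 1 (e / (B + 1)).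
have z0 : 0 < z by rewrite lt_min ltr01 divr_gt0.
have z1 : z <= 1 by rewrite ge_min lexx.
have zB : z * B <= e.
  apply: (@le_trans _ _ (z * (B + 1))); first by rewrite ler_wpM2l ?(ltW z0) // lerDl.
  by rewrite -ler_pdivlMr // ge_min lexx orbT.
have h1 := gf_partial_le m.+1 p0 (ltW z0); rewrite -ap ?(ltW z0) // in h1.
have h2 : (gf a z%:E <= (\sum_(l < m.+1) a l * z ^+ l + z ^+ m.+1 * B)%:E)%E.
  apply/gf_le => //; first exact: ltW.
  move=> N; have [Nm|mN] := leqP N m.+1.
    apply: (@le_trans _ _ (\sum_(l < m.+1) a l * z ^+ l)); last first.
      by rewrite lerDl mulr_ge0 ?exprn_ge0 ?(ltW z0).
    rewrite -!(big_mkord xpredT (fun l => a l * z ^+ l)) [leRHS](big_cat_nat _ (n := N)) //=.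
    by rewrite lerDl sumr_ge0 // => i _; rewrite mulr_ge0 // exprn_ge0 // ltW.
  rewrite -!(big_mkord xpredT (fun l => a l * z ^+ l)) [leLHS](big_cat_nat _ (n := m.+1)) ?(ltnW mN) //=.
  rewrite lerD2l; apply: (@le_trans _ _ (z ^+ m.+1 * \sum_(m.+1 <= l < N) a l)).
    rewrite mulr_sumr !big_nat; apply: ler_sum => l /andP[ml _].
    by rewrite mulrC ler_wpM2r // ler_wiXn2l // ltW.
  rewrite ler_wpM2l ?exprn_ge0 ?(ltW z0) //.
  have : \sum_(l < N) a l * 1 ^+ l <= B by move: N mN => N _; move: N; apply/gf_le; rewrite ?aB.
  apply: le_trans; rewrite -(big_mkord xpredT (fun l => a l * 1 ^+ l)).
  rewrite [leRHS](big_cat_nat _ (n := m.+1)) ?(ltnW mN) //=.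
  apply: (@le_trans _ _ (\sum_(m.+1 <= l < N) a l * 1 ^+ l)).
    by apply: ler_sum => l _; rewrite expr1n mulr1.
  by rewrite lerDr sumr_ge0 // => i _; rewrite expr1n mulr1.
have := le_trans h1 h2; rewrite lee_fin !big_ord_recr /=.
rewrite (eq_bigr (fun l : 'I_m => a l * z ^+ l)) => [|l _]; last by rewrite IH.
rewrite -addrA lerD2l exprS => h.
have zm : 0 < z ^+ m by rewrite exprn_gt0.
rewrite -(ler_pM2r zm); apply: le_trans h _.
by rewrite mulrDl lerD2l mulrAC ler_wpM2r // ltW.
Qed.

Lemma gf_inj a p (B : R) : (forall i, 0 <= a i) -> (forall i, 0 <= p i) ->
  gf a 1%:E = B%:E -> (forall z : R, 0 <= z -> z <= 1 -> gf a z%:E = gf p z%:E) ->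
  a =1 p.
Proof.
move=> a0 p0 aB ap m; elim/ltn_ind: m => m IH.
apply/eqP; rewrite eq_le; apply/andP; split.
  apply: (@gf_coef_le p a B) => //; first by rewrite -ap.
    by move=> z z0 z1; rewrite ap.
  by move=> l lm; rewrite IH.
exact: (@gf_coef_le a p B).
Qed.

End generating_function_uniqueness.

Section natural_variable.
Context {R : realType} (d : measure_display) (T : measurableType d).
Context (Q : probability T R) (X : {RV Q >-> nat}).

Let mX (l : nat) : measurable (X @^-1` [set l]).
Proof. by rewrite -[X in measurable X]setTI; exact: measurable_funP. Qed.

Definition point_mass (l : nat) : R := fine (Q (X @^-1` [set l])).

Lemma point_massE l : Q (X @^-1` [set l]) = (point_mass l)%:E.
Proof. by rewrite /point_mass fineK // fin_num_measure. Qed.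

Lemma point_mass_ge0 l : 0 <= point_mass l.
Proof. by rewrite -lee_fin -point_massE. Qed.

Lemma expectation_nat (f : nat -> R) : (forall l, 0 <= f l) ->
  ('E_Q[(fun o => f (X o))])%E = (\sum_(0 <= l <oo) (f l * point_mass l)%:E)%E.
Proof.
move=> f0; rewrite unlock.
have E o : (f (X o))%:E = (\sum_(0 <= l <oo) (f l)%:E * (\1_(X @^-1` [set l]) o)%:E)%E.
  apply/esym/lim_near_cst => //; near=> M.
  have XM : (X o < M)%N by near: M; exact: nbhs_infty_gt.
  rewrite (bigD1_seq (X o)) ?iota_uniq ?mem_index_iota //=.
  rewrite indicE mem_set // mule1 big1 ?adde0 // => l lX.
  by rewrite indicE memNset ?mule0 //= => /eqP; rewrite eq_sym (negbTE lX).
under eq_integral do rewrite E.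
rewrite integral_nneseries //; last 2 first.
- move=> l; apply: emeasurable_funM => //.
  by apply/measurable_EFinP; exact: measurable_indic.
- by move=> l o _; rewrite -EFinM lee_fin mulr_ge0.
apply: eq_eseriesr => l _; rewrite ge0_integralZl //.
- by rewrite integral_indic // setIT EFinM -point_massE.
- by apply/measurable_EFinP; exact: measurable_indic.
- by rewrite lee_fin.
Unshelve. all: by end_near.
Qed.

Variable (p : nat -> R).
Hypotheses (Xp : forall l, point_mass l = p l).

Lemma tail_of_variable (x : R) : 0 <= x ->
  Q [set o | (x < (X o)%:R :> R)%R] = (tail_mass p (Num.truncn x))%:E.
Proof.
move=> x0.
have -> : [set o | (x < (X o)%:R :> R)%R] = ~` (X @^-1` [set` iota 0 (Num.truncn x).+1]).
  have E o : (X o \in iota 0 (Num.truncn x).+1) = ~~ (x < (X o)%:R).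
    by rewrite mem_iota add0n ltnS -leNgt truncn_ge_nat.
  apply/seteqP; split => o h.
    by move=> h'; have : X o \in iota 0 (Num.truncn x).+1 := h'; rewrite E h.
  by apply: contraPP h => /negP h h'; apply: h'; rewrite /preimage /= E.
rewrite probability_setC; last by apply: measurable_discrete; exact: mX.
rewrite measure_discrete_seq ?iota_uniq //.
rewrite /tail_mass EFinB -(big_mkord xpredT) /index_iota subn0 -sumEFin.
by congr (_ - _)%E; apply: eq_bigr => l _; rewrite -Xp -point_massE.
Qed.

Lemma expectation_partial (f : nat -> R) (M : nat) : (forall l, 0 <= f l) ->
  ((\sum_(l < M) f l * p l)%:E <= 'E_Q[(fun o => f (X o))])%E.
Proof.
move=> f0; rewrite expectation_nat //.
have h l : (0 <= l)%N -> xpredT l -> (0 <= (f l * point_mass l)%:E)%E.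
  by move=> _ _; rewrite lee_fin mulr_ge0 // point_mass_ge0.
apply: le_trans (nneseries_lim_ge M h); rewrite big_mkord sumEFin lee_fin.
by apply: ler_sum => l _; rewrite Xp.
Qed.

Lemma expectation_bound (f : nat -> R) (B : R) : (forall l, 0 <= f l) ->
  (forall M, \sum_(l < M) f l * p l <= B) -> ('E_Q[(fun o => f (X o))] <= B%:E)%E.
Proof.
move=> f0 fB; rewrite expectation_nat //; apply: lime_le.
  by apply: is_cvg_nneseries => n _ _; rewrite lee_fin mulr_ge0 // point_mass_ge0.
apply: nearW => M; rewrite big_mkord sumEFin lee_fin; apply: le_trans (fB M).
by apply: ler_sum => l _; rewrite Xp.
Qed.

Lemma truncated_second_momentE (x : R) : 0 <= x ->
  truncated_second_moment X x = second_moment_below p (Num.truncn x).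
Proof.
move=> x0; have p0 l : 0 <= p l by rewrite -Xp point_mass_ge0.
pose f (l : nat) : R := l%:R ^+ 2 * (l%:R <= x :> R)%:R.
have f0 l : 0 <= f l by rewrite mulr_ge0 ?exprn_ge0.
rewrite /truncated_second_moment -[X in fine X]/('E_Q[(fun o => f (X o))])%E.
have fE M : (Num.truncn x < M)%N -> \sum_(l < M) f l * p l = second_moment_below p (Num.truncn x).
  move=> xM; rewrite /second_moment_below -(big_mkord xpredT (fun l => f l * p l)).
  rewrite -(big_mkord xpredT (fun l => l%:R ^+ 2 * p l)).
  rewrite (big_cat_nat _ (n := (Num.truncn x).+1)) //= [X in _ + X]big_nat.
  rewrite [X in _ + X]big1 ?addr0; last first.
    move=> l /andP[xl _]; rewrite /f (_ : (l%:R <= x) = false) ?mulr0 ?mul0r //.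
    by rewrite -truncn_ge_nat // leqNgt xl.
  rewrite !big_nat; apply: eq_bigr => l; rewrite ltnS truncn_ge_nat // => /andP[_ lx].
  by rewrite /f lx mulr1.
suff -> : ('E_Q[(fun o => f (X o))])%E = (second_moment_below p (Num.truncn x))%:E by [].
apply/eqP; rewrite eq_le; apply/andP; split.
  apply: expectation_bound => // M; have [xM|Mx] := ltnP (Num.truncn x) M; first by rewrite fE.
  rewrite -(fE (Num.truncn x).+1) // -!(big_mkord xpredT (fun l => f l * p l)).
  rewrite [leRHS](big_cat_nat _ (n := M)) ?(leqW Mx) //= lerDl sumr_ge0 // => l _.
  by rewrite mulr_ge0.
by rewrite -(fE (Num.truncn x).+1) //; exact: expectation_partial.
Qed.

Hypothesis p1 : series p @ \oo --> (1 : R).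

(** Each of x^2 and (x - m)^2 is at most twice the other plus 2 m^2, whatever the
    centring m; this covers the value 0 that stands for an infinite mean. *)
Lemma variance_finite :
  (('V_Q[(fun o => (X o)%:R)%R])%E < +oo)%E <->
  exists B : R, forall N, second_moment_below p N <= B.
Proof.
have p0 l : 0 <= p l by rewrite -Xp point_mass_ge0.
have sp M : \sum_(l < M) p l <= 1 := sum_law_le1 p0 p1 M.
pose m : R := fine ('E_Q[(fun o => (X o)%:R)%R])%E.
pose f (l : nat) : R := (l%:R - m) ^+ 2.
have f0 l : 0 <= f l by rewrite sqr_ge0.
have VE : ('V_Q[(fun o => (X o)%:R)%R])%E = ('E_Q[(fun o => f (X o))])%E.
  by rewrite /variance unlock; congr (expectation Q _); apply/funext => o; rewrite /f expr2.
rewrite VE; split=> [fin|[B HB]].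
  have [B EB] : exists B : R, ('E_Q[(fun o => f (X o))])%E = B%:E.
    have : (0 <= 'E_Q[(fun o => f (X o))])%E by exact: expectation_ge0.
    by move: fin; case: ('E_Q[_])%E => // B _ _; exists B.
  exists (2 * B + 2 * m ^+ 2) => N.
  have h := expectation_partial N.+1 f0; rewrite EB lee_fin in h.
  apply: (@le_trans _ _ (2 * (\sum_(l < N.+1) f l * p l) + 2 * m ^+ 2 * \sum_(l < N.+1) p l)).
    rewrite !mulr_sumr -big_split /=; apply: ler_sum => l _.
    rewrite mulrA -mulrDl ler_wpM2r // /f -subr_ge0.
    rewrite (_ : _ - _ = (l%:R - 2 * m) ^+ 2); first exact: sqr_ge0.
    by ring.
  apply: lerD; first by rewrite ler_wpM2l.
  by rewrite ler_piMr // mulr_ge0 // sqr_ge0.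
apply: (@le_lt_trans _ _ (2 * B + 2 * m ^+ 2)%:E); last exact: ltry.
have B0 : 0 <= B by apply: le_trans (HB 0%N); rewrite second_moment_below_ge0.
apply: expectation_bound => // -[|N].
  by rewrite big_ord0 addr_ge0 // mulr_ge0 // sqr_ge0.
apply: (@le_trans _ _ (2 * second_moment_below p N + 2 * m ^+ 2 * \sum_(l < N.+1) p l)).
  rewrite /second_moment_below !mulr_sumr -big_split /=; apply: ler_sum => l _.
  rewrite mulrA -mulrDl ler_wpM2r // /f -subr_ge0.
  rewrite (_ : _ - _ = (l%:R + m) ^+ 2); first exact: sqr_ge0.
  by ring.
apply: lerD; first by rewrite ler_wpM2l.
by rewrite ler_piMr // mulr_ge0 // sqr_ge0.
Qed.

End natural_variable.

Lemma tilted_point_mass (R : realType) (w p : nat -> R) (r rho : R)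
    (d : measure_display) (T : measurableType d) (Q : probability T R) (X : {RV Q >-> nat}) :
  (forall i, 0 <= w i) -> 0 < rho -> 0 <= r -> (forall l, p l * rho = w l * r ^+ l) ->
  gf w r%:E = rho%:E -> has_tilted_pgf w r X -> forall l, point_mass X l = p l.
Proof.
move=> w0 rho0 r0 pw wr pgf.
have pE l : p l = w l * r ^+ l / rho by rewrite -pw mulfK // gt_eqF.
have p0 l : 0 <= p l by rewrite pE divr_ge0 ?mulr_ge0 ?exprn_ge0 // ltW.
have aE (z : R) : 0 <= z -> z <= 1 -> gf (point_mass X) z%:E = gf p z%:E.
  move=> z0 z1; have zz l : 0 <= z ^+ l by rewrite exprn_ge0.
  have -> : gf (point_mass X) z%:E = ('E_Q[(fun o => z ^+ X o)%R])%E.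
    rewrite (expectation_nat X zz) /gf; apply: eq_eseriesr => l _.
    by rewrite -EFin_expe -EFinM mulrC.
  have rz : 0 <= r * z by rewrite mulr_ge0.
  have fin : (gf w (r * z)%:E < +oo)%E.
    by apply: le_lt_trans (gf_mono w0 rz (_ : _ <= r)) _; [rewrite ler_piMr | rewrite wr ltry].
  rewrite pgf // wr; have [s sE cv] := gf_finite w0 rz fin; rewrite sE /=.
  apply/esym/gf_of_series => //.
  have : series (fun i => w i * (r * z) ^+ i) M / rho @[M --> \oo] --> s / rho.
    by apply: cvgM; [exact: cv | exact: cvg_cst].
  apply: cvg_trans; apply: near_eq_cvg; apply: nearW => M /=.
  rewrite /series /= mulr_suml; apply: eq_bigr => i _.
  by rewrite pE exprMn mulrA mulrAC.
have B1 : gf p 1%:E = 1%:E.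
  have fin : (gf w r%:E < +oo)%E by rewrite wr ltry.
  have [s sE cv] := gf_finite w0 r0 fin.
  have sr : s = rho by move: wr; rewrite sE => -[].
  apply: gf_of_series => //.
  have : series (fun i => w i * r ^+ i) M / rho @[M --> \oo] --> (1 : R).
    rewrite -(divff (_ : rho != 0)) ?gt_eqF // -{2}sr.
    by apply: cvgM; [exact: cv | exact: cvg_cst].
  apply: cvg_trans; apply: near_eq_cvg; apply: nearW => M /=.
  rewrite /series /= mulr_suml; apply: eq_bigr => i _.
  by rewrite pE expr1n mulr1.
apply: (@gf_inj R _ _ 1) => //; first exact: point_mass_ge0.
by rewrite aE.
Qed.

(** * Tilting the component weights to criticality *)

Lemma offspring_mean_tilted (R : realType) (w p : nat -> R) (r rho mu : R) :
  0 < rho -> (forall l, p l * rho = w l * r ^+ l) -> gf w r%:E = rho%:E ->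
  series (fun l => l%:R * p l) @ \oo --> mu -> offspring_mean w r = mu.
Proof.
move=> rho0 pw wr cv; rewrite /offspring_mean wr /=.
have -> : (\sum_(1 <= n <oo) (n%:R * w n * r ^+ n)%:E)%E = (rho * mu)%:E.
  apply: cvg_lim => //.
  have : (rho * series (fun l => l%:R * p l) M)%:E @[M --> \oo] --> (rho * mu)%:E.
    by apply: cvg_EFin; [exact: nearW | apply: cvgM => //; exact: cvg_cst].
  apply: cvg_trans; apply: near_eq_cvg; exists 1%N => // M /= M1.
  rewrite sumEFin /series /= (big_cat_nat _ (n := 1)) //= big_nat1 mul0r add0r.
  congr EFin; rewrite mulr_sumr; apply: eq_bigr => l _.
  by rewrite -mulrA -pw; ring.
by rewrite /= mulKf // gt_eqF.
Qed.

Lemma tilted_sum1 (R : realType) (w p : nat -> R) (r rho : R) :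
  (forall i, 0 <= w i) -> 0 <= r -> 0 < rho ->
  (forall l, p l * rho = w l * r ^+ l) -> gf w r%:E = rho%:E ->
  series p @ \oo --> (1 : R).
Proof.
move=> w0 r0 rho0 pw wr.
have fin : (gf w r%:E < +oo)%E by rewrite wr ltry.
have [s sE cv] := gf_finite w0 r0 fin.
have sr : s = rho by move: wr; rewrite sE => -[].
have : series (fun i => w i * r ^+ i) M / rho @[M --> \oo] --> (1 : R).
  rewrite -(divff (_ : rho != 0)) ?gt_eqF // -{2}sr.
  by apply: cvgM; [exact: cv | exact: cvg_cst].
apply: cvg_trans; apply: near_eq_cvg; apply: nearW => M /=.
rewrite /series /= mulr_suml; apply: eq_bigr => i _.
by rewrite -pw mulfK // gt_eqF.
Qed.

(** The step law inherits regular variation in the critical case; in the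
    subcritical case W converges beyond r and the steps have exponential tails. *)
Definition step_tail (R : realType) (p : nat -> R) (alpha : R) : Prop :=
  (exists (L : R -> R) (c a : R), [/\ regular_seq p L c a, 2 < a & alpha = Num.min (a - 1) 2]) \/
  (alpha = 2 /\ exists B : R, forall N, second_moment_below p N <= B).

Section tilting.
Context {R : realType}.
Variables (v w : nat -> R) (Lv : R -> R) (rho b : R).
Hypotheses (v0 : forall i, 0 <= v i) (w0 : forall i, 0 <= w i).
Hypothesis u_fin : forall n, (gibbs_coef_ereal v w n < +oo)%E.
Hypotheses (rho0 : 0 < rho) (Lv_slow : slowly_varying Lv) (b1 : 1 < b).
Hypothesis v_asymp : forall n, (0 < n)%N -> v n = Lv n%:R * n%:R `^ (- b) * rho ^- n.
Notation u := (gibbs_coef v w).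
Let q k := v k * rho ^+ k.

Let q_regular : regular_seq q Lv 1 b.
Proof.
split=> // k k0; rewrite /q v_asymp // mul1r -mulrA mulVf ?mulr1 //.
by rewrite gt_eqF // exprn_gt0.
Qed.

Let q_smooth : smooth_weights q.
Proof. exact: regular_smooth (lt_trans ltr01 b1) q_regular. Qed.

Let q_bounded : exists Bq : R, forall K, \sum_(1 <= k < K) q k <= Bq.
Proof.
pose e := (b - 1) / 2; have e0 : 0 < e by rewrite divr_gt0 // subr_gt0.
have [C C0 HC] := regular_poly q_regular e0.
exists (C * (1 + e^-1)) => K; apply: le_trans (ler_wpM2l (ltW C0) (powR_series_le K e0)).
rewrite mulr_sumr !big_nat; apply: ler_sum => k /andP[k1 _].
have [h _] := HC k k1; apply: le_trans h _.
by rewrite (_ : - b + e = - 1 - e) // /e; field.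
Qed.

(** Here r = rho_w, and p is regularly varying with the exponent a of w. *)
Lemma tilting_critical (Lw : R -> R) (rho_w a alpha : R) :
  conv_radius w = rho_w%:E -> rho%:E = gf w rho_w%:E -> slowly_varying Lw -> 2 < a ->
  (forall n, (0 < n)%N -> w n = Lw n%:R * n%:R `^ (- a) * rho_w ^- n) ->
  b < a \/ b = a /\ (fun n : nat => Lw n%:R) =o_\oo (fun n : nat => Lv n%:R) ->
  alpha = Num.min (a - 1) 2 ->
  exists (r : R) (p : nat -> R), [/\ fine (conv_radius u) = r, 0 < r /\ gf w r%:E = rho%:E,
    forall l, p l * rho = w l * r ^+ l,
    step_law p (offspring_mean w r) /\ negligible_jumps p q & step_tail p alpha].
Proof.
move=> cr /esym gw Lw_slow a2 w_asymp ba alphaE.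
have rw0 : 0 <= rho_w by rewrite -lee_fin -cr conv_radius_ge0.
have rw1 : 0 < rho_w.
  rewrite lt_neqAle rw0 andbT; apply/eqP => rE.
  have wz n : (0 < n)%N -> w n = 0.
    by move=> n0; rewrite w_asymp // -rE expr0n gtn_eqF // invr0 mulr0.
  have : (1%:E <= conv_radius w)%E.
    apply: ereal_sup_ubound; exists 1 => //; split => //.
    apply: (@le_lt_trans _ _ (w 0%N)%:E); last exact: ltry.
    apply/gf_le => // -[|N]; first by rewrite big_ord0.
    rewrite big_ord_recl big1 ?addr0 ?expr0 ?mulr1 // => i _.
    by rewrite wz // mul0r.
  by rewrite cr -rE lee_fin ler10.
have [Bq HB] := q_bounded.
have rE : conv_radius u = rho_w%:E.
  rewrite (conv_radius_gibbs v0 w0 u_fin rho0 (fun k => erefl (q k)) q_smooth HB).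
  exact: sup_critical.
pose p l := w l * rho_w ^+ l / rho.
have pw l : p l * rho = w l * rho_w ^+ l by rewrite /p divfK // gt_eqF.
have p0 l : 0 <= p l by rewrite divr_ge0 ?mulr_ge0 ?exprn_ge0 // ltW.
have p1 : series p @ \oo --> (1 : R) := tilted_sum1 w0 rw0 rho0 pw gw.
have p_regular : regular_seq p Lw rho^-1 a.
  split=> //; first by rewrite invr_gt0.
  move=> l l0; rewrite /p w_asymp // -(mulrA _ (rho_w ^- l)) mulVf ?mulr1; last first.
    by rewrite gt_eqF // exprn_gt0.
  by rewrite mulrC mulrA.
have lawp : step_law p (limn (series (fun l => l%:R * p l))).
  pose e := (a - 2) / 2; have e0 : 0 < e by rewrite /e; lra.
  have [C C0 HC] := regular_poly p_regular e0.
  apply: (@step_law_of_bound R p C e) => //.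
  - move=> l l0; have [h _] := HC l l0; apply: le_trans h _.
    by rewrite (_ : - a + e = - 2 - e) // /e; field.
  - by exists 1%N => //; exact: regular_gt0 p_regular _.
  - by move=> d; apply; exact: regular_gt0 p_regular _.
exists rho_w, p; split=> //; first by rewrite rE.
- split; first by rewrite (offspring_mean_tilted rho0 pw gw (step_mean lawp)).
  apply: (negligible_regular p_regular q_regular a2 b1).
  case: ba => [|[-> /eqoP ho]]; [by left | right; split => // e e0].
  near=> n; have n0 : (0 < n)%N by near: n; exact: nbhs_infty_gt.
  have [Lw0 _ _] := Lw_slow; have [Lv0 _ _] := Lv_slow.
  have : `|Lw n%:R| <= e * `|Lv n%:R| by near: n; exact: ho.
  by rewrite !gtr0_norm ?Lw0 ?Lv0 ?ltr0n.
- by left; exists Lw, rho^-1, a.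
Unshelve. all: by end_near.
Qed.

(** W is finite at some r' > r, so p l is at most a multiple of (r / r')^l. *)
Lemma tilting_subcritical (alpha : R) :
  (rho%:E < gf w (conv_radius w))%E -> is_gcd_of [set n | 0 < w n] 1 -> alpha = 2 ->
  exists (r : R) (p : nat -> R), [/\ fine (conv_radius u) = r, 0 < r /\ gf w r%:E = rho%:E,
    forall l, p l * rho = w l * r ^+ l,
    step_law p (offspring_mean w r) /\ negligible_jumps p q & step_tail p alpha].
Proof.
move=> sub [_ gcd1] alphaE.
have [l [l0 wl]] : exists l, (0 < l)%N /\ 0 < w l.
  apply/not_existsP => no; have := gcd1 0%N; rewrite dvd0n /= => h; suff : false by [].
  apply: h => n /= wn; apply/eqP; case: n wn => // n wn.
  by case: (no n.+1).
have [Bq HB] := q_bounded.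
have w0r : w 0%N < rho := w0_lt v0 w0 u_fin rho0 (fun k => erefl (q k)) q_smooth l0 wl.
have [r [r' [rE r0 rr' wr fin']]] := sup_subcritical w0 rho0 sub l0 wl w0r.
have r'0 : 0 < r' by exact: lt_trans rr'.
have cE : conv_radius u = r%:E.
  by rewrite (conv_radius_gibbs v0 w0 u_fin rho0 (fun k => erefl (q k)) q_smooth HB).
pose p l := w l * r ^+ l / rho.
have pw k : p k * rho = w k * r ^+ k by rewrite /p divfK // gt_eqF.
have p0 k : 0 <= p k by rewrite divr_ge0 ?mulr_ge0 ?exprn_ge0 // ltW.
have p1 : series p @ \oo --> (1 : R) := tilted_sum1 w0 (ltW r0) rho0 pw wr.
have [B EB _] := gf_finite w0 (ltW r'0) fin'.
have B0 : 0 <= B by rewrite -lee_fin -EB gf_ge0 // ltW.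
pose c := ln (r' / r); have c0 : 0 < c by rewrite ln_gt0 // ltr_pdivlMr // mul1r.
have A0 : 0 < (B + 1) / rho by rewrite divr_gt0 // ltr_wpDl.
have pexp k : p k <= (B + 1) / rho * expR (- (c * k%:R)).
  have wk : w k * r' ^+ k <= B.
    rewrite -lee_fin -EB; apply: le_trans (gf_partial_le k.+1 w0 (ltW r'0)).
    rewrite lee_fin big_ord_recr /= lerDr sumr_ge0 // => i _.
    by rewrite mulr_ge0 // exprn_ge0 // ltW.
  rewrite expRN expRM_natr /c lnK ?posrE ?divr_gt0 // -exprVn invf_div expr_div_n.
  rewrite /p [leRHS]mulrAC ler_wpM2r ?invr_ge0 ?(ltW rho0) // mulrA ler_pdivlMr ?exprn_gt0 //.
  rewrite mulrAC ler_wpM2r ?exprn_ge0 ?(ltW r0) //; apply: le_trans wk _.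
  by rewrite lerDl.
have rapid (A : R) : 0 < A -> exists2 C : R, 0 < C &
    forall k, (0 < k)%N -> p k <= C * k%:R `^ (- A).
  by move=> Apos; exact: exponential_rapid c0 A0 Apos pexp.
have pl : 0 < p l by rewrite divr_gt0 // mulr_gt0 // exprn_gt0.
have lawp : step_law p (limn (series (fun k => k%:R * p k))).
  have [C C0 HC] := rapid 3 (ltr0n _ 3).
  apply: (@step_law_of_bound R p C 1) => //.
  - by move=> k k0; rewrite (_ : - 2 - 1 = - 3); [exact: HC | ring].
  - by exists l.
  - move=> d hd; apply: gcd1 => n wn; apply: hd.
    by rewrite divr_gt0 // mulr_gt0 // exprn_gt0.
exists r, p; split=> //; first by rewrite cE.
- split; first by rewrite (offspring_mean_tilted rho0 pw wr (step_mean lawp)).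
  exact: (negligible_rapid p0 rapid (lt_trans ltr01 b1) q_regular).
- right; split => //.
  have [C C0 HC] := rapid 4 (ltr0n _ 4).
  exists (C * (1 + 1^-1)) => N; rewrite /second_moment_below.
  apply: le_trans (ler_wpM2l (ltW C0) (powR_series_le N.+1 ltr01)).
  rewrite -(big_mkord xpredT (fun l => l%:R ^+ 2 * p l)) big_ltn // expr0n /= mul0r add0r.
  rewrite mulr_sumr !big_nat; apply: ler_sum => k /andP[k1 _].
  have kR : 0 < k%:R :> R by rewrite ltr0n.
  apply: le_trans (ler_wpM2l (sqr_ge0 _) (HC k k1)) _.
  rewrite mulrCA -powR_mulrn ?(ltW kR) // -powRDl //.
  by rewrite (_ : 2%:R + - 4 = - 1 - 1) //; ring.
Qed.

Lemma weights_regular : smooth_weights q.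
Proof. exact: q_smooth. Qed.

End tilting.

(** * Scaling of the large components *)

Section scaling.
Context {R : realType}.
Context (d : measure_display) (T : measurableType d) (Q : probability T R).
Context (X : {RV Q >-> nat}) (p : nat -> R) (mu : R).
Hypotheses (lawp : step_law p mu) (Xp : forall l, point_mass X l = p l).

Let p0 : forall l, 0 <= p l := step_ge0 lawp.
Let p1 : series p @ \oo --> (1 : R) := step_sum1 lawp.
Let m0 : 0 < mu := mean_gt0 lawp.

Let scale (alpha : R) (n : nat) : R := scaling_L X alpha mu n * n%:R `^ alpha^-1.

Lemma quantile_exists : exists N : nat -> nat, forall n m, (0 < n)%N ->
  (tail_mass p m <= n%:R^-1) = (N n <= m)%N.
Proof.
suff H n : exists N : nat, forall m, (0 < n)%N -> (tail_mass p m <= n%:R^-1) = (N <= m)%N.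
  by have [N HN] := choice H; exists N.
have [->|n0] := posnP n; first by exists 0%N.
have ex : exists N, tail_mass p N <= n%:R^-1.
  have ni : 0 < n%:R^-1 :> R by rewrite invr_gt0 ltr0n.
  by have [N _ H] := tail_cvg0 p0 p1 ni; exists N; apply: ltW; apply: H => /=.
exists (ex_minn ex) => m _; case: ex_minnP => N hN Nmin; apply/idP/idP; first exact: Nmin.
by move=> Nm; apply: le_trans (tail_mass_anti p0 Nm) hN.
Qed.

Lemma inf_quantile (N : nat -> nat) n : (0 < n)%N ->
  (forall n m, (0 < n)%N -> (tail_mass p m <= n%:R^-1) = (N n <= m)%N) ->
  inf [set x : R | 0 <= x /\ (Q [set o | (x < (X o)%:R :> R)%R] <= (n%:R^-1)%:E)%E] = (N n)%:R.
Proof.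
move=> n0 NP; set S := [set x | _].
have SE x : S x <-> (N n)%:R <= x.
  split=> [[x0]|Nx].
    by rewrite (tail_of_variable Xp) // lee_fin NP // truncn_ge_nat.
  have x0 : 0 <= x by apply: le_trans Nx.
  by split => //; rewrite (tail_of_variable Xp) // lee_fin NP // truncn_ge_nat.
apply/eqP; rewrite eq_le; apply/andP; split.
  apply: ge_inf; last by apply/SE.
  by exists (N n)%:R => x /SE.
by apply: lb_le_inf; [exists (N n)%:R; apply/SE | move=> x /SE].
Qed.

(** With exponent alpha < 2 the scale is a multiple of the 1/n-quantile of the
    steps; the constants are such that n tail (x scale) tends to mu c x^(-alpha). *)
Lemma scale_heavy (L : R -> R) (cp a alpha : R) : regular_seq p L cp a -> 2 < a ->
  alpha = Num.min (a - 1) 2 -> 1 < alpha < 2 ->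
  (\forall n \near \oo, 0 < scale alpha n) /\
  forall x, 0 < x -> n%:R * tail_mass p (Num.truncn (x * scale alpha n)) @[n --> \oo] -->
    mu * (mu `^ alpha / `|Gamma (1 - alpha)| * x `^ (- alpha)).
Proof.
move=> rp a2 aE /andP[al1 al2].
have alE : alpha = a - 1.
  by move: al2; rewrite aE; case: (leP (a - 1) 2) => //; rewrite ltxx.
have a3 : a < 3 by lra.
have al0 : 0 < alpha by lra.
have G0 : 0 < `|Gamma (1 - alpha)|.
  by rewrite normr_gt0 lt_eqF // Gamma_continued // al1.
have [N NP] := quantile_exists.
pose t0 := mu `^ (- 1 - alpha^-1) * `|Gamma (1 - alpha)| `^ alpha^-1.
have t00 : 0 < t0 by rewrite mulr_gt0 ?powR_gt0.
have sE n : (0 < n)%N -> scale alpha n = t0 * (N n)%:R.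
  move=> n0; have nR : 0 < n%:R :> R by rewrite ltr0n.
  rewrite /scale /scaling_L /scaling_g ifF; last first.
    apply/negP => /(variance_finite Xp p1)[B HB].
    have [M] := second_moment_infinite B p0 rp a3.
    by rewrite ltNge HB.
  rewrite ifN ?(lt_eqF al2) // (inf_quantile n0 NP).
  have nn : n%:R `^ (- alpha^-1) * n%:R `^ alpha^-1 = 1 :> R.
    by rewrite -powRDl // addNr powRr0.
  rewrite [LHS](_ : _ = t0 * (N n)%:R * (n%:R `^ (- alpha^-1) * n%:R `^ alpha^-1)).
    by rewrite nn mulr1.
  by rewrite /t0; ring.
split.
  have [N1 _ H] : \forall n \near \oo, (0 < N n)%N.
    exists (Num.truncn (tail_mass p 0)^-1).+1 => //= n hn.
    have n0 : (0 < n)%N by apply: leq_trans hn.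
    have t1 : 0 < tail_mass p 0 := tail_mass_gt0 0 p0 p1 rp.
    have : ~~ (N n <= 0)%N.
      rewrite -NP // -ltNge invf_plt ?posrE ?ltr0n //.
      by apply: lt_le_trans (truncnS_gt _) _; rewrite ler_nat.
    by rewrite -ltnNge.
  exists (maxn N1 1) => // n /=; rewrite geq_max => /andP[h1 h2].
  by rewrite sE // mulr_gt0 // ltr0n H.
move=> x x0; have xt0 : 0 < x * t0 by rewrite mulr_gt0.
have a1 : 1 < a by lra.
have := tail_quantile p0 p1 rp a1 xt0 NP.
have -> : (x * t0) `^ (- (a - 1)) = mu * (mu `^ alpha / `|Gamma (1 - alpha)| * x `^ (- alpha)).
  rewrite -alE /t0 powRM ?(ltW x0) ?(ltW t00) // powRM ?powR_ge0 // -!powRrM.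
  rewrite (_ : (- 1 - alpha^-1) * - alpha = alpha + 1); last by field; rewrite gt_eqF.
  rewrite (_ : alpha^-1 * - alpha = - 1); last by field; rewrite gt_eqF.
  by rewrite powRDl // powRr1 ?(ltW m0) // powR_inv1 ?(ltW G0) //; ring.
move=> h; apply: cvg_near_eq h _; exists 1%N => // n /= n0.
by rewrite sE // !mulrA.
Qed.

Lemma scale_ge0 alpha n : 0 <= scale alpha n.
Proof.
rewrite /scale /scaling_L !mulr_ge0 ?powR_ge0 // /scaling_g.
case: ifP => _; first exact: sqrtr_ge0.
case: ifP => _; first exact: sqrtr_ge0.
rewrite !mulr_ge0 ?powR_ge0 //; set S := [set x | _].
have [->|/set0P[x Sx]] := eqVneq S set0; first by rewrite inf0.
by apply: lb_le_inf; [exists x | move=> y []].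
Qed.

(** For alpha = 2 the scale is a multiple of sqrt n, or of sqrt (n T (x_n)) when
    the variance is infinite; both are of larger order than the 1/n-quantile. If
    the steps are constant the scale vanishes. *)
Lemma scale_light (alpha : R) : step_tail p alpha -> alpha = 2 ->
  (forall n, scale alpha n = 0) \/
  forall x, 0 < x -> n%:R * tail_mass p (Num.truncn (x * scale alpha n)) @[n --> \oo] --> (0 : R).
Proof.
move=> st aE.
have nE n : n%:R `^ alpha^-1 = Num.sqrt n%:R :> R by rewrite aE powR12_sqrt.
pose M := mu `^ (- 1 - alpha^-1); have M0 : 0 < M by rewrite powR_gt0.
have [fin|inf] := boolP (('V_Q[(fun o => (X o)%:R)%R])%E < +oo)%E.
  pose s := Num.sqrt (fine ('V_Q[(fun o => (X o)%:R)%R])%E / 2).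
  have sE n : scale alpha n = M * s * Num.sqrt n%:R.
    by rewrite /scale /scaling_L /scaling_g fin nE.
  have [s0|s0] := eqVneq s 0; first by left => n; rewrite sE s0 mulr0 mul0r.
  have sp : 0 < s by rewrite lt_neqAle eq_sym s0 sqrtr_ge0.
  right => x x0; have [B HB] := (variance_finite Xp p1).1 fin.
  have xs : 0 < x * (M * s) by rewrite !mulr_gt0.
  apply: cvg_near_eq (tail_finite_second_moment p0 p1 HB xs) _.
  by apply: nearW => n; rewrite sE !mulrA.
have unb (B : R) : exists N, B < second_moment_below p N.
  apply/not_existsP => h; move/negP: inf; apply; apply/(variance_finite Xp p1).
  by exists B => N; rewrite leNgt; apply/negP; exact: h.
case: st => [[L [cp [a [rp a2 aE']]]]|[_ [B HB]]]; last first.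
  by have [N] := unb B; rewrite ltNge HB.
have a3 : 3 <= a.
  move: aE'; rewrite aE; case: (leP (a - 1) 2) => h E; lra.
right => x x0.
pose T2 (z : R) := second_moment_below p (Num.truncn z).
pose x_ n := sup [set z : R | 0 <= z /\ n%:R^-1 <= T2 z / z ^+ 2].
have x_0 n : 0 <= x_ n.
  rewrite /x_; set S := [set z | _].
  have [hs|hs] := pselect (has_sup S); last by rewrite sup_out.
  have [[z Sz] hub] := hs; apply: le_trans (ub_le_sup hub Sz).
  by case: Sz.
have sE n : scale alpha n = M * Num.sqrt 2^-1 * (Num.sqrt (T2 (x_ n)) * Num.sqrt n%:R).
  have al2 : alpha == 2 by rewrite aE eqxx.
  rewrite /scale /scaling_L /scaling_g (negbTE inf) al2 nE -/M.
  rewrite [X in sup X](_ : _ = [set z : R | 0 <= z /\ n%:R^-1 <= T2 z / z ^+ 2]); last first.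
    have E z (z0 : 0 <= z) : truncated_second_moment X z = T2 z := truncated_second_momentE Xp z0.
    by apply/seteqP; split => z [z0 h]; split => //; [rewrite -E | rewrite E].
  rewrite -/(x_ n) (truncated_second_momentE Xp) ?x_0 // -/(T2 _) sqrtrM ?invr_ge0 //.
  by rewrite !mulrA.
have xs : 0 < x * (M * Num.sqrt 2^-1) by rewrite !mulr_gt0 // sqrtr_gt0 invr_gt0.
have pm n : \sum_(l < n) l%:R * p l <= mu := mean_partial_le p0 (step_mean lawp) n.
have := tail_infinite_second_moment p0 p1 rp a3 pm unb xs.
move=> /= h; apply: cvg_near_eq h _.
by apply: nearW => n; rewrite sE !mulrA.
Qed.

End scaling.

(** * Convergence in distribution *)

Section convergence_in_distribution.
Context {R : realType}.
Variables (v w : nat -> R).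
Context (dP : nat -> measure_display) (Omega : forall n, measurableType (dP n)).
Context (P : forall n, probability (Omega n) R) (K : forall n, Omega n -> seq nat).
Hypothesis K_law : forall n, (0 < n)%N -> 0 < gibbs_coef v w n ->
  gibbs_component_sizes v w n (P n) (@K n).
Variables (j : nat) (A : nat -> R).
Hypothesis A0 : forall n, 0 <= A n.
Notation u := (gibbs_coef v w).
Notation F := (within [set n | 0 < u n] \oo).
Let Y (n : nat) (o : Omega n) : R := (A n)^-1 * (nth_largest (K o) j)%:R.

Let Y_ge0 n (o : Omega n) : 0 <= Y o.
Proof. by rewrite mulr_ge0 ?invr_ge0. Qed.

Let below n (x : R) : set (Omega n) := [set o | (nth_largest (K o) j)%:R <= x * A n].

Let Y_le n (x : R) : 0 < A n -> [set o | @Y n o <= x] = @below n x.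
Proof.
by move=> An; apply/seteqP; split => o; rewrite /below /Y /= ler_pdivrMl // mulrC.
Qed.

Let mK n (B : set (seq nat)) : (0 < n)%N -> 0 < u n -> measurable (@K n @^-1` B).
Proof. by move=> n0 un; have [h _] := K_law n0 un; exact: measurable_discrete. Qed.

Let below_sub n (x : R) : 0 <= x -> @below n x `<=` [set o | @Y n o <= x].
Proof.
move=> x0 o; rewrite /below /Y /=; have [->|An] := eqVneq (A n) 0.
  by rewrite invr0 mul0r.
by rewrite ler_pdivrMl ?(mulrC x) // lt_neqAle eq_sym An A0.
Qed.

Let prob_neg (x : R) : x < 0 -> P n [set o | @Y n o <= x] @[n --> F] --> 0%E.
Proof.
move=> x0; rewrite (_ : (fun n => _) = fun=> 0%E); first exact: cvg_cst.
apply/funext => n; rewrite (_ : [set o | _] = set0) ?measure0 //.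
apply/seteqP; split => o //= h.
by have := le_lt_trans (le_trans (Y_ge0 o) h) x0; rewrite ltxx.
Qed.

(** The limit jumps at 0, where convergence is not required. A vanishing scale
    makes the scaled sizes 0, by the convention for the inverse of 0. *)
Lemma cvg_to_dirac0 : (forall n, A n = 0) \/
    (forall x, 0 < x -> P n (@below n x) @[n --> F] --> 1%E) ->
  cvg_in_distribution F P (fun n => @Y n) \d_(0 : R).
Proof.
move=> H x; set nu : probability R R := \d_(0 : R).
have nuE (t : R) : nu `]-oo, t]%classic = ((0 <= t)%R%:R)%:E.
  rewrite /nu /= diracE; case: (boolP (0 <= t)) => t0.
    by rewrite mem_set //= in_itv.
  by rewrite memNset //= in_itv /=; apply/negP.
move=> cx; rewrite nuE.
have [x0|x0|x0] := ltgtP 0 x.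
- case: H => [Az|H].
    rewrite (_ : (fun n => _) = fun=> 1%E); first exact: cvg_cst.
    apply/funext => n; rewrite (_ : [set o | _] = setT) ?probability_setT //.
    by apply/seteqP; split => o //= _; rewrite /Y Az invr0 mul0r ltW.
  apply: (squeeze_cvge _ (H x x0) (cvg_cst _)).
  rewrite near_withinE; near=> n => un.
  have n0 : (0 < n)%N by near: n; exact: nbhs_infty_gt.
  have mY : measurable [set o | @Y n o <= x].
    exact: (mK [set s | (A n)^-1 * (nth_largest s j)%:R <= x] n0 un).
  rewrite probability_le1 // andbT; apply: le_measure; rewrite ?inE //.
    exact: (mK [set s | (nth_largest s j)%:R <= x * A n] n0 un).
  by apply: below_sub; exact: ltW.
- exact: prob_neg.
- exfalso; move: cx; rewrite -x0 => cx.
  have h0 : - harmonic n @[n --> \oo] --> (0 : R).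
    by rewrite -[X in _ --> X]oppr0; apply: cvgN; exact: cvg_harmonic.
  have h := cvg_comp _ _ h0 cx.
  have : (fun=> 0%E : \bar R) @ \oo --> nu `]-oo, 0]%classic.
    apply: cvg_trans h; apply: near_eq_cvg; apply: nearW => n /=.
    by rewrite nuE lerNr oppr0 leNgt invr_gt0 ltr0n.
  move=> h1; have : nu `]-oo, 0]%classic = 0%E.
    by apply: (cvg_unique _ h1 (cvg_cst _)) => //; exact: ereal_hausdorff.
  by rewrite nuE lexx => /eqP; rewrite eqe oner_eq0.
Unshelve. all: by end_near.
Qed.

(** At 0 the distribution functions are squeezed between 0 and their values at
    small positive points, whose limits tend to 0. *)
Lemma cvg_to_continuous (G : R -> R) (nu : probability R R) :
  (\forall n \near \oo, 0 < A n) ->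
  (forall x, 0 < x -> P n (@below n x) @[n --> F] --> (G x)%:E) ->
  G n.+1%:R^-1 @[n --> \oo] --> (0 : R) ->
  (forall x, 0 < x -> nu `]-oo, x]%classic = (G x)%:E) ->
  (forall x, x <= 0 -> nu `]-oo, x]%classic = 0%E) ->
  cvg_in_distribution F P (fun n => @Y n) nu.
Proof.
move=> Apos H G0 nup nun x _.
have [x0|x0|x0] := ltgtP 0 x.
- rewrite nup //; apply: cvg_trans (H x x0); apply: near_eq_cvg.
  rewrite near_withinE; near=> n => un.
  by rewrite Y_le //; near: n; exact: Apos.
- by rewrite nun ?(ltW x0) //; exact: prob_neg.
- rewrite nun -x0 //.
  suff h : fine (P n [set o | @Y n o <= 0]) @[n --> F] --> (0 : R).
    have : (fine (P n [set o | @Y n o <= 0]))%:E @[n --> F] --> 0%:E.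
      by apply: cvg_EFin; [exact: nearW | exact: h].
    apply: cvg_trans; apply: near_eq_cvg; rewrite near_withinE; near=> n => un.
    have n0 : (0 < n)%N by near: n; exact: nbhs_infty_gt.
    rewrite fineK //; apply: fin_num_measure.
    exact: (mK [set s | (A n)^-1 * (nth_largest s j)%:R <= 0] n0 un).
  apply/cvgrPdist_le => /= e e0; have e2 : 0 < e / 2 by rewrite divr_gt0.
  have /cvgrPdist_le/(_ _ e2)[m _ Hm] := G0.
  pose t : R := m.+1%:R^-1; have t0 : 0 < t by rewrite invr_gt0 ltr0n.
  have Gt : `|0 - G t| <= e / 2 by apply: Hm => /=.
  have ft : fine (P n (@below n t)) @[n --> F] --> G t.
    by apply: fine_cvg; exact: (H t t0).
  have /cvgrPdist_le/(_ _ e2) := ft; rewrite !near_withinE => Ht.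
  near=> n => un.
  have n0 : (0 < n)%N by near: n; exact: nbhs_infty_gt.
  have An : 0 < A n by near: n; exact: Apos.
  have b1 : `|G t - fine (P n (@below n t))| <= e / 2.
    have : [set n | 0 < u n] n -> `|G t - fine (P n (@below n t))| <= e / 2.
      by near: n; exact: Ht.
    by apply.
  have m1 : measurable [set o | @Y n o <= 0].
    exact: (mK [set s | (A n)^-1 * (nth_largest s j)%:R <= 0] n0 un).
  have m2 : measurable (@below n t).
    exact: (mK [set s | (nth_largest s j)%:R <= t * A n] n0 un).
  have le : fine (P n [set o | @Y n o <= 0]) <= fine (P n (@below n t)).
    apply: fine_le; rewrite ?fin_num_measure //.
    apply: le_measure; rewrite ?inE // Y_le // => o; rewrite /below /= mul0r => h.
    by apply: le_trans h _; rewrite mulr_ge0 ?(ltW t0) ?(ltW An).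
  rewrite sub0r normrN ger0_norm ?fine_ge0 //.
  move: le b1 Gt; rewrite sub0r normrN => le.
  move=> /ler_normlP[b1 _] /ler_normlP[_ b2].
  by rewrite (splitr e); apply: le_trans le _; rewrite -lerBlDr; lra.
Unshelve. all: by end_near.
Qed.

End convergence_in_distribution.

(** * The largest components of a Gibbs partition *)

Section random_variables.
Context {R : realType} (Q : probability R R).

Lemma measurable_max0 : measurable_fun [set: R] (fun x : R => Num.max 0 x).
Proof. by apply: measurable_maxr => //; exact: measurable_cst. Qed.

(** A law carried by the positive half-line makes the identity non-negative almost
    surely only. *)
Definition positive_part_variable : {RV Q >-> R} :=
  HB.pack_for {RV Q >-> R} (fun x : R => Num.max 0 x)
    (isMeasurableFun.Build _ _ _ _ _ measurable_max0).

Definition identity_variable : {RV Q >-> R} :=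
  HB.pack_for {RV Q >-> R} (fun x : R => x)
    (isMeasurableFun.Build _ _ _ _ _ (@measurable_id _ R setT)).

Lemma distribution_identity (A : set R) :
  distribution Q identity_variable A = Q A.
Proof. by []. Qed.

Lemma distribution_positive_part (x : R) : 0 <= x ->
  distribution Q positive_part_variable `]-oo, x]%classic = Q `]-oo, x]%classic.
Proof.
move=> x0; rewrite /distribution /= /pushforward; congr (Q _).
by apply/seteqP; split => y /=; rewrite !in_itv /= ge_max x0.
Qed.

Lemma distribution_positive_part_neg (x : R) : x < 0 ->
  distribution Q positive_part_variable `]-oo, x]%classic = 0%E.
Proof.
move=> x0; rewrite /distribution /= /pushforward (_ : _ @^-1` _ = set0) ?measure0 //.
by apply/seteqP; split => y //=; rewrite in_itv /= ge_max leNgt x0.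
Qed.

End random_variables.

Theorem corollary3p4 (R : realType) (v w : nat -> R)
  (v_ge0 : forall i, 0 <= v i) (w_ge0 : forall i, 0 <= w i)
  (u_fin : forall n, (gibbs_coef_ereal v w n < +oo)%E)
  (* component sizes of the Gibbs partition of {1, ..., n} *)
  (dP : nat -> measure_display) (Omega : forall n, measurableType (dP n))
  (P : forall n, probability (Omega n) R) (K : forall n, Omega n -> seq nat)
  (K_law : forall n, (0 < n)%N -> 0 < gibbs_coef v w n ->
     gibbs_component_sizes v w n (P n) (K n))
  (* the random variable X *)
  (dX : measure_display) (OmegaX : measurableType dX)
  (PX : probability OmegaX R) (X : {RV PX >-> nat})
  (X_law : has_tilted_pgf w (fine (conv_radius (gibbs_coef v w))) X)
  (Lv : R -> R) (rho_v b alpha : R)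
  (rho_v_radius : conv_radius v = rho_v%:E) (rho_v_gt0 : 0 < rho_v)
  (Lv_slow : slowly_varying Lv) (b_gt1 : 1 < b)
  (v_asymp : forall n, (0 < n)%N ->
     v n = Lv n%:R * n%:R `^ (- b) * rho_v ^- n)
  (cases :
    (exists (Lw : R -> R) (rho_w a : R),
      [/\ conv_radius w = rho_w%:E /\ rho_v%:E = gf w rho_w%:E,
          slowly_varying Lw /\ 2 < a,
          forall n, (0 < n)%N ->
            w n = Lw n%:R * n%:R `^ (- a) * rho_w ^- n,
          (b < a) \/
          (b = a /\ (fun n : nat => Lw n%:R) =o_\oo (fun n : nat => Lv n%:R)) &
          alpha = Num.min (a - 1) 2])
    \/
    [/\ (rho_v%:E < gf w (conv_radius w))%E,
        is_gcd_of [set n | 0 < w n] 1 &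
        alpha = 2]) :
  let mu := offspring_mean w (fine (conv_radius (gibbs_coef v w))) in
  let F := within [set n | 0 < gibbs_coef v w n] \oo in
  let Kscaled j n (o : Omega n) :=
    (scaling_L X alpha mu n * n%:R `^ alpha^-1)^-1 *
    (nth_largest (K n o) j)%:R in
  let c := mu `^ alpha / `|Gamma (1 - alpha)| in
  [/\ 1 < alpha < 2 ->
        exists (d : measure_display) (T : measurableType d)
               (Q : probability T R) (W1 : {RV Q >-> R}),
          [/\ forall o, 0 <= W1 o,
              forall x, 0 < x ->
                cdf W1 x =
                  (expR (mu `^ alpha / Gamma (1 - alpha) * x `^ (- alpha)))%:E &
              cvg_in_distribution F P (Kscaled 1%N) (distribution Q W1)],
      alpha = 2 -> cvg_in_distribution F P (Kscaled 1%N) \d_(0 : R) &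
      1 < alpha < 2 ->
        forall j, (2 <= j)%N ->
        exists (d : measure_display) (T : measurableType d)
               (Q : probability T R) (Wj : {RV Q >-> R}),
          (forall A : set R, measurable A ->
             distribution Q Wj A =
             \int[lebesgue_measure]_(x in A `&` `]0%R, +oo[%classic)
               (alpha * c * x `^ (- alpha - 1) *
                ((c * x `^ (- alpha)) ^+ j.-1 / (j.-1)`!%:R) *
                expR (- (c * x `^ (- alpha))))%:E)%E /\
          cvg_in_distribution F P (Kscaled j) (distribution Q Wj)].
Proof.
move=> mu F Kscaled c.
pose q k := v k * rho_v ^+ k.
have smq : smooth_weights q := weights_regular rho_v_gt0 Lv_slow b_gt1 v_asymp.
have [r [p [rE [r0 wr] pw [lawp negl] st]]] : exists (r : R) (p : nat -> R),
    [/\ fine (conv_radius (gibbs_coef v w)) = r, 0 < r /\ gf w r%:E = rho_v%:E,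
    forall l, p l * rho_v = w l * r ^+ l,
    step_law p (offspring_mean w r) /\ negligible_jumps p q & step_tail p alpha].
  case: cases => [[Lw [rho_w [a [[cr gw] [Lws a2] wa ba aE]]]]|[sub g aE]].
    exact: (tilting_critical v_ge0 w_ge0 u_fin rho_v_gt0 Lv_slow b_gt1 v_asymp cr gw Lws a2 wa ba aE).
  exact: (tilting_subcritical v_ge0 w_ge0 u_fin rho_v_gt0 Lv_slow b_gt1 v_asymp sub g aE).
have muE : mu = offspring_mean w r by rewrite /mu rE.
rewrite -muE in lawp; rewrite rE in X_law.
have mu0 : 0 < mu := mean_gt0 lawp.
have Xp : forall l, point_mass X l = p l :=
  tilted_point_mass w_ge0 rho_v_gt0 (ltW r0) pw wr X_law.
pose A n := scaling_L X alpha mu n * n%:R `^ alpha^-1.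
have A0 n : 0 <= A n by exact: scale_ge0.
have lim := nth_largest_limit v_ge0 w_ge0 u_fin K_law r0 pw (fun k => erefl (q k)) lawp smq negl.
have heavy : 1 < alpha < 2 -> [/\ 0 < alpha, 0 < c, \forall n \near \oo, 0 < A n &
    forall j x, 0 < x -> P n [set o | (nth_largest (K n o) j.+1)%:R <= x * A n]
      @[n --> F] --> (frechet_cdf alpha c j x)%:E].
  move=> al; have /andP[al1 al2] := al.
  have al0 : 0 < alpha by lra.
  have G0 : Gamma (1 - alpha) < 0 := Gamma_continued al.
  have c0 : 0 < c by rewrite divr_gt0 ?powR_gt0 // normr_gt0 lt_eqF.
  case: st => [[L [cp [a [rp a2 aE]]]]|[aE _]]; last by rewrite aE ltxx in al2.
  have [Apos Alim] := scale_heavy lawp Xp rp a2 aE al.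
  split=> // j x x0.
  have l0 : 0 <= c * x `^ (- alpha) by rewrite mulr_ge0 ?powR_ge0 // ltW.
  by apply: (lim j _ _ l0) => [n|]; [rewrite mulr_ge0 // ltW | exact: Alim].
split.
- move=> al; have [al0 c0 Apos cvA] := heavy al.
  have [Q [_ Qpos Qneg]] := frechet_probability 0 al0 c0.
  exists _, _, Q, (positive_part_variable Q); split.
  + by move=> o; rewrite /= le_max lexx.
  + move=> x x0; rewrite /cdf distribution_positive_part ?(ltW x0) // Qpos //.
    rewrite /frechet_cdf /poisson_below big_ord1 expr0 fact0 divr1 mulr1; congr ((expR _)%:E).
    by rewrite /c ltr0_norm ?Gamma_continued // invrN mulrN mulNr opprK.
  + apply: (cvg_to_continuous K_law A0 Apos (cvA 0%N) (frechet_cdf_cvg0 0 al0 c0)).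
      by move=> x x0; exact: eq_trans (distribution_positive_part Q (ltW x0)) (Qpos x x0).
    move=> x; rewrite le_eqVlt => /predU1P[->|x0].
      exact: eq_trans (distribution_positive_part Q (lexx 0)) (Qneg 0 (lexx 0)).
    exact: distribution_positive_part_neg.
- move=> al2; apply: (cvg_to_dirac0 K_law A0).
  have [Az|Alim] := scale_light lawp Xp st al2; first by left.
  right => x x0.
  have y0 n : 0 <= x * A n by rewrite mulr_ge0 // ltW.
  have tail0 : n%:R * tail_mass p (Num.truncn (x * A n)) @[n --> \oo] --> mu * 0.
    by rewrite mulr0; exact: Alim.
  by have := lim 0%N 0 _ (lexx 0) y0 tail0; rewrite poisson_below0.
- move=> al [//|j] _; have [al0 c0 Apos cvA] := heavy al.
  have [Q [Qdens Qpos Qneg]] := frechet_probability j al0 c0.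
  exists _, _, Q, (identity_variable Q); split.
    by move=> B mB; rewrite distribution_identity Qdens.
  exact: (cvg_to_continuous K_law A0 Apos (cvA j) (frechet_cdf_cvg0 j al0 c0) Qpos Qneg).
Qed.
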